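(* Let $\alpha>0$. For any $\mu\in(0,\frac12)$ there exists $r_0>0$ such that for any initial data $\tilde v_0\in L^2(2)$ with $\|\tilde v_0\|_2\le r_0$, the global solution $\tilde v$ of $$\tilde v_t+u\cdot\nabla\tilde v=\triangle\tilde v,\qquad u=B(H_\alpha(\tilde v)),\qquad \tilde v(0)=\tilde v_0$$ satisfies, for $1\le p\le2$, with some constant $C>0$ and all $t\ge0$, $$\left|\tilde v(\cdot,t)-a\big(\Omega(\cdot,t)-\alpha^2\triangle\Omega(\cdot,t)\big)\right|_p\le C(1+t)^{-1-\mu+\frac1p},$$ where $a=\int_{\mathbb{R}^2}\tilde v_0\,dx$ and $$\Omega(x,t)=\frac1{4\pi(1+t)}e^{-\frac{|x|^2}{4(1+t)}} .$$
   Context: $|\cdot|_p$ is the norm of $L^p(\mathbb{R}^2)$. For $m\ge0$, $L^2(m)$ is the Hilbert space of (scalar) $f\in L^2(\mathbb{R}^2)$ with $\|f\|_m^2=\int_{\mathbb{R}^2}(1+|x|^2)^m|f(x)|^2\,dx<\infty$; thus $\|\cdot\|_2$ is the norm of $L^2(2)$, not of $L^2$. $H_\alpha(f)$ is the solution $g$ of $g-\alpha^2\triangle g=f$ on $\mathbb{R}^2$. $B(f)(x)=\frac1{2\pi}\int_{\mathbb{R}^2}\frac{(x-y)^\perp}{|x-y|^2}f(y)\,dy$, $x^\perp=(-x_2,x_1)^T$. Since $L^2(2)\subset L^1(\mathbb{R}^2)$, ''the solution'' is the unique $\tilde v\in L^\infty([0,\infty);L^1(\mathbb{R}^2))$ solving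 the integral equation $\tilde v(t)=e^{t\triangle}\tilde v_0-\int_0^t\nabla\Phi(t-s)\ast[B(H_\alpha(\tilde v))\,\tilde v](s)\,ds$, where $\Phi(x,t)=\frac1{4\pi t}e^{-|x|^2/(4t)}$, $e^{t\triangle}f=\Phi(t)\ast f$, and the convolution involves the Euclidean inner product of the two vector fields. *)

(* Defs.v *)
From HB Require Import structures.
From mathcomp Require Import all_boot all_order all_algebra.
From mathcomp Require Import all_classical all_reals all_analysis.

Set Implicit Arguments.
Unset Strict Implicit.
Unset Printing Implicit Defensive.

Import Order.TTheory GRing.Theory Num.Theory.
Import numFieldNormedType.Exports.

Local Open Scope classical_set_scope.
Local Open Scope ring_scope.

(* Functions on R^2 are functions on [R * R].  The library norm of [R * R] is
   the sup norm, hence the explicit Euclidean quantities below; topology and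
   directional derivatives do not depend on this choice. *)
Notation leb2 := (@lebesgue_measure _ \x @lebesgue_measure _)%E.

Section Plane.
Variable R : realType.
Implicit Types (f g phi : R * R -> R) (x y : R * R).

Definition sqeucl x : R := x.1 ^+ 2 + x.2 ^+ 2.

Definition dot x y : R := x.1 * y.1 + x.2 * y.2.

Definition perp x : R * R := (- x.2, x.1).

Definition partial1 f : R * R -> R := fun x => 'D_((1, 0) : R * R) f x.

Definition partial2 f : R * R -> R := fun x => 'D_((0, 1) : R * R) f x.

Definition grad f x : R * R := (partial1 f x, partial2 f x).

Definition laplacian f x : R :=
  partial1 (partial1 f) x + partial2 (partial2 f) x.

Fixpoint class_C (k : nat) f : Prop :=
  if k is k'.+1 then
    [/\ continuous f,
        forall x, derivable f x ((1, 0) : R * R),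
        forall x, derivable f x ((0, 1) : R * R),
        class_C k' (partial1 f) & class_C k' (partial2 f)]
  else continuous f.

Definition test_function phi : Prop :=
  (forall k, class_C k phi) /\ compact (closure [set x | phi x != 0]).

Definition in_L1 f : Prop := leb2.-integrable [set: R * R] (EFin \o f).

Definition weighted (m : R) f x : R := (1 + sqeucl x) `^ m * `|f x| ^+ 2.

(* The space L^2(m) for m >= 0; membership in L^2 follows since the weight is
   at least 1. *)
Definition in_L2w (m : R) f : Prop :=
  measurable_fun [set: R * R] f /\
  (\int[leb2]_x (weighted m f x)%:E < +oo)%E.

Definition normL2w (m : R) f : R := Num.sqrt (\int[leb2]_x weighted m f x).

(* [g - alpha^2 * laplacian g = f] in the sense of distributions, with [g] in
   L^1. For [f] in L^1 such a [g] exists and is unique up to a null set; without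
   a decay condition on [g] uniqueness would fail. *)
Definition helmholtz_sol (alpha : R) f g : Prop :=
  in_L1 g /\
  forall phi, test_function phi ->
    \int[leb2]_x (g x * (phi x - alpha ^+ 2 * laplacian phi x)) =
    \int[leb2]_x (f x * phi x).

Definition Halpha (alpha : R) f : R * R -> R :=
  get [set g | helmholtz_sol alpha f g].

(* Biot-Savart operator. The kernel takes the value 0 at [y = x]; the result
   depends on [f] only up to a null set. *)
Definition BS_kernel x : R * R := (sqeucl x)^-1 *: perp x.

Definition BS f x : R * R :=
  (2 * pi)^-1 *: (\int[leb2]_y ((BS_kernel (x - y)).1 * f y),
                  \int[leb2]_y ((BS_kernel (x - y)).2 * f y)).

Definition heat_kernel (t : R) x : R :=
  (4 * pi * t)^-1 * expR (- (sqeucl x / (4 * t))).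

(* The formula with [heat_kernel] only makes sense for [0 < t]. *)
Definition heat_semigroup (t : R) f x : R :=
  if 0 < t then \int[leb2]_y (heat_kernel t (x - y) * f y) else f x.

Definition conv_dot (F G : R * R -> R * R) x : R :=
  \int[leb2]_y dot (F (x - y)) (G y).

Definition duhamel (alpha : R) (v : R -> R * R -> R) (t : R) x : R :=
  \int[@lebesgue_measure R]_(s in `[0, t])
    conv_dot (grad (heat_kernel (t - s)))
             (fun y => v s y *: BS (Halpha alpha (v s)) y) x.

(* [v] is a jointly measurable representative of an element of
   L^oo([0, oo); L^1(R^2)). The right-hand side of the integral equation is
   continuous in time with values in L^1, so the representative can be taken to
   satisfy the equation at every [t >= 0] (as an equality in L^1, that is, for
   almost every [x]); this is what gives a meaning to [v t] for every [t]. *)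
Definition in_LooL1 (v : R -> R * R -> R) : Prop :=
  measurable_fun [set z : R * (R * R) | 0 <= z.1]
                 (fun z : R * (R * R) => v z.1 z.2) /\
  exists M : R, {ae @lebesgue_measure R, forall t, 0 <= t ->
    ('N[leb2]_1[EFin \o v t] <= M%:E)%E}.

Definition global_solution (alpha : R) (v0 : R * R -> R)
    (v : R -> R * R -> R) : Prop :=
  in_LooL1 v /\
  forall t, 0 <= t -> {ae leb2, forall x : R * R,
    v t x = heat_semigroup t v0 x - duhamel alpha v t x}.

Definition Omega (t : R) x : R :=
  (4 * pi * (1 + t))^-1 * expR (- (sqeucl x / (4 * (1 + t)))).

Definition total_mass f : R := \int[leb2]_x f x.

End Plane.

(* Main.v *)
(* Write v = w + a Omega. The gradient of the heat kernel is dominated by c t^(-1/2) times the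
   heat kernel at time 2t, and |B(H_alpha f)| by a potential V|f| that is bounded by |f|_1 and
   whose Biot-Savart kernel 1/|x| is, up to 1/r, a superposition of heat kernels at times below
   2r^2. Every term of the Duhamel integral is thus dominated by a positive superposition of
   heat kernels, to which Minkowski and Cauchy-Schwarz apply. The term quadratic in a Omega
   cancels, because the velocity of a radial vorticity is orthogonal to the radial direction;
   this follows from the equivariance of B(H_alpha .) under reflections.

   For the linear part, v0 - a Omega(0) has mean zero and a moment of order 2 mu, so its heat
   evolution gains t^(-mu); the L^1 modulus of continuity of the heat kernel comes from its L^2
   modulus, as the kernel is a multiple of the square of the kernel at twice the time. The
   decay |w|_1 <= N (1+t)^(-mu), |w|_2 <= N (1+t)^(-mu-1/2) then propagates by continuation:
   on a time step of fixed length, depending only on the L^1 bound of the solution, the a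
   priori bounds give these estimates with some large constant, and the integral equation,
   used repeatedly on the same step, brings the constant back to N when the data are small.
   The L^p bounds follow by interpolation. *)

Require Import Defs.
From HB Require Import structures.
From mathcomp Require Import all_boot all_order all_algebra.
From mathcomp Require Import all_classical all_reals all_analysis.
From mathcomp Require Import measurable_realfun ring lra.
Import Order.TTheory GRing.Theory Num.Theory.
Import numFieldNormedType.Exports.
Local Open Scope classical_set_scope.
Local Open Scope ring_scope.
Set Implicit Arguments.
Unset Strict Implicit.
Unset Printing Implicit Defensive.

(** * Integral inequalities on the plane *)

(** The hypotheses give a bound in [L^1], uniform for almost every time, and no continuity in time
    of the norms that are to be propagated; hence a continuation by steps of fixed length instead of
    a continuity argument. It works because the regularisation by [H_alpha] makes the velocity
    bounded by the [L^1] norm alone: over a step of length [d] the uncontrolled part of the flux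
    costs a factor of order [sqrt d], and smallness of the data is needed only for the quadratic
    term and for the terms linear in [a]. The restriction [mu < 1/2] enters twice: the time integral
    of [(1+s)^(-mu-1/2)] has to be dominated by its upper end, and [(1+|x|^2)^(mu-1)] has to be
    square integrable for the norm of [L^2(2)] to control a moment of order [2 mu]. A separate
    obstacle is that [Halpha] is a choice among weak solutions. Existence and uniqueness in [L^1] of
    the solution of the Helmholtz equation have to be proved before the velocity has a formula; this
    is the purpose of the heat-kernel representation of the resolvent and of the explicit test
    functions. *)

Section ProductSigmaFinite.
Local Open Scope ereal_scope.
Context d1 d2 (T1 : measurableType d1) (T2 : measurableType d2) (R : realType).
Variable m1 : {sigma_finite_measure set T1 -> \bar R}.
Variable m2 : {sigma_finite_measure set T2 -> \bar R}.

(* The canonical sigma-finite structure that the library attaches to [\x] only applies to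
   subprobabilities; an alias is needed to carry the general one. *)
Definition sfprod : set (T1 * T2) -> \bar R := m1 \x m2.

HB.instance Definition _ := Measure.on sfprod.

Lemma sfprod_sigma_finite : sigma_finite setT sfprod.
Proof.
have /sigma_finiteP[F [TF ndF Foo]] := sigma_finiteT m1.
have /sigma_finiteP[G [TG ndG Goo]] := sigma_finiteT m2.
exists (fun n => F n `*` G n).
  rewrite -setXTT TF TG predeqE => -[x y]; split; last first.
    by move=> [n _ []/= ? ?]; split; exists n.
  move=> [/= [n _ Fnx] [k _ Gky]]; exists (maxn n k) => //; split.
  - by move: x Fnx; exact/subsetPset/ndF/leq_maxl.
  - by move: y Gky; exact/subsetPset/ndG/leq_maxr.
move=> k; have [? ?] := Foo k; have [? ?] := Goo k.
split; first exact: measurableX.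
by rewrite /sfprod product_measure1E// lte_mul_pinfty// ge0_fin_numE.
Qed.

HB.instance Definition _ := Measure_isSigmaFinite.Build _ _ _ sfprod sfprod_sigma_finite.

End ProductSigmaFinite.

Section CauchySchwarzMinkowski.
Local Open Scope ereal_scope.
Context (R : realType).

(** The real case completes the square; in the infinite cases the right-hand side is infinite as
    well. *)
Lemma amgm_ereal (c : R) (x y : \bar R) : (0 < c)%R -> 0 <= x -> 0 <= y ->
  x * y <= (c / 2)%:E * (x * x) + (c^-1 / 2)%:E * (y * y).
Proof.
move=> c0; have c2 : (0 < c / 2)%R by rewrite divr_gt0.
have c'2 : (0 < c^-1 / 2)%R by rewrite divr_gt0// invr_gt0.
case: x => [x| |]//; case: y => [y| |]// x0 y0.
- rewrite -!EFinM -EFinD lee_fin.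
  have -> : (c / 2 * (x * x) + c^-1 / 2 * (y * y) = x * y + c^-1 / 2 * (c * x - y) ^+ 2)%R.
    by field; rewrite gt_eqF.
  by rewrite lerDl mulr_ge0// ?sqr_ge0// ltW.
- by rewrite mulyy (gt0_muley (x := (c^-1 / 2)%:E)) ?lte_fin// addey ?leey//.
- by rewrite mulyy (gt0_muley (x := (c / 2)%:E)) ?lte_fin// addye ?leey//.
- by rewrite !mulyy !gt0_muley ?lte_fin.
Qed.

Context d (T : measurableType d) (mu : {measure set T -> \bar R}).

(** Integrates [amgm_ereal] with a balanced parameter. Upper bounds stand in for the norms, so that
    neither finiteness nor a root of an extended real is at issue; vanishing bounds are approached
    from above. *)
Lemma le_cauchy_schwarz (f g : T -> \bar R) (A B : R) :
  measurable_fun setT f -> measurable_fun setT g ->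
  (forall x, 0 <= f x) -> (forall x, 0 <= g x) -> (0 <= A)%R -> (0 <= B)%R ->
  \int[mu]_x (f x * f x) <= (A ^+ 2)%:E -> \int[mu]_x (g x * g x) <= (B ^+ 2)%:E ->
  \int[mu]_x (f x * g x) <= (A * B)%:E.
Proof.
move=> mf mg f0 g0 A0 B0 fA gB.
have pos (a b : R) : (0 < a)%R -> (0 < b)%R ->
    \int[mu]_x (f x * f x) <= (a ^+ 2)%:E -> \int[mu]_x (g x * g x) <= (b ^+ 2)%:E ->
    \int[mu]_x (f x * g x) <= (a * b)%:E.
  move=> a0 b0 fa gb.
  (* The weight [b / a] makes both terms equal to [a b / 2]. *)
  have c0 : (0 < b / a)%R by rewrite divr_gt0.
  apply: (@le_trans _ _ (\int[mu]_x ((b / a / 2)%:E * (f x * f x) + ((b / a)^-1 / 2)%:E * (g x * g x)))).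
    apply: ge0_le_integral => //.
    - by move=> x _; rewrite mule_ge0.
    - exact: emeasurable_funM.
    - by apply: emeasurable_funD; apply: emeasurable_funM => //; exact: emeasurable_funM.
    - by move=> x _; exact: amgm_ereal.
  have k1 : (0 <= b / a / 2)%R by rewrite divr_ge0// ltW.
  have k2 : (0 <= (b / a)^-1 / 2)%R by rewrite divr_ge0// invr_ge0 ltW.
  rewrite ge0_integralD//; first last.
  - by apply: emeasurable_funM => //; exact: emeasurable_funM.
  - by move=> x _; rewrite !mule_ge0// lee_fin.
  - by apply: emeasurable_funM => //; exact: emeasurable_funM.
  - by move=> x _; rewrite !mule_ge0// lee_fin.
  rewrite ge0_integralZl_EFin//; [|by move=> x _; rewrite mule_ge0|exact: emeasurable_funM].
  rewrite ge0_integralZl_EFin//; [|by move=> x _; rewrite mule_ge0|exact: emeasurable_funM].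
  apply: (@le_trans _ _ ((b / a / 2)%:E * (a ^+ 2)%:E + ((b / a)^-1 / 2)%:E * (b ^+ 2)%:E)).
    by apply: leeD; apply: lee_pmul => //; rewrite ?lee_fin// integral_ge0// => x _; rewrite mule_ge0.
  rewrite -!EFinM -EFinD lee_fin le_eqVlt; apply/orP; left; apply/eqP.
  by field; rewrite !gt_eqF.
apply/lee_addgt0Pr => e e0.
(* As [h <= 1], the product [(A + h) (B + h)] exceeds [A B] by at most [h (A + B + 1)]. *)
pose h := (Num.min 1 (e / (A + B + 1)))%R.
have ABp : (0 < A + B + 1)%R by rewrite ltr_wpDl// addr_ge0.
have h0 : (0 < h)%R by rewrite lt_min ltr01 divr_gt0.
have h1 : (h <= 1)%R by rewrite ge_min lexx.
have h2 : (h * (A + B + 1) <= e)%R by rewrite -ler_pdivlMr// ge_min lexx orbT.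
apply: (@le_trans _ _ ((A + h) * (B + h))%:E).
  apply: pos; rewrite ?ltr_wpDl//.
  - by rewrite (le_trans fA)// lee_fin ler_pXn2r// ?nnegrE ?addr_ge0 ?lerDl// ltW.
  - by rewrite (le_trans gB)// lee_fin ler_pXn2r// ?nnegrE ?addr_ge0 ?lerDl// ltW.
by rewrite -EFinD lee_fin; nra.
Qed.

End CauchySchwarzMinkowski.

Section Minkowski.
Local Open Scope ereal_scope.
Context (R : realType) d1 d2 (S : measurableType d1) (T : measurableType d2).
Variables (m : {sigma_finite_measure set S -> \bar R}) (mu : {sigma_finite_measure set T -> \bar R}).

Lemma integral_mul_integral (F : S * T -> \bar R) (h : T -> \bar R) :
  measurable_fun setT F -> (forall z, 0 <= F z) -> measurable_fun setT h -> (forall x, 0 <= h x) ->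
  \int[mu]_x ((\int[m]_s F (s, x)) * h x) = \int[m]_s \int[mu]_x (F (s, x) * h x).
Proof.
move=> mF F0 mh h0.
have mFh : measurable_fun setT (fun z : S * T => F z * h z.2).
  by apply: emeasurable_funM => //; exact: measurableT_comp.
have h0' (z : S * T) : 0 <= F z * h z.2 by rewrite mule_ge0.
rewrite (fubini_tonelli (fun z : S * T => F z * h z.2))//=.
apply: eq_integral => x _; rewrite ge0_integralZr//.
exact: (measurableT_comp mF).
Qed.

(* Squaring the inner integral and exchanging the order of integration reduces Minkowski's
   integral inequality in L^2 to Cauchy-Schwarz. *)
Lemma minkowski_integral (F : S * T -> \bar R) (A : S -> R) (I : R) :
  measurable_fun setT F -> (forall z, 0 <= F z) ->
  measurable_fun setT A -> (forall s, (0 <= A s)%R) ->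
  {ae m, forall s, \int[mu]_x (F (s, x) * F (s, x)) <= ((A s) ^+ 2)%:E} ->
  \int[m]_s (A s)%:E <= I%:E ->
  \int[mu]_x ((\int[m]_s F (s, x)) * (\int[m]_s F (s, x))) <= (I ^+ 2)%:E.
Proof.
move=> mF F0 mA A0 FA AI.
have I0 : (0 <= I)%R by rewrite -lee_fin (le_trans _ AI)// integral_ge0// => s _; rewrite lee_fin.
have mH : measurable_fun setT (fun x => \int[m]_s F (s, x)) by exact: measurable_fun_fubini_tonelli_G.
have H0 x : 0 <= \int[m]_s F (s, x) by exact: integral_ge0.
have mFs s : measurable_fun setT (fun x => F (s, x)) by exact: (measurableT_comp mF).
rewrite integral_mul_integral//.
have mFF s : measurable_fun setT (fun z : S * T => F (s, z.2) * F z).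
  by apply: emeasurable_funM => //; apply: (measurableT_comp (mFs s)).
apply: (@le_trans _ _ (\int[m]_s ((A s)%:E * I%:E))).
  apply: ae_ge0_le_integral => //.
  - by move=> s _; apply: integral_ge0 => x _; rewrite mule_ge0.
  - apply: (measurable_fun_fubini_tonelli_F (fun z : S * T => F z * \int[m]_s F (s, z.2))).
    + by apply: emeasurable_funM => //; exact: (measurableT_comp mH).
    + by move=> z; rewrite mule_ge0.
  - by move=> s _; rewrite mule_ge0// lee_fin.
  - by apply: emeasurable_funM => //; exact/measurable_EFinP.
  - have := FA; apply: filterS => s FAs _.
    under eq_integral do rewrite muleC.
    rewrite integral_mul_integral//.
    apply: (@le_trans _ _ (\int[m]_s' ((A s')%:E * (A s)%:E))); last first.
      rewrite ge0_integralZr//; [|exact/measurable_EFinP|by move=> x _; rewrite lee_fin|by rewrite lee_fin].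
      by rewrite muleC lee_pmul ?lee_fin// integral_ge0// => s' _; rewrite lee_fin.
    apply: ae_ge0_le_integral => //.
    + by move=> s' _; apply: integral_ge0 => x _; rewrite mule_ge0.
    + apply: (measurable_fun_fubini_tonelli_F (fun z : S * T => F z * F (s, z.2))) => //.
        by apply: emeasurable_funM => //; exact: (measurableT_comp (mFs s)).
      by move=> z; rewrite mule_ge0.
    + by move=> s' _; rewrite mule_ge0 ?lee_fin.
    + by apply: emeasurable_funM => //; exact/measurable_EFinP.
    + have := FA; apply: filterS => s' FAs' _.
      by rewrite -EFinM; apply: le_cauchy_schwarz.
rewrite ge0_integralZr//; [|exact/measurable_EFinP|by move=> x _; rewrite lee_fin].
by rewrite expr2 EFinM lee_pmul// ?lee_fin// integral_ge0// => s _; rewrite lee_fin.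
Qed.

End Minkowski.

Section Plane.
Local Open Scope ereal_scope.
Context (R : realType).

(* [lebesgue_measure] lives on the type [measurableTypeR R]; it is transported here to the
   canonical measurable structure of [R], which is the same sigma-algebra. *)
Definition line_measure : set R -> \bar R := @lebesgue_measure R.

Let line_measure0 : line_measure set0 = 0.
Proof. exact: (measure0 (@lebesgue_measure R)). Qed.

Let line_measure_ge0 (A : set R) : 0 <= line_measure A.
Proof. exact: (measure_ge0 (@lebesgue_measure R)). Qed.

Let line_measure_sigma_additive : semi_sigma_additive line_measure.
Proof. exact: (@measure_semi_sigma_additive _ _ _ (@lebesgue_measure R)). Qed.

HB.instance Definition _ := isMeasure.Build _ _ _ line_measure
  line_measure0 line_measure_ge0 line_measure_sigma_additive.

Let line_measure_sigma_finite : sigma_finite setT line_measure.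
Proof. exact: (sigma_finiteT (@lebesgue_measure R)). Qed.

HB.instance Definition _ := Measure_isSigmaFinite.Build _ _ _ line_measure line_measure_sigma_finite.

Definition line : {sigma_finite_measure set R -> \bar R} := line_measure.
Definition plane : {sigma_finite_measure set (R * R)%type -> \bar R} := @sfprod _ _ _ _ R line line.

Lemma ge0_integral_lebesgue (f : R -> \bar R) : measurable_fun setT f -> (forall x, 0 <= f x) ->
  \int[lebesgue_measure]_x f x = \int[line]_x f x.
Proof.
move=> mf f0.
have mid : measurable_fun setT (fun x : measurableTypeR R => x : R) by [].
transitivity (\int[pushforward (@lebesgue_measure R) (fun x : measurableTypeR R => x : R)]_x f x).
  by rewrite ge0_integral_pushforward.
by apply: eq_measure_integral.
Qed.

Lemma integral_lebesgue (f : R -> \bar R) : measurable_fun setT f ->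
  \int[lebesgue_measure]_x f x = \int[line]_x f x.
Proof.
move=> mf; rewrite [LHS]integralE [RHS]integralE.
by rewrite !ge0_integral_lebesgue//; [exact: measurable_funeneg|exact: measurable_funepos].
Qed.

Lemma planeE (A : set (R * R)) : measurable A -> plane A = leb2 A.
Proof.
move=> mA; apply/esym; rewrite /plane/= /sfprod /product_measure1.
apply: ge0_integral_lebesgue => //; exact: (measurable_fun_xsection line).
Qed.

Lemma ge0_integral_leb2 (f : R * R -> \bar R) : measurable_fun setT f -> (forall x, 0 <= f x) ->
  \int[leb2]_x f x = \int[plane]_x f x.
Proof.
move=> mf f0.
have mid : measurable_fun setT (fun x : (measurableTypeR R * measurableTypeR R)%type => x : R * R) by [].
transitivity (\int[pushforward leb2 (fun x : (measurableTypeR R * measurableTypeR R)%type => x : R * R)]_x f x).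
  by rewrite ge0_integral_pushforward.
by apply: eq_measure_integral => A mA _; exact/esym/planeE.
Qed.

Lemma integral_leb2 (f : R * R -> \bar R) : measurable_fun setT f ->
  \int[leb2]_x f x = \int[plane]_x f x.
Proof.
move=> mf; rewrite [LHS]integralE [RHS]integralE.
by rewrite !ge0_integral_leb2//; [exact: measurable_funeneg|exact: measurable_funepos].
Qed.

Lemma Rintegral_leb2 (f : R * R -> R) : measurable_fun setT f ->
  (\int[leb2]_x f x)%R = (\int[plane]_x f x)%R.
Proof.
by move=> mf; rewrite /Rintegral integral_leb2//; exact/measurable_EFinP.
Qed.

Lemma integrable_leb2 (f : R * R -> \bar R) :
  leb2.-integrable setT f <-> plane.-integrable setT f.
Proof.
by split=> /integrableP[mf fy]; apply/integrableP; split=> //; move: fy;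
  rewrite ge0_integral_leb2//; apply: measurableT_comp.
Qed.

Lemma ae_leb2 (P : set (R * R)) : {ae leb2, forall x, P x} <-> {ae plane, forall x, P x}.
Proof.
split=> -[A [mA A0 PA]]; exists A; split=> //.
  by rewrite planeE.
by rewrite -planeE.
Qed.

Lemma ae_lebesgue (P : set R) : {ae lebesgue_measure, forall x, P x} <-> {ae line, forall x, P x}.
Proof. by split=> -[A [mA A0 PA]]; exists A; split. Qed.

(** A translation preserves the length of half-open intervals, and these determine Lebesgue
    measure. *)
Lemma line_shift (f : R -> \bar R) (c : R) : measurable_fun setT f -> (forall x, 0 <= f x) ->
  \int[line]_x f (x + c)%R = \int[line]_x f x.
Proof.
move=> mf f0.
have mc : measurable_fun setT (fun x : R => (x + c)%R) by exact: measurable_funD.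
have mc' : measurable_fun setT (fun x : measurableTypeR R => (x + c)%R : measurableTypeR R) by exact: mc.
transitivity (\int[pushforward line (fun x : R => (x + c)%R)]_x f x).
  by rewrite ge0_integral_pushforward.
apply: eq_measure_integral => A mA _; apply/esym.
pose nu := pushforward (@lebesgue_measure R) (fun x : measurableTypeR R => (x + c)%R : measurableTypeR R).
apply: (@lebesgue_measure_unique R nu) => //= _ [[a b]] _ <-.
rewrite /nu /pushforward/= (_ : _ @^-1` _ = `](a - c)%R, (b - c)%R]%classic); last first.
  by apply/seteqP; split => x /=; rewrite !in_itv/= ltrBlDr lerBrDr.
by rewrite !lebesgue_measure_itv/= !lte_fin ltrD2r -!EFinB opprB addrA subrK.
Qed.

Lemma line_opp (f : R -> \bar R) : measurable_fun setT f -> (forall x, 0 <= f x) ->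
  \int[line]_x f (- x)%R = \int[line]_x f x.
Proof.
move=> mf f0.
have mN : measurable_fun setT (fun x : R => (- x)%R) by exact: oppr_measurable.
transitivity (\int[pushforward line (fun x : R => (- x)%R)]_x f x).
  by rewrite ge0_integral_pushforward.
by apply: eq_measure_integral => A mA _; exact: lebesgue_measureN.
Qed.

Lemma line_set1 (r : R) : line [set r] = 0.
Proof. exact: lebesgue_measure_set1. Qed.

Opaque line plane.

Lemma measurable_addc (c : R * R) : measurable_fun setT (fun x : R * R => (x + c)%R).
Proof. by apply/measurable_fun_pairP; split; apply: measurable_funD. Qed.

Lemma measurable_subc (c : R * R) : measurable_fun setT (fun x : R * R => (x - c)%R).
Proof. by apply/measurable_fun_pairP; split; apply: measurable_funB. Qed.

Lemma measurable_csub (c : R * R) : measurable_fun setT (fun x : R * R => (c - x)%R).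
Proof. by apply/measurable_fun_pairP; split; apply: measurable_funB. Qed.

Lemma measurable_opp2 : measurable_fun setT (fun x : R * R => (- x)%R).
Proof. by apply/measurable_fun_pairP; split; apply: measurable_funN. Qed.

Lemma measurable_sub2 : measurable_fun setT (fun z : (R * R) * (R * R) => (z.1 - z.2)%R).
Proof.
by apply/measurable_fun_pairP; split; apply: measurable_funB; apply: measurableT_comp.
Qed.

Lemma measurable_sub21 : measurable_fun setT (fun z : (R * R) * (R * R) => (z.2 - z.1)%R).
Proof.
by apply/measurable_fun_pairP; split; apply: measurable_funB; apply: measurableT_comp.
Qed.

Lemma plane_line (f : R * R -> \bar R) : measurable_fun setT f -> (forall x, 0 <= f x) ->
  \int[plane]_x f x = \int[line]_a \int[line]_b f (a, b).
Proof. by move=> mf f0; exact: fubini_tonelli1. Qed.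

Lemma plane_line2 (f : R * R -> \bar R) : measurable_fun setT f -> (forall x, 0 <= f x) ->
  \int[plane]_x f x = \int[line]_b \int[line]_a f (a, b).
Proof. by move=> mf f0; exact: fubini_tonelli2. Qed.

Lemma plane_shift (f : R * R -> \bar R) (c : R * R) : measurable_fun setT f -> (forall x, 0 <= f x) ->
  \int[plane]_x f (x + c)%R = \int[plane]_x f x.
Proof.
move=> mf f0.
rewrite (plane_line (measurableT_comp mf (measurable_addc c)) (fun x => f0 _)) (plane_line mf f0) /=.
have mF : measurable_fun setT (fun a => \int[line]_b f (a, b)).
  exact: (measurable_fun_fubini_tonelli_F f).
rewrite -(line_shift c.1 mF); last by move=> a; exact: integral_ge0.
apply: eq_integral => a _.
have mfa : measurable_fun setT (fun b => f ((a + c.1)%R, b)) by exact: (measurableT_comp mf).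
exact: (line_shift c.2 mfa).
Qed.

Lemma plane_opp (f : R * R -> \bar R) : measurable_fun setT f -> (forall x, 0 <= f x) ->
  \int[plane]_x f (- x)%R = \int[plane]_x f x.
Proof.
move=> mf f0.
rewrite (plane_line (measurableT_comp mf measurable_opp2) (fun x => f0 _)) (plane_line mf f0) /=.
have mF : measurable_fun setT (fun a => \int[line]_b f (a, b)).
  exact: (measurable_fun_fubini_tonelli_F f).
rewrite -(line_opp mF); last by move=> a; exact: integral_ge0.
apply: eq_integral => a _.
have mfa : measurable_fun setT (fun b => f ((- a)%R, b)) by exact: (measurableT_comp mf).
exact: (line_opp mfa).
Qed.

Lemma plane_sub (f : R * R -> \bar R) (c : R * R) : measurable_fun setT f -> (forall x, 0 <= f x) ->
  \int[plane]_x f (c - x)%R = \int[plane]_x f x.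
Proof.
move=> mf f0.
rewrite -(plane_shift c mf f0) -(plane_opp (measurableT_comp mf (measurable_addc c)) (fun x => f0 _)).
by apply: eq_integral => x _; rewrite /= addrC.
Qed.

Lemma measurable_shear1 (k : R) : measurable_fun setT (fun x : R * R => (x.1 + k * x.2, x.2)%R).
Proof.
apply/measurable_fun_pairP; split; last exact: measurable_snd.
by apply: (@measurable_funD _ _ _ _ fst (fun x => k * x.2)%R) => //; exact: measurable_funM.
Qed.

Lemma measurable_shear2 (k : R) : measurable_fun setT (fun x : R * R => (x.1, x.2 + k * x.1)%R).
Proof.
apply/measurable_fun_pairP; split; first exact: measurable_fst.
by apply: (@measurable_funD _ _ _ _ snd (fun x => k * x.1)%R) => //; exact: measurable_funM.
Qed.

Lemma measurable_oppl : measurable_fun setT (fun x : R * R => (- x.1, x.2)%R).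
Proof.
apply/measurable_fun_pairP; split; last exact: measurable_snd.
exact: (@measurable_funN _ _ _ _ fst).
Qed.

Lemma plane_shear1 (f : R * R -> \bar R) (k : R) : measurable_fun setT f -> (forall x, 0 <= f x) ->
  \int[plane]_x f (x.1 + k * x.2, x.2)%R = \int[plane]_x f x.
Proof.
move=> mf f0.
rewrite (plane_line2 (measurableT_comp mf (measurable_shear1 k)) (fun x => f0 _)) (plane_line2 mf f0) /=.
apply: eq_integral => b _.
have mfb : measurable_fun setT (fun a => f (a, b)) by exact: (measurableT_comp mf).
exact: (line_shift _ mfb).
Qed.

Lemma plane_shear2 (f : R * R -> \bar R) (k : R) : measurable_fun setT f -> (forall x, 0 <= f x) ->
  \int[plane]_x f (x.1, x.2 + k * x.1)%R = \int[plane]_x f x.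
Proof.
move=> mf f0.
rewrite (plane_line (measurableT_comp mf (measurable_shear2 k)) (fun x => f0 _)) (plane_line mf f0) /=.
apply: eq_integral => a _.
have mfa : measurable_fun setT (fun b => f (a, b)) by exact: (measurableT_comp mf).
exact: (line_shift _ mfa).
Qed.

Lemma plane_oppl (f : R * R -> \bar R) : measurable_fun setT f -> (forall x, 0 <= f x) ->
  \int[plane]_x f (- x.1, x.2)%R = \int[plane]_x f x.
Proof.
move=> mf f0.
rewrite (plane_line2 (measurableT_comp mf measurable_oppl) (fun x => f0 _)) (plane_line2 mf f0) /=.
apply: eq_integral => b _.
have mfb : measurable_fun setT (fun a => f (a, b)) by exact: (measurableT_comp mf).
exact: (line_opp mfb).
Qed.

(** For [c = cos theta] and [s = sin theta] this is the reflection in the line at angle [theta / 2];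
    every reflection fixing the origin has this form. *)
Definition refl (c s : R) (x : R * R) : R * R := (c * x.1 + s * x.2, s * x.1 - c * x.2)%R.

Lemma measurable_refl c s : measurable_fun setT (refl c s).
Proof.
by apply/measurable_fun_pairP; split => /=; [apply: measurable_funD|apply: measurable_funB];
  exact: measurable_funM.
Qed.

(* Away from [c = 1] the reflection is the product of three shears and of a reflection in a
   coordinate axis. *)
Lemma plane_refl (f : R * R -> \bar R) (c s : R) : (c ^+ 2 + s ^+ 2 = 1)%R ->
  measurable_fun setT f -> (forall x, 0 <= f x) ->
  \int[plane]_x f (refl c s x) = \int[plane]_x f x.
Proof.
move=> cs mf f0; have [c1|c1] := eqVneq c 1%R.
  have s0 : s = 0%R by apply/eqP; rewrite -sqrf_eq0; apply/eqP; nra.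
  have mf' := measurableT_comp mf measurable_opp2.
  rewrite -(plane_opp mf f0) -(plane_oppl mf' (fun x => f0 _)).
  apply: eq_integral => x _; rewrite /refl c1 s0 /=; congr f.
  by congr pair; rewrite /=; ring.
pose k := (s / (1 - c))%R.
have c1' : (1 - c != 0)%R by rewrite subr_eq0 eq_sym.
rewrite -(plane_shear1 k mf f0).
have mf1 := measurableT_comp mf (measurable_shear1 k).
rewrite -(plane_shear2 (- s) mf1 (fun x => f0 _)).
have mf2 := measurableT_comp mf1 (measurable_shear2 (- s)).
rewrite -(plane_shear1 k mf2 (fun x => f0 _)).
have mf3 := measurableT_comp mf2 (measurable_shear1 k).
rewrite -(plane_oppl mf3 (fun x => f0 _)).
apply: eq_integral => x _; rewrite /refl/=; congr f.
have e1 : (s * k = 1 + c)%R.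
  rewrite /k mulrA -expr2 (_ : s ^+ 2 = (1 + c) * (1 - c))%R ?mulfK//.
  by lra.
have e2 : (k * (1 - c) = s)%R by rewrite /k divfK.
have e3 : (x.2 + - s * (- x.1 + k * x.2) = s * x.1 - c * x.2)%R.
  by rewrite mulNr mulrDr mulrA e1; ring.
congr pair; last by rewrite e3.
rewrite e3 mulrBr mulrA (mulrC k s) e1 -{1}e2.
by ring.
Qed.

Definition conv (p q : R * R -> \bar R) (x : R * R) : \bar R := \int[plane]_y (p (x - y)%R * q y).

Lemma measurable_conv_integrand (p q : R * R -> \bar R) :
  measurable_fun setT p -> measurable_fun setT q ->
  measurable_fun setT (fun z : (R * R) * (R * R) => p (z.1 - z.2)%R * q z.2).
Proof.
move=> mp mq; apply: emeasurable_funM; last exact: (measurableT_comp mq).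
exact: (measurableT_comp mp measurable_sub2).
Qed.

Lemma measurable_conv (p q : R * R -> \bar R) : measurable_fun setT p -> measurable_fun setT q ->
  (forall x, 0 <= p x) -> (forall x, 0 <= q x) -> measurable_fun setT (conv p q).
Proof.
move=> mp mq p0 q0.
apply: (measurable_fun_fubini_tonelli_F (fun z : (R * R) * (R * R) => p (z.1 - z.2)%R * q z.2)).
  exact: measurable_conv_integrand.
by move=> z; rewrite mule_ge0.
Qed.

Lemma conv_ge0 (p q : R * R -> \bar R) x : (forall x, 0 <= p x) -> (forall x, 0 <= q x) -> 0 <= conv p q x.
Proof. by move=> p0 q0; apply: integral_ge0 => y _; rewrite mule_ge0. Qed.

Lemma convC (p q : R * R -> \bar R) : measurable_fun setT p -> measurable_fun setT q ->
  (forall x, 0 <= p x) -> (forall x, 0 <= q x) -> conv p q = conv q p.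
Proof.
move=> mp mq p0 q0; apply/funext => x; rewrite /conv.
rewrite -(plane_sub (f := fun y => p (x - y)%R * q y) x)//.
- by apply: eq_integral => y _; rewrite opprB addrC subrK muleC.
- by apply: emeasurable_funM => //; apply: (measurableT_comp mp (measurable_csub x)).
- by move=> y; rewrite mule_ge0.
Qed.

Lemma integral_conv (p q : R * R -> \bar R) : measurable_fun setT p -> measurable_fun setT q ->
  (forall x, 0 <= p x) -> (forall x, 0 <= q x) ->
  \int[plane]_x conv p q x = \int[plane]_x p x * \int[plane]_x q x.
Proof.
move=> mp mq p0 q0; rewrite /conv.
rewrite (fubini_tonelli (fun z : (R * R) * (R * R) => p (z.1 - z.2)%R * q z.2))/=; first last.
- by move=> z; rewrite mule_ge0.
- exact: measurable_conv_integrand.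
rewrite -ge0_integralZl//; last exact: integral_ge0.
apply: eq_integral => y _; rewrite ge0_integralZr//.
  by rewrite (plane_shift (f := p) (- y)%R).
exact: (measurableT_comp mp (measurable_subc y)).
Qed.

Lemma convA (p q r : R * R -> \bar R) : measurable_fun setT p -> measurable_fun setT q -> measurable_fun setT r ->
  (forall x, 0 <= p x) -> (forall x, 0 <= q x) -> (forall x, 0 <= r x) ->
  conv p (conv q r) = conv (conv p q) r.
Proof.
move=> mp mq mr p0 q0 r0; apply/funext => x; rewrite {1}/conv.
have mpx : measurable_fun setT (fun y : R * R => p (x - y)%R) by exact: (measurableT_comp mp (measurable_csub x)).
transitivity (\int[plane]_z \int[plane]_y (q (y - z)%R * r z * p (x - y)%R)).
  rewrite -(integral_mul_integral plane plane (F := fun z : (R * R) * (R * R) => q (z.2 - z.1)%R * r z.1))//.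
  - by apply: eq_integral => y _; rewrite muleC.
  - apply: emeasurable_funM; last exact: (measurableT_comp mr).
    exact: (measurableT_comp mq measurable_sub21).
  - by move=> z; rewrite mule_ge0.
apply: eq_integral => z _.
transitivity (\int[plane]_y ((p (x - y)%R * q (y - z)%R) * r z)).
  by apply: eq_integral => y _; rewrite muleC muleA.
have mpq : measurable_fun setT (fun y : R * R => p (x - y)%R * q (y - z)%R).
  by apply: emeasurable_funM => //; exact: (measurableT_comp mq (measurable_subc z)).
rewrite ge0_integralZr//; last by move=> y _; rewrite mule_ge0.
congr (_ * _); rewrite -(plane_shift z mpq); last by move=> y; rewrite mule_ge0.
by apply: eq_integral => y _; rewrite addrK opprD addrA addrAC.
Qed.

Lemma conv_le_sup (p q : R * R -> \bar R) (A B : R) x :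
  measurable_fun setT p -> measurable_fun setT q ->
  (forall x, 0 <= p x) -> (forall x, 0 <= q x) -> (forall x, p x <= A%:E) ->
  \int[plane]_x q x <= B%:E -> conv p q x <= (A * B)%:E.
Proof.
move=> mp mq p0 q0 pA qB.
have A0 : (0 <= A)%R by rewrite -lee_fin (le_trans (p0 x)).
apply: (@le_trans _ _ (\int[plane]_y (A%:E * q y))).
  apply: ge0_le_integral => //.
  - by move=> y _; rewrite mule_ge0.
  - by apply: emeasurable_funM => //; apply: (measurableT_comp mp (measurable_csub x)).
  - exact: emeasurable_funM.
  - by move=> y _; rewrite lee_wpmul2r.
by rewrite ge0_integralZl// ?lee_fin// EFinM lee_pmul ?lee_fin// integral_ge0.
Qed.

(** The bound is put on the square, so that it includes finiteness and takes no root of an extended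
    real. *)
Definition L2le (f : R * R -> \bar R) (A : R) := \int[plane]_x (f x * f x) <= (A ^+ 2)%:E.

Lemma conv_le_L2 (p q : R * R -> \bar R) (A B : R) x :
  measurable_fun setT p -> measurable_fun setT q ->
  (forall x, 0 <= p x) -> (forall x, 0 <= q x) -> (0 <= A)%R -> (0 <= B)%R ->
  L2le p A -> L2le q B -> conv p q x <= (A * B)%:E.
Proof.
move=> mp mq p0 q0 A0 B0 pA qB; apply: le_cauchy_schwarz => //.
  by apply: (measurableT_comp mp (measurable_csub x)).
rewrite (plane_sub (f := fun y => p y * p y))//; first exact: emeasurable_funM.
by move=> y; rewrite mule_ge0.
Qed.

(** The convolution is a superposition of translates of [p] with density [q], to which Minkowski
    applies. The density there is real, hence the passage to [fine \o q], which agrees with [q]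
    almost everywhere. *)
Lemma L2le_conv (p q : R * R -> \bar R) (A B : R) :
  measurable_fun setT p -> measurable_fun setT q ->
  (forall x, 0 <= p x) -> (forall x, 0 <= q x) -> (0 <= A)%R ->
  L2le p A -> \int[plane]_x q x <= B%:E -> L2le (conv p q) (A * B).
Proof.
move=> mp mq p0 q0 A0 pA qB.
have mfq : measurable_fun setT (fine \o q) by exact: measurableT_comp.
have qfin : {ae plane, forall y, q y \is a fin_num}.
  have : plane.-integrable setT q.
    apply/integrableP; split; first by [].
    rewrite (_ : \int[plane]_x `|q x| = \int[plane]_x q x); first by rewrite (le_lt_trans qB)// ltry.
    by apply: eq_integral => x _; rewrite gee0_abs.
  by move=> /integrable_ae - /(_ measurableT); apply: filterS => y /= /(_ I).
have := @minkowski_integral R _ _ _ _ plane plane (fun z : (R * R) * (R * R) => p (z.2 - z.1)%R * q z.1)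
  (fun y => A * (fine \o q) y)%R (A * B)%R; apply.
- apply: emeasurable_funM; last exact: (measurableT_comp mq).
  exact: (measurableT_comp mp measurable_sub21).
- by move=> z; rewrite mule_ge0.
- exact: measurable_funM.
- by move=> y; rewrite mulr_ge0//= fine_ge0.
- move: qfin; apply: filterS => y qy.
  have mpy : measurable_fun setT (fun x : R * R => p (x - y)%R) by exact: (measurableT_comp mp (measurable_subc y)).
  have -> : \int[plane]_x (p (x - y)%R * q y * (p (x - y)%R * q y)) =
      \int[plane]_x ((p (x - y)%R * p (x - y)%R) * (q y * q y)).
    by apply: eq_integral => x _; rewrite muleACA.
  rewrite ge0_integralZr; [|by []|exact: emeasurable_funM|by move=> x _; rewrite mule_ge0|by rewrite mule_ge0].
  rewrite (plane_shift (f := fun x => p x * p x) (- y)%R); [|exact: emeasurable_funM|by move=> x; rewrite mule_ge0].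
  rewrite [leRHS](_ : _ = (A ^+ 2)%:E * (q y * q y)); first by rewrite lee_wpmul2r// mule_ge0.
  by move: qy; rewrite /=; case: (q y) => [r _| |]//; rewrite -!EFinM; congr EFin; rewrite /=; ring.
- rewrite (_ : \int[plane]_y (A * (fine \o q) y)%:E = \int[plane]_y (A%:E * (fine (q y))%:E)); last first.
    by apply: eq_integral => y _; rewrite EFinM.
  rewrite ge0_integralZl_EFin; [|by []|by move=> y _; rewrite lee_fin fine_ge0|exact/measurable_EFinP|by []].
  rewrite EFinM lee_wpmul2l ?lee_fin// (le_trans _ qB)//.
  apply: ge0_le_integral => //.
  + by move=> y _; rewrite lee_fin fine_ge0.
  + exact/measurable_EFinP.
  + by move=> y _; case: (q y) (q0 y) => //= *; exact: leey.
Qed.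

Lemma L2leD (f g : R * R -> \bar R) (A B : R) : measurable_fun setT f -> measurable_fun setT g ->
  (forall x, 0 <= f x) -> (forall x, 0 <= g x) -> (0 <= A)%R -> (0 <= B)%R ->
  L2le f A -> L2le g B -> L2le (fun x => f x + g x) (A + B).
Proof.
move=> mf mg f0 g0 A0 B0 fA gB; rewrite /L2le.
have -> : \int[plane]_x ((f x + g x) * (f x + g x)) =
    \int[plane]_x ((f x * f x + f x * g x) + (f x * g x + g x * g x)).
  by apply: eq_integral => x _; rewrite ge0_muleDl// !ge0_muleDr// (muleC (g x) (f x)).
have mff := emeasurable_funM mf mf. have mfg := emeasurable_funM mf mg. have mgg := emeasurable_funM mg mg.
rewrite ge0_integralD//; [|by move=> x _; rewrite adde_ge0// mule_ge0|exact: emeasurable_funD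
  |by move=> x _; rewrite adde_ge0// mule_ge0|exact: emeasurable_funD].
rewrite !ge0_integralD//; try by move=> x _; rewrite mule_ge0.
have fg := le_cauchy_schwarz mf mg f0 g0 A0 B0 fA gB.
rewrite (_ : ((A + B) ^+ 2)%:E = (A ^+ 2)%:E + (A * B)%:E + ((A * B)%:E + (B ^+ 2)%:E)).
  by rewrite !leeD.
by rewrite -!EFinD; congr EFin; ring.
Qed.

Lemma L2le_mono (f g : R * R -> \bar R) (A : R) : measurable_fun setT f -> measurable_fun setT g ->
  (forall x, 0 <= f x) -> (forall x, f x <= g x) -> L2le g A -> L2le f A.
Proof.
move=> mf mg f0 fg; apply: le_trans; apply: ge0_le_integral => //.
- by move=> x _; rewrite mule_ge0.
- exact: emeasurable_funM.
- exact: emeasurable_funM.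
- by move=> x _; rewrite lee_pmul.
Qed.

Lemma L2leW (f : R * R -> \bar R) (A B : R) : (0 <= A)%R -> (A <= B)%R -> L2le f A -> L2le f B.
Proof.
by move=> A0 AB /le_trans; apply; rewrite lee_fin ler_pXn2r// nnegrE// (le_trans A0).
Qed.

Lemma L2leZ (f : R * R -> \bar R) (k A : R) : measurable_fun setT f -> (forall x, 0 <= f x) -> (0 <= k)%R ->
  L2le f A -> L2le (fun x => k%:E * f x) (k * A).
Proof.
move=> mf f0 k0 fA; rewrite /L2le.
have -> : \int[plane]_x (k%:E * f x * (k%:E * f x)) = \int[plane]_x ((k ^+ 2)%:E * (f x * f x)).
  by apply: eq_integral => x _; rewrite muleACA expr2 EFinM.
rewrite ge0_integralZl_EFin; [|by []|by move=> x _; rewrite mule_ge0|exact: emeasurable_funM|exact: sqr_ge0].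
by rewrite exprMn [leRHS]EFinM lee_wpmul2l// lee_fin sqr_ge0.
Qed.

End Plane.
Opaque line plane.

(** * The heat kernel *)

Section HeatKernel.
Local Open Scope ereal_scope.
Context (R : realType).
Implicit Types (s t : R) (x y : R * R).

Definition hk t x : \bar R := (heat_kernel t x)%:E.

Lemma sqeucl_ge0 x : (0 <= sqeucl x)%R.
Proof. by rewrite addr_ge0// sqr_ge0. Qed.

Lemma sqeuclN x : sqeucl (- x)%R = sqeucl x.
Proof. by rewrite /sqeucl !sqrrN. Qed.

Lemma heat_kernel_ge0 t x : (0 <= t)%R -> (0 <= heat_kernel t x)%R.
Proof. by move=> t0; rewrite mulr_ge0 ?expR_ge0// invr_ge0 !mulr_ge0// pi_ge0. Qed.

Lemma heat_kernelN t x : heat_kernel t (- x)%R = heat_kernel t x.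
Proof. by rewrite /heat_kernel sqeuclN. Qed.

Lemma measurable_inv : measurable_fun [set: R] (fun r : R => r^-1)%R.
Proof.
rewrite [X in measurable_fun _ X](_ : _ = fun r : R => if (0 <= r)%R then (r `^ (- 1))%R else (- ((- r) `^ (- 1)))%R).
  apply: measurable_fun_ifT.
  - exact: measurable_fun_ler.
  - exact: measurable_powR.
  - apply: measurable_funN. exact: (measurableT_comp (@measurable_powR R (- 1)%R) (@oppr_measurable R setT)).
apply/funext => r; case: ifPn => [r0|]; first by rewrite powR_inv1.
by rewrite -ltNge => r0; rewrite powR_inv1 ?invrN ?opprK// oppr_ge0 ltW.
Qed.

Lemma measurable_sqeucl : measurable_fun setT (@sqeucl R).
Proof. by apply: measurable_funD; apply: measurable_funX. Qed.

Lemma measurable_heat_kernel2 : measurable_fun setT (fun z : R * (R * R) => heat_kernel z.1 z.2).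
Proof.
apply: measurable_funM.
  apply: (measurableT_comp measurable_inv); apply: measurable_funM => //.
apply: (measurableT_comp (@measurable_expR R)); apply: measurable_funN; apply: measurable_funM.
  exact: (measurableT_comp measurable_sqeucl).
by apply: (measurableT_comp measurable_inv); apply: measurable_funM.
Qed.

Lemma measurable_heat_kernel t : measurable_fun setT (heat_kernel t).
Proof. exact: (measurableT_comp measurable_heat_kernel2 (pair1_measurable t)). Qed.

Lemma measurable_hk t : measurable_fun setT (hk t).
Proof. by apply/measurable_EFinP; exact: measurable_heat_kernel. Qed.

Lemma hk_ge0 t x : (0 <= t)%R -> 0 <= hk t x.
Proof. by move=> t0; rewrite lee_fin heat_kernel_ge0. Qed.

(** Each coordinate is a centred Gaussian of variance [2 * t]; the total mass of the heat kernel
    follows. *)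
Lemma heat_kernel_normal_pdf t x : (0 < t)%R ->
  heat_kernel t x = (normal_pdf 0 (Num.sqrt (2 * t)) x.1 * normal_pdf 0 (Num.sqrt (2 * t)) x.2)%R.
Proof.
move=> t0; have s0 : (Num.sqrt (2 * t) != 0)%R by rewrite gt_eqF// sqrtr_gt0 mulr_gt0.
rewrite !normal_pdfE// /normal_fun /normal_peak !subr0 mulrACA -expRD.
rewrite sqr_sqrtr; last by rewrite mulr_ge0// ltW.
congr (_ * expR _)%R.
  rewrite -invfM -expr2 sqr_sqrtr; last by rewrite mulrn_wge0// !mulr_ge0 ?pi_ge0// ltW.
  by congr (_^-1)%R; ring.
by rewrite /sqeucl; field; rewrite gt_eqF.
Qed.

Lemma integral_hk t : (0 < t)%R -> \int[plane R]_x hk t x = 1.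
Proof.
move=> t0; have s0 : (Num.sqrt (2 * t) != 0)%R by rewrite gt_eqF// sqrtr_gt0 mulr_gt0.
rewrite plane_line; [|exact: measurable_hk|by move=> x; rewrite hk_ge0// ltW].
pose g : R -> R := normal_pdf 0 (Num.sqrt (2 * t))%R.
have mg : measurable_fun setT g by exact: measurable_normal_pdf.
have g0 r : (0 <= g r)%R by exact: normal_pdf_ge0.
have ig : \int[line R]_x (g x)%:E = 1.
  by rewrite -ge0_integral_lebesgue; [exact: integral_normal_pdf|exact/measurable_EFinP|].
transitivity (\int[line R]_a (g a)%:E); last by [].
apply: eq_integral => a _.
transitivity (\int[line R]_b ((g a)%:E * (g b)%:E)).
  by apply: eq_integral => b _; rewrite /hk heat_kernel_normal_pdf.
by rewrite ge0_integralZl ?ig ?mule1//; [exact/measurable_EFinP|by move=> r _; rewrite lee_fin|by rewrite lee_fin].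
Qed.

(** Completing the square in [y]. The second factor has mass one in [y], so integration gives the
    semigroup law. *)
Lemma heat_kernel_mul s t x y : (0 < s)%R -> (0 < t)%R ->
  (heat_kernel s (x - y) * heat_kernel t y =
   heat_kernel (s + t) x * heat_kernel (s * t / (s + t)) (y - (t / (s + t)) *: x))%R.
Proof.
move=> s0 t0; have st0 : (0 < s + t)%R by rewrite addr_gt0.
rewrite /heat_kernel mulrACA -expRD [RHS]mulrACA -expRD; congr (_ * expR _)%R.
  move: (pi_gt0 R); move: (@pi R) => P P0.
  by field; rewrite !gt_eqF.
rewrite /sqeucl/= /GRing.scale/=.
by field; rewrite !gt_eqF.
Qed.

Lemma conv_hk s t : (0 < s)%R -> (0 < t)%R -> conv (hk s) (hk t) = hk (s + t)%R.
Proof.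
move=> s0 t0; apply/funext => x; rewrite /conv.
have st0 : (0 < s + t)%R by rewrite addr_gt0.
have r0 : (0 < s * t / (s + t))%R by rewrite divr_gt0// mulr_gt0.
transitivity (\int[plane R]_y (hk (s + t)%R x * hk (s * t / (s + t))%R (y - (t / (s + t)) *: x)%R)).
  by apply: eq_integral => y _; rewrite /hk -EFinM heat_kernel_mul.
have mh := measurable_hk (s * t / (s + t))%R.
rewrite ge0_integralZl; [|by []|exact: (measurableT_comp mh (measurable_subc _))
  |by move=> y _; rewrite hk_ge0// ltW|by rewrite hk_ge0// ltW].
rewrite (plane_shift (- ((t / (s + t)) *: x))%R mh); last by move=> y; rewrite hk_ge0// ltW.
by rewrite integral_hk// mule1.
Qed.

Lemma pi_gt1 : (1 < pi :> R)%R.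
Proof. by have := @pi_ge2 R; lra. Qed.

Lemma heat_kernel_le t x : (0 < t)%R -> (heat_kernel t x <= t^-1)%R.
Proof.
move=> t0; rewrite -[leRHS]mulr1 ler_pM ?expR_ge0//.
- by rewrite invr_ge0 !mulr_ge0// ?pi_ge0// ltW.
- rewrite lef_pV2 ?posrE ?mulr_gt0 ?pi_gt0//.
  by have := pi_gt1; nra.
- by rewrite expR_le1 oppr_le0 divr_ge0 ?sqeucl_ge0// mulr_ge0// ltW.
Qed.

Lemma hk_le t x : (0 < t)%R -> hk t x <= (t^-1)%:E.
Proof. by move=> t0; rewrite lee_fin heat_kernel_le. Qed.

Lemma integral_hk_mul t x : (0 < t)%R ->
  \int[plane R]_y (hk t (x - y)%R * hk t y) = hk (2 * t)%R x.
Proof. by move=> t0; rewrite -[LHS]/(conv (hk t) (hk t) x) conv_hk// mulrDl mul1r. Qed.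

Lemma integral_hk_sqr t : (0 < t)%R -> \int[plane R]_y (hk t y * hk t y) = hk (2 * t)%R 0%R.
Proof.
move=> t0; rewrite -(integral_hk_mul 0%R t0); apply: eq_integral => y _.
by rewrite /hk sub0r heat_kernelN.
Qed.

(** By the semigroup law the square of the norm is the value at the origin of the kernel at time
    [2 * t]. *)
Lemma L2le_hk t : (0 < t)%R -> L2le (hk t) (t `^ (- 2^-1)).
Proof.
move=> t0; rewrite /L2le integral_hk_sqr// lee_fin.
rewrite -powR_mulrn ?powR_ge0// -powRrM mulNr mulVf// powR_inv1; last exact: ltW.
rewrite (le_trans (heat_kernel_le _ _)) ?mulr_gt0// lef_pV2 ?posrE ?mulr_gt0//.
by rewrite ler_peMl ?ltW// ltr1n.
Qed.

(* [u exp (- u^2 / 8) <= 2]: the polynomial factor is absorbed by doubling the time. *)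
Lemma gaussian_moment (r q P : R) : (0 <= r -> 0 < q -> 0 < P ->
  r / (2 * q ^+ 2) * ((4 * P * q ^+ 2)^-1 * expR (- (r ^+ 2 / (4 * q ^+ 2)))) <=
  2 * q^-1 * ((4 * P * (2 * q ^+ 2))^-1 * expR (- (r ^+ 2 / (4 * (2 * q ^+ 2))))))%R.
Proof.
move=> r0 q0 P0; pose u : R := (r / q)%R.
have u0 : (0 <= u)%R by rewrite divr_ge0// ltW.
have -> : (r ^+ 2 / (4 * q ^+ 2) = u ^+ 2 / 8 + u ^+ 2 / 8)%R by rewrite /u; field; rewrite gt_eqF.
have -> : (r ^+ 2 / (4 * (2 * q ^+ 2)) = u ^+ 2 / 8)%R by rewrite /u; field; rewrite gt_eqF.
rewrite opprD expRD.
have eu : (u * expR (- (u ^+ 2 / 8)) <= 2)%R.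
  rewrite expRN ler_pdivrMr ?expR_gt0//.
  have := expR_ge1Dx (u ^+ 2 / 8); nra.
move: (expR_gt0 (- (u ^+ 2 / 8))) eu; move: (expR _) => e e0 eu.
have -> : (r / (2 * q ^+ 2) * ((4 * P * q ^+ 2)^-1 * (e * e)) =
    (u * e) * ((2 * q)^-1 * ((4 * P * q ^+ 2)^-1 * e)))%R.
  by rewrite /u; field; rewrite !gt_eqF.
have -> : (2 * q^-1 * ((4 * P * (2 * q ^+ 2))^-1 * e) = 2 * ((2 * q)^-1 * ((4 * P * q ^+ 2)^-1 * e)))%R.
  by field; rewrite !gt_eqF.
by rewrite ler_wpM2r// mulr_ge0 ?mulr_ge0 ?invr_ge0 ?mulr_ge0 ?sqr_ge0 ?ltW.
Qed.

(** The factor in front of [heat_kernel t x] on the left turns it into the Euclidean length of its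
    gradient. *)
Lemma heat_kernel_moment t x : (0 < t)%R ->
  (Num.sqrt (sqeucl x) / (2 * t) * heat_kernel t x <= 2 * t `^ (- 2^-1) * heat_kernel (2 * t) x)%R.
Proof.
move=> t0.
have st : (0 < Num.sqrt t)%R by rewrite sqrtr_gt0.
have := gaussian_moment (sqrtr_ge0 (sqeucl x)) st (pi_gt0 R).
by rewrite !sqr_sqrtr ?sqeucl_ge0 ?(ltW t0)// powRN powR12_sqrt ?(ltW t0).
Qed.

End HeatKernel.

(** * Gradient and Laplacian of the heat kernel *)

Section HeatKernelDerivatives.
Context (R : realType).
Implicit Types (t : R) (x : R * R).

Lemma quotient1E (f : R * R -> R) a b :
  (fun h : R => h^-1 *: ((f \o shift (a, b)) (h *: ((1, 0) : R * R)) - f (a, b))) =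
  (fun h : R => h^-1 *: (((fun r => f (r, b)) \o shift a) (h *: (1 : R)) - f (a, b))).
Proof.
by apply/funext => h /=; congr (_ *: (f _ - _)); congr pair; rewrite /= /GRing.scale/= mulr0 add0r.
Qed.

Lemma quotient2E (f : R * R -> R) a b :
  (fun h : R => h^-1 *: ((f \o shift (a, b)) (h *: ((0, 1) : R * R)) - f (a, b))) =
  (fun h : R => h^-1 *: (((fun r => f (a, r)) \o shift b) (h *: (1 : R)) - f (a, b))).
Proof.
by apply/funext => h /=; congr (_ *: (f _ - _)); congr pair; rewrite /= /GRing.scale/= mulr0 add0r.
Qed.

Lemma partial1E (f : R * R -> R) x : partial1 f x = 'D_1 (fun r => f (r, x.2)) x.1.
Proof. by case: x => a b; rewrite /partial1 /derive quotient1E. Qed.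

Lemma partial2E (f : R * R -> R) x : partial2 f x = 'D_1 (fun r => f (x.1, r)) x.2.
Proof. by case: x => a b; rewrite /partial2 /derive quotient2E. Qed.

Lemma derivable1E (f : R * R -> R) x :
  derivable f x ((1, 0) : R * R) = derivable (fun r => f (r, x.2)) x.1 1.
Proof. by case: x => a b; rewrite /derivable quotient1E. Qed.

Lemma derivable2E (f : R * R -> R) x :
  derivable f x ((0, 1) : R * R) = derivable (fun r => f (x.1, r)) x.2 1.
Proof. by case: x => a b; rewrite /derivable quotient2E. Qed.

Lemma is_derive_gaussian (c b t r : R) : (0 < t) ->
  is_derive r 1 (fun r => c * expR (- ((r ^+ 2 + b) / (4 * t))))
    (- (r / (2 * t)) * (c * expR (- ((r ^+ 2 + b) / (4 * t))))).
Proof.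
move=> t0.
have d1 : is_derive r 1 (fun r : R => - ((r ^+ 2 + b) / (4 * t))) (- (r / (2 * t))).
  have -> : (fun r : R => - ((r ^+ 2 + b) / (4 * t))) = (fun r => (- (4 * t)^-1) *: (r ^+ 2 + b)).
    by apply/funext => s; rewrite /GRing.scale/= mulNr mulrC.
  apply: is_derive_eq.
  by rewrite addr0 /GRing.scale/= mulr1; field; rewrite gt_eqF.
have d2 : is_derive r 1 (fun r => expR (- ((r ^+ 2 + b) / (4 * t))))
    (- (r / (2 * t)) * expR (- ((r ^+ 2 + b) / (4 * t)))).
  rewrite [- (r / _) * _]mulrC.
  exact: (@is_derive1_comp R expR _ r _ _ (is_derive_expR _) d1).
apply: is_derive_eq; rewrite /GRing.scale/=; ring.
Qed.

Lemma partial1_heat_kernel t x : (0 < t) ->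
  partial1 (heat_kernel t) x = (- (x.1 / (2 * t)) * heat_kernel t x).
Proof.
move=> t0; rewrite partial1E.
by have /@derive_val -> := is_derive_gaussian (4 * pi * t)^-1 (x.2 ^+ 2) x.1 t0.
Qed.

Lemma partial2_heat_kernel t x : (0 < t) ->
  partial2 (heat_kernel t) x = (- (x.2 / (2 * t)) * heat_kernel t x).
Proof.
move=> t0; rewrite partial2E.
have -> : (fun r => heat_kernel t (x.1, r)) =
    (fun r => (4 * pi * t)^-1 * expR (- ((r ^+ 2 + x.1 ^+ 2) / (4 * t)))).
  by apply/funext => r; rewrite /heat_kernel /sqeucl/= addrC.
have /@derive_val -> := is_derive_gaussian (4 * pi * t)^-1 (x.1 ^+ 2) x.2 t0.
by rewrite /heat_kernel /sqeucl addrC.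
Qed.

Lemma is_derive_gaussian2 (c b t r : R) : (0 < t) ->
  is_derive r 1 (fun r => - (r / (2 * t)) * (c * expR (- ((r ^+ 2 + b) / (4 * t)))))
    ((r ^+ 2 / (4 * t ^+ 2) - (2 * t)^-1) * (c * expR (- ((r ^+ 2 + b) / (4 * t))))).
Proof.
move=> t0; have d1 := is_derive_gaussian c b r t0.
have d2 : is_derive r 1 (fun r : R => - (r / (2 * t))) (- (2 * t)^-1).
  have -> : (fun r : R => - (r / (2 * t))) = (fun r => (- (2 * t)^-1) *: r).
    by apply/funext => s; rewrite /GRing.scale/= mulNr mulrC.
  by apply: is_derive_eq; rewrite /GRing.scale/= mulr1.
apply: is_derive_eq; rewrite /GRing.scale/=.
by field; rewrite gt_eqF.
Qed.

Lemma partial11_heat_kernel t x : (0 < t) ->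
  partial1 (partial1 (heat_kernel t)) x = ((x.1 ^+ 2 / (4 * t ^+ 2) - (2 * t)^-1) * heat_kernel t x).
Proof.
move=> t0; rewrite partial1E.
have -> : (fun r => partial1 (heat_kernel t) (r, x.2)) =
    (fun r => - (r / (2 * t)) * ((4 * pi * t)^-1 * expR (- ((r ^+ 2 + x.2 ^+ 2) / (4 * t))))).
  by apply/funext => r; rewrite partial1_heat_kernel.
by have /@derive_val -> := is_derive_gaussian2 (4 * pi * t)^-1 (x.2 ^+ 2) x.1 t0.
Qed.

Lemma partial22_heat_kernel t x : (0 < t) ->
  partial2 (partial2 (heat_kernel t)) x = ((x.2 ^+ 2 / (4 * t ^+ 2) - (2 * t)^-1) * heat_kernel t x).
Proof.
move=> t0; rewrite partial2E.
have -> : (fun r => partial2 (heat_kernel t) (x.1, r)) =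
    (fun r => - (r / (2 * t)) * ((4 * pi * t)^-1 * expR (- ((r ^+ 2 + x.1 ^+ 2) / (4 * t))))).
  by apply/funext => r; rewrite partial2_heat_kernel// /heat_kernel /sqeucl/= addrC.
have /@derive_val -> := is_derive_gaussian2 (4 * pi * t)^-1 (x.1 ^+ 2) x.2 t0.
by rewrite /heat_kernel /sqeucl (addrC (x.1 ^+ 2)).
Qed.

Lemma laplacian_heat_kernel t x : (0 < t) ->
  laplacian (heat_kernel t) x = ((sqeucl x / (4 * t ^+ 2) - t^-1) * heat_kernel t x).
Proof.
move=> t0; rewrite /laplacian partial11_heat_kernel// partial22_heat_kernel// -mulrDl /sqeucl.
by congr (_ * _); field; rewrite gt_eqF.
Qed.

Lemma heat_kernel_double t x : (0 < t) ->
  heat_kernel t x = (2 * heat_kernel (2 * t) x * expR (- (sqeucl x / (8 * t)))).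
Proof.
move=> t0; rewrite /heat_kernel.
have -> : sqeucl x / (4 * t) = sqeucl x / (4 * (2 * t)) + sqeucl x / (8 * t) by field; rewrite gt_eqF.
rewrite opprD expRD; move: (expR _) (expR _) => e1 e2.
by move: (pi_gt0 R); move: (@pi R) => P P0; field; rewrite !gt_eqF.
Qed.

(** With [q = |x|^2 / (8 t)] the kernel is [2 e^(-q)] times the kernel at time [2 * t], and the
    polynomial factor [2 q - 1] of the Laplacian is absorbed by [e^(-q)]. *)
Lemma laplacian_heat_kernel_le t x : (0 < t) ->
  (`|laplacian (heat_kernel t) x| <= 6 / t * heat_kernel (2 * t) x).
Proof.
move=> t0; rewrite laplacian_heat_kernel// normrM (ger0_norm (heat_kernel_ge0 _ (ltW t0))).
rewrite heat_kernel_double//.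
have h0 := heat_kernel_ge0 x (ltW (mulr_gt0 (ltr0Sn R 1) t0)).
pose q : R := (sqeucl x / (8 * t)).
have q0 : (0 <= q) by rewrite divr_ge0 ?sqeucl_ge0// mulr_ge0// ltW.
have -> : (sqeucl x / (4 * t ^+ 2) - t^-1 = t^-1 * (2 * q - 1)) by rewrite /q; field; rewrite gt_eqF.
rewrite normrM [`|t^-1|]ger0_norm ?invr_ge0 ?(ltW t0)// -/q.
have eq : (`|2 * q - 1| * expR (- q) <= 3).
  rewrite expRN ler_pdivrMr ?expR_gt0//.
  have := expR_ge1Dx q; rewrite ler_norml; nra.
rewrite [leLHS](_ : _ = (t^-1 * (2 * heat_kernel (2 * t) x)) * (`|2 * q - 1| * expR (- q))); last by ring.
rewrite [leRHS](_ : _ = (t^-1 * (2 * heat_kernel (2 * t) x)) * 3); last by ring.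
by rewrite ler_wpM2l// mulr_ge0 ?invr_ge0 ?(ltW t0)// mulr_ge0.
Qed.

(* Only a direction-free bound of the convolution with the gradient is ever used. *)
Lemma dot_grad_heat_kernel t x (F : R * R) : (0 < t) ->
  (`|dot (grad (heat_kernel t) x) F| <= 2 * t `^ (- 2^-1) * heat_kernel (2 * t) x * Num.sqrt (sqeucl F)).
Proof.
move=> t0; have h0 := heat_kernel_ge0 x (ltW t0).
apply: (@le_trans _ _ ((Num.sqrt (sqeucl x) / (2 * t) * heat_kernel t x) * Num.sqrt (sqeucl F))); last first.
  by rewrite ler_wpM2r ?sqrtr_ge0// heat_kernel_moment.
rewrite /dot/= partial1_heat_kernel// partial2_heat_kernel//.
have -> : (- (x.1 / (2 * t)) * heat_kernel t x * F.1 + - (x.2 / (2 * t)) * heat_kernel t x * F.2 =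
   - ((heat_kernel t x / (2 * t)) * (x.1 * F.1 + x.2 * F.2))) by ring.
rewrite normrN normrM ger0_norm; last by rewrite divr_ge0// mulr_ge0// ltW.
rewrite (_ : _ / (2 * t) * heat_kernel t x * _ =
  heat_kernel t x / (2 * t) * (Num.sqrt (sqeucl x) * Num.sqrt (sqeucl F))); last by ring.
rewrite ler_wpM2l//; first by rewrite divr_ge0// mulr_ge0// ltW.
rewrite -sqrtrM ?sqeucl_ge0// -sqrtr_sqr ler_wsqrtr//.
rewrite /sqeucl -subr_ge0 (_ : _ - _ = (x.1 * F.2 - x.2 * F.1) ^+ 2) ?sqr_ge0//.
by ring.
Qed.

Lemma OmegaE t x : Omega t x = heat_kernel (1 + t) x.
Proof. by []. Qed.

End HeatKernelDerivatives.

(** * Time weights and their integrals *)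

Section PowerIntegrals.
Local Open Scope ereal_scope.
Context (R : realType).

(** Fatou's lemma in the form used to remove a truncation. *)
Lemma integral_le_lim d (T : measurableType d) (mu : {measure set T -> \bar R})
    (f_ : nat -> T -> \bar R) (f : T -> \bar R) (C : \bar R) :
  (forall n, measurable_fun setT (f_ n)) -> (forall n x, 0 <= f_ n x) ->
  (forall x, f_ ^~ x @ \oo --> f x) -> (forall n, \int[mu]_x f_ n x <= C) ->
  \int[mu]_x f x <= C.
Proof.
move=> mf f0 ff fC.
have -> : \int[mu]_x f x = \int[mu]_x limn_einf (f_ ^~ x).
  by apply: eq_integral => x _; have [<- _] := cvg_limn_einf_sup (ff x).
apply: (le_trans (fatou mu measurableT mf (fun n x _ => f0 n x))).
rewrite limn_einf_lim; apply: lime_le; first exact: is_cvg_einfs.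
apply: nearW => n; apply: le_trans (fC n).
by apply: ereal_inf_lbound; exists n => /=.
Qed.

(** The cut-off is part of the integrand, so that all time integrals run over the whole line and
    Tonelli's theorem applies without restricting domains. *)
Lemma line_FTC (f F : R -> R) (a b : R) : (a <= b)%R ->
  (forall x, (a <= x <= b)%R -> {for x, continuous f}) ->
  (forall x, (a <= x <= b)%R -> is_derive x 1%R F (f x)) ->
  measurable_fun setT f ->
  \int[line R]_x (if (a <= x <= b)%R then f x else 0%R)%:E = (F b - F a)%:E.
Proof.
move=> ab cf dF mf.
have mif : measurable_fun setT (fun x => if (a <= x <= b)%R then f x else 0%R).
  by apply: measurable_fun_ifT => //; apply: measurable_and; exact: measurable_fun_ler.
rewrite -integral_lebesgue; last exact/measurable_EFinP.
transitivity (\int[lebesgue_measure]_(x in `[a, b]) (f x)%:E).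
  rewrite [RHS]integral_mkcond; apply: eq_integral => x _.
  by rewrite patchE mem_setE in_itv/=; case: ifP.
move: ab; rewrite le_eqVlt => /predU1P[<-|ab].
  by rewrite set_itv1 integral_set1 subrr.
rewrite (continuous_FTC2 (F := F))//.
- apply: continuous_in_subspaceT => x; rewrite inE/= in_itv/= => xab; exact: cf.
- have cF x : (a <= x <= b)%R -> {for x, continuous F}.
    move=> xab; have [dFx _] := dF _ xab.
    by apply: differentiable_continuous; exact/derivable1_diffP.
  split.
  + by move=> x; rewrite in_itv/= => /andP[ax xb]; have [] := dF x; rewrite ?(ltW ax) ?(ltW xb).
  + by apply: cvg_at_right_filter; apply: cF; rewrite lexx ltW.
  + by apply: cvg_at_left_filter; apply: cF; rewrite lexx ltW.
- move=> x; rewrite in_itv/= => /andP[ax xb]; rewrite derive1E.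
  have xab : (a <= x <= b)%R by rewrite !ltW.
  by have [_ ->] := dF _ xab.
Qed.

Definition wt (b t s : R) : R := if (0 < s < t)%R then (s `^ (- b))%R else 0%R.

Lemma wt_ge0 b t s : (0 <= wt b t s)%R.
Proof. by rewrite /wt; case: ifP => // _; exact: powR_ge0. Qed.

Lemma measurable_wt b t : measurable_fun setT (wt b t).
Proof.
rewrite /wt; apply: measurable_fun_ifT; [|exact: measurable_powR|by []].
by apply: measurable_and; exact: measurable_fun_ltr.
Qed.

Lemma is_derive_powRdiv (b x : R) : (b < 1)%R -> (0 < x)%R ->
  is_derive x 1%R (fun s => (1 - b)^-1 * s `^ (1 - b))%R (x `^ (- b))%R.
Proof.
move=> b1 x0.
have b0 : (1 - b != 0)%R by rewrite subr_eq0 gt_eqF.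
have := is_derive1_powR (1 - b) x0.
rewrite (_ : 1 - b - 1 = - b)%R; last by ring.
move=> dp; rewrite [X in is_derive _ _ _ X](_ : _ = (1 - b)^-1 *: ((1 - b) * x `^ (- b)))%R.
  exact: is_deriveZ.
by rewrite /GRing.scale/= mulrA mulVf// mul1r.
Qed.

(** The singularity at [0] is cut off at [a_ n], where the antiderivative is available, and restored
    by Fatou. *)
Lemma integral_wt (b t : R) : (0 <= b)%R -> (b < 1)%R -> (0 < t)%R ->
  \int[line R]_s (wt b t s)%:E <= ((1 - b)^-1 * t `^ (1 - b))%:E.
Proof.
move=> b0 b1 t0.
pose a_ n : R := (t / n.+2%:R)%R.
have a0 n : (0 < a_ n)%R by rewrite divr_gt0.
have at_ n : (a_ n <= t)%R by rewrite ler_pdivrMr// ler_peMr ?ltW// ltr1n.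
have b1' : (0 < (1 - b)^-1)%R by rewrite invr_gt0 subr_gt0.
apply: (@integral_le_lim _ _ _ (fun n s => (if (a_ n <= s <= t) && (s < t) then s `^ (- b) else 0)%:E)%R).
- move=> n; apply/measurable_EFinP; apply: measurable_fun_ifT; [|exact: measurable_powR|by []].
  apply: measurable_and; last exact: measurable_fun_ltr.
  by apply: measurable_and; exact: measurable_fun_ler.
- by move=> n s; rewrite lee_fin; case: ifP => // _; exact: powR_ge0.
- move=> s; apply: cvg_near_cst.
  have [s0|s0] := ltP 0%R s; last first.
    apply: nearW => n; rewrite /wt (le_gtF s0)/=; case: ifP => // /andP[/andP[ans _] _].
    by have := lt_le_trans (a0 n) (le_trans ans s0); rewrite ltxx.
  near=> n; rewrite /wt s0/=; have -> : (a_ n <= s)%R.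
    rewrite /a_ ler_pdivrMr// mulrC -ler_pdivrMr//.
    near: n; exists (Num.trunc (t / s)).+1 => // n /= nt.
    apply: (le_trans (ltW (truncnS_gt _))).
    by rewrite ler_nat (leq_trans nt)// -addn2 leq_addr.
  by rewrite andTb; case: (ltP s t) => [st|ts]; rewrite ?andbF// (ltW st).
- move=> n.
  apply: (@le_trans _ _ (\int[line R]_s (if (a_ n <= s <= t)%R then s `^ (- b) else 0)%R%:E)).
    apply: ge0_le_integral => //.
    + by move=> s _; rewrite lee_fin; case: ifP => // _; exact: powR_ge0.
    + apply/measurable_EFinP; apply: measurable_fun_ifT; [|exact: measurable_powR|by []].
      apply: measurable_and; last exact: measurable_fun_ltr.
      by apply: measurable_and; exact: measurable_fun_ler.
    + apply/measurable_EFinP; apply: measurable_fun_ifT; [|exact: measurable_powR|by []].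
      by apply: measurable_and; exact: measurable_fun_ler.
    + move=> s _; rewrite lee_fin; case: ifP => [/andP[->]//|_].
      by case: ifP => // _; exact: powR_ge0.
  have cf x : (a_ n <= x <= t)%R -> {for x, continuous (fun s => s `^ (- b))%R}.
    move=> /andP[ax _]; apply: differentiable_continuous; apply/derivable1_diffP.
    by apply: derivable_powR; rewrite in_itv/= andbT (lt_le_trans (a0 n)).
  have dF x : (a_ n <= x <= t)%R ->
      is_derive x 1%R (fun s => (1 - b)^-1 * s `^ (1 - b))%R (x `^ (- b))%R.
    by move=> /andP[ax _]; apply: is_derive_powRdiv => //; rewrite (lt_le_trans (a0 n)).
  have -> := line_FTC (at_ n) cf dF (@measurable_powR R _).
  by rewrite lee_fin gerBl mulr_ge0 ?powR_ge0// ltW.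
Unshelve. all: by end_near. Qed.

Lemma integral_exp : \int[line R]_s (if (0 <= s)%R then expR (- s) else 0%R)%:E = 1.
Proof.
rewrite -(@integral_exponential_pdf R 1)// -ge0_integral_lebesgue; first last.
- by move=> s; rewrite lee_fin; case: ifP => // _; exact: expR_ge0.
- apply/measurable_EFinP; apply: measurable_fun_ifT; [exact: measurable_fun_ler| |by []].
  exact: (measurableT_comp (@measurable_expR R) (@oppr_measurable R setT)).
apply: eq_integral => s _; congr EFin.
by rewrite /exponential_pdf patchE mem_setE in_itv/= andbT; case: ifP => // _; rewrite mul1r mulN1r.
Qed.

(** Integrand of the Gamma function at [1 - b]. For [b = 0] it weights heat kernels into the
    resolvent kernel, for other [b] into negative powers of [1 + |x|^2]. *)
Definition ewt (b s : R) : R := if (0 < s)%R then (expR (- s) * s `^ (- b))%R else 0%R.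

Lemma ewt_ge0 b s : (0 <= ewt b s)%R.
Proof. by rewrite /ewt; case: ifP => // _; rewrite mulr_ge0 ?expR_ge0 ?powR_ge0. Qed.

Lemma measurable_ewt b : measurable_fun setT (ewt b).
Proof.
rewrite /ewt; apply: measurable_fun_ifT; [exact: measurable_fun_ltr| |by []].
apply: measurable_funM; last exact: measurable_powR.
exact: (measurableT_comp (@measurable_expR R) (@oppr_measurable R setT)).
Qed.

Lemma integral_ewt0 : \int[line R]_s (ewt 0 s)%:E = 1.
Proof.
rewrite -integral_exp; apply: ge0_ae_eq_integral => //.
- by apply/measurable_EFinP; exact: measurable_ewt.
- apply/measurable_EFinP; apply: measurable_fun_ifT; [exact: measurable_fun_ler| |by []].
  exact: (measurableT_comp (@measurable_expR R) (@oppr_measurable R setT)).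
- by move=> s _; rewrite lee_fin ewt_ge0.
- by move=> s _; rewrite lee_fin; case: ifP => // _; exact: expR_ge0.
- exists [set 0%R]; split => //.
    exact: line_set1.
  move=> s /=; apply: contra_notP => /eqP s0 _.
  by rewrite /ewt oppr0 powRr0 mulr1 le_eqVlt eq_sym (negbTE s0).
Qed.

(** Below [s = 1] the exponential is at most one, above it the power is. *)
Lemma integral_ewt (b : R) : (0 <= b)%R -> (b < 1)%R ->
  \int[line R]_s (ewt b s)%:E <= ((1 - b)^-1 + 1)%:E.
Proof.
move=> b0 b1.
have me : measurable_fun setT (fun s : R => (if (0 <= s)%R then expR (- s) else 0)%:E).
  apply/measurable_EFinP; apply: measurable_fun_ifT; [exact: measurable_fun_ler| |by []].
  exact: (measurableT_comp (@measurable_expR R) (@oppr_measurable R setT)).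
have mw : measurable_fun setT (fun s => (wt b 1 s)%:E) by apply/measurable_EFinP; exact: measurable_wt.
apply: (@le_trans _ _ (\int[line R]_s ((wt b 1 s)%:E + (if (0 <= s)%R then expR (- s) else 0%R)%:E))).
  apply: ge0_le_integral => //.
  - by move=> s _; rewrite lee_fin ewt_ge0.
  - by apply/measurable_EFinP; exact: measurable_ewt.
  - exact: emeasurable_funD.
  - move=> s _; rewrite -EFinD lee_fin /ewt /wt; case: ltP => [s0|s0]/=; last first.
      by case: ifP => //; rewrite add0r expR_ge0.
    rewrite (ltW s0); have e1 : (expR (- s) <= 1)%R by rewrite expR_le1 oppr_le0 ltW.
    have e0 := expR_gt0 (- s); have p0 := powR_ge0 s (- b).
    case: ltP => [s1|s1]; first by nra.
    have : (s `^ (- b) <= s `^ 0)%R by rewrite ler_powR// oppr_le0.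
    by rewrite powRr0; nra.
rewrite ge0_integralD//; first last.
- by move=> s _; rewrite lee_fin; case: ifP => // _; exact: expR_ge0.
- by move=> s _; rewrite lee_fin wt_ge0.
rewrite integral_exp EFinD leeD2r//.
by have := integral_wt b0 b1 ltr01; rewrite powR1 mulr1.
Qed.

End PowerIntegrals.

(** * Superpositions of heat evolutions *)

Section HeatSuperposition.
Local Open Scope ereal_scope.
Context (R : realType).
Implicit Types (t : R) (x y : R * R).

(** Extension by zero to nonpositive times, so that time superpositions over the whole line stay
    measurable and nonnegative. *)
Definition hkp t x : \bar R := (if 0 < t then heat_kernel t x else 0)%R%:E.

Lemma hkpE t : (0 < t)%R -> hkp t = hk t.
Proof. by move=> t0; apply/funext => x; rewrite /hkp t0. Qed.

Lemma hkp_ge0 t x : 0 <= hkp t x.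
Proof. by rewrite lee_fin; case: ifPn => // t0; rewrite heat_kernel_ge0// ltW. Qed.

Lemma measurable_hkp2 : measurable_fun setT (fun z : R * (R * R) => hkp z.1 z.2).
Proof.
apply/measurable_EFinP; apply: measurable_fun_ifT; [|exact: measurable_heat_kernel2|by []].
exact: measurable_fun_ltr.
Qed.

Lemma measurable_hkp t : measurable_fun setT (hkp t).
Proof. exact: (measurableT_comp measurable_hkp2 (pair1_measurable t)). Qed.

Lemma integral_hkp t : (0 < t)%R -> \int[plane R]_x hkp t x = 1.
Proof. by move=> t0; rewrite hkpE// integral_hk. Qed.

Lemma integral_hkp_le1 t : \int[plane R]_x hkp t x <= 1.
Proof.
have [t0|t0] := ltP 0%R t; first by rewrite integral_hkp.
by rewrite integral0_eq// => x _; rewrite /hkp (le_gtF t0).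
Qed.

Lemma conv_hkp s t : (0 < s)%R -> (0 < t)%R -> conv (hkp s) (hkp t) = hkp (s + t)%R.
Proof. by move=> s0 t0; rewrite !hkpE ?addr_gt0// conv_hk. Qed.

Lemma L2le_conv_hkp t f (A : R) : (0 <= A)%R -> measurable_fun setT f -> (forall x, 0 <= f x) -> L2le f A ->
  L2le (conv (hkp t) f) A.
Proof.
move=> A0 mf f0 fA; rewrite convC; [|exact: measurable_hkp|by []|by move=> x; exact: hkp_ge0|by []].
rewrite -[A]mulr1; apply: L2le_conv => //; [exact: measurable_hkp|by move=> x; exact: hkp_ge0|].
exact: integral_hkp_le1.
Qed.

Lemma integral_conv_hkp_le t f : measurable_fun setT f -> (forall x, 0 <= f x) ->
  \int[plane R]_x conv (hkp t) f x <= \int[plane R]_x f x.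
Proof.
move=> mf f0; rewrite integral_conv//; [|exact: measurable_hkp|by move=> x; exact: hkp_ge0].
rewrite -[leRHS]mul1e lee_wpmul2r ?integral_hkp_le1//.
exact: integral_ge0.
Qed.

Lemma conv_hkp_conv s t f : (0 < s)%R -> (0 < t)%R -> measurable_fun setT f -> (forall x, 0 <= f x) ->
  conv (hkp s) (conv (hkp t) f) = conv (hkp (s + t)%R) f.
Proof.
by move=> s0 t0 mf f0; rewrite convA ?conv_hkp//; try exact: measurable_hkp; move=> x; exact: hkp_ge0.
Qed.

(* superposition in [s], with density [w s], of the functions [F (s, _)] evolved during time [c s] *)
Definition hsup (w c : R -> R) (F : R * (R * R) -> \bar R) x : \bar R :=
  \int[line R]_s ((w s)%:E * conv (hkp (c s)) (fun y => F (s, y)) x).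

Section hsup.
Variables (w c : R -> R) (F : R * (R * R) -> \bar R).
Hypotheses (mw : measurable_fun setT w) (mc : measurable_fun setT c) (mF : measurable_fun setT F).
Hypotheses (w0 : forall s, (0 <= w s)%R) (F0 : forall z, 0 <= F z).

Let mFs s : measurable_fun setT (fun y => F (s, y)).
Proof. exact: (measurableT_comp mF (pair1_measurable s)). Qed.

Lemma measurable_conv_hkp2 :
  measurable_fun setT (fun z : R * (R * R) => conv (hkp (c z.1)) (fun y => F (z.1, y)) z.2).
Proof.
apply: (measurable_fun_fubini_tonelli_F
  (fun z : (R * (R * R)) * (R * R) => hkp (c z.1.1) (z.1.2 - z.2)%R * F (z.1.1, z.2))); last first.
  by move=> z; rewrite mule_ge0// hkp_ge0.
apply: emeasurable_funM.
  apply: (measurableT_comp measurable_hkp2 (g := fun z : (R * (R * R)) * (R * R) => (c z.1.1, z.1.2 - z.2)%R)).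
  apply/measurable_fun_pairP; split.
    exact: (measurableT_comp mc (measurableT_comp measurable_fst measurable_fst)).
  apply: (measurableT_comp (@measurable_sub2 R) (g := fun z : (R * (R * R)) * (R * R) => (z.1.2, z.2))).
  apply/measurable_fun_pairP; split; last exact: measurable_snd.
  exact: (measurableT_comp measurable_snd measurable_fst).
apply: (measurableT_comp mF (g := fun z : (R * (R * R)) * (R * R) => (z.1.1, z.2))).
apply/measurable_fun_pairP; split; last exact: measurable_snd.
exact: (measurableT_comp measurable_fst measurable_fst).
Qed.

Let mI : measurable_fun setT
  (fun z : R * (R * R) => (w z.1)%:E * conv (hkp (c z.1)) (fun y => F (z.1, y)) z.2).
Proof.
apply: emeasurable_funM; last exact: measurable_conv_hkp2.
by apply/measurable_EFinP; exact: (measurableT_comp mw).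
Qed.

Let cv0 s x : 0 <= conv (hkp (c s)) (fun y => F (s, y)) x.
Proof. by apply: conv_ge0 => //; exact: hkp_ge0. Qed.

Let mcv s : measurable_fun setT (conv (hkp (c s)) (fun y => F (s, y))).
Proof. exact: (measurableT_comp measurable_conv_hkp2 (pair1_measurable s)). Qed.

Let I0 z : 0 <= (w z.1)%:E * conv (hkp (c z.1)) (fun y => F (z.1, y)) z.2.
Proof. by rewrite mule_ge0// lee_fin. Qed.

Lemma measurable_hsup : measurable_fun setT (hsup w c F).
Proof. exact: (measurable_fun_fubini_tonelli_G (m1 := line R) _ mI I0). Qed.

Lemma hsup_ge0 x : 0 <= hsup w c F x.
Proof. by apply: integral_ge0 => s _; exact: (I0 (s, x)). Qed.

(** Tonelli and the contraction property in [L^1]; slices of weight zero need no bound. *)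
Lemma integral_hsup_le (A : R -> R) (I : R) : measurable_fun setT A -> (forall s, (0 <= A s)%R) ->
  {ae line R, forall s, (0 < w s)%R -> \int[plane R]_x F (s, x) <= (A s)%:E} ->
  \int[line R]_s (w s * A s)%:E <= I%:E -> \int[plane R]_x hsup w c F x <= I%:E.
Proof.
move=> mA A0 FA; apply: le_trans.
rewrite -(fubini_tonelli (m1 := line R) (m2 := plane R) _ mI I0)/=.
apply: ae_ge0_le_integral => //.
- by move=> s _; apply: integral_ge0 => x _; exact: (I0 (s, x)).
- exact: (measurable_fun_fubini_tonelli_F (m2 := plane R) _ mI I0).
- by move=> s _; rewrite lee_fin mulr_ge0.
- by apply/measurable_EFinP; exact: measurable_funM.
- move: FA; apply: filterS => s FAs _.
  rewrite ge0_integralZl; [|by []|exact: mcv|by []|by rewrite lee_fin].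
  have [ws|ws] := ltP 0%R (w s).
    by rewrite EFinM lee_wpmul2l ?lee_fin// (le_trans _ (FAs ws))// integral_conv_hkp_le.
  by rewrite (_ : w s = 0%R) ?mul0e ?mul0r//; apply/eqP; rewrite eq_le ws w0.
Qed.

(** Minkowski in [s]. The hypothesis concerns the slice after its evolution, which leaves room for
    the smoothing from [L^1] to [L^2]. *)
Lemma L2le_hsup (B : R -> R) (I : R) : measurable_fun setT B -> (forall s, (0 <= B s)%R) ->
  {ae line R, forall s, (0 < w s)%R -> L2le (conv (hkp (c s)) (fun y => F (s, y))) (B s)} ->
  \int[line R]_s (w s * B s)%:E <= I%:E -> L2le (hsup w c F) I.
Proof.
move=> mB B0 FB wI.
have := @minkowski_integral R _ _ _ _ (line R) (plane R)
  (fun z : R * (R * R) => (w z.1)%:E * conv (hkp (c z.1)) (fun y => F (z.1, y)) z.2)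
  (fun s => w s * B s)%R I; apply => //.
- exact: measurable_funM.
- by move=> s; rewrite mulr_ge0.
- move: FB; apply: filterS => s FBs.
  have [ws|ws] := ltP 0%R (w s); first exact: (L2leZ (mcv s) (cv0 s) (w0 s) (FBs ws)).
  have -> : w s = 0%R by apply/eqP; rewrite eq_le ws w0.
  rewrite integral0_eq; first by rewrite lee_fin sqr_ge0.
  by move=> x _ /=; rewrite !mul0e.
Qed.

Lemma hsup_le x (B : R -> R) (I : R) : measurable_fun setT B -> (forall s, (0 <= B s)%R) ->
  (forall s, (0 < w s)%R -> conv (hkp (c s)) (fun y => F (s, y)) x <= (B s)%:E) ->
  \int[line R]_s (w s * B s)%:E <= I%:E -> hsup w c F x <= I%:E.
Proof.
move=> mB B0 FB; apply: le_trans; apply: ge0_le_integral => //.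
- by move=> s _; exact: (I0 (s, x)).
- exact: (measurableT_comp mI (pair2_measurable x)).
- by apply/measurable_EFinP; exact: measurable_funM.
- move=> s _; have [ws|ws] := ltP 0%R (w s); first by rewrite EFinM lee_wpmul2l ?lee_fin// FB.
  by rewrite (_ : w s = 0%R) ?mul0e ?mul0r//; apply/eqP; rewrite eq_le ws w0.
Qed.

Lemma integral_mul_hsup (h : R * R -> \bar R) : measurable_fun setT h -> (forall x, 0 <= h x) ->
  \int[plane R]_x (hsup w c F x * h x) =
  \int[line R]_s ((w s)%:E * \int[plane R]_x (conv (hkp (c s)) (fun y => F (s, y)) x * h x)).
Proof.
move=> mh h0.
rewrite (integral_mul_integral (line R) (plane R) mI I0 mh h0).
apply: eq_integral => s _.
transitivity (\int[plane R]_x ((w s)%:E * (conv (hkp (c s)) (fun y => F (s, y)) x * h x))).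
  by apply: eq_integral => x _; rewrite muleA.
rewrite ge0_integralZl; [by []|by []|exact: (emeasurable_funM (mcv s) mh)|by move=> x _; rewrite mule_ge0|by rewrite lee_fin].
Qed.

(** A further evolution only adds [t] to every evolution time; this is what regularises the Duhamel
    term in the a priori [L^2] bound. *)
Lemma conv_hsup t : (0 < t)%R -> (forall s, (0 < w s)%R -> (0 < c s)%R) ->
  conv (hkp t) (hsup w c F) = hsup w (fun s => t + c s)%R F.
Proof.
move=> t0 wc; apply/funext => x; rewrite /conv.
have mt : measurable_fun setT (fun y : R * R => hkp t (x - y)%R).
  exact: (measurableT_comp (measurable_hkp t) (measurable_csub x)).
transitivity (\int[plane R]_y (hsup w c F y * hkp t (x - y)%R)).
  by apply: eq_integral => y _; rewrite muleC.
rewrite integral_mul_hsup; [|by []|by move=> y; exact: hkp_ge0].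
apply: eq_integral => s _.
have [ws|ws] := ltP 0%R (w s); last first.
  by rewrite (_ : w s = 0%R) ?mul0e//; apply/eqP; rewrite eq_le ws w0.
rewrite -conv_hkp_conv//; [|exact: wc].
by congr (_ * _); apply: eq_integral => y _; rewrite muleC.
Qed.

End hsup.

End HeatSuperposition.

(** * The majorant of the velocity *)

Section Kernels.
Local Open Scope ereal_scope.
Context (R : realType) (al : R) (al0 : (0 < al)%R).
Implicit Types (t s : R) (x y : R * R) (f g h : R * R -> \bar R).

(** Kernel of the inverse of [1 - al^2 Laplacian], written as the integral of [e^(-s)] times the
    heat semigroup at time [al^2 s]. *)
Definition Gk x : \bar R := \int[line R]_s ((ewt 0 s)%:E * hkp (al ^+ 2 * s) x).

Let al2 s : (0 < s)%R -> (0 < al ^+ 2 * s)%R.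
Proof. by move=> s0; rewrite mulr_gt0// exprn_gt0. Qed.

Lemma ewt_gt0 b s : (0 < ewt b s)%R -> (0 < s)%R.
Proof. by rewrite /ewt; case: ifP => // _; rewrite ltxx. Qed.

Lemma ewt_le0 b s : (s <= 0)%R -> ewt b s = 0%R.
Proof. by move=> s0; rewrite /ewt (le_gtF s0). Qed.

Lemma wt_gt0 b t s : (0 < wt b t s)%R -> (0 < s < t)%R.
Proof. by rewrite /wt; case: ifP => // _; rewrite ltxx. Qed.

Let mGI : measurable_fun setT (fun z : R * (R * R) => (ewt 0 z.1)%:E * hkp (al ^+ 2 * z.1) z.2).
Proof.
apply: emeasurable_funM.
  by apply/measurable_EFinP; exact: (measurableT_comp (measurable_ewt _)).
apply: (measurableT_comp (@measurable_hkp2 R) (g := fun z : R * (R * R) => (al ^+ 2 * z.1, z.2)%R)).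
apply/measurable_fun_pairP; split; last exact: measurable_snd.
have mc : measurable_fun setT (fun s : R => al ^+ 2 * s)%R by apply: measurable_funM.
exact: (measurableT_comp mc measurable_fst).
Qed.

Let GI0 z : 0 <= (ewt 0 z.1)%:E * hkp (al ^+ 2 * z.1) z.2 :> \bar R.
Proof. by rewrite mule_ge0 ?hkp_ge0// lee_fin ewt_ge0. Qed.

Lemma Gk_ge0 x : 0 <= Gk x.
Proof. by apply: integral_ge0 => s _; exact: (GI0 (s, x)). Qed.

Lemma measurable_Gk : measurable_fun setT Gk.
Proof. exact: (measurable_fun_fubini_tonelli_G (m1 := line R) _ mGI GI0). Qed.

Lemma hkp_sqeucl t x y : sqeucl x = sqeucl y -> hkp t x = hkp t y.
Proof. by move=> xy; rewrite /hkp /heat_kernel xy. Qed.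

Lemma Gk_sqeucl x y : sqeucl x = sqeucl y -> Gk x = Gk y.
Proof. by move=> xy; apply: eq_integral => s _; rewrite (hkp_sqeucl _ xy). Qed.

Lemma integral_Gk : \int[plane R]_x Gk x = 1.
Proof.
rewrite -(fubini_tonelli (m1 := line R) (m2 := plane R) _ mGI GI0)/= -(integral_ewt0 R).
apply: eq_integral => s _.
rewrite ge0_integralZl; [|by []|exact: measurable_hkp|by move=> x _; exact: hkp_ge0|by rewrite lee_fin ewt_ge0].
have [s0|s0] := ltP 0%R s; first by rewrite integral_hkp ?mule1// al2.
by rewrite ewt_le0// mul0e.
Qed.

Lemma integral_mul_Gk h x : measurable_fun setT h -> (forall x, 0 <= h x) ->
  \int[plane R]_y (Gk (x - y)%R * h y) =
  \int[line R]_s ((ewt 0 s)%:E * \int[plane R]_y (hkp (al ^+ 2 * s) (x - y)%R * h y)).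
Proof.
move=> mh h0.
have msub : measurable_fun setT (fun z : R * (R * R) => (z.1, x - z.2)%R).
  apply/measurable_fun_pairP; split; first exact: measurable_fst.
  exact: (measurableT_comp (measurable_csub x) measurable_snd).
have mF := measurableT_comp mGI msub.
rewrite (integral_mul_integral (line R) (plane R) mF (fun z => GI0 _) mh h0)/=.
apply: eq_integral => s _.
transitivity (\int[plane R]_y ((ewt 0 s)%:E * (hkp (al ^+ 2 * s) (x - y)%R * h y))).
  by apply: eq_integral => y _; rewrite muleA.
have mhk : measurable_fun setT (fun y : R * R => hkp (al ^+ 2 * s) (x - y)%R).
  exact: (measurableT_comp (measurable_hkp _) (measurable_csub x)).
rewrite ge0_integralZl; [by []|by []|exact: emeasurable_funM|
  by move=> y _; rewrite mule_ge0// hkp_ge0|by rewrite lee_fin ewt_ge0].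
Qed.

Lemma conv_Gk f : measurable_fun setT f -> (forall x, 0 <= f x) ->
  conv Gk f = hsup (ewt 0) (fun s => al ^+ 2 * s)%R (fun z => f z.2).
Proof. by move=> mf f0; apply/funext => x; rewrite /conv integral_mul_Gk. Qed.

Lemma powR_weighted_amgm s t : (0 < s)%R -> (0 < t)%R ->
  ((s + t)^-1 <= s `^ (- (4^-1)) * t `^ (- (3 / 4)))%R.
Proof.
move=> s0 t0; have st : (0 < s + t)%R by rewrite addr_gt0.
rewrite !powRN -invfM lef_pV2 ?posrE ?mulr_gt0 ?powR_gt0//.
have -> : (s + t = (s + t) `^ 4^-1 * (s + t) `^ (3 / 4))%R.
  rewrite -powRD; last by rewrite (gt_eqF st) implybT.
  by rewrite (_ : 4^-1 + 3 / 4 = 1)%R ?powRr1 ?(ltW st)//; field.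
by rewrite ler_pM ?powR_ge0// ge0_ler_powR ?nnegrE ?(ltW s0) ?(ltW t0) ?(ltW st)// ?lerDl ?lerDr ?(ltW s0) ?(ltW t0).
Qed.

(** The kernel at time [s + al^2 t] is at most [(s + al^2 t)^(-1)]. The exponents [1/4] and [3/4]
    are chosen so that [t^(-3/4)] is integrable against [e^(-t)], with integral at most [5], and
    [s^(-1/4)] remains integrable against the weight [s^(-1/2)] of the Biot-Savart kernel. *)
Lemma conv_hkp_Gk_le s x : (0 < s)%R ->
  conv (hkp s) Gk x <= (s `^ (- (4^-1)) * ((al ^+ 2) `^ (- (3 / 4)) * 5))%:E.
Proof.
move=> s0; rewrite convC; [|exact: measurable_hkp|exact: measurable_Gk|by move=> y; exact: hkp_ge0|exact: Gk_ge0].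
rewrite conv_Gk; [|exact: measurable_hkp|by move=> y; exact: hkp_ge0].
have mw := @measurable_ewt R 0.
have mc : measurable_fun setT (fun s : R => al ^+ 2 * s)%R by apply: measurable_funM.
have mp : measurable_fun setT (fun t : R => t `^ (- (3 / 4)))%R by exact: measurable_powR.
have k0 : (0 <= s `^ (- (4^-1)) * (al ^+ 2) `^ (- (3 / 4)))%R by rewrite mulr_ge0 ?powR_ge0.
apply: (@hsup_le R _ _ _ mw mc _ _ _ x (fun t => s `^ (- (4^-1)) * (al ^+ 2) `^ (- (3 / 4)) * t `^ (- (3 / 4)))%R).
- exact: (measurableT_comp (measurable_hkp s)).
- exact: ewt_ge0.
- by move=> z; exact: hkp_ge0.
- exact: measurable_funM.
- by move=> t; rewrite mulr_ge0// powR_ge0.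
- move=> t /ewt_gt0 t0; have at0 := al2 t0.
  rewrite conv_hkp// hkpE ?addr_gt0//.
  apply: (le_trans (hk_le _ _)); first by rewrite addr_gt0.
  rewrite lee_fin addrC (le_trans (powR_weighted_amgm s0 at0))//.
  by rewrite powRM ?sqr_ge0 ?(ltW t0)// mulrA.
- rewrite (_ : \int[line R]_t _ =
      \int[line R]_t ((s `^ (- (4^-1)) * (al ^+ 2) `^ (- (3 / 4)))%R%:E * (ewt (3 / 4) t)%:E)); last first.
    apply: eq_integral => t _; rewrite -EFinM; congr EFin; rewrite /ewt; case: ifP => _; last by rewrite mul0r mulr0.
    by rewrite oppr0 powRr0; ring.
  rewrite ge0_integralZl_EFin; [|by []|by move=> t _; rewrite lee_fin ewt_ge0|
    by apply/measurable_EFinP; exact: measurable_ewt|by []].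
  rewrite mulrA [leRHS]EFinM lee_wpmul2l ?lee_fin//.
  apply: (le_trans (integral_ewt _ _)); [by lra|by lra|].
  by rewrite lee_fin le_eqVlt; apply/orP; left; apply/eqP; field.
Qed.

Definition bsk x : \bar R := ((Num.sqrt (sqeucl x))^-1)%:E.

Lemma bsk_ge0 x : 0 <= bsk x.
Proof. by rewrite lee_fin invr_ge0 sqrtr_ge0. Qed.

Lemma measurable_bsk : measurable_fun setT bsk.
Proof.
apply/measurable_EFinP; apply: (measurableT_comp (@measurable_inv R)).
rewrite [X in measurable_fun _ X](_ : _ = fun x : R * R => (sqeucl x) `^ 2^-1)%R.
  exact: (measurableT_comp (@measurable_powR R _) (@measurable_sqeucl R)).
by apply/funext => x; rewrite powR12_sqrt// sqeucl_ge0.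
Qed.

Let mNI r : measurable_fun setT (fun z : R * (R * R) => (wt 2^-1 r z.1)%:E * hkp z.1 z.2).
Proof.
apply: emeasurable_funM; last exact: measurable_hkp2.
by apply/measurable_EFinP; exact: (measurableT_comp (measurable_wt _ _)).
Qed.

Let NI0 r z : 0 <= (wt 2^-1 r z.1)%:E * hkp z.1 z.2 :> \bar R.
Proof. by rewrite mule_ge0 ?hkp_ge0// lee_fin wt_ge0. Qed.

(** Without truncation, the integral of [s^(-1/2)] times the heat kernel is a multiple of [1/|x|];
    times below [2 r^2] suffice for [|x| < r]. *)
Definition nearK (r : R) x : \bar R := \int[line R]_s ((wt 2^-1 (2 * r ^+ 2) s)%:E * hkp s x).

Lemma nearK_ge0 r x : 0 <= nearK r x.
Proof. by apply: integral_ge0 => s _; exact: (NI0 _ (s, x)). Qed.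

Lemma measurable_nearK r : measurable_fun setT (nearK r).
Proof. exact: (measurable_fun_fubini_tonelli_G (m1 := line R) _ (mNI _) (NI0 _)). Qed.

(* On the dyadic interval [|x|^2, 2 |x|^2] the heat kernel at [x] is at least a multiple of
   [|x|^(-2)]. *)
Lemma bsk_le (r : R) x : (0 < r)%R -> bsk x <= (r^-1)%:E + 100%:E * nearK r x.
Proof.
move=> r0; rewrite /bsk; set q : R := Num.sqrt (sqeucl x).
have q0 : (0 <= q)%R by exact: sqrtr_ge0.
have N0 : 0 <= 100%:E * nearK r x by rewrite mule_ge0 ?nearK_ge0// lee_fin.
have [rq|qr] := leP r q.
  apply: (@le_trans _ _ (r^-1)%:E); last by rewrite leeDl.
  by rewrite lee_fin lef_pV2 ?posrE// (lt_le_trans r0).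
have [->|qn0] := eqVneq q 0%R.
  by rewrite invr0 adde_ge0// lee_fin invr_ge0 ltW.
have {q0 qn0} q0 : (0 < q)%R by rewrite lt_neqAle eq_sym qn0.
apply: (@le_trans _ _ (100%:E * nearK r x)); last by rewrite leeDr// lee_fin invr_ge0 ltW.
have qE : (sqeucl x = q ^+ 2)%R by rewrite sqr_sqrtr// sqeucl_ge0.
(* [c] bounds the integrand from below on the interval: [s^(-1/2) >= 1 / (2 q)], [4 pi s <= 32 q^2],
   and the exponential is at least [3/4]. Its integral is [3 / (256 q)], and [100] exceeds
   [256 / 3]. *)
pose c : R := (3 / (256 * q ^+ 3))%R.
have c0 : (0 <= c)%R by apply: divr_ge0; [exact: ler0n|apply: mulr_ge0; [exact: ler0n|exact/exprn_ge0/ltW]].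
have q20 : (0 < q ^+ 2)%R by rewrite exprn_gt0.
have q2 : (q ^+ 2 <= 2 * q ^+ 2)%R by lra.
have icst : \int[line R]_s (if (q ^+ 2 <= s <= 2 * q ^+ 2)%R then c else 0%R)%:E = (c * q ^+ 2)%:E.
  have dF s : (q ^+ 2 <= s <= 2 * q ^+ 2)%R -> is_derive s 1%R (fun s => c *: s)%R (cst c s).
    by move=> _; apply: is_derive_eq; rewrite /GRing.scale/= mulr1.
  have cc s : (q ^+ 2 <= s <= 2 * q ^+ 2)%R -> {for s, continuous (cst c : R -> R)} by move=> _; exact: cst_continuous.
  have -> := line_FTC q2 cc dF (measurable_cst c).
  by rewrite /GRing.scale/=; congr EFin; ring.
have : (c * q ^+ 2)%:E <= nearK r x.
  rewrite -icst; apply: ge0_le_integral => //.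
  - by move=> s _; rewrite lee_fin; case: ifP.
  - apply/measurable_EFinP; apply: measurable_fun_ifT => //.
    by apply: measurable_and; exact: measurable_fun_ler.
  - exact: (measurableT_comp (mNI _) (pair2_measurable x)).
  - move=> s _; case: ifPn => [/andP[s1 s2]|_]; last exact: (NI0 _ (s, x)).
    have s0 : (0 < s)%R by rewrite (lt_le_trans q20).
    have sr : (s < 2 * r ^+ 2)%R by rewrite (le_lt_trans s2)// ltr_pM2l// ltr_pXn2r// nnegrE ltW.
    rewrite hkpE// /hk -EFinM lee_fin /wt s0 sr/= /heat_kernel qE.
    have e1 : (3 / 4 <= expR (- (q ^+ 2 / (4 * s))))%R.
      have := expR_ge1Dx (- (q ^+ 2 / (4 * s))).
      have : (q ^+ 2 / (4 * s) <= 4^-1)%R by rewrite ler_pdivrMr ?mulr_gt0//; lra.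
      lra.
    have p1 : ((2 * q)^-1 <= s `^ (- 2^-1))%R.
      rewrite powRN powR12_sqrt ?(ltW s0)// lef_pV2 ?posrE ?sqrtr_gt0 ?mulr_gt0//.
      rewrite -[leRHS](ger0_norm (ltW (mulr_gt0 (ltr0Sn R 1) q0))) -sqrtr_sqr ler_wsqrtr//.
      by rewrite (le_trans s2)// exprMn; nra.
    have p2 : ((32 * q ^+ 2)^-1 <= (4 * pi * s)^-1)%R.
      have p0 := pi_gt0 R; have p4 : (pi < 4 :> R)%R by have := pihalf_lt2 R; lra.
      rewrite lef_pV2 ?posrE ?mulr_gt0//.
      move: p0 p4; move: (@pi R) => P P0 P4.
      have : (P * s <= 4 * (2 * q ^+ 2))%R by apply: ler_pM => //; exact: ltW.
      lra.
    have -> : c = ((2 * q)^-1 * ((32 * q ^+ 2)^-1 * (3 / 4)))%R by rewrite /c; field; rewrite gt_eqF.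
    rewrite ler_pM//; first by rewrite invr_ge0 mulr_ge0// ltW.
    - by rewrite mulr_ge0// invr_ge0 mulr_ge0// ltW.
    - by rewrite ler_pM// invr_ge0 mulr_ge0// ltW.
move=> /(lee_wpmul2l (x := 100%:E)) /= => /(_ (ler0n R 100)); apply: le_trans.
rewrite -EFinM lee_fin /c (_ : 100 * _ = (300 / 256) * q^-1)%R; last by field; rewrite gt_eqF.
by rewrite ler_peMl ?invr_ge0 ?(ltW q0)//; lra.
Qed.

Definition near (r : R) f := hsup (wt 2^-1 (2 * r ^+ 2)) id (fun z => f z.2).

Section near.
Variables (r : R) (r0 : (0 < r)%R).
Variables (f : R * R -> \bar R) (mf : measurable_fun setT f) (f0 : forall x, 0 <= f x).

Let mf2 : measurable_fun setT (fun z : R * (R * R) => f z.2).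
Proof. exact: (measurableT_comp mf). Qed.

Lemma measurable_near : measurable_fun setT (near r f).
Proof. by apply: measurable_hsup => //; [exact: measurable_wt|exact: wt_ge0]. Qed.

Lemma near_ge0 x : 0 <= near r f x.
Proof. by apply: hsup_ge0 => //; exact: wt_ge0. Qed.

Lemma conv_nearK : conv (nearK r) f = near r f.
Proof.
apply/funext => x; rewrite /conv.
have msub : measurable_fun setT (fun z : R * (R * R) => (z.1, x - z.2)%R).
  apply/measurable_fun_pairP; split; first exact: measurable_fst.
  exact: (measurableT_comp (measurable_csub x) measurable_snd).
have mF := measurableT_comp (mNI (2 * r ^+ 2)) msub.
rewrite (integral_mul_integral (line R) (plane R) mF (fun z => NI0 _ _) mf f0)/=.
apply: eq_integral => s _.
transitivity (\int[plane R]_y ((wt 2^-1 (2 * r ^+ 2) s)%:E * (hkp s (x - y)%R * f y))).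
  by apply: eq_integral => y _; rewrite muleA.
have mhk : measurable_fun setT (fun y : R * R => hkp s (x - y)%R).
  exact: (measurableT_comp (measurable_hkp _) (measurable_csub x)).
rewrite ge0_integralZl; [by []|by []|exact: emeasurable_funM|
  by move=> y _; rewrite mule_ge0// hkp_ge0|by rewrite lee_fin wt_ge0].
Qed.

(** The radius [r] stays free: it is [1] for the bound by the [L^1] norm alone, and the diffusive
    length in the decay estimates. *)
Lemma conv_bsk_le (A : R) x : \int[plane R]_y f y <= A%:E ->
  conv bsk f x <= (A / r)%:E + 100%:E * near r f x.
Proof.
move=> fA.
have mN := measurable_nearK r; have N0 := nearK_ge0 r.
have mfx : measurable_fun setT (fun y : R * R => nearK r (x - y)%R * f y).
  exact: (emeasurable_funM (measurableT_comp mN (measurable_csub x)) mf).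
apply: (@le_trans _ _ (\int[plane R]_y ((r^-1)%:E * f y + 100%:E * (nearK r (x - y)%R * f y)))).
  apply: ge0_le_integral => //.
  - by move=> y _; rewrite mule_ge0// bsk_ge0.
  - exact: (emeasurable_funM (measurableT_comp measurable_bsk (measurable_csub x)) mf).
  - exact: (emeasurable_funD (emeasurable_funM (measurable_cst _) mf) (emeasurable_funM (measurable_cst _) mfx)).
  - move=> y _; have n100 : 0 <= 100%:E :> \bar R by rewrite lee_fin; exact: ler0n.
    have r1 : 0 <= (r^-1)%:E by rewrite lee_fin invr_ge0 ltW.
    rewrite muleA -(ge0_muleDl (f y) r1 (mule_ge0 n100 (N0 (x - y)%R))).
    by apply: lee_wpmul2r; [exact: f0|exact: bsk_le].
rewrite ge0_integralD; [|by []| | | |]; first last.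
- exact: (emeasurable_funM (measurable_cst _) mfx).
- by move=> y _; rewrite !mule_ge0// lee_fin.
- exact: (emeasurable_funM (measurable_cst _) mf).
- by move=> y _; rewrite mule_ge0// lee_fin invr_ge0 ltW.
rewrite ge0_integralZl; [|by []|by []|by []|by rewrite lee_fin invr_ge0 ltW].
rewrite ge0_integralZl; [|by []|by []|by move=> y _; rewrite mule_ge0|by rewrite lee_fin].
rewrite -conv_nearK leeD2r// mulrC EFinM lee_wpmul2l// lee_fin invr_ge0 ltW//.
Qed.

(** The heat flow contracts [L^2], and the weight has integral at most [2 * sqrt 2 * r], which is
    below [3 * r]. *)
Lemma L2le_near (A : R) : (0 <= A)%R -> L2le f A -> L2le (near r f) (3 * r * A).
Proof.
move=> A0 fA.
have := @L2le_hsup R _ _ _ (@measurable_wt R 2^-1 (2 * r ^+ 2)) (@measurable_id _ _ setT) mf2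
  (@wt_ge0 R _ _) (fun z => f0 _) (cst A) (3 * r * A)%R; apply => //.
- by apply: aeW => s _; exact: L2le_conv_hkp.
- rewrite (_ : \int[line R]_s _ = \int[line R]_s (A%:E * (wt 2^-1 (2 * r ^+ 2) s)%:E)); last first.
    by apply: eq_integral => s _; rewrite -EFinM mulrC.
  rewrite ge0_integralZl_EFin; [|by []|by move=> t _; rewrite lee_fin wt_ge0|
    by apply/measurable_EFinP; exact: measurable_wt|by []].
  rewrite [leRHS](_ : _ = A%:E * (3 * r)%:E); last by rewrite -EFinM mulrC.
  rewrite lee_wpmul2l ?lee_fin//.
  apply: (le_trans (integral_wt _ _ _)); [by lra|by lra|by rewrite mulr_gt0// exprn_gt0|].
  rewrite lee_fin (_ : 1 - 2^-1 = 2^-1)%R; last by field.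
  rewrite invrK powR12_sqrt; last by rewrite mulr_ge0// sqr_ge0.
  rewrite sqrtrM// sqrtr_sqr (ger0_norm (ltW r0)) mulrA ler_wpM2r ?(ltW r0)//.
  rewrite -ler_pdivlMl// -[leRHS](ger0_norm _)// -sqrtr_sqr ler_wsqrtr//; lra.
Qed.

(* [min (s^(-1/2)) (t^(-1/2)) <= s^(-1/4) t^(-1/4)] makes the superposition integrable at [s = 0]
   without losing integrability in [t]. *)
Lemma L2le_conv_hkp_near (h : R * R -> \bar R) (A B t : R) :
  measurable_fun setT h -> (forall x, 0 <= h x) -> (0 <= A)%R -> (0 <= B)%R -> (0 < t)%R ->
  L2le f A -> L2le h B ->
  L2le (conv (hkp t) (fun x => near r f x * h x)) (5 * r `^ 2^-1 * t `^ (- (4^-1)) * (A * B)).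
Proof.
move=> mh h0 A0 B0 t0 fA hB.
pose F (z : R * (R * R)) := conv (hkp z.1) f z.2 * h z.2.
have mw := @measurable_wt R 2^-1 (2 * r ^+ 2).
have mc1 := @measurable_conv_hkp2 R _ _ (@measurable_id _ _ setT) mf2 (fun z => f0 _).
have cF0 s x : 0 <= conv (hkp s) f x by apply: conv_ge0 => //; exact: hkp_ge0.
have mF : measurable_fun setT F.
  by apply: emeasurable_funM => //; exact: (measurableT_comp mh).
have F0 z : 0 <= F z by rewrite mule_ge0.
have E : conv (hkp t) (fun x => near r f x * h x) = hsup (wt 2^-1 (2 * r ^+ 2)) (cst t) F.
  apply/funext => x; rewrite /conv.
  have mht : measurable_fun setT (fun y : R * R => hkp t (x - y)%R).
    exact: (measurableT_comp (measurable_hkp _) (measurable_csub x)).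
  transitivity (\int[plane R]_y (near r f y * (h y * hkp t (x - y)%R))).
    by apply: eq_integral => y _; rewrite muleC muleA.
  rewrite (integral_mul_hsup mw (@measurable_id _ _ setT) mf2 (@wt_ge0 R _ _) (fun z => f0 _)); first last.
  - by move=> y; rewrite mule_ge0// hkp_ge0.
  - exact: emeasurable_funM.
  apply: eq_integral => s _; congr (_ * _); apply: eq_integral => y _.
  by rewrite /F/= muleA muleC.
rewrite E.
have mB : measurable_fun setT (fun s : R => s `^ (- (4^-1)) * (t `^ (- (4^-1)) * (A * B)))%R.
  by apply: measurable_funM => //; exact: measurable_powR.
have := @L2le_hsup R _ _ _ mw (@measurable_cst _ _ _ _ setT t) mF (@wt_ge0 R _ _) F0
  (fun s => s `^ (- (4^-1)) * (t `^ (- (4^-1)) * (A * B)))%R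
  (5 * r `^ 2^-1 * t `^ (- (4^-1)) * (A * B))%R; apply => //.
- by move=> s; rewrite !mulr_ge0 ?powR_ge0.
- apply: aeW => s /wt_gt0/andP[s0 _]; rewrite /= /F/=.
  have mcf : measurable_fun setT (conv (hkp s) f) by apply: measurable_conv => //; [exact: measurable_hkp|move=> x; exact: hkp_ge0].
  have mch : measurable_fun setT (fun x => conv (hkp s) f x * h x) by exact: emeasurable_funM.
  have ch0 x : 0 <= conv (hkp s) f x * h x by rewrite mule_ge0.
  have AB0 : (0 <= A * B)%R by rewrite mulr_ge0.
  have ps (u : R) : (0 < u)%R -> (u `^ (- 2^-1) = u `^ (- (4^-1)) * u `^ (- (4^-1)) :> R)%R.
    move=> u0; rewrite -powRD; last by rewrite (gt_eqF u0) implybT.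
    by congr (_ `^ _)%R; field.
  (* If [s <= t] the outer evolution carries the product from [L^1] to [L^2]; otherwise the inner
     one carries [f] from [L^2] to the supremum norm. *)
  have [st|ts] := leP s t.
  + apply: (L2leW (A := t `^ (- 2^-1) * (A * B))%R); first by rewrite mulr_ge0 ?powR_ge0.
      rewrite (ps _ t0) -mulrA ler_wpM2r ?mulr_ge0 ?powR_ge0//.
      rewrite !powRN lef_pV2 ?posrE ?powR_gt0// ge0_ler_powR ?nnegrE ?(ltW s0) ?(ltW t0)//.
    apply: L2le_conv => //.
    * exact: measurable_hkp.
    * by move=> x; exact: hkp_ge0.
    * exact: powR_ge0.
    * by rewrite hkpE//; exact: L2le_hk.
    * by apply: le_cauchy_schwarz => //; exact: L2le_conv_hkp.
  + apply: (L2leW (A := s `^ (- 2^-1) * (A * B))%R); first by rewrite mulr_ge0 ?powR_ge0.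
      rewrite (ps _ s0) -mulrA ler_wpM2l ?powR_ge0// ler_wpM2r//.
      by rewrite !powRN lef_pV2 ?posrE ?powR_gt0// ge0_ler_powR ?nnegrE ?(ltW s0) ?(ltW t0)// ltW.
    apply: L2le_conv_hkp => //; first by rewrite mulr_ge0 ?powR_ge0.
    rewrite mulrA; apply: (L2le_mono (g := fun x => (s `^ (- 2^-1) * A)%:E * h x)) => //.
    * exact: emeasurable_funM.
    * move=> x; rewrite lee_wpmul2r//; apply: conv_le_L2 => //.
      - exact: measurable_hkp.
      - by move=> y; exact: hkp_ge0.
      - exact: powR_ge0.
      - by rewrite hkpE//; exact: L2le_hk.
    * by apply: L2leZ => //; rewrite mulr_ge0 ?powR_ge0.
- rewrite (_ : \int[line R]_s _ = \int[line R]_s ((t `^ (- (4^-1)) * (A * B))%:E * (wt (3 / 4) (2 * r ^+ 2) s)%:E)); last first.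
    apply: eq_integral => s _; rewrite -EFinM; congr EFin; rewrite /wt.
    case: ifPn => [/andP[s0 _]|_]; last by rewrite mul0r mulr0.
    rewrite mulrA mulrC; congr (_ * _)%R; rewrite -powRD; last by rewrite (gt_eqF s0) implybT.
    by congr (_ `^ _)%R; field.
  rewrite ge0_integralZl_EFin; [|by []|by move=> s _; rewrite lee_fin wt_ge0|
    by apply/measurable_EFinP; exact: measurable_wt|by rewrite !mulr_ge0 ?powR_ge0].
  rewrite [leRHS](_ : _ = (t `^ (- (4^-1)) * (A * B))%:E * (5 * r `^ 2^-1)%:E); last by rewrite -EFinM; congr EFin; ring.
  rewrite lee_wpmul2l ?lee_fin ?mulr_ge0 ?powR_ge0//.
  apply: (le_trans (integral_wt _ _ _)); [by lra|by lra|by rewrite mulr_gt0// exprn_gt0|].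
  rewrite lee_fin (_ : (1 - 3 / 4)^-1 = 4)%R; last by field.
  rewrite (_ : 1 - 3 / 4 = 4^-1)%R; last by field.
  rewrite powRM ?sqr_ge0// -(powR_mulrn _ (ltW r0)) -powRrM (_ : 2%:R / 4 = 2^-1)%R; last by field.
  rewrite mulrA ler_wpM2r ?powR_ge0//.
  (* What remains is that [4 * 2^(1/4)] is at most [5], because [2 < (5/4)^4]. *)
  have p0 : (0 <= 2 `^ 4^-1 :> R)%R by exact: powR_ge0.
  have : ((2 `^ 4^-1) ^+ 4 = 2 :> R)%R.
    by rewrite -powR_mulrn// -powRrM mulVf// powRr1.
  move: (_ `^ _)%R p0 => p p0 p4.
  rewrite leNgt; apply/negP => pl.
  have : (5 / 4 < p)%R by lra.
  move=> p5; have : ((5 / 4) ^+ 4 < p ^+ 4)%R by rewrite ltr_pXn2r// nnegrE; lra.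
  by rewrite p4; lra.
Qed.

End near.

End Kernels.

(** * Bounds of the velocity majorant and of its products *)

Section VelocityMajorant.
Local Open Scope ereal_scope.
Context (R : realType) (al : R) (al0 : (0 < al)%R).
Implicit Types (t s r : R) (x y : R * R).

Lemma measurable_conv2 (p : R * R -> \bar R) (F : R * (R * R) -> \bar R) :
  measurable_fun setT p -> measurable_fun setT F -> (forall x, 0 <= p x) -> (forall z, 0 <= F z) ->
  measurable_fun setT (fun z : R * (R * R) => conv p (fun y => F (z.1, y)) z.2).
Proof.
move=> mp mF p0 F0.
apply: (measurable_fun_fubini_tonelli_F
  (fun z : (R * (R * R)) * (R * R) => p (z.1.2 - z.2)%R * F (z.1.1, z.2))); last first.
  by move=> z; rewrite mule_ge0.
apply: emeasurable_funM.
  apply: (measurableT_comp mp (g := fun z : (R * (R * R)) * (R * R) => (z.1.2 - z.2)%R)).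
  apply: (measurableT_comp (@measurable_sub2 R) (g := fun z : (R * (R * R)) * (R * R) => (z.1.2, z.2))).
  apply/measurable_fun_pairP; split; last exact: measurable_snd.
  exact: (measurableT_comp measurable_snd measurable_fst).
apply: (measurableT_comp mF (g := fun z : (R * (R * R)) * (R * R) => (z.1.1, z.2))).
apply/measurable_fun_pairP; split; last exact: measurable_snd.
exact: (measurableT_comp measurable_fst measurable_fst).
Qed.

(* majorant of [|B (H_alpha f)|] for [f >= 0] *)
Definition V (f : R * R -> \bar R) : R * R -> \bar R := conv (@bsk R) (conv (Gk al) f).

Lemma V_ge0 f x : (forall y, 0 <= f y) -> 0 <= V f x.
Proof.
by move=> f0; apply: conv_ge0 => y; [exact: bsk_ge0|apply: conv_ge0 => // z; exact: Gk_ge0].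
Qed.

Lemma measurable_V2 (F : R * (R * R) -> \bar R) : measurable_fun setT F -> (forall z, 0 <= F z) ->
  measurable_fun setT (fun z : R * (R * R) => V (fun y => F (z.1, y)) z.2).
Proof.
move=> mF F0.
apply: (measurable_conv2 (p := @bsk R) (F := fun z => conv (Gk al) (fun y => F (z.1, y)) z.2)).
- exact: measurable_bsk.
- apply: measurable_conv2 => //; [exact: measurable_Gk|exact: Gk_ge0].
- exact: bsk_ge0.
- by move=> z; apply: conv_ge0 => // y; exact: Gk_ge0.
Qed.

Lemma measurable_V f : measurable_fun setT f -> (forall y, 0 <= f y) -> measurable_fun setT (V f).
Proof.
move=> mf f0; apply: measurable_conv => //.
- exact: measurable_bsk.
- by apply: measurable_conv => //; [exact: measurable_Gk|exact: Gk_ge0].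
- exact: bsk_ge0.
- by move=> y; apply: conv_ge0 => //; exact: Gk_ge0.
Qed.

Section bounds.
Variables (f : R * R -> \bar R) (mf : measurable_fun setT f) (f0 : forall x, 0 <= f x).
Variables (A1 : R) (f1 : \int[plane R]_x f x <= A1%:E).

Let mG := measurable_Gk al.
Let G0 := Gk_ge0 al.
Let g := conv (Gk al) f.
Let mg : measurable_fun setT g. Proof. exact: measurable_conv. Qed.
Let g0 x : 0 <= g x. Proof. exact: conv_ge0. Qed.

Let g1 : \int[plane R]_x g x <= A1%:E.
Proof. by rewrite integral_conv// integral_Gk// mul1e. Qed.

Let A10 : (0 <= A1)%R.
Proof. by rewrite -lee_fin (le_trans _ f1)// integral_ge0. Qed.

(** The [1] is the far field at radius [1], the [100] comes from [bsk_le], [4 * 2^(1/4)] is the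
    integral of [s^(-3/4)] over [(0, 2)], and the last factor stems from [conv_hkp_Gk_le]. *)
Definition velocity_cst : R := (1 + 100 * (4 * 2 `^ 4^-1 * ((al ^+ 2) `^ (- (3 / 4)) * 5)))%R.

Lemma velocity_cst_gt0 : (0 < velocity_cst)%R.
Proof. by rewrite ltr_pwDl// !mulr_ge0 ?powR_ge0. Qed.

(** In the near field the heat evolution is moved onto the resolvent kernel, where it is of order
    [s^(-1/4)] in supremum norm; against the weight [s^(-1/2)] this is integrable, so [f] is needed
    in [L^1] only. *)
Lemma V_le x : V f x <= (velocity_cst * A1)%:E.
Proof.
apply: (le_trans (conv_bsk_le ltr01 mg g0 x g1)).
rewrite divr1 [leRHS](_ : _ = A1%:E + 100%:E * (4 * 2 `^ 4^-1 * ((al ^+ 2) `^ (- (3 / 4)) * 5) * A1)%:E); last first.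
  by rewrite -EFinM -EFinD; congr EFin; rewrite /velocity_cst; ring.
rewrite leeD2l// lee_wpmul2l ?lee_fin//.
pose K : R := ((al ^+ 2) `^ (- (3 / 4)) * 5)%R.
have K0 : (0 <= K)%R by rewrite mulr_ge0 ?powR_ge0.
have mg2 : measurable_fun setT (fun z : R * (R * R) => g z.2) by exact: (measurableT_comp mg).
apply: (@hsup_le R _ _ _ (@measurable_wt R _ _) (@measurable_id _ _ setT) mg2 (@wt_ge0 R _ _)
  (fun z => g0 z.2) x (fun s => K * A1 * s `^ (- (4^-1)))%R).
- by apply: measurable_funM => //; exact: measurable_powR.
- by move=> s; rewrite !mulr_ge0 ?powR_ge0.
- move=> s /wt_gt0/andP[s0 _]; rewrite /= /g.
  rewrite convA//; [|exact: measurable_hkp|by move=> y; exact: hkp_ge0].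
  rewrite mulrC mulrA; apply: conv_le_sup => //.
  + by apply: measurable_conv => //; [exact: measurable_hkp|move=> y; exact: hkp_ge0].
  + by move=> y; apply: conv_ge0 => // z; exact: hkp_ge0.
  + by move=> y; exact: conv_hkp_Gk_le.
- rewrite (_ : \int[line R]_s _ = \int[line R]_s ((K * A1)%:E * (wt (3 / 4) 2 s)%:E)); last first.
    apply: eq_integral => s _; rewrite -EFinM; congr EFin; rewrite /wt expr1n mulr1.
    case: ifPn => [/andP[s0 _]|_]; last by rewrite mul0r mulr0.
    rewrite mulrCA -powRD; last by rewrite (gt_eqF s0) implybT.
    by congr (_ * _ `^ _)%R; field.
  rewrite ge0_integralZl_EFin; [|by []|by move=> s _; rewrite lee_fin wt_ge0|
    by apply/measurable_EFinP; exact: measurable_wt|by rewrite mulr_ge0].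
  rewrite [leRHS](_ : _ = (K * A1)%:E * (4 * 2 `^ 4^-1)%:E); last by rewrite -EFinM; congr EFin; rewrite /K; ring.
  rewrite lee_wpmul2l ?lee_fin ?(mulr_ge0 K0 A10)//.
  apply: (le_trans (integral_wt _ _ _)); [by lra|by lra|by []|].
  rewrite lee_fin (_ : (1 - 3 / 4)^-1 = 4)%R; last by field.
  by rewrite (_ : 1 - 3 / 4 = 4^-1)%R//; field.
Qed.

Variables (A2 : R) (A20 : (0 <= A2)%R) (f2 : L2le f A2).
Variables (h : R * R -> \bar R) (mh : measurable_fun setT h) (h0 : forall x, 0 <= h x).
Variables (B1 B2 : R) (B20 : (0 <= B2)%R) (h1 : \int[plane R]_x h x <= B1%:E) (h2 : L2le h B2).
Variables (r : R) (r0 : (0 < r)%R).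

Let g2 : L2le g A2.
Proof.
by rewrite /g convC// -[A2]mulr1; apply: L2le_conv => //; rewrite integral_Gk.
Qed.

Let B10 : (0 <= B1)%R.
Proof. by rewrite -lee_fin (le_trans _ h1)// integral_ge0. Qed.

Let mn : measurable_fun setT (near r g). Proof. exact: measurable_near. Qed.
Let n0 x : 0 <= near r g x. Proof. exact: near_ge0. Qed.
Let mnh : measurable_fun setT (fun x => near r g x * h x). Proof. exact: emeasurable_funM. Qed.
Let nh0 x : 0 <= near r g x * h x. Proof. by rewrite mule_ge0. Qed.
Let mV : measurable_fun setT (V f). Proof. exact: measurable_V. Qed.
Let V0 x : 0 <= V f x. Proof. exact: V_ge0. Qed.
Let mVh : measurable_fun setT (fun x => V f x * h x). Proof. exact: emeasurable_funM. Qed.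
Let Vh0 x : 0 <= V f x * h x. Proof. by rewrite mule_ge0. Qed.
Let A1r0 : (0 <= A1 / r)%R. Proof. by rewrite divr_ge0// ltW. Qed.

Let n100 : 0 <= 100%:E :> \bar R. Proof. by rewrite lee_fin; exact: ler0n. Qed.
Let A1rE : 0 <= (A1 / r)%:E. Proof. by rewrite lee_fin. Qed.

Let V_mul_le x : V f x * h x <= (A1 / r)%:E * h x + 100%:E * (near r g x * h x).
Proof.
rewrite muleA -(ge0_muleDl (h x) A1rE (mule_ge0 n100 (n0 x))).
by apply: lee_wpmul2r; [exact: h0|exact: conv_bsk_le].
Qed.

Let m1 : measurable_fun setT (fun x => (A1 / r)%:E * h x).
Proof. exact: (emeasurable_funM (measurable_cst _) mh). Qed.
Let m2 : measurable_fun setT (fun x => 100%:E * (near r g x * h x)).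
Proof. exact: (emeasurable_funM (measurable_cst _) mnh). Qed.
Let p1 x : 0 <= (A1 / r)%:E * h x. Proof. by rewrite mule_ge0// lee_fin. Qed.
Let p2 x : 0 <= 100%:E * (near r g x * h x). Proof. by apply: mule_ge0; [exact: n100|exact: nh0]. Qed.

(** The far field pairs the two [L^1] norms, the near field the two [L^2] norms by
    Cauchy-Schwarz. *)
Lemma integral_V_mul : \int[plane R]_x (V f x * h x) <= (A1 * B1 / r + 300 * r * (A2 * B2))%:E.
Proof.
apply: (@le_trans _ _ (\int[plane R]_x ((A1 / r)%:E * h x + 100%:E * (near r g x * h x)))).
  apply: ge0_le_integral => //; exact: emeasurable_funD.
rewrite ge0_integralD// ge0_integralZl// ?lee_fin// ge0_integralZl// ?lee_fin// [leRHS]EFinD leeD//.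
  by rewrite mulrAC [leRHS]EFinM lee_wpmul2l// lee_fin.
rewrite [leRHS](_ : _ = 100%:E * (3 * r * A2 * B2)%:E); last by rewrite -EFinM; congr EFin; ring.
rewrite lee_wpmul2l ?lee_fin//.
apply: le_cauchy_schwarz => //; first by rewrite !mulr_ge0// ltW.
exact: L2le_near.
Qed.

Lemma L2le_conv_V_mul t : (0 < t)%R ->
  L2le (conv (hkp t) (fun x => V f x * h x)) (A1 * B2 / r + 500 * r `^ 2^-1 * t `^ (- (4^-1)) * (A2 * B2)).
Proof.
move=> t0.
have mt := @measurable_hkp R t. have t0' := @hkp_ge0 R t.
apply: (@L2le_mono R _ (fun x => (A1 / r)%:E * conv (hkp t) h x + 100%:E * conv (hkp t) (fun x => near r g x * h x) x)).
- exact: measurable_conv.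
- apply: emeasurable_funD; apply: emeasurable_funM; [exact: measurable_cst|exact: measurable_conv
    |exact: measurable_cst|exact: measurable_conv].
- by move=> x; exact: conv_ge0.
- move=> x; have mtx : measurable_fun setT (fun y : R * R => hkp t (x - y)%R).
    exact: (measurableT_comp mt (measurable_csub x)).
  apply: (@le_trans _ _ (\int[plane R]_y ((A1 / r)%:E * (hkp t (x - y)%R * h y) +
      100%:E * (hkp t (x - y)%R * (near r g y * h y))))).
    apply: ge0_le_integral.
    + exact: measurableT.
    + by move=> y _; apply: mule_ge0; [exact: t0'|exact: Vh0].
    + exact: (emeasurable_funM mtx mVh).
    + exact: (emeasurable_funD (emeasurable_funM (measurable_cst _) (emeasurable_funM mtx mh))
        (emeasurable_funM (measurable_cst _) (emeasurable_funM mtx mnh))).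
    + move=> y _; rewrite [leRHS](_ : _ = hkp t (x - y)%R * ((A1 / r)%:E * h y + 100%:E * (near r g y * h y))).
        by apply: lee_wpmul2l; [exact: t0'|exact: V_mul_le].
      by rewrite (ge0_muleDr _ (p1 y) (p2 y)); congr (_ + _); exact: muleCA.
  have q1 y : 0 <= hkp t (x - y)%R * h y by exact: mule_ge0.
  have q2 y : 0 <= hkp t (x - y)%R * (near r g y * h y) by exact: mule_ge0.
  have mq1 := emeasurable_funM mtx mh; have mq2 := emeasurable_funM mtx mnh.
  rewrite (ge0_integralD _ measurableT (fun y _ => mule_ge0 A1rE (q1 y)) (emeasurable_funM (measurable_cst _) mq1)
    (fun y _ => mule_ge0 n100 (q2 y)) (emeasurable_funM (measurable_cst _) mq2)).
  rewrite (ge0_integralZl _ measurableT mq1 (fun y _ => q1 y) A1rE).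
  by rewrite (ge0_integralZl _ measurableT mq2 (fun y _ => q2 y) n100).
- have := @L2leD R (fun x => (A1 / r)%:E * conv (hkp t) h x) (fun x => 100%:E * conv (hkp t) (fun x => near r g x * h x) x)
    (A1 / r * B2)%R (100 * (5 * r `^ 2^-1 * t `^ (- (4^-1)) * (A2 * B2)))%R.
  rewrite (_ : A1 / r * B2 + _ = A1 * B2 / r + 500 * r `^ 2^-1 * t `^ (- (4^-1)) * (A2 * B2))%R; last by ring.
  apply.
  + by apply: emeasurable_funM; [exact: measurable_cst|exact: measurable_conv].
  + by apply: emeasurable_funM; [exact: measurable_cst|exact: measurable_conv].
  + by move=> x; rewrite mule_ge0 ?lee_fin//; exact: conv_ge0.
  + by move=> x; rewrite mule_ge0 ?lee_fin//; exact: conv_ge0.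
  + by rewrite mulr_ge0.
  + by rewrite !mulr_ge0 ?powR_ge0.
  + apply: L2leZ => //; [exact: measurable_conv|by move=> x; exact: conv_ge0|exact: L2le_conv_hkp].
  + apply: L2leZ => //; [exact: measurable_conv|by move=> x; exact: conv_ge0|].
    exact: L2le_conv_hkp_near.
Qed.

(** The heat flow enters through its norm [t^(-1/2)] from [L^1] to [L^2]: singular for small [t],
    but the form needed for slices far in the past. *)
Lemma L2le_conv_V_mul_singular t : (0 < t)%R ->
  L2le (conv (hkp t) (fun x => V f x * h x)) (t `^ (- 2^-1) * (A1 * B1 / r + 300 * r * (A2 * B2))).
Proof.
move=> t0; apply: L2le_conv => //.
- exact: measurable_hkp.
- by move=> x; exact: hkp_ge0.
- exact: powR_ge0.
- by rewrite hkpE//; exact: L2le_hk.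
- exact: integral_V_mul.
Qed.

End bounds.

End VelocityMajorant.

(** * The Helmholtz equation *)

Section ContinuousPlane.
Context (R : realType).

(** The preimage of an open half-line is open, hence a countable union of boxes with rational
    corners, which belong to the product sigma-algebra. *)
Lemma measurable_continuous2 (f : R * R -> R) : continuous f -> measurable_fun [set: R * R] f.
Proof.
move=> cf mD; apply: (measurability _ (RGenOInfty.measurableE R)) => //.
move=> /= _ [_ [y ->] <-]; rewrite setTI.
pose box (p : rat * rat * (rat * rat)) : set (R * R) :=
  `]ratr p.1.1, ratr p.1.2[%classic `*` `]ratr p.2.1, ratr p.2.2[%classic.
pose U := f @^-1` `]y, +oo[%classic.
have mbox p : measurable (box p) by apply: measurableX; exact: measurable_itv.
rewrite (_ : _ @^-1` _ = \bigcup_(a : rat) \bigcup_(b : rat) \bigcup_(c : rat) \bigcup_(d : rat)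
    (if `[< box (a, b, (c, d)) `<=` U >] then box (a, b, (c, d)) else set0)).
  by do 4!(apply: bigcupT_measurable_rat => ?); case: ifP.
apply/seteqP; split => [x Ux|x]; last first.
  by move=> [a _ [b _ [c _ [d _]]]]; case: ifPn => // /asboolP bU /bU.
have : nbhs x U.
  by apply: cf; apply: open_nbhs_nbhs; split; [exact: interval_open|exact: Ux].
move=> /nbhs_ballP[e /= e0 eU].
have [a /[!in_itv]/= /andP[a1 a2]] : exists q, ratr q \in `]x.1 - e, x.1[.
  by have /rat_in_itvoo : (x.1 - e < x.1)%R by rewrite ltrBlDr ltrDl.
have [b /[!in_itv]/= /andP[b1 b2]] : exists q, ratr q \in `]x.1, x.1 + e[.
  by have /rat_in_itvoo : (x.1 < x.1 + e)%R by rewrite ltrDl.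
have [c /[!in_itv]/= /andP[c1 c2]] : exists q, ratr q \in `]x.2 - e, x.2[.
  by have /rat_in_itvoo : (x.2 - e < x.2)%R by rewrite ltrBlDr ltrDl.
have [d /[!in_itv]/= /andP[d1 d2]] : exists q, ratr q \in `]x.2, x.2 + e[.
  by have /rat_in_itvoo : (x.2 < x.2 + e)%R by rewrite ltrDl.
exists a => //; exists b => //; exists c => //; exists d => //.
rewrite ifT; first by split; rewrite /= in_itv/=; apply/andP.
apply/asboolP => -[z1 z2] [/=]; rewrite !in_itv/= => /andP[za zb] /andP[zc zd].
apply: eU; split; rewrite /= ball_itv/= in_itv/=; apply/andP; split.
- exact: lt_trans a1 _.
- exact: lt_trans b2.
- exact: lt_trans c1 _.
- exact: lt_trans d2.
Qed.

(** Support in a square, put coordinatewise so that it passes to the restrictions to lines and to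
    partial derivatives. *)
Definition boxed (K : R) (f : R * R -> R) := forall x, K < `|x.1| \/ K < `|x.2| -> f x = 0.

Lemma boxed_bounded (K : R) (f : R * R -> R) : continuous f -> boxed K f ->
  exists2 M : R, 0 < M & forall x, `|f x| <= M.
Proof.
move=> cf bf.
have cK : compact (`[- K, K]%classic `*` `[- K, K]%classic : set (R * R)).
  by apply: compact_setX; exact: segment_compact.
have := compact_bounded (continuous_compact (continuous_subspaceT cf) cK).
move=> [M [_ Mb]].
exists (`|M| + 1); first by rewrite ltr_wpDl.
move=> x; have [x1|x1] := ltP K `|x.1|; first by rewrite bf ?normr0 ?addr_ge0//; left.
have [x2|x2] := ltP K `|x.2|; first by rewrite bf ?normr0 ?addr_ge0//; right.
apply: (Mb (`|M| + 1)); first by rewrite (le_lt_trans (ler_norm _))// ltrDl.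
by exists x => //; split => /=; rewrite in_itv/= -ler_norml.
Qed.

Lemma boxed_partial1 (K : R) (f : R * R -> R) : boxed K f -> boxed K (partial1 f).
Proof.
move=> bf x hx; rewrite partial1E (@near_eq_derive _ _ _ _ (cst 0))//; first by rewrite derive_cst.
case: hx => hx; apply/nbhs_ballP; last by exists 1 => //= r _; apply: bf; right.
exists (`|x.1| - K); first by rewrite /= subr_gt0.
move=> r; rewrite /ball/= => xr; apply: bf; left => /=.
by have := lerB_dist x.1 r; lra.
Qed.

Lemma boxed_partial2 (K : R) (f : R * R -> R) : boxed K f -> boxed K (partial2 f).
Proof.
move=> bf x hx; rewrite partial2E (@near_eq_derive _ _ _ _ (cst 0))//; first by rewrite derive_cst.
case: hx => hx; apply/nbhs_ballP; first by exists 1 => //= r _; apply: bf; left.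
exists (`|x.2| - K); first by rewrite /= subr_gt0.
move=> r; rewrite /ball/= => xr; apply: bf; right => /=.
by have := lerB_dist x.2 r; lra.
Qed.

Lemma is_derive_partial1 (f : R * R -> R) r b : derivable f (r, b) ((1, 0) : R * R) ->
  is_derive r 1 (fun r => f (r, b)) (partial1 f (r, b)).
Proof. by rewrite derivable1E/= => df; apply: DeriveDef; [exact: df|rewrite partial1E]. Qed.

Lemma is_derive_partial2 (f : R * R -> R) a r : derivable f (a, r) ((0, 1) : R * R) ->
  is_derive r 1 (fun r => f (a, r)) (partial2 f (a, r)).
Proof. by rewrite derivable2E/= => df; apply: DeriveDef; [exact: df|rewrite partial2E]. Qed.

Lemma continuous_line1 (f : R * R -> R) (b : R) : continuous f -> continuous (fun r => f (r, b)).
Proof.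
move=> cf r; have h : (fun r : R => (r, b)) x @[x --> r] --> (r, b).
  move=> A /nbhs_ballP[e /= e0 eA]; apply/nbhs_ballP; exists e => // z rz.
  by apply: eA; split => //=; exact: ballxx.
by apply: (@continuous_comp _ _ _ (fun r : R => (r, b)) f); [exact: h|exact: cf].
Qed.

Lemma continuous_line2 (f : R * R -> R) (a : R) : continuous f -> continuous (fun r => f (a, r)).
Proof.
move=> cf r; have h : (fun r : R => (a, r)) x @[x --> r] --> (a, r).
  move=> A /nbhs_ballP[e /= e0 eA]; apply/nbhs_ballP; exists e => // z rz.
  by apply: eA; split => //=; exact: ballxx.
by apply: (@continuous_comp _ _ _ (fun r : R => (a, r)) f); [exact: h|exact: cf].
Qed.

Record C2box (K : R) (f : R * R -> R) : Prop := MkC2box {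
  C2_cont : continuous f;
  C2_box : boxed K f;
  C2_d1 : forall x, derivable f x ((1, 0) : R * R);
  C2_d2 : forall x, derivable f x ((0, 1) : R * R);
  C2_c1 : continuous (partial1 f);
  C2_c2 : continuous (partial2 f);
  C2_d11 : forall x, derivable (partial1 f) x ((1, 0) : R * R);
  C2_d22 : forall x, derivable (partial2 f) x ((0, 1) : R * R);
  C2_c11 : continuous (partial1 (partial1 f));
  C2_c22 : continuous (partial2 (partial2 f)) }.

Lemma test_function_box (f : R * R -> R) : test_function f -> exists2 K : R, 0 < K & boxed K f.
Proof.
move=> [_ /compact_bounded[M [_ Mb]]].
exists (`|M| + 1); first by rewrite ltr_wpDl.
move=> x hx; apply/eqP; apply/negP => /negP fx0.
have : `|x| <= `|M| + 1.
  apply: (Mb (`|M| + 1)); first by rewrite (le_lt_trans (ler_norm _))// ltrDl.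
  exact: subset_closure.
rewrite prod_normE ge_max => /andP[x1 x2].
by case: hx => /lt_le_trans h; [move: (h _ x1)|move: (h _ x2)]; rewrite ltxx.
Qed.

Lemma test_function_C2 (f : R * R -> R) : test_function f -> exists2 K : R, 0 < K & C2box K f.
Proof.
move=> tf; have [K K0 bK] := test_function_box tf; exists K => //.
have [/(_ 3%N) /= [cf d1 d2 [c1 d11 _ [c11 _ _ _ _] _] [c2 _ d22 _ [c22 _ _ _ _]]] _] := tf.
exact: (MkC2box cf bK d1 d2 c1 c2 d11 d22 c11 c22).
Qed.

Lemma quotient_translate (f : R * R -> R) (c x v : R * R) :
  (fun h : R => h^-1 *: (((fun x => f (x + c)) \o shift x) (h *: v) - f (x + c))) =
  (fun h : R => h^-1 *: ((f \o shift (x + c)) (h *: v) - f (x + c))).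
Proof. by apply/funext => h /=; rewrite addrA. Qed.

Lemma partial_translate (f : R * R -> R) (c : R * R) :
  (partial1 (fun x => f (x + c)) = fun x => partial1 f (x + c)) /\
  (partial2 (fun x => f (x + c)) = fun x => partial2 f (x + c)).
Proof. by split; apply/funext => x; rewrite /partial1 /partial2 /derive quotient_translate. Qed.

Lemma derivable_translate (f : R * R -> R) (c x v : R * R) :
  derivable f (x + c) v -> derivable (fun x => f (x + c)) x v.
Proof. by rewrite /derivable quotient_translate. Qed.

Lemma continuous_translate (f : R * R -> R) (c : R * R) :
  continuous f -> continuous (fun x : R * R => f (x + c)).
Proof.
move=> cf x A /cf/nbhs_ballP[e /= e0 eA]; apply/nbhs_ballP; exists e => // z [xz1 xz2].
apply: eA; split.
  have : `|x.1 - z.1| < e by exact: xz1.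
  by rewrite (_ : x.1 - z.1 = (x.1 + c.1) - (z.1 + c.1))//; ring.
have : `|x.2 - z.2| < e by exact: xz2.
by rewrite (_ : x.2 - z.2 = (x.2 + c.2) - (z.2 + c.2))//; ring.
Qed.

Lemma class_C_translate k (f : R * R -> R) (c : R * R) : class_C k f -> class_C k (fun x => f (x + c)).
Proof.
elim: k f => [|k IH] f /=; first exact: continuous_translate.
move=> [cf d1 d2 c1 c2]; have [p1 p2] := partial_translate f c.
split; [exact: continuous_translate|by move=> x; exact: derivable_translate|
  by move=> x; exact: derivable_translate|by rewrite p1; exact: IH|by rewrite p2; exact: IH].
Qed.

Lemma bounded_support_compact (K : R) (f : R * R -> R) : boxed K f -> compact (closure [set x | f x != 0]).
Proof.
move=> bf; have cK : compact (`[- K, K]%classic `*` `[- K, K]%classic : set (R * R)).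
  by apply: compact_setX; exact: segment_compact.
apply: (subclosed_compact _ cK); first exact: closed_closure.
have clK : closed (`[- K, K]%classic `*` `[- K, K]%classic : set (R * R)).
  by apply: compact_closed => //; exact: norm_hausdorff.
move/closure_id: clK => ->; apply: closure_subset => x /= /eqP fx.
split; rewrite /= in_itv/= -ler_norml leNgt; apply/negP => h; apply: fx; apply: bf; [by left|by right].
Qed.

Lemma test_function_translate (f : R * R -> R) (c : R * R) : test_function f ->
  test_function (fun x => f (x + c)).
Proof.
move=> tf; have [K K0 bK] := test_function_box tf; have [Cf _] := tf; split.
  by move=> k; exact: class_C_translate.
apply: (@bounded_support_compact (K + `|c.1| + `|c.2|)) => x hx; apply: bK => /=.
have t1 : `|x.1| <= `|x.1 + c.1| + `|c.1| by rewrite -[in leLHS](addrK c.1 x.1) (le_trans (ler_normB _ _)).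
have t2 : `|x.2| <= `|x.2 + c.2| + `|c.2| by rewrite -[in leLHS](addrK c.2 x.2) (le_trans (ler_normB _ _)).
have n1 := normr_ge0 c.1; have n2 := normr_ge0 c.2.
by case: hx => hx; [left|right]; lra.
Qed.

Lemma laplacian_translate (f : R * R -> R) (c x : R * R) :
  laplacian (fun x => f (x + c)) x = laplacian f (x + c).
Proof.
rewrite /laplacian; have [-> ->] := partial_translate f c.
by have [-> _] := partial_translate (partial1 f) c; have [_ ->] := partial_translate (partial2 f) c.
Qed.

End ContinuousPlane.

(** * Green's formula against the heat kernel *)

Section Green.
Context (R : realType).

Lemma integrable_dom d (T : measurableType d) (mu : {measure set T -> \bar R}) (f h : T -> R) (M : R) :
  measurable_fun setT f -> mu.-integrable setT (EFin \o h) -> (forall x, 0 <= h x) ->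
  (forall x, `|f x| <= M * h x) -> mu.-integrable setT (EFin \o f).
Proof.
move=> mf ih h0 fh.
have imh : mu.-integrable setT (EFin \o (fun x => M * h x)).
  rewrite (_ : _ \o _ = fun x => (M%:E * (EFin \o h) x)%E) ?integrableZl//.
apply: le_integrable imh => //; first exact/measurable_EFinP.
by move=> x _ /=; rewrite lee_fin (le_trans (fh x))// ler_norm.
Qed.

Lemma integrable_heat_kernel (t : R) : 0 < t -> (plane R).-integrable setT (EFin \o heat_kernel t).
Proof.
move=> t0; apply/integrableP; split; first by apply/measurable_EFinP; exact: measurable_heat_kernel.
rewrite (_ : (\int[plane R]_x _)%E = (\int[plane R]_x hk t x)%E); first by rewrite integral_hk// ltry.
by apply: eq_integral => x _ /=; rewrite ger0_norm// heat_kernel_ge0// ltW.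
Qed.

Lemma lipschitz_is_derive (f df : R -> R) (M : R) : (forall r : R, is_derive r 1 f (df r)) ->
  (forall r, `|df r| <= M) -> forall a b, `|f b - f a| <= M * `|b - a|.
Proof.
move=> fdf dfM a b; wlog ab : a b / a <= b.
  move=> H; case/orP: (le_total a b) => ab; first exact: H.
  by rewrite distrC [`|b - a|]distrC; exact: H.
have cf : {within `[a, b], continuous f}.
  apply: continuous_subspaceT => r; apply: differentiable_continuous.
  by apply/derivable1_diffP; have [] := fdf r.
have [c _ ->] := MVT_segment ab (fun r _ => fdf r) cf.
by rewrite normrM ler_wpM2r.
Qed.

Lemma continuous_is_derive (f df : R -> R) (r : R) : is_derive r 1 f (df r) -> {for r, continuous f}.
Proof. by move=> [df' _]; apply: differentiable_continuous; exact/derivable1_diffP. Qed.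

(** The integrand is the derivative of [u w' - u' w], which vanishes at the ends of an interval
    containing the support of [w]. *)
Lemma green_line (u u1 u2 w w1 w2 : R -> R) (K : R) : 0 < K ->
  (forall r : R, is_derive r 1 u (u1 r)) -> (forall r : R, is_derive r 1 u1 (u2 r)) ->
  (forall r : R, is_derive r 1 w (w1 r)) -> (forall r : R, is_derive r 1 w1 (w2 r)) ->
  continuous u2 -> continuous w2 ->
  (forall r, K < `|r| -> w r = 0) -> (forall r, K < `|r| -> w1 r = 0) -> (forall r, K < `|r| -> w2 r = 0) ->
  (\int[line R]_r (u r * w2 r - u2 r * w r)%:E = 0)%E.
Proof.
move=> K0 du du1 dw dw1 cu2 cw2 w0 w10 w20.
pose f r := u r * w2 r - u2 r * w r.
have cu : continuous u by move=> r; exact: continuous_is_derive.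
have cw : continuous w by move=> r; exact: continuous_is_derive.
have cf : continuous f.
  move=> r; apply: cvgB; apply: cvgM; [exact: cu|exact: cw2|exact: cu2|exact: cw].
have dF (r : R) : is_derive r 1 (fun r => u r * w1 r - u1 r * w r) (f r).
  apply: is_derive_eq; rewrite /GRing.scale/= /f; ring.
(* [w] and [w1] vanish strictly beyond [K] only, so the interval is enlarged by one. *)
have K1 : K < `|K + 1| by rewrite ger0_norm ?ltrDl// addr_ge0// ltW.
have K1' : K < `|- (K + 1)| by rewrite normrN.
have KK : - (K + 1) <= K + 1 by rewrite ge0_cp// addr_ge0// ltW.
have := line_FTC KK (fun r _ => cf r) (fun r _ => dF r) (continuous_measurable_fun cf).
rewrite (w0 _ K1) (w10 _ K1) (w0 _ K1') (w10 _ K1') !mulr0 !subr0 => E; rewrite -[RHS]E.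
apply: eq_integral => r _; congr EFin; case: ifPn => //.
rewrite -ler_norml -ltNge => h.
have Kr : K < `|r| by rewrite (lt_trans _ h)// ltrDl.
by rewrite w20// w0// !mulr0 subr0.
Qed.

Lemma plane_fubini1 (f : R * R -> \bar R) : (plane R).-integrable setT f ->
  (\int[plane R]_x f x = \int[line R]_a \int[line R]_b f (a, b))%E.
Proof. by move=> fi; apply/esym; exact: integral12_prod_meas1. Qed.

Lemma plane_fubini2 (f : R * R -> \bar R) : (plane R).-integrable setT f ->
  (\int[plane R]_x f x = \int[line R]_b \int[line R]_a f (a, b))%E.
Proof. by move=> fi; apply/esym; exact: integral21_prod_meas1. Qed.

Section green_plane.
Variables (K : R) (K0 : 0 < K) (f : R * R -> R) (Cf : C2box K f) (t : R) (t0 : 0 < t).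

Let bf := C2_box Cf.
Let bf1 := boxed_partial1 bf.
Let bf2 := boxed_partial2 bf.
Let bf11 := boxed_partial1 bf1.
Let bf22 := boxed_partial2 bf2.
Let mf := measurable_continuous2 (C2_cont Cf).
Let mf11 := measurable_continuous2 (C2_c11 Cf).
Let mf22 := measurable_continuous2 (C2_c22 Cf).

Lemma measurable_fst_sqr : measurable_fun setT (fun x : R * R => x.1 ^+ 2).
Proof. exact: measurable_funX. Qed.

Lemma measurable_snd_sqr : measurable_fun setT (fun x : R * R => x.2 ^+ 2).
Proof. exact: measurable_funX. Qed.

Let coef (r : R) := r ^+ 2 / (4 * t ^+ 2) - (2 * t)^-1.

Let coef_le r : `|r| <= K -> `|coef r| <= K ^+ 2 / (4 * t ^+ 2) + (2 * t)^-1.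
Proof.
move=> rK; apply: (le_trans (ler_normB _ _)).
have p1 : 0 <= (4 * t ^+ 2)^-1 by rewrite invr_ge0 mulr_ge0// sqr_ge0.
have p2 : 0 <= (2 * t)^-1 by rewrite invr_ge0 mulr_ge0// ltW.
rewrite (ger0_norm p2) lerD2r normrM (ger0_norm p1) ler_wpM2r// normrX.
by rewrite ler_pXn2r// ?nnegrE// ltW.
Qed.

Let D1 z := heat_kernel t z * partial1 (partial1 f) z - coef z.1 * heat_kernel t z * f z.
Let D2 z := heat_kernel t z * partial2 (partial2 f) z - coef z.2 * heat_kernel t z * f z.

Let mcoef1 : measurable_fun setT (fun z : R * R => coef z.1).
Proof. by apply: measurable_funB => //; apply: measurable_funM => //; exact: measurable_fst_sqr. Qed.

Let mcoef2 : measurable_fun setT (fun z : R * R => coef z.2).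
Proof. by apply: measurable_funB => //; apply: measurable_funM => //; exact: measurable_snd_sqr. Qed.

Let mD1 : measurable_fun setT D1.
Proof.
apply: measurable_funB; first by apply: measurable_funM; [exact: measurable_heat_kernel|exact: mf11].
by apply: measurable_funM; [apply: measurable_funM; [exact: mcoef1|exact: measurable_heat_kernel]|exact: mf].
Qed.

Let mD2 : measurable_fun setT D2.
Proof.
apply: measurable_funB; first by apply: measurable_funM; [exact: measurable_heat_kernel|exact: mf22].
by apply: measurable_funM; [apply: measurable_funM; [exact: mcoef2|exact: measurable_heat_kernel]|exact: mf].
Qed.

Let iD (g : R * R -> R) (c : R * R -> R) (M M' : R) : (forall x, `|f x| <= M) -> (forall x, `|g x| <= M') ->
  (forall z, f z != 0 -> `|c z| <= K ^+ 2 / (4 * t ^+ 2) + (2 * t)^-1) ->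
  measurable_fun setT (fun z => heat_kernel t z * g z - c z * heat_kernel t z * f z) ->
  (plane R).-integrable setT (EFin \o (fun z => heat_kernel t z * g z - c z * heat_kernel t z * f z)).
Proof.
move=> fM gM cK mD.
apply: (integrable_dom (M := M' + (K ^+ 2 / (4 * t ^+ 2) + (2 * t)^-1) * M) mD (integrable_heat_kernel t0)).
  by move=> z; rewrite heat_kernel_ge0// ltW.
move=> z; have h0 := heat_kernel_ge0 z (ltW t0).
have H (h a b k B : R) : 0 <= h -> `|a| <= M' -> `|k * b| <= B -> `|h * a - k * h * b| <= (M' + B) * h.
  move=> hh aM cb; apply: (le_trans (ler_normB _ _)); rewrite mulrAC !normrM (ger0_norm hh) mulrDl -normrM.
  by apply: lerD; [rewrite mulrC ler_wpM2r|rewrite ler_wpM2r].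
apply: H h0 (gM z) _.
have [->|fz] := eqVneq (f z) 0.
  rewrite mulr0 normr0 mulr_ge0//; last exact: le_trans (fM z).
  by rewrite addr_ge0 ?invr_ge0 ?divr_ge0 ?sqr_ge0 ?mulr_ge0 ?sqr_ge0// ltW.
by rewrite normrM ler_pM// cK.
Qed.

Let f_neq0 z : f z != 0 -> `|z.1| <= K /\ `|z.2| <= K.
Proof.
move=> /eqP fz; split; rewrite leNgt; apply/negP => h; apply: fz; apply: bf; [by left|by right].
Qed.

Let dhk1 (b r : R) : is_derive r 1 (fun r => heat_kernel t (r, b)) (- (r / (2 * t)) * heat_kernel t (r, b)).
Proof. rewrite /heat_kernel /sqeucl/=; exact: (is_derive_gaussian (4 * pi * t)^-1 (b ^+ 2) r t0). Qed.

Let dhk11 (b r : R) : is_derive r 1 (fun r => - (r / (2 * t)) * heat_kernel t (r, b)) (coef r * heat_kernel t (r, b)).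
Proof. rewrite /heat_kernel /sqeucl/=; exact: (is_derive_gaussian2 (4 * pi * t)^-1 (b ^+ 2) r t0). Qed.

Let heat_kernel_swap (a r : R) : heat_kernel t (a, r) = heat_kernel t (r, a).
Proof. by rewrite /heat_kernel /sqeucl/= addrC. Qed.

Let swapE (a : R) : (fun r => heat_kernel t (a, r)) = (fun r => heat_kernel t (r, a)).
Proof. by apply/funext => r; exact: heat_kernel_swap. Qed.

Let chk b : continuous (fun r => coef r * heat_kernel t (r, b)).
Proof.
move=> r; apply: cvgM; last exact: (@continuous_is_derive (fun r => heat_kernel t (r, b)) (fun r => - (r / (2 * t)) * heat_kernel t (r, b)) r (dhk1 b r)).
apply: cvgB; last exact: cvg_cst.
by apply: cvgM; [exact: exprn_continuous|exact: cvg_cst].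
Qed.

(** The second derivatives are treated separately: [D1] is integrated first in the first variable
    and [D2] in the second, and [green_line] annihilates each inner integral. *)
Lemma green_plane :
  (plane R).-integrable setT (EFin \o (fun z => heat_kernel t z * laplacian f z - laplacian (heat_kernel t) z * f z)) /\
  (\int[plane R]_z (heat_kernel t z * laplacian f z - laplacian (heat_kernel t) z * f z)%:E = 0)%E.
Proof.
have [M _ fM] := boxed_bounded (C2_cont Cf) bf.
have [M1 _ fM1] := boxed_bounded (C2_c11 Cf) bf11.
have [M2 _ fM2] := boxed_bounded (C2_c22 Cf) bf22.
have i1 : (plane R).-integrable setT (EFin \o D1).
  by apply: iD fM fM1 _ mD1 => z /f_neq0[zK _]; exact: coef_le.
have i2 : (plane R).-integrable setT (EFin \o D2).
  by apply: iD fM fM2 _ mD2 => z /f_neq0[_ zK]; exact: coef_le.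
have E z : heat_kernel t z * laplacian f z - laplacian (heat_kernel t) z * f z = D1 z + D2 z.
  by rewrite /laplacian partial11_heat_kernel// partial22_heat_kernel// /D1 /D2 /coef; ring.
have -> : (fun z => heat_kernel t z * laplacian f z - laplacian (heat_kernel t) z * f z) = (fun z => D1 z + D2 z).
  exact/funext.
have -> : (\int[plane R]_z (heat_kernel t z * laplacian f z - laplacian (heat_kernel t) z * f z)%:E =
    \int[plane R]_z ((EFin \o D1) z + (EFin \o D2) z))%E.
  by apply: eq_integral => z _; rewrite E.
split; first by rewrite (_ : _ \o _ = (EFin \o D1) \+ (EFin \o D2))//; exact: integrableD.
rewrite integralD// plane_fubini2// plane_fubini1//.
rewrite !integral0_eq ?adde0// => a _.
- rewrite /= /D2/=.
  apply: (@green_line (fun r => heat_kernel t (a, r)) (fun r => - (r / (2 * t)) * heat_kernel t (a, r))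
    (fun r => coef r * heat_kernel t (a, r)) (fun r => f (a, r)) (fun r => partial2 f (a, r)) (fun r => partial2 (partial2 f) (a, r)) K K0).
  + by move=> r; rewrite swapE heat_kernel_swap; exact: dhk1.
  + move=> r; rewrite (_ : (fun r => _) = (fun r => - (r / (2 * t)) * heat_kernel t (r, a))).
      by rewrite heat_kernel_swap; exact: dhk11.
    by apply/funext => s; rewrite heat_kernel_swap.
  + by move=> r; apply: is_derive_partial2; exact: (C2_d2 Cf).
  + by move=> r; apply: is_derive_partial2; exact: (C2_d22 Cf).
  + rewrite (_ : (fun r => _) = (fun r => coef r * heat_kernel t (r, a))); first exact: chk.
    by apply/funext => s; rewrite heat_kernel_swap.
  + exact: (continuous_line2 (C2_c22 Cf)).
  + by move=> r h; apply: bf; right.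
  + by move=> r h; apply: bf2; right.
  + by move=> r h; apply: bf22; right.
- rewrite /= /D1/=.
  apply: (@green_line (fun r => heat_kernel t (r, a)) (fun r => - (r / (2 * t)) * heat_kernel t (r, a))
    (fun r => coef r * heat_kernel t (r, a)) (fun r => f (r, a)) (fun r => partial1 f (r, a)) (fun r => partial1 (partial1 f) (r, a)) K K0).
  + by move=> r; exact: dhk1.
  + by move=> r; exact: dhk11.
  + by move=> r; apply: is_derive_partial1; exact: (C2_d1 Cf).
  + by move=> r; apply: is_derive_partial1; exact: (C2_d11 Cf).
  + exact: chk.
  + exact: (continuous_line1 (C2_c11 Cf)).
  + by move=> r h; apply: bf; left.
  + by move=> r h; apply: bf1; left.
  + by move=> r h; apply: bf11; left.
Qed.

End green_plane.

End Green.

(** * Real-valued integrals and Fubini's theorem *)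

Section RealIntegral.
Context d (T : measurableType d) (R : realType) (mu : {measure set T -> \bar R}).
Implicit Types (f g h : T -> R).

Lemma integrable_bound f h (B : R) : measurable_fun setT f -> measurable_fun setT h ->
  (forall x, `|f x| <= h x) -> (\int[mu]_x (h x)%:E <= B%:E)%E -> mu.-integrable setT (EFin \o f).
Proof.
move=> mf mh fh hB; apply/integrableP; split; first by apply/measurable_EFinP.
apply: (@le_lt_trans _ _ (\int[mu]_x (h x)%:E)%E); last exact: le_lt_trans hB (ltry _).
apply: ge0_le_integral => //.
- by apply/measurable_EFinP; exact: (measurableT_comp (@normr_measurable R setT) mf).
- by apply/measurable_EFinP.
- by move=> x _; rewrite /= lee_fin.
Qed.

Lemma Rintegral_bound f h (B : R) : measurable_fun setT f -> measurable_fun setT h ->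
  (forall x, `|f x| <= h x) -> (\int[mu]_x (h x)%:E <= B%:E)%E -> `|\int[mu]_x f x| <= B.
Proof.
move=> mf mh fh hB; have fi := integrable_bound mf mh fh hB.
rewrite -lee_fin EFin_normr_Rintegral//; apply: le_trans hB.
apply: (le_trans (le_abse_integral _ _ _)) => //; first by case/integrableP : fi.
apply: ge0_le_integral => //.
- by apply/measurable_EFinP; exact: (measurableT_comp (@normr_measurable R setT) mf).
- by apply/measurable_EFinP.
- by move=> x _; rewrite /= lee_fin.
Qed.

Lemma EFin_Rintegral f : mu.-integrable setT (EFin \o f) ->
  ((\int[mu]_x f x)%R)%:E = (\int[mu]_x (f x)%:E)%E.
Proof. by move=> fi; rewrite /Rintegral fineK//; exact: integrable_fin_num. Qed.

Lemma ae_eq_Rintegral f g : measurable_fun setT f -> measurable_fun setT g ->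
  {ae mu, forall x, f x = g x} -> \int[mu]_x f x = \int[mu]_x g x.
Proof.
move=> mf mg fg; rewrite /Rintegral; congr fine; apply: ae_eq_integral => //.
- by apply/measurable_EFinP.
- by apply/measurable_EFinP.
- by apply: filterS fg => x ->.
Qed.

Lemma integrable_fine_part (F : T -> \bar R) : mu.-integrable setT F -> mu.-integrable setT (EFin \o (fine \o F)).
Proof.
move=> /integrableP[mF Fy]; have mfF : measurable_fun setT (fine \o F) by exact: (measurableT_comp (@fine_measurable R setT measurableT) mF).
apply/integrableP; split; first by apply/measurable_EFinP.
apply: le_lt_trans Fy; apply: ge0_le_integral => //.
- by apply/measurable_EFinP; exact: (measurableT_comp (@normr_measurable R setT)).
- exact: (measurableT_comp (@abse_measurable R setT)).
- by move=> x _ /=; case: (F x) => [r| |] //=; rewrite normr0 leey.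
Qed.

Lemma integrable_scale (k : R) f : mu.-integrable setT (EFin \o f) -> mu.-integrable setT (EFin \o (fun x => k * f x)).
Proof.
move=> fi; have := integrableZl (mu := mu) (D := setT) measurableT k fi.
by apply: eq_integrable => // x _.
Qed.

Lemma integrable_add f g : mu.-integrable setT (EFin \o f) -> mu.-integrable setT (EFin \o g) ->
  mu.-integrable setT (EFin \o (fun x => f x + g x)).
Proof. by move=> fi gi; have := integrableD measurableT fi gi; apply: eq_integrable => // x _. Qed.

Lemma integrable_sub f g : mu.-integrable setT (EFin \o f) -> mu.-integrable setT (EFin \o g) ->
  mu.-integrable setT (EFin \o (fun x => f x - g x)).
Proof. by move=> fi gi; have := integrableB measurableT fi gi; apply: eq_integrable => // x _. Qed.

End RealIntegral.

Section RealFubini.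
Context d1 d2 (T1 : measurableType d1) (T2 : measurableType d2) (R : realType).
Variables (m1 : {sigma_finite_measure set T1 -> \bar R}) (m2 : {sigma_finite_measure set T2 -> \bar R}).
Variables (f h : T1 * T2 -> R) (B : R).
Hypotheses (mf : measurable_fun setT f) (mh : measurable_fun setT h).
Hypotheses (fh : forall x, `|f x| <= h x) (hB : (\int[m1]_x \int[m2]_y (h (x, y))%:E <= B%:E)%E).

Let h0 x : 0 <= h x. Proof. exact: le_trans (fh x). Qed.

Let mEh : measurable_fun setT (EFin \o h). Proof. by apply/measurable_EFinP. Qed.

Let mEf : measurable_fun setT (EFin \o f). Proof. by apply/measurable_EFinP. Qed.

Let fi : (m1 \x m2)%E.-integrable setT (EFin \o f).
Proof.
apply: (integrable_bound (h := h) (B := B)) => //.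
by rewrite fubini_tonelli1.
Qed.

Let Fi : m1.-integrable setT (fun x => \int[m2]_y (f (x, y))%:E)%E.
Proof. exact: (integrable_fubini_F fi). Qed.

Let Gi : m2.-integrable setT (fun y => \int[m1]_x (f (x, y))%:E)%E.
Proof.
have /(@integrable21ltyP _ _ _ _ _ _ _ _ mEf) fy := fi.
have mG : measurable_fun setT (fun y => \int[m1]_x (f (x, y))%:E)%E by exact: (measurable_fubini_G fi).
apply/integrableP; split => //; apply: le_lt_trans fy; apply: ge0_le_integral => //.
- exact: (measurableT_comp (@abse_measurable R _)).
- apply: (measurable_fun_fubini_tonelli_G (abse \o (EFin \o f))); last by move=> x; exact: abse_ge0.
  exact: (measurableT_comp (@abse_measurable R setT) mEf).
- move=> y _; apply: le_abse_integral => //.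
  exact: (measurable_fun_pair1 y mEf).
Qed.

Lemma integrable_section1 : m1.-integrable setT (EFin \o (fun x => \int[m2]_y f (x, y))).
Proof. exact: (integrable_fine_part Fi). Qed.

Lemma integrable_section2 : m2.-integrable setT (EFin \o (fun y => \int[m1]_x f (x, y))).
Proof. exact: (integrable_fine_part Gi). Qed.

(** The real-valued integral replaces an infinite inner integral by [0]; by integrability of [f]
    this happens on a null set only. *)
Lemma Rfubini : \int[m1]_x (\int[m2]_y f (x, y)) = \int[m2]_y (\int[m1]_x f (x, y)).
Proof.
have -> : \int[m1]_x (\int[m2]_y f (x, y)) = fine (\int[m1]_x \int[m2]_y (f (x, y))%:E)%E.
  congr fine; apply: ae_eq_integral => //.
  - exact: (measurable_int _ integrable_section1).
  - exact: (measurable_int _ Fi).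
  - by apply: filterS (integrable_ae measurableT Fi) => x /(_ I) Fx _; rewrite /Rintegral fineK.
have -> : \int[m2]_y (\int[m1]_x f (x, y)) = fine (\int[m2]_y \int[m1]_x (f (x, y))%:E)%E.
  congr fine; apply: ae_eq_integral => //.
  - exact: (measurable_int _ integrable_section2).
  - exact: (measurable_int _ Gi).
  - by apply: filterS (integrable_ae measurableT Gi) => x /(_ I) Gx _; rewrite /Rintegral fineK.
by congr fine; have := integral12_prod_meas1 fi; have := integral21_prod_meas1 fi; rewrite /fubini_F /fubini_G => -> ->.
Qed.

End RealFubini.

(** * The resolvent kernel inverts the Helmholtz operator *)

Section HeatTime.
Context (R : realType).
Implicit Types (s c p : R).

(** With [c] and [p] read off from [heat_kernel_scaled], the function is [- e^(-s)] times the heat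
    kernel at time [al^2 s]. By the heat equation its derivative is [e^(-s)] times the Helmholtz
    operator applied to that kernel. *)
Lemma is_derive_heat_time c p s : 0 < s ->
  is_derive s 1 (fun s => - (expR (- s) * (c * s^-1 * expR (- (p * s^-1)))))
    (expR (- s) * (c * s^-1 * expR (- (p * s^-1))) * (1 - (p * s^-1 * s^-1 - s^-1))).
Proof.
move=> s0; have sn0 : s != 0 by rewrite gt_eqF.
have dV : is_derive s 1 (fun s : R => s^-1) (- s ^- 2).
  have := @is_deriveV R id s 1 1 sn0 (is_derive_id _ _).
  by rewrite /= /GRing.scale/= mulr1.
have d1 : is_derive s 1 (fun s : R => - (p * s^-1)) (p * s ^- 2).
  have -> : (fun s : R => - (p * s^-1)) = (fun s => (- p) *: s^-1).
    by apply/funext => r; rewrite /GRing.scale/= mulNr.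
  by apply: is_derive_eq; rewrite /GRing.scale/= mulrNN.
have d2 : is_derive s 1 (fun s : R => expR (- (p * s^-1))) (expR (- (p * s^-1)) * (p * s ^- 2)).
  exact: (@is_derive1_comp R (@expR R) (fun s : R => - (p * s^-1)) s _ _ (is_derive_expR _) d1).
have d3 : is_derive s 1 (fun s : R => c * s^-1) (- (c * s ^- 2)).
  have -> : (fun s : R => c * s^-1) = (fun s => c *: s^-1) by apply/funext.
  by apply: is_derive_eq; rewrite /GRing.scale/= mulrN.
have dN : is_derive s 1 (fun s : R => - s) (-1) by exact: is_deriveNid.
have d4 : is_derive s 1 (fun s : R => expR (- s)) (expR (- s) * -1).
  exact: (@is_derive1_comp R (@expR R) (fun s : R => - s) s _ _ (is_derive_expR _) dN).
have dM : is_derive s 1 (fun s => expR (- s) * (c * s^-1 * expR (- (p * s^-1))))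
    (expR (- s) *: ((c * s^-1) *: (expR (- (p * s^-1)) * (p * s ^- 2)) + expR (- (p * s^-1)) *: (- (c * s ^- 2)))
     + (c * s^-1 * expR (- (p * s^-1))) *: (expR (- s) * -1)).
  exact: (is_deriveM (f := fun s : R => expR (- s)) (g := fun s => c * s^-1 * expR (- (p * s^-1))) d4
    (is_deriveM (f := fun s : R => c * s^-1) (g := fun s : R => expR (- (p * s^-1))) d3 d2)).
apply: is_derive_eq; rewrite /GRing.scale/= -exprVn; ring.
Qed.

Lemma continuous_heat_time c p s : 0 < s ->
  {for s, continuous (fun s => expR (- s) * (c * s^-1 * expR (- (p * s^-1))) * (1 - (p * s^-1 * s^-1 - s^-1)))}.
Proof.
move=> s0; have cV : (fun r : R => r^-1) x @[x --> s] --> s^-1 by apply: inv_continuous; rewrite gt_eqF.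
apply: cvgM.
  apply: cvgM.
    by apply: (@continuous_comp _ _ _ (fun r : R => - r) (@expR R)); [exact: opp_continuous|exact: continuous_expR].
  apply: cvgM; first by apply: cvgM; [exact: cvg_cst|exact: cV].
  apply: (@cvg_comp _ _ _ (fun r : R => - (p * r^-1)) (@expR R) _ (nbhs (- (p * s^-1)))); last exact: continuous_expR.
  by apply: cvgN; apply: cvgM; [exact: cvg_cst|exact: cV].
apply: cvgB; first exact: cvg_cst.
by apply: cvgB; [apply: cvgM; [apply: cvgM; [exact: cvg_cst|exact: cV]|exact: cV]|exact: cV].
Qed.

Lemma measurable_heat_time c p : measurable_fun setT
  (fun s => expR (- s) * (c * s^-1 * expR (- (p * s^-1))) * (1 - (p * s^-1 * s^-1 - s^-1))).
Proof.
have mV := @measurable_inv R.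
have me : measurable_fun setT (fun s : R => expR (- s)).
  exact: (measurableT_comp (@measurable_expR R) (@oppr_measurable R setT)).
apply: measurable_funM; last first.
  by apply: measurable_funB => //; apply: measurable_funB => //; apply: measurable_funM => //; apply: measurable_funM.
apply: measurable_funM => //; apply: measurable_funM; first by apply: measurable_funM.
apply: (measurableT_comp (@measurable_expR R)).
by apply: (measurableT_comp (@oppr_measurable R setT)); apply: measurable_funM.
Qed.

End HeatTime.

Section Helmholtz.
Context (R : realType) (al : R) (al0 : 0 < al).

Lemma al_sqr_gt0 s : 0 < s -> 0 < al ^+ 2 * s.
Proof. by move=> s0; rewrite mulr_gt0// exprn_gt0. Qed.

Definition heat0 (t : R) (x : R * R) : R := if 0 < t then heat_kernel t x else 0.

Lemma heat0_ge0 t x : 0 <= heat0 t x.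
Proof. by have := hkp_ge0 t x; rewrite lee_fin. Qed.

Lemma measurable_heat0 : measurable_fun setT (fun z : R * (R * R) => heat0 z.1 z.2).
Proof. by apply/measurable_EFinP; exact: measurable_hkp2. Qed.

Lemma measurable_heat0_scaled (k : R) : measurable_fun setT (fun z : R * (R * R) => heat0 (k * z.1) z.2).
Proof.
apply: (measurableT_comp measurable_heat0 (g := fun z : R * (R * R) => (k * z.1, z.2))).
apply/measurable_fun_pairP; split; last exact: measurable_snd.
by apply: measurable_funM => //; exact: measurable_fst.
Qed.

Lemma heat_kernel_scaled s z : heat_kernel (al ^+ 2 * s) z =
  (4 * pi * al ^+ 2)^-1 * s^-1 * expR (- (sqeucl z / (4 * al ^+ 2) * s^-1)).
Proof. by rewrite /heat_kernel !mulrA !invfM !mulrA. Qed.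

Lemma line_FTC_heat (a b : R) z : 0 < a -> a <= b ->
  (\int[line R]_s (if (a <= s <= b)%R then expR (- s) * heat_kernel (al ^+ 2 * s) z
     * (1 - (sqeucl z / (4 * al ^+ 2) * s^-1 * s^-1 - s^-1)) else 0)%:E =
   (expR (- a) * heat_kernel (al ^+ 2 * a) z - expR (- b) * heat_kernel (al ^+ 2 * b) z)%:E)%E.
Proof.
move=> a0 ab.
set c := (4 * pi * al ^+ 2)^-1; set p := sqeucl z / (4 * al ^+ 2).
have pos s : a <= s <= b -> 0 < s by move=> /andP[as_ _]; exact: lt_le_trans as_.
have := line_FTC ab (fun s h => @continuous_heat_time R c p s (pos s h))
  (fun s h => @is_derive_heat_time R c p s (pos s h)) (measurable_heat_time c p).
rewrite -!heat_kernel_scaled opprK addrC => <-.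
by apply: eq_integral => s _; rewrite heat_kernel_scaled.
Qed.

Lemma laplacian_heat_scaled s z : 0 < s ->
  al ^+ 2 * laplacian (heat_kernel (al ^+ 2 * s)) z =
  (sqeucl z / (4 * al ^+ 2) * s^-1 * s^-1 - s^-1) * heat_kernel (al ^+ 2 * s) z.
Proof.
move=> s0; rewrite laplacian_heat_kernel ?al_sqr_gt0// mulrA; congr (_ * _).
by field; rewrite !gt_eqF.
Qed.


(** The resolvent kernel is infinite at the origin, where [fine] gives [0]. *)
Definition Gr (z : R * R) : R := fine (Gk al z).

Lemma Gr_ge0 z : 0 <= Gr z.
Proof. by rewrite fine_ge0// Gk_ge0. Qed.

Lemma measurable_Gr : measurable_fun setT Gr.
Proof. exact: (measurableT_comp (@fine_measurable R setT measurableT) (measurable_Gk al)). Qed.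

Lemma ae_Gk : {ae plane R, forall z, Gk al z = (Gr z)%:E}.
Proof.
have : (plane R).-integrable setT (Gk al).
  apply/integrableP; split; first exact: measurable_Gk.
  rewrite (_ : (\int[plane R]_x _)%E = (\int[plane R]_x Gk al x)%E); first by rewrite integral_Gk// ltry.
  by apply: eq_integral => x _; rewrite gee0_abs// Gk_ge0.
move=> /(integrable_ae measurableT); apply: filterS => z /(_ I) h.
by rewrite /Gr fineK.
Qed.

Lemma integral_Gr : (\int[plane R]_z (Gr z)%:E = 1)%E.
Proof.
rewrite -(integral_Gk al0); apply: ge0_ae_eq_integral => //.
- by apply/measurable_EFinP; exact: measurable_Gr.
- exact: measurable_Gk.
- by move=> z _; rewrite lee_fin Gr_ge0.
- by move=> z _; exact: Gk_ge0.
- by apply: filterS ae_Gk => z -> _.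
Qed.

Section resolvent_at_zero.
Variables (K : R) (K0 : 0 < K) (f : R * R -> R) (Cf : C2box K f) (M L : R).
Let psi z := f z - al ^+ 2 * laplacian f z.
Hypotheses (fM : forall z, `|f z| <= M) (psiM : forall z, `|psi z| <= M).
Hypothesis fL : forall z, `|f z - f 0| <= L * Num.sqrt (sqeucl z).

Let M0 : 0 <= M. Proof. exact: le_trans (fM 0). Qed.

Let mf : measurable_fun setT f. Proof. exact: measurable_continuous2 (C2_cont Cf). Qed.

Let mpsi : measurable_fun setT psi.
Proof.
apply: measurable_funB; first exact: mf.
apply: measurable_funM => //; apply: measurable_funD; apply: measurable_continuous2;
  [exact: C2_c11 Cf|exact: C2_c22 Cf].
Qed.

Let W (k : R) (z : R * (R * R)) := ewt 0 z.1 * heat0 (k * z.1) z.2.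

Let mW k : measurable_fun setT (W k).
Proof.
apply: measurable_funM; last exact: measurable_heat0_scaled.
exact: (measurableT_comp (measurable_ewt _) measurable_fst).
Qed.

Let W0 k z : 0 <= W k z.
Proof. by rewrite mulr_ge0 ?ewt_ge0 ?heat0_ge0. Qed.

Let integral_W (k s : R) : 0 < k -> (\int[plane R]_z (W k (s, z))%:E = (ewt 0 s)%:E)%E.
Proof.
move=> k0; rewrite (_ : (\int[plane R]_z _)%E = ((ewt 0 s)%:E * \int[plane R]_z hkp (k * s) z)%E); last first.
  rewrite -ge0_integralZl//.
  - exact: measurable_hkp.
  - by move=> z _; exact: hkp_ge0.
  - by rewrite lee_fin ewt_ge0.
have [s0|s0] := leP s 0; first by rewrite ewt_le0// mul0e.
by rewrite integral_hkp ?mule1// mulr_gt0.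
Qed.

Let integral_WM (k B : R) : 0 < k -> 0 <= B ->
  (\int[line R]_s \int[plane R]_z (W k (s, z) * B)%:E = B%:E)%E.
Proof.
move=> k0 B0.
rewrite (_ : (\int[line R]_s _)%E = (B%:E * \int[line R]_s (ewt 0 s)%:E)%E); first by rewrite integral_ewt0 mule1.
rewrite -ge0_integralZl//; last 2 first.
- by apply/measurable_EFinP; exact: measurable_ewt.
- by move=> s _; rewrite lee_fin ewt_ge0.
apply: eq_integral => s _; rewrite -(integral_W s k0) -ge0_integralZl//; last 2 first.
- by apply/measurable_EFinP; exact: (measurableT_comp (mW k) (pair1_measurable s)).
- by move=> z _; rewrite lee_fin.
by apply: eq_integral => z _; rewrite -EFinM mulrC.
Qed.

Let al2_gt0 : 0 < al ^+ 2. Proof. by rewrite exprn_gt0. Qed.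

Let A (z : R * (R * R)) := W (al ^+ 2) z * psi z.2.

Let mA : measurable_fun setT A.
Proof. by apply: measurable_funM; [exact: mW|exact: (measurableT_comp mpsi measurable_snd)]. Qed.

Let mAM : measurable_fun setT (fun z => W (al ^+ 2) z * M).
Proof. by apply: measurable_funM; [exact: mW|]. Qed.

Let AM z : `|A z| <= W (al ^+ 2) z * M.
Proof. by rewrite normrM (ger0_norm (W0 _ _)) ler_wpM2l. Qed.

Let AMi : (\int[line R]_s \int[plane R]_z (W (al ^+ 2) (s, z) * M)%:E <= M%:E)%E.
Proof. by rewrite integral_WM. Qed.

Let resolvent_swap : \int[plane R]_z (Gr z * psi z) = \int[line R]_s (\int[plane R]_z A (s, z)).
Proof.
rewrite (Rfubini mA mAM AM AMi); apply: ae_eq_Rintegral.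
- by apply: measurable_funM; [exact: measurable_Gr|exact: mpsi].
- by apply/measurable_EFinP; apply: measurable_int; exact: (integrable_section2 mA mAM AM AMi).
apply: filterS ae_Gk => z Gz.
rewrite -[RHS]/(\int[line R]_s (W (al ^+ 2) (s, z) * psi z)) RintegralZr//; apply/integrableP; split.
  by apply/measurable_EFinP; exact: (measurable_fun_pair1 z (mW (al ^+ 2))).
rewrite (_ : (\int[line R]_x _)%E = Gk al z); first by rewrite Gz ltry.
by apply: eq_integral => s _; rewrite gee0_abs// lee_fin.
Qed.

Section cutoff.
Variables (e S : R) (e0 : 0 < e) (eS : e <= S).
(** The bound on the Laplacian of the heat kernel is of order [1/s], not integrable at [s = 0];
    Fubini is therefore applied only after cutting the times to [[e, S]]. *)
Let chi (s : R) : R := if (e <= s <= S)%R then 1 else 0.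

Let chi01 s : 0 <= chi s <= 1.
Proof. by rewrite /chi; case: ifP => _; rewrite ?ler01 ?lexx. Qed.

Let mchi : measurable_fun setT (fun z : R * (R * R) => chi z.1).
Proof.
apply: measurable_fun_ifT => //; apply: measurable_and; apply: measurable_fun_ler => //; exact: measurable_fst.
Qed.

Let B (z : R * (R * R)) := chi z.1 * (expR (- z.1) * heat_kernel (al ^+ 2 * z.1) z.2 *
  (1 - (sqeucl z.2 / (4 * al ^+ 2) * z.1^-1 * z.1^-1 - z.1^-1)) * f z.2).

Let mB : measurable_fun setT B.
Proof.
have m1 := @measurable_fst _ _ R (R * R)%type.
have mV : measurable_fun setT (fun z : R * (R * R) => z.1^-1) by exact: (measurableT_comp (@measurable_inv R) m1).
apply: measurable_funM; first exact: mchi.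
apply: measurable_funM; last exact: (measurableT_comp mf measurable_snd).
apply: measurable_funM; first apply: measurable_funM.
- apply: (measurableT_comp (@measurable_expR R)); exact: (measurableT_comp (@oppr_measurable R setT) m1).
- apply: (measurableT_comp (@measurable_heat_kernel2 R) (g := fun z : R * (R * R) => (al ^+ 2 * z.1, z.2))).
  by apply/measurable_fun_pairP; split; [apply: measurable_funM|exact: measurable_snd].
- apply: measurable_funB => //; apply: measurable_funB => //; apply: measurable_funM => //; apply: measurable_funM => //.
  by apply: measurable_funM => //; exact: (measurableT_comp (@measurable_sqeucl R) measurable_snd).
Qed.

Let BE s z : e <= s <= S -> B (s, z) = expR (- s) *
  (heat_kernel (al ^+ 2 * s) z - al ^+ 2 * laplacian (heat_kernel (al ^+ 2 * s)) z) * f z.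
Proof.
move=> h; have s0 : 0 < s by case/andP: h => + _; exact: lt_le_trans.
by rewrite /B/= /chi h mul1r laplacian_heat_scaled//; ring.
Qed.

Let B_A s z : e <= s <= S -> A (s, z) - B (s, z) = - (al ^+ 2 * expR (- s)) *
  (heat_kernel (al ^+ 2 * s) z * laplacian f z - laplacian (heat_kernel (al ^+ 2 * s)) z * f z).
Proof.
move=> h; have s0 : 0 < s by case/andP: h => + _; exact: lt_le_trans.
rewrite BE// /A /W/= /ewt s0 oppr0 powRr0 /heat0 al_sqr_gt0// /psi.
have E (q k a2 p p2 l : R) : q * 1 * k * (p - a2 * p2) - q * (k - a2 * l) * p = - (a2 * q) * (k * p2 - l * p) by ring.
exact: E.
Qed.

Let BM0 z : `|B z| <= W (al ^+ 2) z * M + W (2 * al ^+ 2) z * (6 / e * M).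
Proof.
case: z => s z; have [h|h] := boolP (e <= s <= S); last first.
  by rewrite /B/= /chi (negbTE h) mul0r normr0 addr_ge0// mulr_ge0// mulr_ge0// divr_ge0// ltW.
have s0 : 0 < s by case/andP: h => + _; exact: lt_le_trans.
have es : e <= s by case/andP: h.
rewrite BE// normrM; apply: (@le_trans _ _ (expR (- s) * (heat_kernel (al ^+ 2 * s) z +
   6 / e * heat_kernel (2 * (al ^+ 2 * s)) z) * M)).
  rewrite ler_pM// normrM ger0_norm ?expR_ge0// ler_wpM2l ?expR_ge0//.
  apply: (le_trans (ler_normB _ _)).
  rewrite ger0_norm ?heat_kernel_ge0 ?lerD2l ?(ltW (al_sqr_gt0 s0))// normrM ger0_norm ?(ltW al2_gt0)//.
  have := laplacian_heat_kernel_le z (al_sqr_gt0 s0).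
  rewrite -(ler_pM2l al2_gt0) => /le_trans; apply.
  have hk0 : 0 <= heat_kernel (2 * (al ^+ 2 * s)) z by rewrite heat_kernel_ge0// mulr_ge0// ltW// al_sqr_gt0.
  rewrite (_ : al ^+ 2 * (_ * _) = 6 / s * heat_kernel (2 * (al ^+ 2 * s)) z); last first.
    by move: (heat_kernel _ _) => k; field; rewrite !gt_eqF.
  rewrite ler_wpM2r//.
  by rewrite ler_pM2l// lef_pV2.
have WE k : 0 < k -> W k (s, z) = expR (- s) * heat_kernel (k * s) z.
  by move=> k0; rewrite /W/= /ewt s0 oppr0 powRr0 mulr1 /heat0 mulr_gt0.
have k2 : 0 < 2 * al ^+ 2 by rewrite mulr_gt0.
rewrite (WE _ al2_gt0) (WE _ k2) -[2 * al ^+ 2 * s]mulrA le_eqVlt; apply/orP; left; apply/eqP.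
have E (q k1 k3 k m : R) : q * (k1 + k * k3) * m = q * k1 * m + q * k3 * (k * m) by ring.
exact: E.
Qed.

Let mBM : measurable_fun setT (fun z => W (al ^+ 2) z * M + W (2 * al ^+ 2) z * (6 / e * M)).
Proof. by apply: measurable_funD; apply: measurable_funM => //; exact: mW. Qed.

Let BMi : (\int[line R]_s \int[plane R]_z (W (al ^+ 2) (s, z) * M + W (2 * al ^+ 2) (s, z) * (6 / e * M))%:E
  <= (M + 6 / e * M)%:E)%E.
Proof.
have eM : 0 <= 6 / e * M by rewrite mulr_ge0// divr_ge0// ltW.
have mm k (D : R) : measurable_fun setT (fun z => (W k z * D)%:E).
  by apply/measurable_EFinP; apply: measurable_funM => //; exact: mW.
rewrite EFinD -[in leRHS](integral_WM al2_gt0 M0) -[in leRHS](integral_WM (k := 2 * al ^+ 2) _ eM) ?mulr_gt0//.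
rewrite -ge0_integralD//; last 4 first.
- by move=> s _; apply: integral_ge0 => z _; rewrite lee_fin mulr_ge0.
- by apply: (measurable_fun_fubini_tonelli_F (fun z => (W (al ^+ 2) z * M)%:E)); [exact: mm|move=> z; rewrite lee_fin mulr_ge0].
- by move=> s _; apply: integral_ge0 => z _; rewrite lee_fin mulr_ge0.
- by apply: (measurable_fun_fubini_tonelli_F (fun z => (W (2 * al ^+ 2) z * (6 / e * M))%:E)); [exact: mm|move=> z; rewrite lee_fin mulr_ge0].
rewrite le_eqVlt; apply/orP; left; apply/eqP; apply: eq_integral => s _.
rewrite -ge0_integralD//.
- by move=> z _; rewrite lee_fin mulr_ge0.
- exact: (measurable_fun_pair2 s (mm _ _)).
- by move=> z _; rewrite lee_fin mulr_ge0.
- exact: (measurable_fun_pair2 s (mm _ _)).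
Qed.

Let section_integrable (F H : R * (R * R) -> R) s : measurable_fun setT F -> measurable_fun setT H ->
  (forall z, `|F z| <= H z) -> (\int[plane R]_z (H (s, z))%:E < +oo)%E ->
  (plane R).-integrable setT (EFin \o (fun z => F (s, z))).
Proof.
move=> mF mH FH Hy.
apply: (integrable_bound (h := fun z => H (s, z)) (B := fine (\int[plane R]_z (H (s, z))%:E)%E)).
- exact: (measurable_fun_pair2 s mF).
- exact: (measurable_fun_pair2 s mH).
- by move=> z; exact: FH.
- rewrite fineK// ge0_fin_numE//.
  by apply: integral_ge0 => z _; rewrite lee_fin (le_trans _ (FH (s, z))).
Qed.

Let A_section s : (plane R).-integrable setT (EFin \o (fun z => A (s, z))).
Proof.
apply: (section_integrable (H := fun z => W (al ^+ 2) z * M)) => //.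
rewrite (_ : (\int[plane R]_z _)%E = (M * ewt 0 s)%:E) ?ltry//.
rewrite EFinM -(integral_W s al2_gt0) -ge0_integralZl//.
- by apply: eq_integral => z _; rewrite -EFinM mulrC.
- by apply/measurable_EFinP; exact: (measurable_fun_pair2 s (mW _)).
- by move=> z _; rewrite lee_fin.
Qed.

Let inner_AB s : chi s * \int[plane R]_z A (s, z) = \int[plane R]_z B (s, z).
Proof.
have [h|h] := boolP (e <= s <= S); last first.
  rewrite /chi (negbTE h) mul0r /B/= /chi (negbTE h) -[RHS](_ : \int[plane R]_z (0 : R) = _).
    by rewrite /Rintegral integral0.
  by apply: eq_Rintegral => z _; rewrite mul0r.
have s0 : 0 < s by case/andP: h => + _; exact: lt_le_trans.
have [gi g0] := green_plane K0 Cf (al_sqr_gt0 s0).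
rewrite {1}/chi h mul1r; apply/eqP; rewrite -subr_eq0; apply/eqP.
set D := fun z => heat_kernel (al ^+ 2 * s) z * laplacian f z - laplacian (heat_kernel (al ^+ 2 * s)) z * f z in gi g0.
have E z : B (s, z) = A (s, z) + (al ^+ 2 * expR (- s)) * D z.
  by have := B_A z h; rewrite -/(D z); lra.
have Di : (plane R).-integrable setT (EFin \o (fun z => (al ^+ 2 * expR (- s)) * D z)).
  by rewrite (_ : _ \o _ = (fun z => ((al ^+ 2 * expR (- s))%:E * (EFin \o D) z)%E)) ?integrableZl//.
rewrite (_ : \int[plane R]_z B (s, z) = \int[plane R]_z (A (s, z) + (al ^+ 2 * expR (- s)) * D z)).
  rewrite RintegralD// RintegralZl// (_ : \int[plane R]_z D z = 0); first by rewrite mulr0 addr0 subrr.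
  by rewrite /Rintegral g0.
by apply: eq_Rintegral => z _; exact: E.
Qed.

Let cutoff_integral : \int[line R]_s (chi s * \int[plane R]_z A (s, z)) =
  \int[plane R]_z ((expR (- e) * heat_kernel (al ^+ 2 * e) z - expR (- S) * heat_kernel (al ^+ 2 * S) z) * f z).
Proof.
under eq_Rintegral do rewrite inner_AB.
rewrite (Rfubini mB mBM BM0 BMi); apply: eq_Rintegral => z _.
have E := line_FTC_heat z e0 eS.
set k := fun s : R => if (e <= s <= S)%R then expR (- s) * heat_kernel (al ^+ 2 * s) z
     * (1 - (sqeucl z / (4 * al ^+ 2) * s^-1 * s^-1 - s^-1)) else 0.
have ki : (line R).-integrable setT (EFin \o k).
  apply/integrableP; split.
    apply/measurable_EFinP; apply: measurable_fun_ifT => //.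
      by apply: measurable_and; exact: measurable_fun_ler.
    have := measurable_heat_time (4 * pi * al ^+ 2)^-1 (sqeucl z / (4 * al ^+ 2)).
    by under eq_fun do rewrite -heat_kernel_scaled.
  apply/abse_integralP => //.
    apply/measurable_EFinP; apply: measurable_fun_ifT => //.
      by apply: measurable_and; exact: measurable_fun_ler.
    have := measurable_heat_time (4 * pi * al ^+ 2)^-1 (sqeucl z / (4 * al ^+ 2)).
    by under eq_fun do rewrite -heat_kernel_scaled.
  by rewrite /k /= E ltry.
rewrite (_ : \int[line R]_s B (s, z) = \int[line R]_s (k s * f z)).
  by rewrite RintegralZr//; congr (_ * _); rewrite /Rintegral /k E.
apply: eq_Rintegral => s _; rewrite /B /k /chi/=; case: ifP => _; ring.
Qed.

Let tail_integral : `|\int[line R]_s (\int[plane R]_z A (s, z)) - \int[line R]_s (chi s * \int[plane R]_z A (s, z))|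
  <= M * (1 - (expR (- e) - expR (- S))).
Proof.
have mJ : measurable_fun setT (fun s => \int[plane R]_z A (s, z)).
  by apply/measurable_EFinP; apply: measurable_int; exact: (integrable_section1 mA mAM AM AMi).
have mchi1 : measurable_fun setT chi.
  by apply: measurable_fun_ifT => //; apply: measurable_and; exact: measurable_fun_ler.
have JM s : `|\int[plane R]_z A (s, z)| <= ewt 0 s * M.
  apply: (Rintegral_bound (h := fun z => W (al ^+ 2) (s, z) * M)).
  - exact: (measurable_fun_pair2 s mA).
  - exact: (measurable_fun_pair2 s mAM).
  - by move=> z; exact: AM.
  rewrite [leRHS]EFinM muleC -(integral_W s al2_gt0) -ge0_integralZl//.
  - by rewrite le_eqVlt; apply/orP; left; apply/eqP; apply: eq_integral => z _; rewrite -EFinM mulrC.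
  - by apply/measurable_EFinP; exact: (measurable_fun_pair2 s (mW _)).
  - by move=> z _; rewrite lee_fin.
have Ji := integrable_section1 mA mAM AM AMi.
have cJi : (line R).-integrable setT (EFin \o (fun s => chi s * \int[plane R]_z A (s, z))).
  apply: le_integrable Ji => //; first by apply/measurable_EFinP; exact: measurable_funM.
  move=> s _ /=; rewrite lee_fin normrM; have /andP[c0 c1] := chi01 s.
  by rewrite (ger0_norm c0) ler_piMl.
rewrite -RintegralB//.
have E : (\int[line R]_s (chi s * expR (- s))%:E = (expR (- e) - expR (- S))%:E)%E.
  have dN (s : R) : is_derive s 1 (fun s : R => - s) (-1) by exact: is_deriveNid.
  have d4 (s : R) : is_derive s 1 (fun s : R => - expR (- s)) (expR (- s)).
    have := is_deriveN (@is_derive1_comp R (@expR R) (fun s : R => - s) s _ _ (is_derive_expR _) (dN s)).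
    by rewrite mulrN1 opprK.
  have ce : continuous (fun s : R => expR (- s)).
    by move=> s; apply: (@continuous_comp _ _ _ (fun r : R => - r) (@expR R)); [exact: opp_continuous|exact: continuous_expR].
  have := line_FTC eS (fun s _ => ce s) (fun s _ => d4 s) (continuous_measurable_fun ce).
  rewrite opprK addrC => <-; apply: eq_integral => s _; rewrite /chi.
  by case: ifP => _; rewrite ?mul1r ?mul0r.
have ew s : chi s * expR (- s) <= ewt 0 s.
  rewrite /chi; case: ifP => [/andP[es _]|_]; last by rewrite mul0r ewt_ge0.
  by rewrite mul1r /ewt (lt_le_trans e0 es) oppr0 powRr0 mulr1.
have me : measurable_fun setT (fun s : R => chi s * expR (- s)).
  apply: measurable_funM => //; exact: (measurableT_comp (@measurable_expR R) (@oppr_measurable R setT)).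
apply: (Rintegral_bound (h := fun s => M * (ewt 0 s - chi s * expR (- s)))).
- by apply: measurable_funB => //; apply: measurable_funM.
- apply: measurable_funM => //; apply: measurable_funB => //; exact: measurable_ewt.
- move=> s; rewrite -[X in X - _]mul1r -mulrBl normrM; have /andP[c0 c1] := chi01 s.
  rewrite ger0_norm ?subr_ge0//.
  apply: (@le_trans _ _ ((1 - chi s) * (ewt 0 s * M))); first by rewrite ler_wpM2l ?subr_ge0.
  rewrite mulrA [leLHS]mulrC ler_wpM2l// mulrBl mul1r lerB//.
  rewrite /chi; case: ifP => [/andP[es _]|_]; last by rewrite !mul0r.
  by rewrite !mul1r /ewt (lt_le_trans e0 es) oppr0 powRr0 mulr1.
have wi : (line R).-integrable setT (EFin \o ewt 0).
  by apply: (integrable_bound (h := ewt 0) (B := 1)); [exact: measurable_ewt|exact: measurable_ewt|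
    move=> s; rewrite ger0_norm// ewt_ge0|rewrite integral_ewt0].
have ei : (line R).-integrable setT (EFin \o (fun s => chi s * expR (- s))).
  apply: (integrable_bound (h := ewt 0) (B := 1)); [exact: me|exact: measurable_ewt| |by rewrite integral_ewt0].
  by move=> s; rewrite ger0_norm// mulr_ge0 ?expR_ge0//; case/andP: (chi01 s).
have -> : (\int[line R]_s (M * (ewt 0 s - chi s * expR (- s)))%:E)%E =
  (M%:E * (\int[line R]_s (ewt 0 s)%:E - \int[line R]_s (chi s * expR (- s))%:E))%E.
  rewrite -integralB// -ge0_integralZl//.
  - by apply/measurable_EFinP; apply: measurable_funB => //; exact: measurable_ewt.
  - by move=> s _; rewrite lee_fin subr_ge0.
by rewrite integral_ewt0 E -EFinB -EFinM.
Qed.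

(** For times in [[e, S]] Green's formula moves the operator onto the heat kernel and the time
    integral reduces to its two end values. The error is [M] times the mass of [e^(-s)] outside
    [[e, S]]. *)
Lemma resolvent_cutoff :
  `|\int[plane R]_z (Gr z * psi z) -
    \int[plane R]_z ((expR (- e) * heat_kernel (al ^+ 2 * e) z - expR (- S) * heat_kernel (al ^+ 2 * S) z) * f z)|
  <= M * (1 - (expR (- e) - expR (- S))).
Proof. by rewrite resolvent_swap -cutoff_integral; exact: tail_integral. Qed.

End cutoff.

Hypothesis L0 : 0 <= L.

Let fhi (tau : R) : 0 < tau -> (plane R).-integrable setT (EFin \o (fun z => heat_kernel tau z * f z)).
Proof.
move=> t0; have mh := measurable_heat_kernel tau.
apply: (integrable_bound (h := fun z => M * heat_kernel tau z) (B := M)).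
- by apply: measurable_funM.
- by apply: measurable_funM.
- by move=> z; rewrite normrM ger0_norm ?heat_kernel_ge0 ?(ltW t0)// mulrC ler_wpM2r// heat_kernel_ge0// ltW.
rewrite (_ : (\int[plane R]_z _)%E = (M%:E * \int[plane R]_z hk tau z)%E); first by rewrite integral_hk// mule1.
rewrite -ge0_integralZl//.
- exact: measurable_hk.
- by move=> z _; exact: hk_ge0 (ltW t0).
Qed.

(** The Lipschitz bound reduces this to the first absolute moment of the heat kernel, at most
    [4 * sqrt tau] by [heat_kernel_moment]. *)
Lemma heat_kernel_approx (tau : R) : 0 < tau -> `|\int[plane R]_z (heat_kernel tau z * f z) - f 0| <= 4 * L * Num.sqrt tau.
Proof.
move=> t0; have mh := measurable_heat_kernel tau; have hi := integrable_heat_kernel t0.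
have -> : f 0 = \int[plane R]_z (heat_kernel tau z * f 0).
  rewrite RintegralZr// (_ : \int[plane R]_z heat_kernel tau z = 1) ?mul1r//.
  by rewrite /Rintegral -/(hk tau) (integral_hk t0).
rewrite -RintegralB//; last 2 first.
- exact: fhi.
- by rewrite (_ : _ \o _ = (fun z => (EFin \o heat_kernel tau) z * (f 0)%:E)%E) ?integrableZr.
apply: (Rintegral_bound (h := fun z => 4 * L * Num.sqrt tau * heat_kernel (2 * tau) z)).
- by apply: measurable_funB; apply: measurable_funM.
- by apply: measurable_funM => //; exact: measurable_heat_kernel.
- move=> z; rewrite -mulrBr normrM ger0_norm ?heat_kernel_ge0 ?(ltW t0)//.
  apply: (le_trans (ler_wpM2l (heat_kernel_ge0 z (ltW t0)) (fL z))).
  have := heat_kernel_moment z t0; rewrite powRN powR12_sqrt ?(ltW t0)//.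
  have st0 : 0 < Num.sqrt tau by rewrite sqrtr_gt0.
  have t2 : 0 <= 2 * tau * L by rewrite !mulr_ge0// ltW.
  move=> /(ler_wpM2l t2) H; apply: le_trans (le_trans H _).
    by rewrite le_eqVlt; apply/orP; left; apply/eqP; field; rewrite gt_eqF.
  rewrite le_eqVlt; apply/orP; left; apply/eqP.
  rewrite -[X in 2 * X * L](sqr_sqrtr (ltW t0)); move: (Num.sqrt _) st0 => q q0.
  by field; rewrite gt_eqF.
rewrite (_ : (\int[plane R]_z _)%E = ((4 * L * Num.sqrt tau)%:E * \int[plane R]_z hk (2 * tau) z)%E).
  by rewrite integral_hk ?mule1// mulr_gt0.
rewrite -ge0_integralZl//.
- exact: measurable_hk.
- by move=> z _; apply: hk_ge0; rewrite mulr_ge0// ltW.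
- by rewrite lee_fin !mulr_ge0// sqrtr_ge0.
Qed.

Lemma heat_kernel_mean (tau : R) : 0 < tau -> `|\int[plane R]_z (heat_kernel tau z * f z)| <= M.
Proof.
move=> t0; have mh := measurable_heat_kernel tau.
apply: (Rintegral_bound (h := fun z => M * heat_kernel tau z)).
- by apply: measurable_funM.
- by apply: measurable_funM.
- by move=> z; rewrite normrM ger0_norm ?heat_kernel_ge0 ?(ltW t0)// mulrC ler_wpM2r// heat_kernel_ge0// ltW.
rewrite (_ : (\int[plane R]_z _)%E = (M%:E * \int[plane R]_z hk tau z)%E); first by rewrite integral_hk// mule1.
rewrite -ge0_integralZl//.
- exact: measurable_hk.
- by move=> z _; exact: hk_ge0 (ltW t0).
Qed.

Lemma resolvent_at_zero_le (d : R) : 0 < d <= 1 ->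
  `|\int[plane R]_z (Gr z * psi z) - f 0| <= (4 * L * al + 4 * M) * d.
Proof.
(* The approximation at the early time is of order [sqrt e], hence [e = d^2]; [S = 1 / e] makes
   [e^(-S)] at most [e]. *)
move=> /andP[d0 d1]; pose e := d ^+ 2; pose S := e^-1.
have e0 : 0 < e by rewrite exprn_gt0.
have e1 : e <= 1 by rewrite exprn_ile1// ltW.
have ed : e <= d by rewrite /e expr2 ler_piMr// ltW.
have S0 : 0 < S by rewrite invr_gt0.
have eS : e <= S by rewrite (le_trans e1)// invf_ge1.
have H := resolvent_cutoff e0 eS.
have Ee : 1 - e <= expR (- e) by exact: expR_ge1Dx.
have Ee1 : expR (- e) <= 1 by rewrite expR_le1 oppr_le0 ltW.
have ES0 := expR_gt0 (- S).
have ES : expR (- S) <= e.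
  rewrite expRN -[leRHS]invrK lef_pV2 ?posrE ?expR_gt0//.
  by apply: le_trans (expR_ge1Dx _); rewrite lerDr.
have ae0 := al_sqr_gt0 e0; have aS0 := al_sqr_gt0 S0.
have H1 := heat_kernel_approx ae0; have H2 := heat_kernel_mean aS0.
rewrite (_ : Num.sqrt (al ^+ 2 * e) = al * d) in H1; last first.
  by rewrite /e -exprMn sqrtr_sqr ger0_norm// mulr_ge0// ltW.
have E : \int[plane R]_z ((expR (- e) * heat_kernel (al ^+ 2 * e) z - expR (- S) * heat_kernel (al ^+ 2 * S) z) * f z) =
  expR (- e) * \int[plane R]_z (heat_kernel (al ^+ 2 * e) z * f z) - expR (- S) * \int[plane R]_z (heat_kernel (al ^+ 2 * S) z * f z).
  have iZ (k tau : R) : 0 < tau -> (plane R).-integrable setT (EFin \o (fun z => k * (heat_kernel tau z * f z))).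
    by move=> tau0; apply: integrable_scale; exact: fhi.
  rewrite -RintegralZl; [|by []|exact: fhi].
  rewrite -RintegralZl; [|by []|exact: fhi].
  rewrite -RintegralB; [|by []|exact: iZ|exact: iZ].
  by apply: eq_Rintegral => z _; ring.
rewrite E in H.
move: H H1 H2 (fM 0).
move: (\int[plane R]_z (Gr z * psi z)) (\int[plane R]_z (heat_kernel (al ^+ 2 * e) z * f z))
  (\int[plane R]_z (heat_kernel (al ^+ 2 * S) z * f z)) (f 0) => I I1 I2 f0 H H1 H2 H3.
have T1 : `|expR (- e) * (I1 - f0)| <= 4 * L * (al * d).
  by rewrite normrM ger0_norm ?expR_ge0// (le_trans _ H1)// ler_piMl.
have T2 : `|(expR (- e) - 1) * f0| <= d * M.
  have Ed : 1 - expR (- e) <= d by rewrite lerBlDr (le_trans _ (lerD ed (lexx _)))// -lerBlDl.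
  have E1 : `|expR (- e) - 1| <= d by rewrite distrC ger0_norm ?subr_ge0.
  by rewrite normrM; apply: ler_pM; [exact: normr_ge0|exact: normr_ge0|exact: E1|exact: H3].
have T3 : `|expR (- S) * I2| <= d * M.
  by rewrite normrM ler_pM// ger0_norm ?(ltW ES0)//; exact: le_trans ed.
have T4 : M * (1 - (expR (- e) - expR (- S))) <= M * (2 * d).
  apply: ler_wpM2l; first exact: le_trans H3.
  rewrite opprB addrCA addrC mulr_natl mulr2n; apply: lerD; last exact: le_trans ES ed.
  by rewrite lerBlDr (le_trans _ (lerD ed (lexx _)))// -lerBlDl.
rewrite (_ : I - f0 = (I - (expR (- e) * I1 - expR (- S) * I2)) + (expR (- e) * (I1 - f0) + (expR (- e) - 1) * f0 - expR (- S) * I2)); last by ring.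
apply: (le_trans (ler_normD _ _)); apply: (@le_trans _ _ (M * (2 * d) + (4 * L * (al * d) + d * M + d * M))).
  apply: lerD; first exact: le_trans H T4.
  by apply: (le_trans (ler_normB _ _)); apply: lerD => //; apply: (le_trans (ler_normD _ _)); exact: lerD.
by rewrite le_eqVlt; apply/orP; left; apply/eqP; ring.
Qed.

End resolvent_at_zero.

Lemma resolvent0 (K : R) (f : R * R -> R) : 0 < K -> C2box K f ->
  \int[plane R]_z (Gr z * (f z - al ^+ 2 * laplacian f z)) = f 0.
Proof.
move=> K0 Cf; have bf := C2_box Cf.
have [M M0 fM] := boxed_bounded (C2_cont Cf) bf.
have [M1 M10 fM1] := boxed_bounded (C2_c1 Cf) (boxed_partial1 bf).
have [M2 M20 fM2] := boxed_bounded (C2_c2 Cf) (boxed_partial2 bf).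
have [N1 N10 fN1] := boxed_bounded (C2_c11 Cf) (boxed_partial1 (boxed_partial1 bf)).
have [N2 N20 fN2] := boxed_bounded (C2_c22 Cf) (boxed_partial2 (boxed_partial2 bf)).
have NN : 0 <= al ^+ 2 * (N1 + N2) by rewrite mulr_ge0 ?sqr_ge0// addr_ge0// ltW.
have fM' z : `|f z| <= M + al ^+ 2 * (N1 + N2) by rewrite (le_trans (fM z))// lerDl.
have psiM z : `|f z - al ^+ 2 * laplacian f z| <= M + al ^+ 2 * (N1 + N2).
  apply: (le_trans (ler_normB _ _)); apply: lerD => //.
  rewrite normrM ger0_norm ?sqr_ge0// ler_wpM2l ?sqr_ge0//.
  apply: (le_trans (ler_normD _ _)); apply: lerD; [exact: fN1|exact: fN2].
have fL z : `|f z - f 0| <= (M1 + M2) * Num.sqrt (sqeucl z).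
  case: z => a b.
  have l1 : `|f (a, b) - f (0, b)| <= M1 * `|a - 0|.
    apply: (@lipschitz_is_derive R (fun r => f (r, b)) (fun r => partial1 f (r, b)) M1) => r; [apply: is_derive_partial1; exact: (C2_d1 Cf)|exact: fM1].
  have l2 : `|f (0, b) - f (0, 0)| <= M2 * `|b - 0|.
    apply: (@lipschitz_is_derive R (fun r => f (0, r)) (fun r => partial2 f (0, r)) M2) => r; [apply: is_derive_partial2; exact: (C2_d2 Cf)|exact: fM2].
  have a1 : `|a| <= Num.sqrt (sqeucl (a, b)) by rewrite -sqrtr_sqr ler_sqrt /sqeucl/= ?lerDl ?addr_ge0 ?sqr_ge0.
  have b1 : `|b| <= Num.sqrt (sqeucl (a, b)) by rewrite -sqrtr_sqr ler_sqrt /sqeucl/= ?lerDr ?addr_ge0 ?sqr_ge0.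
  rewrite (_ : f (a, b) - f 0 = (f (a, b) - f (0, b)) + (f (0, b) - f (0, 0))); last by rewrite addrA subrK.
  apply: (le_trans (ler_normD _ _)); rewrite mulrDl; apply: lerD.
    by apply: (le_trans l1); rewrite subr0 ler_wpM2l// ltW.
  by apply: (le_trans l2); rewrite subr0 ler_wpM2l// ltW.
have LL : 0 <= M1 + M2 by rewrite addr_ge0// ltW.
have H := resolvent_at_zero_le K0 Cf fM' psiM fL LL.
set C := (4 * _ * al + _) in H.
have C0 : 0 <= C by rewrite addr_ge0 ?mulr_ge0 ?addr_ge0// ltW.
apply/eqP; rewrite -subr_eq0 -normr_eq0 eq_le normr_ge0 andbT.
apply/ler_addgt0Pr => d d0; rewrite add0r; have C1 : 0 < C + 1 by rewrite ltr_wpDl.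
have dd : 0 < Num.min 1 (d / (C + 1)) <= 1 by rewrite lt_min ltr01 divr_gt0//= ge_min lexx.
apply: (le_trans (H _ dd)); apply: (@le_trans _ _ (C * (d / (C + 1)))).
  by rewrite ler_wpM2l// ge_min lexx orbT.
by rewrite mulrA ler_pdivrMr// mulrC ler_wpM2l ?(ltW d0)// lerDl.
Qed.

Lemma resolvent (phi : R * R -> R) x : test_function phi ->
  \int[plane R]_z (Gr z * (phi (z + x) - al ^+ 2 * laplacian phi (z + x))) = phi x.
Proof.
move=> tphi; have [K K0 Cf] := test_function_C2 (test_function_translate x tphi).
by have := resolvent0 K0 Cf; rewrite add0r => <-; apply: eq_Rintegral => z _; rewrite laplacian_translate.
Qed.

End Helmholtz.

Lemma integral_EFinZ d (T : measurableType d) (R : realType) (mu : {measure set T -> \bar R}) (k : R) (f : T -> R) :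
  0 <= k -> measurable_fun setT f -> (forall x, 0 <= f x) ->
  (\int[mu]_x (k * f x)%:E = k%:E * \int[mu]_x (f x)%:E)%E.
Proof.
move=> k0 mf f0; rewrite -ge0_integralZl//; first exact/measurable_EFinP.
by move=> x _; rewrite lee_fin.
Qed.

Section SignedChange.
Context (R : realType).
Implicit Types (T : R * R -> R * R).

Lemma integral_signed_change T (F : R * R -> \bar R) : measurable_fun setT T ->
  (forall f : R * R -> \bar R, measurable_fun setT f -> (forall x, 0 <= f x)%E ->
    (\int[plane R]_x f (T x) = \int[plane R]_x f x)%E) ->
  measurable_fun setT F -> (\int[plane R]_x F (T x) = \int[plane R]_x F x)%E.
Proof.
move=> mT H mF; rewrite integralE [RHS]integralE.
congr (_ - _)%E.
  under eq_integral do rewrite funepos_comp/=.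
  exact: (H (F^\+)%E (measurable_funepos mF) (funepos_ge0 F)).
under eq_integral do rewrite funeneg_comp/=.
exact: (H (F^\-)%E (measurable_funeneg mF) (funeneg_ge0 F)).
Qed.

Lemma Rintegral_shift (f : R * R -> R) (c : R * R) : measurable_fun setT f ->
  \int[plane R]_x f (x + c) = \int[plane R]_x f x.
Proof.
move=> mf; congr fine; apply: (@integral_signed_change (fun x => x + c) (EFin \o f)).
- exact: measurable_addc.
- by move=> h mh h0; exact: plane_shift.
- by apply/measurable_EFinP.
Qed.

Lemma Rintegral_refl (f : R * R -> R) (c s : R) : c ^+ 2 + s ^+ 2 = 1 -> measurable_fun setT f ->
  \int[plane R]_x f (refl c s x) = \int[plane R]_x f x.
Proof.
move=> cs mf; congr fine; apply: (@integral_signed_change (refl c s) (EFin \o f)).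
- exact: measurable_refl.
- by move=> h mh h0; exact: plane_refl.
- by apply/measurable_EFinP.
Qed.

End SignedChange.

(** * Weak solutions of the Helmholtz equation *)

Section HelmholtzSolution.
Context (R : realType) (al : R) (al0 : 0 < al).
Implicit Types (f g phi : R * R -> R).

Definition helmholtz_op phi x := phi x - al ^+ 2 * laplacian phi x.

Lemma helmholtz_op_bounded phi : test_function phi -> measurable_fun setT (helmholtz_op phi) /\
  exists2 M : R, 0 < M & forall x, `|helmholtz_op phi x| <= M.
Proof.
move=> /test_function_C2[K K0 Cf]; split.
  apply: measurable_funB; first exact: measurable_continuous2 (C2_cont Cf).
  apply: measurable_funM => //; apply: measurable_funD; apply: measurable_continuous2;
    [exact: C2_c11 Cf|exact: C2_c22 Cf].
have bf := C2_box Cf.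
have [M M0 fM] := boxed_bounded (C2_cont Cf) bf.
have [N1 N10 fN1] := boxed_bounded (C2_c11 Cf) (boxed_partial1 (boxed_partial1 bf)).
have [N2 N20 fN2] := boxed_bounded (C2_c22 Cf) (boxed_partial2 (boxed_partial2 bf)).
exists (M + al ^+ 2 * (N1 + N2)).
  by rewrite ltr_wpDr// mulr_ge0 ?sqr_ge0// addr_ge0// ltW.
move=> z; apply: (le_trans (ler_normB _ _)); apply: lerD => //.
rewrite normrM ger0_norm ?sqr_ge0// ler_wpM2l ?sqr_ge0//.
by apply: (le_trans (ler_normD _ _)); apply: lerD.
Qed.

Lemma test_function_bounded phi : test_function phi -> measurable_fun setT phi /\
  exists2 M : R, 0 < M & forall x, `|phi x| <= M.
Proof.
move=> /test_function_C2[K K0 Cf]; split; first exact: measurable_continuous2 (C2_cont Cf).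
by have [M M0 fM] := boxed_bounded (C2_cont Cf) (C2_box Cf); exists M.
Qed.

Lemma in_L1P f : in_L1 f <-> (plane R).-integrable setT (EFin \o f).
Proof. exact: integrable_leb2. Qed.

Lemma in_L1_measurable f : in_L1 f -> measurable_fun setT f.
Proof. by move=> /in_L1P/(measurable_int (plane R))/measurable_EFinP. Qed.

Lemma in_L1_norm f : in_L1 f -> exists2 A : R, 0 <= A & (\int[plane R]_x (`|f x|)%:E = A%:E)%E.
Proof.
move=> /in_L1P/integrableP[mf fy]; exists (fine (\int[plane R]_x (`|f x|)%:E)%E).
  by rewrite fine_ge0// integral_ge0// => x _; rewrite lee_fin.
by rewrite fineK// ge0_fin_numE// integral_ge0// => x _; rewrite lee_fin.
Qed.

Lemma measurable_abs f : measurable_fun setT f -> measurable_fun setT (fun x => `|f x|).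
Proof. by move=> mf; exact: (measurableT_comp (@normr_measurable R setT) mf). Qed.

Definition resolvent_conv f x : R := \int[plane R]_y (Gr al (x - y) * f y).

Section existence.
Variables (f : R * R -> R) (L1f : in_L1 f).
Let mf := in_L1_measurable L1f.

Let maf : measurable_fun setT (fun x => (`|f x|)%:E).
Proof. by apply/measurable_EFinP; exact: measurable_abs. Qed.

Let mGr2 : measurable_fun setT (fun z : (R * R) * (R * R) => Gr al (z.1 - z.2)).
Proof. exact: (measurableT_comp (measurable_Gr al) (@measurable_sub2 R)). Qed.

Let F (z : (R * R) * (R * R)) := Gr al (z.1 - z.2) * f z.2.
Let H (z : (R * R) * (R * R)) := Gr al (z.1 - z.2) * `|f z.2|.

Let mF : measurable_fun setT F.
Proof. by apply: measurable_funM; [exact: mGr2|exact: (measurableT_comp mf measurable_snd)]. Qed.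

Let mH : measurable_fun setT H.
Proof. by apply: measurable_funM; [exact: mGr2|exact: (measurableT_comp (measurable_abs mf) measurable_snd)]. Qed.

Let FH z : `|F z| <= H z.
Proof. by rewrite normrM ger0_norm ?Gr_ge0. Qed.

Let H0 z : 0 <= H z. Proof. exact: le_trans (FH z). Qed.

Let HB : (\int[plane R]_x \int[plane R]_y (H (x, y))%:E = \int[plane R]_x (`|f x|)%:E)%E.
Proof.
have mG : measurable_fun setT (EFin \o Gr al) by apply/measurable_EFinP; exact: measurable_Gr.
have := integral_conv mG maf (fun x => Gr_ge0 al x) (fun x => normr_ge0 (f x)).
by rewrite (integral_Gr al0) mul1e => <-.
Qed.

Lemma in_L1_resolvent_conv : in_L1 (resolvent_conv f).
Proof.
have [A A0 fA] := in_L1_norm L1f.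
by apply/in_L1P; apply: (integrable_section1 (B := A) mF mH FH); rewrite HB fA.
Qed.

Lemma resolvent_conv_le x : ((`|resolvent_conv f x|)%:E <= conv (Gk al) (fun y => (`|f y|)%:E) x)%E.
Proof.
have mFx : measurable_fun setT (fun y => (F (x, y))%:E).
  by apply/measurable_EFinP; exact: (measurable_fun_pair2 x mF).
apply: (@le_trans _ _ (`|\int[plane R]_y (F (x, y))%:E|)%E).
  rewrite /resolvent_conv /Rintegral /F/=; case: (\int[plane R]_y _)%E => [r| |] //=; by rewrite normr0 leey.
apply: (le_trans (le_abse_integral _ _ _)) => //; apply: ge0_le_integral => //.
- exact: (measurableT_comp (@abse_measurable R setT) mFx).
- apply: emeasurable_funM; last exact: maf.
  exact: (measurableT_comp (measurable_Gk al) (measurable_csub x)).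
move=> y _; rewrite /= normrM EFinM lee_wpmul2r ?lee_fin// ger0_norm ?Gr_ge0//.
have := Gk_ge0 al (x - y); rewrite /Gr; case: (Gk al (x - y)) => //= r _; exact: leey.
Qed.

(** By Fubini the kernel is tested against [helmholtz_op phi] around each [y], where [resolvent]
    returns [phi y]. *)
Lemma resolvent_conv_weak phi : test_function phi ->
  \int[plane R]_x (resolvent_conv f x * helmholtz_op phi x) = \int[plane R]_x (f x * phi x).
Proof.
move=> tphi; have [mpsi [M M0 psiM]] := helmholtz_op_bounded tphi.
have [A A0 fA] := in_L1_norm L1f.
pose F' z := F z * helmholtz_op phi z.1; pose H' z := M * H z.
have mF' : measurable_fun setT F' by apply: measurable_funM; [exact: mF|exact: (measurableT_comp mpsi measurable_fst)].
have mH' : measurable_fun setT H' by apply: measurable_funM; [|exact: mH].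
have FH' z : `|F' z| <= H' z by rewrite normrM mulrC ler_pM.
have HB' : (\int[plane R]_x \int[plane R]_y (H' (x, y))%:E <= (M * A)%:E)%E.
  rewrite EFinM -fA -HB -ge0_integralZl//.
  - apply: ge0_le_integral => //.
    + by move=> x _; apply: integral_ge0 => y _; rewrite lee_fin mulr_ge0// ltW.
    + apply: (measurable_fun_fubini_tonelli_F (EFin \o H')); first by apply/measurable_EFinP.
      by move=> z; rewrite lee_fin mulr_ge0// ltW.
    + apply: emeasurable_funM => //.
      apply: (measurable_fun_fubini_tonelli_F (EFin \o H)); first by apply/measurable_EFinP.
      by move=> z; rewrite lee_fin.
    move=> x _; rewrite -ge0_integralZl//.
    + by apply/measurable_EFinP; exact: (measurable_fun_pair2 x mH).
    + by move=> y _; rewrite lee_fin.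
    + by rewrite lee_fin ltW.
  - apply: (measurable_fun_fubini_tonelli_F (EFin \o H)); first by apply/measurable_EFinP.
    by move=> z; rewrite lee_fin.
  - by move=> x _; apply: integral_ge0 => y _; rewrite lee_fin.
  - by rewrite lee_fin ltW.
have Fi : {ae plane R, forall x, (plane R).-integrable setT (fun y => (F (x, y))%:E)}.
  have fi : ((plane R) \x (plane R))%E.-integrable setT (EFin \o F).
    apply: (integrable_bound (h := H) (B := A)) => //.
    rewrite fubini_tonelli1//=; last by apply/measurable_EFinP.
    by rewrite HB fA.
  by have := ae_integrable1 fi; apply: filterS => x; apply.
transitivity (\int[plane R]_x (\int[plane R]_y F' (x, y))).
  apply: ae_eq_Rintegral.
  - by apply: measurable_funM => //; exact: in_L1_measurable in_L1_resolvent_conv.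
  - by apply/measurable_EFinP; apply: measurable_int; exact: (integrable_section1 mF' mH' FH' HB').
  - by apply: filterS Fi => x Fx; rewrite /F'/= RintegralZr.
rewrite (Rfubini mF' mH' FH' HB'); apply: eq_Rintegral => y _.
rewrite -(resolvent al0 y tphi).
have S := @Rintegral_shift R (fun x => Gr al (x - y) * helmholtz_op phi x) y.
transitivity (f y * \int[plane R]_x (Gr al (x - y) * helmholtz_op phi x)); last first.
  apply: (f_equal (fun r => f y * r)); apply: (etrans (esym (S _))).
    by apply: measurable_funM; [exact: (measurableT_comp (measurable_Gr al) (measurable_subc y))|exact: mpsi].
  apply: eq_Rintegral => x _; by rewrite (addrK y x) /helmholtz_op.
rewrite -RintegralZl; [|exact: measurableT|].
  by apply: eq_Rintegral => x _; rewrite /F' /F/=; ring.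
have mG : measurable_fun setT (fun x : R * R => Gr al (x - y)) by exact: (measurableT_comp (measurable_Gr al) (measurable_subc y)).
apply: (integrable_bound (h := fun x : R * R => M * Gr al (x - y)) (B := M)).
- by apply: measurable_funM.
- by apply: measurable_funM.
- move=> x; have G0 : 0 <= Gr al (x - y) := Gr_ge0 al _.
  by rewrite normrM mulrC (ger0_norm G0); exact: (ler_wpM2r G0 (psiM x)).
have E : (\int[plane R]_x (Gr al (x - y))%:E = 1)%E.
  rewrite -(integral_Gr al0); apply: (@plane_shift R (EFin \o Gr al) (- y)).
  - by apply/measurable_EFinP; exact: measurable_Gr.
  - by move=> x; rewrite lee_fin Gr_ge0.
have Z := @integral_EFinZ _ _ R (plane R) M (fun x : R * R => Gr al (x - y)) (ltW M0) mG (fun x => Gr_ge0 al _).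
by rewrite E mule1 in Z; rewrite Z.
Qed.

Lemma helmholtz_sol_resolvent_conv : helmholtz_sol al f (resolvent_conv f).
Proof.
split; first exact: in_L1_resolvent_conv.
move=> phi tphi; have [mpsi _] := helmholtz_op_bounded tphi; have [mphi _] := test_function_bounded tphi.
rewrite !Rintegral_leb2; first exact: resolvent_conv_weak.
- by apply: measurable_funM.
- by apply: measurable_funM => //; exact: in_L1_measurable in_L1_resolvent_conv.
Qed.

End existence.

(** A test function need not be the image of a compactly supported one under the operator. By
    [resolvent] it is, however, a superposition with density [Gr] of translates of
    [helmholtz_op phi], and each of these is orthogonal to [g]. *)
Lemma helmholtz_op_orthogonal g : in_L1 g ->
  (forall phi, test_function phi -> \int[plane R]_x (g x * helmholtz_op phi x) = 0) ->
  forall phi, test_function phi -> \int[plane R]_x (g x * phi x) = 0.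
Proof.
move=> L1g g0 phi tphi; have mg := in_L1_measurable L1g.
have [mpsi [M M0 psiM]] := helmholtz_op_bounded tphi.
have [A A0 gA] := in_L1_norm L1g.
have mpsi2 : measurable_fun setT (fun z : (R * R) * (R * R) => helmholtz_op phi (z.2 + z.1)).
  apply: (measurableT_comp mpsi (g := fun z : (R * R) * (R * R) => z.2 + z.1)).
  have E : (fun z : (R * R) * (R * R) => z.2 + z.1) = (fun z => z.2 - (- z.1)) by apply/funext => z; rewrite opprK.
  rewrite E; apply: (measurableT_comp (@measurable_sub2 R) (g := fun z : (R * R) * (R * R) => (z.2, - z.1))).
  apply/measurable_fun_pairP; split; first exact: measurable_snd.
  exact: (measurableT_comp (@measurable_opp2 R) measurable_fst).
pose F (z : (R * R) * (R * R)) := g z.1 * (Gr al z.2 * helmholtz_op phi (z.2 + z.1)).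
pose H (z : (R * R) * (R * R)) := `|g z.1| * (M * Gr al z.2).
have mG := measurable_Gr al.
have mG2 : measurable_fun setT (fun z : (R * R) * (R * R) => Gr al z.2) by exact: (measurableT_comp mG measurable_snd).
have mF : measurable_fun setT F.
  apply: measurable_funM; first exact: (measurableT_comp mg measurable_fst).
  by apply: measurable_funM.
have mH : measurable_fun setT H.
  apply: measurable_funM; first exact: (measurableT_comp (measurable_abs mg) measurable_fst).
  by apply: measurable_funM.
have FH z : `|F z| <= H z.
  rewrite normrM ler_wpM2l// normrM mulrC (ger0_norm (Gr_ge0 al _)) ler_wpM2r// Gr_ge0//.
have HB : (\int[plane R]_x \int[plane R]_y (H (x, y))%:E <= (M * A)%:E)%E.
  have E x : (\int[plane R]_y (H (x, y))%:E = (M * `|g x|)%:E)%E.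
    rewrite (_ : (\int[plane R]_y _)%E = ((M * `|g x|)%:E * \int[plane R]_y (Gr al y)%:E)%E).
      by rewrite (integral_Gr al0) mule1.
    rewrite -ge0_integralZl//.
    - by apply: eq_integral => y _; rewrite -EFinM /H/= mulrCA mulrA.
    - by apply/measurable_EFinP; exact: mG.
    - by move=> y _; rewrite lee_fin Gr_ge0.
    - by rewrite lee_fin mulr_ge0// ltW.
  rewrite EFinM -gA -ge0_integralZl//.
  - rewrite le_eqVlt; apply/orP; left; apply/eqP; apply: eq_integral => x _.
    by rewrite E EFinM.
  - by apply/measurable_EFinP; exact: measurable_abs.
  - by rewrite lee_fin ltW.
have Gi x : (plane R).-integrable setT (EFin \o (fun z => Gr al z * helmholtz_op phi (z + x))).
  apply: (integrable_bound (h := fun z => M * Gr al z) (B := M)).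
  - by apply: measurable_funM; [exact: mG|exact: (measurableT_comp mpsi (measurable_addc x))].
  - by apply: measurable_funM; [exact: measurable_cst|exact: mG].
  - by move=> z; rewrite normrM mulrC (ger0_norm (Gr_ge0 al _)) ler_wpM2r// Gr_ge0.
  rewrite (_ : (\int[plane R]_x _)%E = (M%:E * \int[plane R]_x (Gr al x)%:E)%E); first by rewrite (integral_Gr al0) mule1.
  rewrite -ge0_integralZl//.
  - by apply/measurable_EFinP; exact: mG.
  - by move=> z _; rewrite lee_fin Gr_ge0.
  - by rewrite lee_fin ltW.
transitivity (\int[plane R]_x (\int[plane R]_z F (x, z))).
  apply: eq_Rintegral => x _; rewrite -[in LHS](resolvent al0 x tphi) /F/= RintegralZl//; exact: Gi.
rewrite (Rfubini mF mH FH HB) -[RHS](_ : \int[plane R]_z (0 : R) = 0); last by rewrite /Rintegral integral0.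
apply: eq_Rintegral => z _.
have tz := test_function_translate z tphi.
have [mz [M' M'0 zM]] := helmholtz_op_bounded tz.
transitivity (Gr al z * \int[plane R]_x (g x * helmholtz_op (fun x => phi (x + z)) x)).
  rewrite -RintegralZl; [|exact: measurableT|].
    by apply: eq_Rintegral => x _; rewrite /F/= /helmholtz_op laplacian_translate [z + x]addrC; ring.
  apply: (integrable_bound (h := fun x => M' * `|g x|) (B := M' * A)).
  - by apply: measurable_funM; [exact: mg|exact: mz].
  - by apply: measurable_funM => //; exact: measurable_abs.
  - by move=> x; rewrite normrM mulrC ler_wpM2r.
  rewrite (_ : (\int[plane R]_x _)%E = (M'%:E * \int[plane R]_x (`|g x|)%:E)%E); first by rewrite gA.
  rewrite -ge0_integralZl//.
  - by apply/measurable_EFinP; exact: measurable_abs.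
  - by rewrite lee_fin ltW.
by rewrite g0// mulr0.
Qed.

End HelmholtzSolution.

(** * Smooth bump functions *)

Section Bump.
Context (R : realType).
Implicit Types (p : {poly R}) (r : R).

(** The polynomial factor makes the family closed under differentiation, so that smoothness follows
    by induction on the order. *)
Definition flat p r : R := if 0 < r then p.[r^-1] * expR (- r^-1) else 0.

(** Coefficientwise, [y^(i+2)] is at most [(i+2)!] times [e^y]; the two extra powers give the
    quadratic vanishing of [flat] at the origin, hence its derivative there. *)
Lemma poly_le_exp p : exists2 C : R, 0 <= C & forall y, 0 < y -> `|p.[y]| * y ^+ 2 <= C * expR y.
Proof.
exists (\sum_(i < size p) `|p`_i| * (i.+2)`!%:R).
  by apply: sumr_ge0 => i _; rewrite mulr_ge0.
move=> y y0; rewrite horner_coef [leRHS]mulr_suml.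
apply: (@le_trans _ _ (\sum_(i < size p) `|p`_i| * y ^+ i.+2)).
  apply: (@le_trans _ _ ((\sum_(i < size p) `|p`_i * y ^+ i|) * y ^+ 2)).
    by rewrite ler_wpM2r ?sqr_ge0// ler_norm_sum.
  rewrite mulr_suml; apply: ler_sum => i _.
  by rewrite normrM (ger0_norm (exprn_ge0 _ (ltW y0))) -mulrA -exprD addn2.
apply: ler_sum => i _; rewrite -mulrA ler_wpM2l//.
have := expR_ge1Dxn i.+1 (ltW y0) => /(le_trans _) H.
have f0 : 0 < (i.+2)`!%:R :> R by rewrite ltr0n fact_gt0.
rewrite -ler_pdivrMl// mulrC; apply: H.
by rewrite lerDr.
Qed.

Lemma flat_quadratic p : exists2 C : R, 0 <= C & forall r, `|flat p r| <= C * r ^+ 2.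
Proof.
have [C C0 H] := poly_le_exp p; exists C => // r; rewrite /flat; case: ifPn => r0; last first.
  by rewrite normr0 mulr_ge0 ?sqr_ge0.
have := H r^-1; rewrite invr_gt0 => /(_ r0) {}H.
rewrite normrM (ger0_norm (expR_ge0 _)) expRN ler_pdivrMr ?expR_gt0//.
by rewrite mulrAC -ler_pdivrMr ?exprn_gt0// -exprVn.
Qed.

Lemma is_derive_quadratic (f : R -> R) (C : R) : (forall r, `|f r| <= C * r ^+ 2) -> is_derive (0 : R) 1 f 0.
Proof.
move=> fC; have f0 : f 0 = 0.
  by apply/eqP; rewrite -normr_le0 (le_trans (fC 0))// expr0n/= mulr0.
have C0 : 0 <= C by have := le_trans (normr_ge0 _) (fC 1); rewrite expr1n mulr1.
have H : h^-1 *: ((f \o shift 0) (h *: (1 : R)) - f 0) @[h --> 0^'] --> (0 : R).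
  apply/cvgrPdist_le => e e0; rewrite near_withinE/=.
  exists (e / (C + 1)) => /=; first by rewrite divr_gt0// ltr_wpDl.
  move=> h; rewrite /= sub0r normrN => hd h0.
  rewrite sub0r normrN f0 subr0 addr0 /GRing.scale/= mulr1 normrM normfV.
  rewrite ler_pdivrMl ?normr_gt0//; apply: (le_trans (fC h)).
  rewrite -[h ^+ 2]real_normK ?num_real// expr2 mulrA [leRHS]mulrC ler_wpM2r//.
  apply: (@le_trans _ _ ((C + 1) * `|h|)); first by rewrite ler_wpM2r// lerDl.
  by rewrite mulrC -ler_pdivlMr ?ltr_wpDl// ltW.
by apply: DeriveDef; [apply/cvg_ex; exists 0|exact: (cvg_lim _ H)].
Qed.

Lemma is_derive_flat p r : is_derive r 1 (flat p) (flat ('X^2 * (p - p^`())) r).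
Proof.
case: (ltgtP r 0) => [r0|r0|->].
- rewrite {2}/flat (le_gtF (ltW r0)).
  have D0 := @is_derive_cst R R R (0 : R) r (1 : R); apply: (near_eq_is_derive _ D0).
  by near=> s; rewrite /flat/= ltNge (_ : s <= 0)//; apply: ltW; near: s; exact: lt_nbhsl.
- have rn0 : r != 0 by rewrite gt_eqF.
  apply: (@near_eq_is_derive _ _ _ (fun r => p.[r^-1] * expR (- r^-1))).
    by near=> s; rewrite /flat (_ : 0 < s)//; near: s; exact: lt_nbhsr.
  have dV : is_derive r 1 (fun s : R => s^-1) (- r ^- 2).
    have := @is_deriveV R id r 1 1 rn0 (is_derive_id _ _).
    by rewrite /= /GRing.scale/= mulr1.
  have d1 : is_derive r 1 (fun s : R => - s^-1) (r ^- 2).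
    by have := is_deriveN dV; rewrite opprK.
  have d2 : is_derive r 1 (fun s : R => expR (- s^-1)) (expR (- r^-1) * r ^- 2).
    exact: (@is_derive1_comp R (@expR R) (fun s : R => - s^-1) r _ _ (is_derive_expR _) d1).
  have d3 : is_derive r 1 (fun s : R => p.[s^-1]) (p^`().[r^-1] * - r ^- 2).
    exact: (@is_derive1_comp R (horner p) (fun s : R => s^-1) r _ _ (is_derive_poly _ _) dV).
  have := is_deriveM d3 d2; rewrite /GRing.scale/= /flat r0.
  move=> D; apply: (is_derive_eq D).
  rewrite !hornerE/= -exprVn; ring.
- rewrite {2}/flat ltxx; have [C _ H] := flat_quadratic p; exact: is_derive_quadratic H.
Unshelve. all: by end_near. Qed.

Lemma class_C_weaken k (f : R * R -> R) : class_C k.+1 f -> class_C k f.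
Proof.
elim: k f => [|k IH] f; first by move=> [].
move=> [cf d1 d2 c1 c2]; split; [exact: cf|exact: d1|exact: d2|exact: (IH _ c1)|exact: (IH _ c2)].
Qed.

Lemma class_CD k (f g : R * R -> R) : class_C k f -> class_C k g -> class_C k (fun x => f x + g x).
Proof.
elim: k f g => [|k IH] f g /=; first by move=> cf cg x; apply: cvgD; [exact: cf|exact: cg].
move=> [cf df1 df2 cf1 cf2] [cg dg1 dg2 cg1 cg2].
have p1 : partial1 (fun x => f x + g x) = fun x => partial1 f x + partial1 g x.
  by apply/funext => x; rewrite /partial1 (deriveD (df1 x) (dg1 x)).
have p2 : partial2 (fun x => f x + g x) = fun x => partial2 f x + partial2 g x.
  by apply/funext => x; rewrite /partial2 (deriveD (df2 x) (dg2 x)).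
split.
- by move=> x; apply: cvgD; [exact: cf|exact: cg].
- by move=> x; exact: derivableD.
- by move=> x; exact: derivableD.
- by rewrite p1; exact: IH.
- by rewrite p2; exact: IH.
Qed.

Lemma class_CM k (f g : R * R -> R) : class_C k f -> class_C k g -> class_C k (fun x => f x * g x).
Proof.
elim: k f g => [|k IH] f g /=; first by move=> cf cg x; apply: cvgM; [exact: cf|exact: cg].
move=> Cf Cg; have Cf' := class_C_weaken Cf; have Cg' := class_C_weaken Cg.
move: Cf Cg => [cf df1 df2 cf1 cf2] [cg dg1 dg2 cg1 cg2].
have p1 : partial1 (fun x => f x * g x) = fun x => f x * partial1 g x + g x * partial1 f x.
  by apply/funext => x; rewrite /partial1 (deriveM (df1 x) (dg1 x)).
have p2 : partial2 (fun x => f x * g x) = fun x => f x * partial2 g x + g x * partial2 f x.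
  by apply/funext => x; rewrite /partial2 (deriveM (df2 x) (dg2 x)).
split.
- by move=> x; apply: cvgM; [exact: cf|exact: cg].
- by move=> x; exact: derivableM.
- by move=> x; exact: derivableM.
- by rewrite p1; apply: class_CD; exact: IH.
- by rewrite p2; apply: class_CD; exact: IH.
Qed.

Lemma is_derive_flat_affine (p : {poly R}) (m c e r : R) :
  is_derive r 1 (fun s => m * flat p (c * s + e)) (m * c * flat ('X^2 * (p - p^`())) (c * r + e)).
Proof.
have d1 : is_derive r 1 (fun s : R => c * s + e) c.
  have dc : is_derive r 1 (fun s : R => c *: s) (c *: (1 : R)) by exact: is_deriveZ.
  have := is_deriveD dc (is_derive_cst e r 1); rewrite addr0 /GRing.scale/= mulr1; exact.
have d2 := @is_derive1_comp R (flat p) (fun s => c * s + e) r _ _ (is_derive_flat p _) d1.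
have dm : is_derive r 1 (fun s : R => m *: (flat p \o (fun s => c * s + e)) s)
  (m *: (flat ('X^2 * (p - p^`())) (c * r + e) * c)) by exact: is_deriveZ.
by apply: (is_derive_eq dm); rewrite /GRing.scale/=; ring.
Qed.

(** The general affine argument and the factor [m] make the statement stable under both partial
    derivatives. *)
Lemma class_C_flat k p (m c1 c2 e : R) : class_C k (fun x => m * flat p (c1 * x.1 + c2 * x.2 + e)).
Proof.
elim: k p m => [|k IH] p m.
  move=> x; apply: cvgM; first exact: cvg_cst.
  apply: (@cvg_comp _ _ _ (fun x : R * R => c1 * x.1 + c2 * x.2 + e) (flat p) _ (nbhs (c1 * x.1 + c2 * x.2 + e))).
    apply: cvgD; last exact: cvg_cst.
    by apply: cvgD; apply: cvgM; [exact: cvg_cst|exact: cvg_fst|exact: cvg_cst|exact: cvg_snd].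
  exact: (continuous_is_derive (is_derive_flat p _)).
have d1 (x : R * R) : is_derive x.1 1 (fun r => m * flat p (c1 * r + c2 * x.2 + e))
    (m * c1 * flat ('X^2 * (p - p^`())) (c1 * x.1 + c2 * x.2 + e)).
  under eq_fun do rewrite -addrA; rewrite -addrA; exact: is_derive_flat_affine.
have d2 (x : R * R) : is_derive x.2 1 (fun r => m * flat p (c1 * x.1 + c2 * r + e))
    (m * c2 * flat ('X^2 * (p - p^`())) (c1 * x.1 + c2 * x.2 + e)).
  under eq_fun do rewrite [c1 * _ + _]addrC -addrA; rewrite [c1 * _ + _]addrC -addrA; exact: is_derive_flat_affine.
split.
- by have := class_C_weaken; move: (IH p m); case: (k) => [//|n []].
- by move=> x; rewrite derivable1E; have [] := d1 x.
- by move=> x; rewrite derivable2E; have [] := d2 x.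
- rewrite (_ : partial1 _ = fun x => m * c1 * flat ('X^2 * (p - p^`())) (c1 * x.1 + c2 * x.2 + e)); first exact: IH.
  by apply/funext => x; rewrite partial1E/=; have [_ ->] := d1 x.
- rewrite (_ : partial2 _ = fun x => m * c2 * flat ('X^2 * (p - p^`())) (c1 * x.1 + c2 * x.2 + e)); first exact: IH.
  by apply/funext => x; rewrite partial2E/=; have [_ ->] := d2 x.
Qed.

(** Supported in [[c, n]]; as [n] grows, the first factor becomes steep at [c] and the second
    recedes, so the limit is the indicator of []c, +oo[]. *)
Definition bump (c n r : R) : R := flat 1 (n * (r - c)) * flat 1 (n - r).

Lemma flat1E r : flat 1 r = if 0 < r then expR (- r^-1) else 0.
Proof. by rewrite /flat; case: ifP => // _; rewrite hornerE mul1r. Qed.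

Lemma flat1_01 r : 0 <= flat 1 r <= 1.
Proof.
rewrite flat1E; case: ifP => r0; last by rewrite lexx ler01.
by rewrite expR_ge0/= expR_le1 oppr_le0 invr_ge0 ltW.
Qed.

Lemma test_function_bump (a b n : R) : 0 < n -> test_function (fun x : R * R => bump a n x.1 * bump b n x.2).
Proof.
move=> n0; split.
  move=> k; rewrite (_ : (fun x => _) = fun x =>
    ((1 * flat 1 (n * x.1 + 0 * x.2 + - (n * a))) * (1 * flat 1 (-1 * x.1 + 0 * x.2 + n))) *
    ((1 * flat 1 (0 * x.1 + n * x.2 + - (n * b))) * (1 * flat 1 (0 * x.1 + -1 * x.2 + n)))).
    by apply: class_CM; apply: class_CM; exact: class_C_flat.
  apply/funext => x; rewrite /bump !mul1r; congr (flat 1 _ * flat 1 _ * (flat 1 _ * flat 1 _)); ring.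
apply: (@bounded_support_compact R (n + `|a| + `|b|)) => x H.
have key c (r : R) : `|c| <= `|a| + `|b| -> n + `|a| + `|b| < `|r| -> bump c n r = 0.
  move=> cab rn; rewrite /bump /flat; case: (ifPn (0 < n - r)) => nr; last by rewrite mulr0.
  case: ifPn => rc; last by rewrite mul0r.
  exfalso; move: rc; rewrite pmulr_rgt0// => rc.
  have := ler_norm (- c); rewrite normrN => c1.
  by move: rn; case: (ger0P r) => r0; have := normr_ge0 a; have := normr_ge0 b; lra.
case: H => H; first by rewrite (key a) ?mul0r// lerDl.
by rewrite (key b x.2) ?mulr0// lerDr.
Qed.

Lemma bump_01 c n r : 0 <= bump c n r <= 1.
Proof.
have /andP[a0 a1] := flat1_01 (n * (r - c)); have /andP[b0 b1] := flat1_01 (n - r).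
by rewrite /bump mulr_ge0//= mulr_ile1.
Qed.

Lemma cvg_flat1 (u : nat -> R) : (\forall n \near \oo, 0 < u n) -> (u n)^-1 @[n --> \oo] --> (0 : R) -> flat 1 (u n) @[n --> \oo] --> (1 : R).
Proof.
move=> u0 uc; have H : expR (- (u n)^-1) @[n --> \oo] --> expR (- 0).
  apply: (@cvg_comp _ _ _ (fun n => - (u n)^-1) (@expR R) _ (nbhs (- 0))); last exact: continuous_expR.
  exact: cvgN.
rewrite oppr0 expR0 in H; apply: cvg_trans H; apply: near_eq_cvg.
by near=> n; rewrite flat1E (_ : 0 < u n)//; near: n.
Unshelve. all: by end_near. Qed.

Lemma cvg_bump c r : bump c n.+1%:R r @[n --> \oo] --> ((if c < r then 1 else 0) : R).
Proof.
case: ifPn => rc; last first.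
  rewrite (_ : (fun n => _) = cst 0); first exact: cvg_cst.
  apply/funext => n; rewrite /bump flat1E pmulr_rgt0 ?ltr0n// subr_gt0 (negbTE rc) mul0r//.
have cr0 : 0 < r - c by rewrite subr_gt0.
rewrite -[X in _ --> X]mulr1; apply: cvgM; apply: cvg_flat1.
- by apply: nearW => n; rewrite mulr_gt0// ltr0n.
- rewrite (_ : (fun n => _) = (fun n => harmonic n * (r - c)^-1)); last by apply/funext => n; rewrite invfM.
  by rewrite -[X in _ --> X](mul0r (r - c)^-1); apply: cvgM; [exact: cvg_harmonic|exact: cvg_cst].
- near=> n; rewrite subr_gt0 (lt_le_trans (truncnS_gt r))// ler_nat.
  by rewrite ltnS ltnW//; near: n; exact: nbhs_infty_gt.
- rewrite (_ : (fun n => _) = (fun n => harmonic n * (1 - r * harmonic n)^-1)).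
    rewrite -[X in _ --> X](mul0r (1 - r * 0)^-1); apply: cvgM; first exact: cvg_harmonic.
    apply: cvgV; first by rewrite mulr0 subr0 oner_neq0.
    by apply: cvgB; [exact: cvg_cst|apply: cvgM; [exact: cvg_cst|exact: cvg_harmonic]].
  apply/funext => n; rewrite /harmonic/= -invfM; congr (_^-1).
  by rewrite mulrBr mulr1 mulrCA divff ?mulr1// pnatr_eq0.
Unshelve. all: by end_near. Qed.

End Bump.

(** * Integrable functions that vanish against all test functions *)

Section Density.
Context d (T : measurableType d) (R : realType) (mu : {measure set T -> \bar R}).
Variables (h : T -> \bar R) (mh : measurable_fun setT h) (h0 : forall x, (0 <= h x)%E).

(** The proofs of measurability and positivity are arguments of the set function so that a measure
    structure can be attached to it. *)
Definition density (_ : measurable_fun setT h) (_ : forall x, (0 <= h x)%E) (A : set T) : \bar R :=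
  (\int[mu]_(x in A) h x)%E.

Let density0 : density mh h0 set0 = 0%E.
Proof. by rewrite /density integral_set0. Qed.

Let density_ge0 A : (0 <= density mh h0 A)%E.
Proof. by apply: integral_ge0. Qed.

Let density_sigma_additive : semi_sigma_additive (density mh h0).
Proof. exact: semi_sigma_additive_nng_induced. Qed.

HB.instance Definition _ := isMeasure.Build _ _ _ (density mh h0) density0 density_ge0 density_sigma_additive.

End Density.

Section WeakZero.
Context (R : realType).

(** Quadrants form an intersection-stable generator of the sigma-algebra, and their indicators are
    limits of products of two bumps. *)
Definition quadrant (a b : R) : set (R * R) := `]a, +oo[%classic `*` `]b, +oo[%classic.

Definition quadrants : set (set (R * R)) := [set A | exists a b, A = quadrant a b].

Lemma measurable_quadrant a b : measurable (quadrant a b).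
Proof. by apply: measurableX; exact: measurable_itv. Qed.

Lemma quadrant_setI : setI_closed quadrants.
Proof.
move=> _ _ [a [b ->]] [c [e ->]]; exists (Num.max a c), (Num.max b e).
apply/seteqP; split => x; rewrite /quadrant/= !in_itv/= !andbT !gt_max.
  by move=> [[-> ->] [-> ->]].
by move=> [/andP[-> ->] /andP[-> ->]].
Qed.

Lemma quadrant_cover : \bigcup_k quadrant (- k%:R) (- k%:R) = setT.
Proof.
apply/seteqP; split => // x _; exists (Num.trunc (Num.max `|x.1| `|x.2|)).+1 => //.
have := truncnS_gt (Num.max `|x.1| `|x.2|); rewrite gt_max => /andP[h1 h2].
rewrite /quadrant/= !in_itv/= !andbT; split; rewrite ltrNl; [apply: le_lt_trans h1|apply: le_lt_trans h2];
  by rewrite -normrN ler_norm.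
Qed.

Lemma measurable_quadrantsE : @measurable _ (R * R)%type = <<s quadrants >>.
Proof.
apply/seteqP; split; last first.
  apply: smallest_sub; first exact: sigma_algebra_measurable.
  by move=> _ [a [b ->]]; exact: measurable_quadrant.
rewrite measurable_prod_measurableType.
apply: smallest_sub; first exact: smallest_sigma_algebra.
pose T1 := g_sigma_algebraType (quadrants : set (set (R * R))).
have m1 : measurable_fun [set: T1] (fst : T1 -> R).
  apply: (measurability _ (RGenOInfty.measurableE R)) => _ [_ [y ->] <-]; rewrite setTI.
  rewrite (_ : _ @^-1` _ = \bigcup_k quadrant y (- k%:R)).
    by apply: bigcup_measurable => k _; apply: sub_sigma_algebra; exists y, (- k%:R).
  apply/seteqP; split => x.
    rewrite /= in_itv/= andbT => yx; exists (Num.trunc `|x.2|).+1 => //.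
    rewrite /quadrant/= !in_itv/= !andbT; split => //; rewrite ltrNl; apply: le_lt_trans (truncnS_gt _).
    by rewrite -normrN ler_norm.
  by move=> [k _ []].
have m2 : measurable_fun [set: T1] (snd : T1 -> R).
  apply: (measurability _ (RGenOInfty.measurableE R)) => _ [_ [y ->] <-]; rewrite setTI.
  rewrite (_ : _ @^-1` _ = \bigcup_k quadrant (- k%:R) y).
    by apply: bigcup_measurable => k _; apply: sub_sigma_algebra; exists (- k%:R), y.
  apply/seteqP; split => x.
    rewrite /= in_itv/= andbT => yx; exists (Num.trunc `|x.1|).+1 => //.
    rewrite /quadrant/= !in_itv/= !andbT; split => //; rewrite ltrNl; apply: le_lt_trans (truncnS_gt _).
    by rewrite -normrN ler_norm.
  by move=> [k _ []].
move=> _ [A mA] [B mB] <-.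
have h1 : measurable ((fst : T1 -> R) @^-1` A) by rewrite -[X in measurable X]setTI; exact: m1.
have h2 : measurable ((snd : T1 -> R) @^-1` B) by rewrite -[X in measurable X]setTI; exact: m2.
exact: (measurableI _ _ h1 h2).
Qed.

Variables (g : R * R -> R) (L1g : in_L1 g).
Hypothesis g0 : forall phi, test_function phi -> \int[plane R]_x (g x * phi x) = 0.

Let mg := in_L1_measurable L1g.

Let mEg : measurable_fun setT (EFin \o g). Proof. by apply/measurable_EFinP; exact: mg. Qed.

Let gi : (plane R).-integrable setT (EFin \o g). Proof. exact/in_L1P. Qed.

Let phi a b n (x : R * R) : R := bump a n.+1%:R x.1 * bump b n.+1%:R x.2.

(** Dominated convergence along products of bumps, with [|g|] as dominating function. *)
Lemma integral_quadrant0 a b : (\int[plane R]_(x in quadrant a b) (g x)%:E = 0)%E.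
Proof.
have tphi n : test_function (phi a b n) by apply: test_function_bump; rewrite ltr0n.
have mphi n : measurable_fun setT (phi a b n) by have [] := test_function_bounded (tphi n).
have phi1 n x : `|phi a b n x| <= 1.
  have /andP[p0 p1] := bump_01 a n.+1%:R x.1; have /andP[q0 q1] := bump_01 b n.+1%:R x.2.
  by rewrite /phi ger0_norm; [exact: mulr_ile1 p0 q0 p1 q1|exact: mulr_ge0].
have gphi n x : `|g x * phi a b n x| <= `|g x| by rewrite normrM ler_piMr.
have ii n : (\int[plane R]_x (g x * phi a b n x)%:E = 0)%E.
  have fi : (plane R).-integrable setT (EFin \o (fun x => g x * phi a b n x)).
    apply: le_integrable gi => //; first by apply/measurable_EFinP; exact: measurable_funM.
    by move=> x _; rewrite /= lee_fin; exact: gphi.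
  by rewrite -(EFin_Rintegral fi) g0.
pose lim (x : R * R) : R := (if a < x.1 then 1 else 0) * (if b < x.2 then 1 else 0).
have := @dominated_cvg _ _ R (plane R) setT measurableT (fun n x => (g x * phi a b n x)%:E)
  (fun x => (g x * lim x)%:E) (fun x => (`|g x|)%:E).
move=> /(_ _ _ _ _ _) H.
have {H} : (\int[plane R]_x (g x * phi a b n x)%:E)%E @[n --> \oo] --> (\int[plane R]_x (g x * lim x)%:E)%E.
  apply: H.
  - by move=> n; apply/measurable_EFinP; exact: measurable_funM.
  - move=> x _; apply: cvg_EFin; first exact: nearW.
    apply: cvgM; first exact: cvg_cst.
    by apply: cvgM; exact: cvg_bump.
  - by [].
  - exact: integrable_abse gi.
  - by move=> n x _; rewrite /= lee_fin.
under eq_fun do rewrite ii.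
move=> /(cvg_lim (@ereal_hausdorff R)); rewrite lim_cst; last exact: ereal_hausdorff.
move=> ->; rewrite [LHS]integral_mkcond; apply: eq_integral => x _.
rewrite patchE /quadrant/lim; case: ifPn.
  by rewrite inE/= !in_itv/= !andbT => -[-> ->]; rewrite !mulr1.
rewrite notin_setE/= !in_itv/= !andbT => h.
case: ifPn => x1; last by rewrite mul0r mulr0.
by case: ifPn => x2; [exfalso; apply: h|rewrite mulr0 mulr0].
Qed.

(** The finite measures with densities the positive and negative parts of [g] agree on quadrants,
    hence on all measurable sets. *)
Lemma weak_zero : {ae plane R, forall x, g x = 0}.
Proof.
have gp := integrable_funepos measurableT gi; have gn := integrable_funeneg measurableT gi.
pose mp := density (plane R) (measurable_funepos mEg) (funepos_ge0 (EFin \o g)).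
pose mn := density (plane R) (measurable_funeneg mEg) (funeneg_ge0 (EFin \o g)).
have finp A : measurable A -> mp A \is a fin_num.
  by move=> mA; apply: integrable_fin_num => //; exact: (integrableS measurableT).
have finn A : measurable A -> mn A \is a fin_num.
  by move=> mA; apply: integrable_fin_num => //; exact: (integrableS measurableT).
have E A : measurable A -> mp A = mn A.
  apply: (@measure_unique _ R _ quadrants (fun k => quadrant (- k%:R) (- k%:R)) measurable_quadrantsE quadrant_setI).
  - by move=> k; exists (- k%:R), (- k%:R).
  - exact: quadrant_cover.
  - move=> _ [a [b ->]]; have := integral_quadrant0 a b; rewrite integralE -/(mp _) -/(mn _).
    have := finp _ (measurable_quadrant a b); have := finn _ (measurable_quadrant a b).
    change (mn (quadrant a b) \is a fin_num -> mp (quadrant a b) \is a fin_num ->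
      (mp (quadrant a b) - mn (quadrant a b))%E = 0%E -> mp (quadrant a b) = mn (quadrant a b)).
    case: (mp _) => [r| |]//; case: (mn _) => [s| |]// _ _ [] /eqP.
    by rewrite subr_eq0 => /eqP ->.
  - move=> k; have := finp _ (measurable_quadrant (- k%:R) (- k%:R)).
    change (mp (quadrant (- k%:R) (- k%:R)) \is a fin_num -> (mp (quadrant (- k%:R) (- k%:R)) < +oo)%E).
    by case: (mp _) => //= r _; exact: ltry.
have H : ae_eq (plane R) setT (EFin \o g) (cst 0%E).
  apply: integral_ae_eq => // A _ mA; rewrite integral0 integralE.
  change ((mp A - mn A)%E = 0%E); rewrite E// subee//; exact: finn.
by apply: filterS H => x /(_ I)[].
Qed.

End WeakZero.

(** * The Biot-Savart velocity *)

Section NonMeasurable.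
Local Open Scope ereal_scope.
Context d (T : measurableType d) (R : realType) (mu : {measure set T -> \bar R}).

(* These bounds do not ask [f] to be measurable, which spares a measurability proof
   for integrands built with [get]. *)
Lemma ge0_integral_mono (f g : T -> \bar R) : (forall x, 0 <= f x) -> (forall x, f x <= g x) ->
  \int[mu]_x f x <= \int[mu]_x g x.
Proof.
move=> f0 fg; have g0 x : 0 <= g x by exact: le_trans (fg x).
rewrite !ge0_integralTE//; apply: le_ereal_sup => _ [h hf <-]; exists h => // x.
exact: le_trans (hf x) (fg x).
Qed.

Lemma abse_sub_le (a b c : \bar R) : 0 <= a <= c -> 0 <= b <= c -> `|a - b| <= c.
Proof.
move=> /andP[a0 ac] /andP[b0 bc]; case: c ac bc => [c| |]; last 2 first.
- by move=> *; exact: leey.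
- by move=> /(le_trans a0).
case: a a0 => [a| |] //; case: b b0 => [b| |] //; rewrite !lee_fin => b0 a0 ac bc.
by rewrite ler_norml; apply/andP; split; lra.
Qed.

Lemma abse_integral_le (f g : T -> \bar R) : (forall x, `|f x| <= g x) ->
  `|\int[mu]_x f x| <= \int[mu]_x g x.
Proof.
move=> fg; have fE x : `|f x| = f^\+ x + f^\- x by exact: (congr1 (fun h => h x) (fune_abse f)).
rewrite integralE; apply: abse_sub_le; apply/andP; split.
- by apply: integral_ge0 => x _; exact: funepos_ge0.
- apply: ge0_integral_mono => x; first exact: funepos_ge0.
  by apply: le_trans (fg x); rewrite fE leeDl// funeneg_ge0.
- by apply: integral_ge0 => x _; exact: funeneg_ge0.
- apply: ge0_integral_mono => x; first exact: funeneg_ge0.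
  by apply: le_trans (fg x); rewrite fE leeDr// funepos_ge0.
Qed.

Lemma abs_Rintegral_le (f : T -> R) (g : T -> \bar R) : (forall x, (`|f x|%R)%:E <= g x) ->
  (`|(\int[mu]_x f x)%R|%R)%:E <= \int[mu]_x g x.
Proof.
move=> fg; apply: le_trans (abse_integral_le (f := EFin \o f) fg).
rewrite /Rintegral /=; case: (\int[mu]_x _) => [r| |] //=; by rewrite normr0 leey.
Qed.

Lemma abs_Rintegral_le_ae (f : T -> R) (g : T -> \bar R) : measurable_fun setT g -> (forall x, 0 <= g x) ->
  {ae mu, forall x, (`|f x|%R)%:E <= g x} -> (`|(\int[mu]_x f x)%R|%R)%:E <= \int[mu]_x g x.
Proof.
move=> mg g0 [N [mN N0 fgN]].
(* Setting the majorant to [+oo] on the exceptional null set makes the bound hold everywhere without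
   changing the integral, and [f] need not be measurable. *)
pose h x := if x \in N then +oo else g x.
have -> : \int[mu]_x g x = \int[mu]_x h x.
  apply: ge0_ae_eq_integral => //.
  - apply: measurable_fun_ifT => //; apply: (@measurable_fun_bool _ _ _ _ true).
    by rewrite setTI (_ : _ @^-1` _ = N)//; apply/seteqP; split => x /=; [move/set_mem|move/mem_set].
  - by move=> x _; rewrite /h; case: ifP.
  - exists N; split => // x /= xN; apply: contrapT => nN; apply: xN => _.
    by rewrite /h memNset.
apply: abs_Rintegral_le => x; rewrite /h; case: ifPn => [_|]; first exact: leey.
rewrite notin_setE => nN; apply: contrapT => H; apply: nN; exact: fgN.
Qed.

End NonMeasurable.

Lemma measurable_integral_param d1 d2 (T1 : measurableType d1) (T2 : measurableType d2) (R : realType)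
    (m : {sigma_finite_measure set T2 -> \bar R}) (F : T1 * T2 -> \bar R) :
  measurable_fun setT F -> measurable_fun setT (fun x => \int[m]_y F (x, y))%E.
Proof.
move=> mF.
have -> : (fun x => \int[m]_y F (x, y))%E =
    (fun x => \int[m]_y F^\+ (x, y) - \int[m]_y F^\- (x, y))%E.
  apply/funext => x; rewrite integralE; under eq_integral do rewrite funepos_comp/=.
  by under [X in (_ - X)%E = _]eq_integral do rewrite funeneg_comp/=.
apply: emeasurable_funB; apply: measurable_fun_fubini_tonelli_F.
- exact: measurable_funepos.
- by move=> z; exact: funepos_ge0.
- exact: measurable_funeneg.
- by move=> z; exact: funeneg_ge0.
Qed.

Section Velocity.
Context (R : realType) (al : R) (al0 : 0 < al).
Implicit Types (f g : R * R -> R).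

Lemma helmholtz_solB f1 f2 g1 g2 (k : R) : in_L1 f1 -> in_L1 f2 ->
  helmholtz_sol al f1 g1 -> helmholtz_sol al f2 g2 ->
  helmholtz_sol al (fun x => f1 x + k * f2 x) (fun x => g1 x + k * g2 x).
Proof.
move=> L1 L2 [G1 H1] [G2 H2].
have Lg : in_L1 (fun x => g1 x + k * g2 x).
  by apply/in_L1P; apply: integrable_add; [exact/in_L1P|apply: integrable_scale; exact/in_L1P].
split => // phi tphi; have := H1 _ tphi; have := H2 _ tphi.
have [mpsi [M M0 psiM]] := helmholtz_op_bounded al tphi; have [mphi [N N0 phiN]] := test_function_bounded tphi.
have mg1 := in_L1_measurable G1; have mg2 := in_L1_measurable G2.
have mf1 := in_L1_measurable L1; have mf2 := in_L1_measurable L2.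
have bi (f psi : R * R -> R) (K : R) : 0 < K -> in_L1 f -> measurable_fun setT psi -> (forall x, `|psi x| <= K) ->
    (plane R).-integrable setT (EFin \o (fun x => f x * psi x)).
  move=> K0 Lf mp pK; have mf := in_L1_measurable Lf; have [A A0 fA] := in_L1_norm Lf.
  apply: (integrable_bound (h := fun x => K * `|f x|) (B := K * A)).
  - exact: measurable_funM.
  - by apply: measurable_funM => //; exact: measurable_abs.
  - by move=> x; rewrite normrM mulrC ler_wpM2r.
  - by rewrite (integral_EFinZ _ (ltW K0) (measurable_abs mf))// fA.
have mLg := in_L1_measurable Lg.
have mL : measurable_fun setT (fun x => (f1 x + k * f2 x) * phi x).
  by apply: measurable_funM => //; apply: measurable_funD => //; exact: measurable_funM.
rewrite (Rintegral_leb2 (measurable_funM mg2 mpsi)) (Rintegral_leb2 (measurable_funM mf2 mphi)).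
rewrite (Rintegral_leb2 (measurable_funM mg1 mpsi)) (Rintegral_leb2 (measurable_funM mf1 mphi)).
rewrite (Rintegral_leb2 (measurable_funM mLg mpsi)) (Rintegral_leb2 mL).
move=> E2 E1.
transitivity (\int[plane R]_x (g1 x * (phi x - al ^+ 2 * laplacian phi x) + k * (g2 x * (phi x - al ^+ 2 * laplacian phi x)))).
  by apply: eq_Rintegral => x _; rewrite /= mulrDl mulrA.
transitivity (\int[plane R]_x (f1 x * phi x + k * (f2 x * phi x))); last first.
  by apply: eq_Rintegral => x _; rewrite /= mulrDl mulrA.
have b1 := bi _ _ _ M0 G1 mpsi psiM; have b2 := bi _ _ _ M0 G2 mpsi psiM.
have c1 := bi _ _ _ N0 L1 mphi phiN; have c2 := bi _ _ _ N0 L2 mphi phiN.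
rewrite RintegralD; [|by []|exact: b1|exact: integrable_scale b2].
rewrite RintegralD; [|by []|exact: c1|exact: integrable_scale c2].
rewrite RintegralZl; [|by []|exact: b2]; rewrite RintegralZl; [|by []|exact: c2].
by rewrite E1 E2.
Qed.

(** The difference is orthogonal to [helmholtz_op phi] for every test function [phi], hence to [phi]
    itself, and [weak_zero] applies. *)
Lemma helmholtz_sol_unique f g1 g2 : in_L1 f -> helmholtz_sol al f g1 -> helmholtz_sol al f g2 ->
  {ae plane R, forall x, g1 x = g2 x}.
Proof.
move=> L1 S1 S2; have [Lg H] := helmholtz_solB (-1) L1 L1 S1 S2.
have mLg := in_L1_measurable Lg.
have : {ae plane R, forall x, g1 x + -1 * g2 x = 0}.
  apply: (weak_zero Lg); apply: (helmholtz_op_orthogonal al0 Lg) => phi tphi.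
  have [mpsi [M M0 psiM]] := helmholtz_op_bounded al tphi.
  rewrite -Rintegral_leb2; last exact: measurable_funM.
  rewrite (H _ tphi) -[RHS](_ : \int[leb2]_x (0 : R) = 0); last by rewrite /Rintegral integral0.
  by apply: eq_Rintegral => x _; rewrite mulN1r subrr mul0r.
by apply: filterS => x /eqP; rewrite mulN1r subr_eq0 => /eqP.
Qed.

Lemma Halpha_sol f : in_L1 f -> helmholtz_sol al f (Halpha al f).
Proof. by move=> Lf; apply: getPex; exists (resolvent_conv al f); exact: helmholtz_sol_resolvent_conv. Qed.

Lemma Halpha_ae f : in_L1 f -> {ae plane R, forall x, Halpha al f x = resolvent_conv al f x}.
Proof.
by move=> Lf; apply: (helmholtz_sol_unique Lf (Halpha_sol Lf)); exact: helmholtz_sol_resolvent_conv.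
Qed.

Lemma Halpha_measurable f : in_L1 f -> measurable_fun setT (Halpha al f).
Proof. by move=> /Halpha_sol[/in_L1_measurable]. Qed.

Lemma measurable_BS_kernel : measurable_fun setT (fun x : R * R => (BS_kernel x).1) /\
  measurable_fun setT (fun x : R * R => (BS_kernel x).2).
Proof.
have mi : measurable_fun setT (fun x : R * R => (sqeucl x)^-1).
  exact: (measurableT_comp (@measurable_inv R) (@measurable_sqeucl R)).
split; apply: measurable_funM => //; last exact: measurable_fst.
exact: (measurableT_comp (@oppr_measurable R setT) measurable_snd).
Qed.

Lemma BS_kernel_le (x : R * R) : `|(BS_kernel x).1| <= (Num.sqrt (sqeucl x))^-1 /\
  `|(BS_kernel x).2| <= (Num.sqrt (sqeucl x))^-1.
Proof.
have key (r q : R) : r ^+ 2 <= q -> `|q^-1 * r| <= (Num.sqrt q)^-1.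
  move=> rq; have q0 : 0 <= q by exact: le_trans (sqr_ge0 r) rq.
  have [->|qn] := eqVneq q 0; first by rewrite invr0 mul0r sqrtr0 invr0 normr0.
  have qp : 0 < q by rewrite lt_def qn.
  have sp : 0 < Num.sqrt q by rewrite sqrtr_gt0.
  rewrite normrM ger0_norm ?invr_ge0// mulrC ler_pdivrMr// -[X in _ * X](sqr_sqrtr q0) expr2.
  by rewrite mulKf ?gt_eqF// -sqrtr_sqr ler_sqrt.
by split; apply: key; rewrite /= ?sqrrN /sqeucl ?lerDl ?lerDr sqr_ge0.
Qed.

(** A velocity component with the chosen solution [Halpha] replaced by its explicit representative,
    for which measurability and symmetry can be proved. *)
Definition kernel_comp (K : R * R -> R) f (x : R * R) : R := \int[plane R]_y (K (x - y) * resolvent_conv al f y).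

Section components.
Variables (K : R * R -> R) (mK : measurable_fun setT K) (K_le : forall x, `|K x| <= (Num.sqrt (sqeucl x))^-1).

Lemma kernel_comp_Halpha f (x : R * R) : in_L1 f -> \int[leb2]_y (K (x - y) * Halpha al f y) = kernel_comp K f x.
Proof.
move=> Lf; have mKx : measurable_fun setT (fun y : R * R => K (x - y)) by exact: (measurableT_comp mK (measurable_csub x)).
have mH := Halpha_measurable Lf.
have mr := in_L1_measurable (in_L1_resolvent_conv al0 Lf).
rewrite Rintegral_leb2; last exact: measurable_funM.
apply: ae_eq_Rintegral; [exact: measurable_funM|exact: measurable_funM|].
by apply: filterS (Halpha_ae Lf) => y ->.
Qed.

Lemma kernel_comp_le f (x : R * R) : in_L1 f ->
  ((`|kernel_comp K f x|)%:E <= V al (fun y => (`|f y|)%:E) x)%E.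
Proof.
move=> Lf; apply: abs_Rintegral_le => y; rewrite normrM EFinM.
apply: lee_pmul; [by rewrite lee_fin|by rewrite lee_fin|by rewrite lee_fin; exact: K_le|].
exact: (resolvent_conv_le al Lf).
Qed.

Lemma V_abs_le f (A : R) x : in_L1 f -> (\int[plane R]_x (`|f x|)%:E <= A%:E)%E ->
  (V al (fun y => (`|f y|)%:E) x <= (velocity_cst al * A)%:E)%E.
Proof.
move=> Lf fA; have m : measurable_fun setT (fun y => (`|f y|)%:E).
  by apply/measurable_EFinP; exact: measurable_abs (in_L1_measurable Lf).
have p y : (0 <= (`|f y|)%:E)%E by rewrite lee_fin.
exact: (V_le al0 m p fA x).
Qed.

Lemma kernel_comp_integrable f (x : R * R) : in_L1 f ->
  (plane R).-integrable setT (EFin \o (fun y => K (x - y) * resolvent_conv al f y)).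
Proof.
move=> Lf; have mKx : measurable_fun setT (fun y : R * R => K (x - y)) by exact: (measurableT_comp mK (measurable_csub x)).
have mr := in_L1_measurable (in_L1_resolvent_conv al0 Lf).
apply/integrableP; split; first by apply/measurable_EFinP; exact: measurable_funM.
have [A A0 fA] := in_L1_norm Lf.
have fA' : (\int[plane R]_x (`|f x|)%:E <= A%:E)%E by rewrite fA.
apply: le_lt_trans (le_lt_trans (V_abs_le x Lf fA') (ltry _)).
apply: ge0_integral_mono => y; first exact: abse_ge0.
rewrite /= normrM EFinM.
apply: lee_pmul; [by rewrite lee_fin|by rewrite lee_fin|by rewrite lee_fin; exact: K_le|].
exact: (resolvent_conv_le al Lf).
Qed.

(** The explicit representative is linear only almost everywhere, since its defining integral may
    diverge on a null set; this is obtained from uniqueness for the Helmholtz equation. *)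
Lemma kernel_comp_linear f1 f2 (k : R) (x : R * R) : in_L1 f1 -> in_L1 f2 ->
  kernel_comp K (fun y => f1 y + k * f2 y) x = kernel_comp K f1 x + k * kernel_comp K f2 x.
Proof.
move=> L1 L2; have S1 := helmholtz_sol_resolvent_conv al0 L1; have S2 := helmholtz_sol_resolvent_conv al0 L2.
have S := helmholtz_solB k L1 L2 S1 S2.
have L : in_L1 (fun y => f1 y + k * f2 y).
  by apply/in_L1P; apply: integrable_add; [exact/in_L1P|apply: integrable_scale; exact/in_L1P].
have E := helmholtz_sol_unique L (helmholtz_sol_resolvent_conv al0 L) S.
have i1 := kernel_comp_integrable x L1; have i2 := kernel_comp_integrable x L2.
rewrite -[X in _ = _ + X]RintegralZl; [|by []|exact: i2].
rewrite -RintegralD; [|by []|exact: i1|exact: integrable_scale i2].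
have mKx : measurable_fun setT (fun y : R * R => K (x - y)) by exact: (measurableT_comp mK (measurable_csub x)).
have mr := in_L1_measurable (in_L1_resolvent_conv al0 L).
have mr1 := in_L1_measurable (in_L1_resolvent_conv al0 L1).
have mr2 := in_L1_measurable (in_L1_resolvent_conv al0 L2).
apply: ae_eq_Rintegral.
- exact: measurable_funM.
- by apply: measurable_funD; [exact: measurable_funM|apply: measurable_funM => //; exact: measurable_funM].
- by apply: filterS E => y ->; rewrite mulrDr mulrCA.
Qed.

Lemma measurable_kernel_comp f : in_L1 f -> measurable_fun setT (kernel_comp K f).
Proof.
move=> Lf; apply: (measurableT_comp (@fine_measurable R setT measurableT)).
apply: (measurable_integral_param (plane R) (F := fun z : (R * R) * (R * R) => (K (z.1 - z.2) * resolvent_conv al f z.2)%:E)).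
apply/measurable_EFinP; apply: measurable_funM; first exact: (measurableT_comp mK (@measurable_sub2 R)).
exact: (measurableT_comp (in_L1_measurable (in_L1_resolvent_conv al0 Lf)) measurable_snd).
Qed.

End components.

Let K1 (x : R * R) := (BS_kernel x).1.
Let K2 (x : R * R) := (BS_kernel x).2.
Let mK1 : measurable_fun setT K1 := measurable_BS_kernel.1.
Let mK2 : measurable_fun setT K2 := measurable_BS_kernel.2.
Let K1_le x : `|K1 x| <= (Num.sqrt (sqeucl x))^-1 := (BS_kernel_le x).1.
Let K2_le x : `|K2 x| <= (Num.sqrt (sqeucl x))^-1 := (BS_kernel_le x).2.

Definition velocity f x : R * R := (2 * pi)^-1 *: (kernel_comp K1 f x, kernel_comp K2 f x).

Lemma velocityE f x : in_L1 f -> BS (Halpha al f) x = velocity f x.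
Proof.
by move=> Lf; rewrite /BS /velocity (kernel_comp_Halpha mK1 x Lf) (kernel_comp_Halpha mK2 x Lf).
Qed.

Lemma measurable_velocity f : in_L1 f -> measurable_fun setT (fun x => (velocity f x).1) /\
  measurable_fun setT (fun x => (velocity f x).2).
Proof. by move=> Lf; split; apply: measurable_funM => //; exact: measurable_kernel_comp. Qed.

Lemma velocity_linear f1 f2 (k : R) x : in_L1 f1 -> in_L1 f2 ->
  velocity (fun y => f1 y + k * f2 y) x = velocity f1 x + k *: velocity f2 x.
Proof.
move=> L1 L2; rewrite /velocity (kernel_comp_linear mK1 K1_le k x L1 L2) (kernel_comp_linear mK2 K2_le k x L1 L2).
move: (kernel_comp K1 f1 x) (kernel_comp K1 f2 x) (kernel_comp K2 f1 x) (kernel_comp K2 f2 x) ((2 * pi)^-1) => A B C D q.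
by congr pair; rewrite /= /GRing.scale/=; ring.
Qed.

(** The length is at most the sum of the absolute values of the components, hence at most twice [V];
    the factor [1 / (2 pi)] absorbs the [2]. *)
Lemma velocity_le f x : in_L1 f ->
  ((Num.sqrt (sqeucl (velocity f x)))%:E <= V al (fun y => (`|f y|)%:E) x)%E.
Proof.
move=> Lf; have := kernel_comp_le K1_le x Lf; have := kernel_comp_le K2_le x Lf.
have : (0 <= V al (fun y => (`|f y|)%:E) x)%E by apply: V_ge0 => y; rewrite lee_fin.
case: (V _ _ x) => [r| |] //; last by move=> *; exact: leey.
rewrite !lee_fin => r0 k2 k1; rewrite /velocity.
move: (kernel_comp K1 f x) (kernel_comp K2 f x) k1 k2 => p q pr qr.
have pi1 := pi_gt1 R; have pi0 : 0 < pi :> R := pi_gt0 R.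
have P0 : 0 < (2 * pi : R)^-1 by rewrite invr_gt0 mulr_gt0.
have -> : sqeucl ((2 * pi)^-1 *: (p, q)) = ((2 * pi)^-1) ^+ 2 * (p ^+ 2 + q ^+ 2).
  by move: ((2 * pi)^-1) => k; rewrite /sqeucl /= /GRing.scale/= mulrDr !exprMn.
rewrite sqrtrM ?sqr_ge0// sqrtr_sqr ger0_norm ?(ltW P0)// ler_pdivrMl ?mulr_gt0//.
apply: (@le_trans _ _ (`|p| + `|q|)).
  rewrite -(ger0_norm (addr_ge0 (normr_ge0 p) (normr_ge0 q))) -sqrtr_sqr ler_sqrt ?sqr_ge0// sqrrD !real_normK ?num_real//.
  by rewrite addrAC lerDl mulrn_wge0// mulr_ge0.
apply: (le_trans (lerD pr qr)); have : 0 <= (pi - 1) * r by rewrite mulr_ge0// subr_ge0 ltW.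
by move: (pi : R) => P; lra.
Qed.

Section reflection.
Variables (c s : R) (cs : c ^+ 2 + s ^+ 2 = 1).

Lemma refl_sqeucl (x : R * R) : sqeucl (refl c s x) = sqeucl x.
Proof.
rewrite /sqeucl /refl/= -[RHS]mul1r -cs; ring.
Qed.

Lemma reflB (x y : R * R) : refl c s (x - y) = refl c s x - refl c s y.
Proof. by congr pair; rewrite /=; ring. Qed.

Lemma BS_kernel_refl (x : R * R) : K1 (refl c s x) = - (c * K1 x + s * K2 x) /\
  K2 (refl c s x) = - (s * K1 x - c * K2 x).
Proof.
rewrite /K1 /K2 /BS_kernel refl_sqeucl /= /GRing.scale/=; split; ring.
Qed.

Variables (f : R * R -> R) (Lf : in_L1 f) (fS : forall x, f (refl c s x) = f x).

Lemma resolvent_conv_refl x : resolvent_conv al f (refl c s x) = resolvent_conv al f x.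
Proof.
have mh : measurable_fun setT (fun y : R * R => Gr al (refl c s x - y) * f y).
  apply: measurable_funM; last exact: in_L1_measurable.
  exact: (measurableT_comp (measurable_Gr al) (measurable_csub _)).
apply: (etrans (esym (Rintegral_refl cs mh))); apply: eq_Rintegral => y _.
have GS : Gr al (refl c s x - refl c s y) = Gr al (x - y).
  by rewrite -reflB; apply: (f_equal fine); exact: Gk_sqeucl (refl_sqeucl _).
by rewrite fS GS.
Qed.

Lemma kernel_comp_refl (K : R * R -> R) (x : R * R) : measurable_fun setT K ->
  kernel_comp K f (refl c s x) = \int[plane R]_y (K (refl c s (x - y)) * resolvent_conv al f y).
Proof.
move=> mK; have mh : measurable_fun setT (fun y : R * R => K (refl c s x - y) * resolvent_conv al f y).
  apply: measurable_funM; last exact: in_L1_measurable (in_L1_resolvent_conv al0 Lf).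
  exact: (measurableT_comp mK (measurable_csub _)).
apply: (etrans (esym (Rintegral_refl cs mh))); apply: eq_Rintegral => y _.
by rewrite resolvent_conv_refl reflB.
Qed.

Lemma velocity_refl (x : R * R) : velocity f (refl c s x) = - refl c s (velocity f x).
Proof.
have i1 := kernel_comp_integrable mK1 K1_le x Lf; have i2 := kernel_comp_integrable mK2 K2_le x Lf.
have E1 : kernel_comp K1 f (refl c s x) = - c * kernel_comp K1 f x + - s * kernel_comp K2 f x.
  rewrite (kernel_comp_refl _ mK1) /kernel_comp -(RintegralZl (- c) measurableT i1) -(RintegralZl (- s) measurableT i2).
  rewrite -RintegralD; [|by []|exact: integrable_scale i1|exact: integrable_scale i2].
  by apply: eq_Rintegral => y _; rewrite (BS_kernel_refl _).1; ring.
have E2 : kernel_comp K2 f (refl c s x) = - s * kernel_comp K1 f x + c * kernel_comp K2 f x.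
  rewrite (kernel_comp_refl _ mK2) /kernel_comp -(RintegralZl (- s) measurableT i1) -(RintegralZl c measurableT i2).
  rewrite -RintegralD; [|by []|exact: integrable_scale i1|exact: integrable_scale i2].
  by apply: eq_Rintegral => y _; rewrite (BS_kernel_refl _).2; ring.
rewrite /velocity E1 E2; move: ((2 * pi)^-1) => q; congr pair; rewrite /= /GRing.scale/=; ring.
Qed.

End reflection.

End Velocity.

(** * The flux against the gradient of the heat kernel *)

Section ConvDot.
Context (R : realType) (al : R) (al0 : 0 < al).
Implicit Types (f w om : R * R -> R).

Lemma measurable_dot_grad_heat (tau : R) (x : R * R) (F1 F2 : R * R -> R) : 0 < tau ->
  measurable_fun setT F1 -> measurable_fun setT F2 ->
  measurable_fun setT (fun y : R * R => dot (grad (heat_kernel tau) (x - y)) (F1 y, F2 y)).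
Proof.
move=> t0 m1 m2.
have E : (fun y : R * R => dot (grad (heat_kernel tau) (x - y)) (F1 y, F2 y)) = fun y =>
    (- ((x - y).1 / (2 * tau)) * heat_kernel tau (x - y)) * F1 y +
    (- ((x - y).2 / (2 * tau)) * heat_kernel tau (x - y)) * F2 y.
  by apply/funext => y; rewrite /dot /grad/= partial1_heat_kernel// partial2_heat_kernel.
rewrite E; have mx := measurable_csub x.
have mh : measurable_fun setT (fun y : R * R => heat_kernel tau (x - y)) by exact: (measurableT_comp (measurable_heat_kernel tau) mx).
have ma : measurable_fun setT (fun y : R * R => (x - y).1) by exact: (measurableT_comp measurable_fst mx).
have mb : measurable_fun setT (fun y : R * R => (x - y).2) by exact: (measurableT_comp measurable_snd mx).
have mN : measurable_fun setT (fun r : R => - (r / (2 * tau))).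
  by apply: (measurableT_comp (@oppr_measurable R setT)); exact: measurable_funM.
apply: measurable_funD.
  by apply: measurable_funM; [apply: measurable_funM; [exact: (measurableT_comp mN ma)|exact: mh]|exact: m1].
by apply: measurable_funM; [apply: measurable_funM; [exact: (measurableT_comp mN mb)|exact: mh]|exact: m2].
Qed.

Definition flux f y : R * R := f y *: velocity al f y.

Lemma sqeuclZ (k : R) (v : R * R) : Num.sqrt (sqeucl (k *: v)) = `|k| * Num.sqrt (sqeucl v).
Proof.
have -> : sqeucl (k *: v) = k ^+ 2 * sqeucl v by rewrite /sqeucl /= /GRing.scale/= mulrDr !exprMn.
by rewrite sqrtrM ?sqr_ge0// sqrtr_sqr.
Qed.

Lemma dot_grad_heat_scale_velocity (tau k : R) (x y : R * R) f : 0 < tau -> in_L1 f ->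
  ((`|dot (grad (heat_kernel tau) (x - y)) (k *: velocity al f y)|)%:E <=
   (2 * tau `^ (- 2^-1))%:E * (hkp (2 * tau) (x - y)%R * (V al (fun y => (`|f y|)%:E) y * (`|k|)%:E)))%E.
Proof.
move=> t0 Lf; have H := dot_grad_heat_kernel (x - y) (k *: velocity al f y) t0.
have t2 : 0 < 2 * tau by rewrite mulr_gt0.
apply: (@le_trans _ _ ((2 * tau `^ (- 2^-1) * heat_kernel (2 * tau) (x - y) * (`|k| * Num.sqrt (sqeucl (velocity al f y))))%:E)).
  by rewrite lee_fin -sqeuclZ.
rewrite -mulrA EFinM lee_wpmul2l ?lee_fin ?mulr_ge0 ?powR_ge0//.
rewrite (hkpE t2) EFinM lee_wpmul2l ?lee_fin ?heat_kernel_ge0 ?(ltW t2)//.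
by rewrite mulrC EFinM lee_wpmul2r ?lee_fin//; exact: velocity_le.
Qed.

Section cancellation.
Variables (om : R * R -> R) (Lom : in_L1 om).
Hypothesis om_radial : forall c s : R, c ^+ 2 + s ^+ 2 = 1 -> forall x, om (refl c s x) = om x.
Variables (tau : R) (t0 : 0 < tau) (x : R * R).

Let q (y : R * R) : R := dot (grad (heat_kernel tau) (x - y)) (flux om y).

Lemma measurable_dot_flux : measurable_fun setT q.
Proof.
have [v1 v2] := measurable_velocity al0 Lom; have mom := in_L1_measurable Lom.
exact: (@measurable_dot_grad_heat tau x (fun y => om y * (velocity al om y).1) (fun y => om y * (velocity al om y).2)
  t0 (measurable_funM mom v1) (measurable_funM mom v2)).
Qed.

Lemma integrable_dot_flux : (plane R).-integrable setT (EFin \o q).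
Proof.
have [A A0 omA] := in_L1_norm Lom; have mom := in_L1_measurable Lom.
have omA' : (\int[plane R]_x (`|om x|)%:E <= A%:E)%E by rewrite omA.
pose k : R := 2 * tau `^ (- 2^-1) * (2 * tau)^-1 * (velocity_cst al * A).
have t2 : 0 < 2 * tau by rewrite mulr_gt0.
have vc := velocity_cst_gt0 al.
have k0 : 0 <= k.
  have ti : 0 <= (2 * tau)^-1 by rewrite invr_ge0 ltW.
  have vA : 0 <= velocity_cst al * A by rewrite mulr_ge0// ltW.
  by rewrite /k mulr_ge0// mulr_ge0// mulr_ge0// powR_ge0.
apply: (integrable_bound (h := fun y => k * `|om y|) (B := k * A)).
- exact: measurable_dot_flux.
- by apply: measurable_funM => //; exact: measurable_abs.
- move=> y; apply: (le_trans (dot_grad_heat_kernel (x - y) (flux om y) t0)).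
  have vy : Num.sqrt (sqeucl (velocity al om y)) <= velocity_cst al * A.
    by rewrite -lee_fin; apply: (le_trans (velocity_le al y Lom)); exact: V_abs_le.
  have h1 := heat_kernel_le (x - y) t2; have h0 := heat_kernel_ge0 (x - y) (ltW t2).
  rewrite sqeuclZ /k; have s0 := sqrtr_ge0 (sqeucl (velocity al om y)).
  have p0 : 0 <= 2 * tau `^ (- 2^-1) by rewrite mulr_ge0// powR_ge0.
  move: (heat_kernel _ _) h0 h1 (Num.sqrt _) vy s0 => h h0 h1 v vA v0.
  rewrite -!(mulrA (2 * _)) ler_wpM2l//; apply: (@le_trans _ _ ((2 * tau)^-1 * (`|om y| * v))).
    by rewrite ler_wpM2r// mulr_ge0.
  by rewrite -mulrA ler_wpM2l ?invr_ge0 ?(ltW t2)// mulrC ler_wpM2r.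
- by rewrite (integral_EFinZ _ k0 (measurable_abs mom))// omA.
Qed.

Lemma grad_heat_refl (c s : R) (z : R * R) : c ^+ 2 + s ^+ 2 = 1 ->
  grad (heat_kernel tau) (refl c s z) = refl c s (grad (heat_kernel tau) z).
Proof.
move=> cs; rewrite /grad !partial1_heat_kernel// !partial2_heat_kernel//.
have -> : heat_kernel tau (refl c s z) = heat_kernel tau z by rewrite /heat_kernel refl_sqeucl.
by congr pair; rewrite /=; ring.
Qed.

(* The reflection across the line through [x] and the origin maps the integrand to its
   opposite. *)
Lemma flux_radial_cancel : \int[plane R]_y q y = 0.
Proof.
have [c [s [cs xE]]] : exists c s : R, c ^+ 2 + s ^+ 2 = 1 /\ refl c s x = x.
  have [x0|x0] := eqVneq (sqeucl x) 0.
    exists 1, 0; split; first by rewrite expr1n expr0n addr0.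
    move: x0 => /eqP; rewrite paddr_eq0 ?sqr_ge0// !sqrf_eq0 => /andP[/eqP x1 /eqP x2].
    by case: (x) x1 x2 => a b /= -> ->; rewrite /refl/= !mulr0 addr0 subr0.
  (* The cosine and sine of twice the polar angle of [x]. *)
  exists ((x.1 ^+ 2 - x.2 ^+ 2) / sqeucl x), (2 * x.1 * x.2 / sqeucl x); move: x0; rewrite /sqeucl => x0; split.
    by field.
  by rewrite [RHS]surjective_pairing; congr pair; rewrite /=; field.
have E y : q (refl c s y) = - q y.
  rewrite /q /flux -{1}xE -reflB grad_heat_refl// om_radial// (velocity_refl al0 cs Lom (om_radial cs)).
  move: (grad _ _) (velocity _ _ _) (om y) => [p1 p2] [v1 v2] o.
  rewrite /dot /refl /= /GRing.scale/= -[RHS]mulr1 -cs; ring.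
have H := Rintegral_refl cs measurable_dot_flux.
have : \int[plane R]_y q (refl c s y) = - \int[plane R]_y q y.
  rewrite -mulN1r -(RintegralZl (-1) measurableT integrable_dot_flux); apply: eq_Rintegral => y _.
  by rewrite E mulN1r.
by rewrite H => /eqP; rewrite -addr_eq0 -mulr2n mulrn_eq0/= => /eqP.
Qed.

End cancellation.

(** The flux of [w + a om] has four terms. The one quadratic in [om] integrates to zero by
    [flux_radial_cancel]; the other three are bounded in absolute value. *)
Lemma conv_dot_split f w om (a tau : R) (x : R * R) : in_L1 w -> in_L1 om ->
  (forall c s : R, c ^+ 2 + s ^+ 2 = 1 -> forall x, om (refl c s x) = om x) ->
  (forall y, f y = w y + a * om y) -> 0 < tau ->
  ((`|conv_dot (grad (heat_kernel tau)) (fun y => f y *: BS (Halpha al f) y) x|)%:E <=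
   (2 * tau `^ (- 2^-1))%:E * conv (hkp (2 * tau)) (fun y =>
     V al (fun y => (`|w y|)%:E) y * (`|w y|)%:E + (V al (fun y => (`|om y|)%:E) y * (`|a * w y|)%:E
     + V al (fun y => (`|w y|)%:E) y * (`|a * om y|)%:E)) x)%E.
Proof.
move=> Lw Lom radial fE t0.
have fE' : f = fun y => w y + a * om y by exact/funext.
have Lf : in_L1 f.
  by rewrite fE'; apply/in_L1P; apply: integrable_add; [exact/in_L1P|apply: integrable_scale; exact/in_L1P].
have mw := in_L1_measurable Lw; have mom := in_L1_measurable Lom; have mf := in_L1_measurable Lf.
have [vw1 vw2] := measurable_velocity al0 Lw; have [vo1 vo2] := measurable_velocity al0 Lom.
have [vf1 vf2] := measurable_velocity al0 Lf.
pose d (y : R * R) (v : R * R) := dot (grad (heat_kernel tau) (x - y)) v.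
pose p y := d y (w y *: velocity al w y) + (d y ((a * w y) *: velocity al om y) + d y ((a * om y) *: velocity al w y)).
pose q y := d y (flux om y).
have fluxE y : d y (f y *: BS (Halpha al f) y) = p y + a ^+ 2 * q y.
  have vE : velocity al f y = velocity al w y + a *: velocity al om y.
    by rewrite -(velocity_linear al0 a y Lw Lom) -fE'.
  rewrite (velocityE al0 y Lf) vE fE /p /q /flux /d.
  move: (grad _ _) (velocity al w y) (velocity al om y) (w y) (om y) => [p1 p2] [u1 u2] [v1 v2] r1 r2.
  by rewrite /dot /= /GRing.scale/=; ring.
have mdf : measurable_fun setT (fun y => d y (f y *: velocity al f y)).
  exact: (@measurable_dot_grad_heat tau x (fun y => f y * (velocity al f y).1) (fun y => f y * (velocity al f y).2)
    t0 (measurable_funM mf vf1) (measurable_funM mf vf2)).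
have mq : measurable_fun setT q := measurable_dot_flux Lom t0 x.
have qi : (plane R).-integrable setT (EFin \o q) := integrable_dot_flux Lom t0 x.
have q0 : \int[plane R]_y q y = 0 := flux_radial_cancel Lom radial t0 x.
have mp : measurable_fun setT p.
  have -> : p = fun y => d y (f y *: velocity al f y) - a ^+ 2 * q y.
    by apply/funext => y; rewrite -(velocityE al0 y Lf) fluxE addrK.
  apply: measurable_funB; first exact: mdf.
  by apply: measurable_funM; [exact: measurable_cst|exact: mq].
set F := fun y : R * R => (_ + (_ + _))%E.
set g := fun y : R * R => ((2 * tau `^ (- 2^-1))%:E * (hkp (2 * tau) (x - y)%R * F y))%E.
have aw y : (0 <= (`|w y|)%:E)%E by rewrite lee_fin.
have ao y : (0 <= (`|om y|)%:E)%E by rewrite lee_fin.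
have Vw0 y : (0 <= V al (fun y => (`|w y|)%:E) y)%E by apply: V_ge0.
have Vo0 y : (0 <= V al (fun y => (`|om y|)%:E) y)%E by apply: V_ge0.
have maw : measurable_fun setT (fun y => (`|w y|)%:E) by apply/measurable_EFinP; exact: measurable_abs.
have mao : measurable_fun setT (fun y => (`|om y|)%:E) by apply/measurable_EFinP; exact: measurable_abs.
have mVw := measurable_V al maw aw; have mVo := measurable_V al mao ao.
have mF : measurable_fun setT F.
  apply: emeasurable_funD; first exact: emeasurable_funM mVw maw.
  have ma1 : measurable_fun setT (fun y => (`|a * w y|)%:E).
    by apply/measurable_EFinP; apply: measurable_abs; apply: measurable_funM; [exact: measurable_cst|exact: mw].
  have ma2 : measurable_fun setT (fun y => (`|a * om y|)%:E).
    by apply/measurable_EFinP; apply: measurable_abs; apply: measurable_funM; [exact: measurable_cst|exact: mom].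
  exact: (emeasurable_funD (emeasurable_funM mVo ma1) (emeasurable_funM mVw ma2)).
have F0 y : (0 <= F y)%E.
  apply: adde_ge0; first by apply: mule_ge0; [exact: Vw0|rewrite lee_fin].
  by apply: adde_ge0; apply: mule_ge0; [exact: Vo0|rewrite lee_fin|exact: Vw0|rewrite lee_fin].
have mhF : measurable_fun setT (fun y : R * R => hkp (2 * tau) (x - y)%R * F y)%E.
  apply: emeasurable_funM; [exact: (measurableT_comp (@measurable_hkp R _) (measurable_csub x))|exact: mF].
have hF0 (y : R * R) : (0 <= hkp (2 * tau) (x - y)%R * F y)%E by rewrite mule_ge0// hkp_ge0.
have c0 : 0 <= 2 * tau `^ (- 2^-1) by rewrite mulr_ge0// powR_ge0.
have intg : (\int[plane R]_y g y = (2 * tau `^ (- 2^-1))%:E * conv (hkp (2 * tau)) F x)%E.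
  rewrite /g /conv; apply: ge0_integralZl; [exact: measurableT|exact: mhF|by move=> y _; exact: hF0|by rewrite lee_fin].
have pg y : ((`|p y|)%:E <= g y)%E.
  have dist (c h a1 a2 a3 : \bar R) : (0 <= c -> 0 <= h -> 0 <= a1 -> 0 <= a2 -> 0 <= a3 ->
      c * (h * (a1 + (a2 + a3))) = c * (h * a1) + (c * (h * a2) + c * (h * a3)))%E.
    by move=> p1 p2 p3 p4 p5; rewrite !ge0_muleDr ?mule_ge0 ?adde_ge0 ?mule_ge0.
  rewrite /g /F dist; [|by rewrite lee_fin|exact: hkp_ge0|by apply: mule_ge0; [exact: Vw0|rewrite lee_fin]
    |by apply: mule_ge0; [exact: Vo0|rewrite lee_fin]|by apply: mule_ge0; [exact: Vw0|rewrite lee_fin]].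
  apply: (@le_trans _ _ ((`|d y (w y *: velocity al w y)|)%:E + ((`|d y ((a * w y) *: velocity al om y)|)%:E + (`|d y ((a * om y) *: velocity al w y)|)%:E))%E).
    by rewrite -!EFinD lee_fin; apply: (le_trans (ler_normD _ _)); rewrite lerD2l ler_normD.
  apply: leeD; first exact: (dot_grad_heat_scale_velocity _ x y t0 Lw).
  by apply: leeD; [exact: (dot_grad_heat_scale_velocity _ x y t0 Lom)|exact: (dot_grad_heat_scale_velocity _ x y t0 Lw)].
rewrite -intg.
have g0 y : (0 <= g y)%E by rewrite /g mule_ge0// lee_fin.
have mg : measurable_fun setT g by apply: emeasurable_funM; [exact: measurable_cst|exact: mhF].
(* An infinite majorant leaves nothing to prove; a finite one makes [p] integrable, which is what
   allows the radial term to be split off. *)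
have [gy|] := ltP (\int[plane R]_y g y)%E +oo%E; last by rewrite leye_eq => /eqP ->; exact: leey.
have pi : (plane R).-integrable setT (EFin \o p).
  apply/integrableP; split; first by apply/measurable_EFinP.
  by apply: le_lt_trans gy; apply: ge0_integral_mono => y; [exact: abse_ge0|exact: pg].
have -> : conv_dot (grad (heat_kernel tau)) (fun y => f y *: BS (Halpha al f) y) x = \int[plane R]_y p y.
  transitivity (\int[plane R]_y (p y + a ^+ 2 * q y)).
    have mpq : measurable_fun setT (fun y => p y + a ^+ 2 * q y).
      by apply: measurable_funD; [exact: mp|apply: measurable_funM; [exact: measurable_cst|exact: mq]].
    rewrite -(Rintegral_leb2 mpq); apply: eq_Rintegral => y _; exact: fluxE.
  apply: (etrans (RintegralD measurableT pi (integrable_scale (a ^+ 2) qi))).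
  by rewrite (RintegralZl (a ^+ 2) measurableT qi) q0 mulr0 addr0.
exact: (abs_Rintegral_le (plane R) pg).
Qed.

End ConvDot.

(** * Decay of the Duhamel term *)

Section TimeIntegrals.
Context (R : realType).
Implicit Types (s t b mu k : R).

Lemma half_powR b t (r : R) : 0 <= b -> b <= 2 -> 0 <= t -> (1 + t) / 2 <= r -> r `^ (- b) <= 4 * (1 + t) `^ (- b).
Proof.
move=> b0 b2 t0 tr; have t1 : 0 < 1 + t by rewrite ltr_pwDl.
have h0 : 0 < (1 + t) / 2 by rewrite divr_gt0.
have r0 : 0 < r by exact: lt_le_trans tr.
have H : (1 + t) `^ b <= 4 * r `^ b.
  have e4 : (2 : R) `^ b <= 4.
    apply: (@le_trans _ _ (2 `^ 2)); first by rewrite ler_powR// ler1n.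
    by rewrite powR_mulrn// -natrX.
  have -> : 1 + t = 2 * ((1 + t) / 2) by field.
  rewrite powRM ?(ltW h0)//; apply: ler_pM; rewrite ?powR_ge0//.
  by apply: ge0_ler_powR; rewrite ?nnegrE ?(ltW h0) ?(ltW r0).
rewrite !powRN ler_pdivlMr ?powR_gt0// mulrC ler_pdivrMr ?powR_gt0//.
Qed.

Definition rwt b t s := wt b t (t - s).

Lemma rwt_ge0 b t s : 0 <= rwt b t s. Proof. exact: wt_ge0. Qed.

Lemma measurable_rwt b t : measurable_fun setT (rwt b t).
Proof.
apply: (measurableT_comp (measurable_wt b t)); exact: measurable_funB.
Qed.

Lemma rwtE b t s : 0 < s < t -> rwt b t s = (t - s) `^ (- b).
Proof. by move=> /andP[s0 st]; rewrite /rwt /wt subr_gt0 st/= ltrBlDr ltrDl s0. Qed.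

Lemma rwt_out b t s : ~~ (0 < s < t) -> rwt b t s = 0.
Proof.
by rewrite /rwt /wt => h; rewrite subr_gt0 ltrBlDr ltrDl andbC (negbTE h).
Qed.

Lemma rwt_gt0 b t s : 0 < rwt b t s -> 0 < s < t.
Proof. by move=> h; apply: contraT => /rwt_out E; rewrite E ltxx in h. Qed.

Lemma line_reverse (f : R -> \bar R) t : measurable_fun setT f -> (forall x, 0 <= f x)%E ->
  (\int[line R]_s f (t - s)%R = \int[line R]_s f s)%E.
Proof.
move=> mf f0; rewrite -[RHS](line_opp mf f0).
have mg : measurable_fun setT (fun s => f (- s)) by exact: (measurableT_comp mf (@oppr_measurable R setT)).
rewrite -(line_shift (- t) mg (fun s => f0 _)); apply: eq_integral => s _.
by congr f; rewrite opprD opprK addrC.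
Qed.

Lemma integral_rwt b t : 0 <= b -> b < 1 -> 0 < t ->
  (\int[line R]_s (rwt b t s)%:E <= ((1 - b)^-1 * t `^ (1 - b))%:E)%E.
Proof.
move=> b0 b1 t0; rewrite /rwt (@line_reverse (fun s => (wt b t s)%:E)); first exact: integral_wt.
- by apply/measurable_EFinP; exact: measurable_wt.
- by move=> s; rewrite lee_fin wt_ge0.
Qed.

Definition pwt b t s : R := if 0 < s < t then (1 + s) `^ (- b) else 0.

Lemma pwt_ge0 b t s : 0 <= pwt b t s.
Proof. by rewrite /pwt; case: ifP => // _; exact: powR_ge0. Qed.

Lemma measurable_pow1 b : measurable_fun setT (fun s : R => (1 + s) `^ (- b)).
Proof. by apply: (measurableT_comp (measurable_powR _)); exact: measurable_funD. Qed.

Lemma measurable_pwt b t : measurable_fun setT (pwt b t).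
Proof.
apply: measurable_fun_ifT; [|exact: measurable_pow1|by []].
by apply: measurable_and; exact: measurable_fun_ltr.
Qed.

Lemma integral_pwt b t : 0 <= b -> b < 1 -> 0 < t ->
  (\int[line R]_s (pwt b t s)%:E <= ((1 - b)^-1 * (1 + t) `^ (1 - b))%:E)%E.
Proof.
move=> b0 b1 t0; have t1 : 0 < 1 + t by rewrite ltr_pwDl// ltW.
apply: le_trans (integral_wt b0 b1 t1).
rewrite -(line_shift 1 (f := fun s => (wt b (1 + t) s)%:E)); last 2 first.
- by apply/measurable_EFinP; exact: measurable_wt.
- by move=> s; rewrite lee_fin wt_ge0.
apply: ge0_integral_mono => s; rewrite lee_fin; first exact: pwt_ge0.
rewrite /pwt; case: ifP => [/andP[s0 st]|_]; last exact: wt_ge0.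
by rewrite /wt [s + 1]addrC ltrD2l st andbT ltr_pwDl// ltW.
Qed.

Lemma integral_EFin_lin2 d (T : measurableType d) (m : {measure set T -> \bar R}) (f g : T -> R) (k1 k2 A B : R) :
  measurable_fun setT f -> measurable_fun setT g -> (forall x, 0 <= f x) -> (forall x, 0 <= g x) ->
  0 <= k1 -> 0 <= k2 -> (\int[m]_x (f x)%:E <= A%:E)%E -> (\int[m]_x (g x)%:E <= B%:E)%E ->
  (\int[m]_x (k1 * f x + k2 * g x)%:E <= (k1 * A + k2 * B)%:E)%E.
Proof.
move=> mf mg f0 g0 k10 k20 fA gB.
have -> : (\int[m]_x (k1 * f x + k2 * g x)%:E = \int[m]_x (k1 * f x)%:E + \int[m]_x (k2 * g x)%:E)%E.
  rewrite -ge0_integralD//.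
  - by move=> x _; rewrite lee_fin mulr_ge0.
  - by apply/measurable_EFinP; exact: measurable_funM.
  - by move=> x _; rewrite lee_fin mulr_ge0.
  - by apply/measurable_EFinP; exact: measurable_funM.
rewrite !integral_EFinZ// EFinD !EFinM; apply: leeD; exact: lee_wpmul2l.
Qed.

Lemma pow_absorb a c e t : 0 < t -> 0 <= c -> c - a = e -> (1 + t) `^ (- a) * t `^ c <= (1 + t) `^ e.
Proof.
move=> t0 c0 <-; have t1 : 0 < 1 + t by rewrite ltr_pwDl// ltW.
apply: (@le_trans _ _ ((1 + t) `^ (- a) * (1 + t) `^ c)).
  rewrite ler_wpM2l ?powR_ge0//; apply: ge0_ler_powR; rewrite ?nnegrE ?(ltW t0) ?(ltW t1)//.
  by rewrite lerDr.
by rewrite -powRD ?(gt_eqF t1) ?implybT// [- a + c]addrC.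
Qed.

Lemma half2 : 2^-1 + 2^-1 = 1 :> R.
Proof. by lra. Qed.

Section decay.
Variables (mu : R) (mu0 : 0 < mu) (mu2 : mu < 2^-1).

(** The range is split at [1 + s = t - s]. In the early part [(t-s)^(-1/2)] is comparable to
    [(1+t)^(-1/2)], and the integral of [(1+s)^(-mu-1/2)] produces the constant [1 / (1/2 - mu)]; in
    the late part [1 + s] is comparable to [1 + t]. *)
Lemma integral_decay1 t : 0 < t ->
  (\int[line R]_s (2 * rwt 2^-1 t s * (1 + s) `^ (- (mu + 2^-1)))%:E <=
   ((4 / (2^-1 - mu) + 16) * (1 + t) `^ (- mu))%:E)%E.
Proof.
move=> t0; have m0 := mu0; have m2 := mu2; have t1 : 0 < 1 + t by rewrite ltr_pwDl// ltW.
have mb0 : 0 <= mu + 2^-1 by lra.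
have mb1 : mu + 2^-1 < 1 by lra.
apply: (@le_trans _ _ (\int[line R]_s (4 * (1 + t) `^ (- 2^-1) * pwt (mu + 2^-1) t s +
    8 * (1 + t) `^ (- (mu + 2^-1)) * rwt 2^-1 t s)%:E)%E).
  apply: ge0_integral_mono => s; rewrite lee_fin.
    by rewrite mulr_ge0 ?powR_ge0// mulr_ge0// rwt_ge0.
  have [h|/[dup] h /rwt_out ->] := boolP (0 < s < t); last first.
    by rewrite mulr0 mul0r mulr0 addr0 !mulr_ge0 ?powR_ge0// pwt_ge0.
  rewrite /pwt h rwtE//; case/andP: h => s0 st.
  have p1 := powR_ge0 (t - s) (- 2^-1); have p2 := powR_ge0 (1 + s) (- (mu + 2^-1)).
  have p3 := powR_ge0 (1 + t) (- 2^-1); have p4 := powR_ge0 (1 + t) (- (mu + 2^-1)).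
  have [h|h] := leP (1 + s) (t - s).
    apply: ler_wpDr; first by rewrite !mulr_ge0.
    have H : (t - s) `^ (- 2^-1) <= 2 * (1 + t) `^ (- 2^-1).
      have h0 : 0 < (1 + t) / 4 by rewrite divr_gt0.
      have r0 : 0 < t - s by lra.
      have K : (1 + t) `^ 2^-1 <= 2 * (t - s) `^ 2^-1.
        rewrite (_ : 1 + t = 4 * ((1 + t) / 4)); last by field.
        rewrite powRM ?(ltW h0)//; apply: ler_pM; rewrite ?powR_ge0//.
          by rewrite powR12_sqrt// (_ : 4 = 2 ^+ 2) ?sqrtr_sqr ?ger0_norm// -natrX.
        by apply: ge0_ler_powR; rewrite ?nnegrE ?(ltW h0) ?(ltW r0)//; lra.
      by rewrite !powRN ler_pdivlMr ?powR_gt0// mulrC ler_pdivrMr ?powR_gt0.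
    rewrite ler_wpM2r// (_ : 4 * _ = 2 * (2 * (1 + t) `^ (- 2^-1))) ?ler_wpM2l//; ring.
  apply: ler_wpDl; first by rewrite !mulr_ge0.
  have H : (1 + s) `^ (- (mu + 2^-1)) <= 4 * (1 + t) `^ (- (mu + 2^-1)) by apply: half_powR; lra.
  rewrite [leRHS](_ : _ = 2 * (t - s) `^ (- 2^-1) * (4 * (1 + t) `^ (- (mu + 2^-1)))); last by ring.
  by rewrite ler_wpM2l// mulr_ge0.
apply: (le_trans (integral_EFin_lin2 _ _ _ _ _ _ (integral_pwt mb0 mb1 t0) (integral_rwt _ _ t0))).
- exact: measurable_pwt.
- exact: measurable_rwt.
- exact: pwt_ge0.
- exact: rwt_ge0.
- by rewrite mulr_ge0// powR_ge0.
- by rewrite mulr_ge0// powR_ge0.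
- by [].
- by lra.
rewrite lee_fin.
have E1 : (1 + t) `^ (- 2^-1) * (1 + t) `^ (1 - (mu + 2^-1)) = (1 + t) `^ (- mu).
  by rewrite -powRD ?(gt_eqF t1) ?implybT//; congr (_ `^ _); lra.
have E2 : (1 + t) `^ (- (mu + 2^-1)) * t `^ (1 - 2^-1) <= (1 + t) `^ (- mu) by apply: pow_absorb; lra.
have E3 : 1 - (mu + 2^-1) = 2^-1 - mu by lra.
have E4 : (1 - 2^-1)^-1 = 2 :> R by rewrite (_ : 1 - 2^-1 = 2^-1) ?invrK//; lra.
rewrite E4 {1}E3 -E1; move: E2; rewrite -E1.
move: ((2^-1 - mu)^-1) (_ `^ _) (_ `^ _) (_ `^ _) (_ `^ _) => *; lra.
Qed.

Variables (K1 K2 : R) (K10 : 0 <= K1) (K20 : 0 <= K2).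

(** Bound in [L^2] at time [t] for the flux of slice [s]: an old slice is measured in [L^1] and
    smoothed, a recent one is measured in [L^2]. For [K1 = 301] and [K2 = 500] it is [slice_decay]
    at [rho = 1 + s], [tau = t - s]. *)
Definition bdecay (t s : R) : R :=
  if 1 + s <= t - s then (t - s) `^ (- 2^-1) * (K1 * (1 + s) `^ (- (mu + 2^-1)))
  else (1 + s) `^ (- (mu + 1)) + K2 * (1 + s) `^ (- (mu + 3 / 4)) * (t - s) `^ (- (4^-1)).

Lemma bdecay_ge0 t s : 0 <= bdecay t s.
Proof.
have p b r : 0 <= r `^ b :> R by exact: powR_ge0.
have k1 := K10; have k2 := K20; rewrite /bdecay; case: ifP => _.
  by apply: mulr_ge0; [exact: p|apply: mulr_ge0; [exact: k1|exact: p]].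
by apply: addr_ge0; [exact: p|apply: mulr_ge0; [apply: mulr_ge0; [exact: k2|exact: p]|exact: p]].
Qed.

Lemma measurable_bdecay t : measurable_fun setT (bdecay t).
Proof.
have mt b : measurable_fun setT (fun s : R => (t - s) `^ (- b)).
  by apply: (measurableT_comp (measurable_powR _)); exact: measurable_funB.
apply: measurable_fun_ifT.
- by apply: measurable_fun_ler; [exact: measurable_funD|exact: measurable_funB].
- by apply: measurable_funM; [exact: mt|apply: measurable_funM; [exact: measurable_cst|exact: measurable_pow1]].
- apply: measurable_funD; first exact: measurable_pow1.
  by apply: measurable_funM; [apply: measurable_funM; [exact: measurable_cst|exact: measurable_pow1]|exact: mt].
Qed.

(** Same splitting. In the early part [(t-s)^(-1/2)] occurs twice, once from the gradient and once
    from the smoothing, and yields [(1+t)^(-1)]; in the late part the worst singularity is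
    [(t-s)^(-3/4)]. *)
Lemma integral_decay2 t : 0 < t ->
  (\int[line R]_s (2 * rwt 2^-1 t s * bdecay t s)%:E <=
   ((4 * K1 / (2^-1 - mu) + 16 + 32 * K2) * (1 + t) `^ (- (mu + 2^-1)))%:E)%E.
Proof.
move=> t0; have m0 := mu0; have m2 := mu2; have t1 : 0 < 1 + t by rewrite ltr_pwDl// ltW.
have mb0 : 0 <= mu + 2^-1 by lra.
have mb1 : mu + 2^-1 < 1 by lra.
pose c1 := 8 * (1 + t) `^ (- (mu + 1)); pose c2 := 8 * K2 * (1 + t) `^ (- (mu + 3 / 4)).
have c10 : 0 <= c1 by rewrite mulr_ge0// powR_ge0.
have k1 := K10; have k2 := K20.
have c20 : 0 <= c2 by apply: mulr_ge0; [apply: mulr_ge0; [|exact: k2]|exact: powR_ge0].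
pose g s := c1 * rwt 2^-1 t s + c2 * rwt (3 / 4) t s.
have mg : measurable_fun setT g.
  by apply: measurable_funD; apply: measurable_funM => //; exact: measurable_rwt.
have g0 s : 0 <= g s by rewrite addr_ge0// mulr_ge0// rwt_ge0.
have gB : (\int[line R]_s (g s)%:E <= (c1 * ((1 - 2^-1)^-1 * t `^ (1 - 2^-1)) + c2 * ((1 - 3 / 4)^-1 * t `^ (1 - 3 / 4)))%:E)%E.
  have h1 : 0 <= 2^-1 :> R by lra.
  have h2 : 2^-1 < 1 :> R by lra.
  have h3 : 0 <= 3 / 4 :> R by lra.
  have h4 : 3 / 4 < 1 :> R by lra.
  exact: (integral_EFin_lin2 (measurable_rwt _ _) (measurable_rwt _ _) (rwt_ge0 _ _) (rwt_ge0 _ _) c10 c20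
    (integral_rwt h1 h2 t0) (integral_rwt h3 h4 t0)).
apply: (@le_trans _ _ (\int[line R]_s (4 * K1 * (1 + t) `^ (- 1) * pwt (mu + 2^-1) t s + 1 * g s)%:E)%E).
  apply: ge0_integral_mono => s; rewrite lee_fin.
    by rewrite mulr_ge0 ?bdecay_ge0// mulr_ge0// rwt_ge0.
  rewrite mul1r; have [h|/[dup] h /rwt_out ->] := boolP (0 < s < t); last first.
    by rewrite mulr0 mul0r addr_ge0// !mulr_ge0 ?powR_ge0// pwt_ge0.
  rewrite /g /pwt h !rwtE//; case/andP: h => s0 st.
  have tau0 : 0 < t - s by rewrite subr_gt0.
  have p1 := powR_ge0 (t - s) (- 2^-1); have p2 := powR_ge0 (1 + s) (- (mu + 2^-1)).
  have p3 := powR_ge0 (t - s) (- (3 / 4)).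
  rewrite /bdecay; case: ifPn => [h|]; last rewrite -ltNge => h.
    apply: ler_wpDr; first by rewrite addr_ge0// mulr_ge0.
    have H : (t - s) `^ (- 2^-1) * (t - s) `^ (- 2^-1) <= 2 * (1 + t) `^ (- 1).
      rewrite -powRD ?(gt_eqF tau0) ?implybT// (_ : - 2^-1 + - 2^-1 = - 1 :> R); last by field.
      rewrite !powRN !powRr1 ?(ltW tau0) ?(ltW t1)// ler_pdivlMr// mulrC ler_pdivrMr//; lra.
    rewrite (_ : 2 * _ * _ = 2 * K1 * (1 + s) `^ (- (mu + 2^-1)) * ((t - s) `^ (- 2^-1) * (t - s) `^ (- 2^-1))); last by ring.
    rewrite [leRHS](_ : _ = 2 * K1 * (1 + s) `^ (- (mu + 2^-1)) * (2 * (1 + t) `^ (- 1))); last by ring.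
    by rewrite ler_wpM2l// !mulr_ge0.
  apply: ler_wpDl; first by rewrite !mulr_ge0// powR_ge0.
  have H1 : (1 + s) `^ (- (mu + 1)) <= 4 * (1 + t) `^ (- (mu + 1)) by apply: half_powR; lra.
  have H2 : (1 + s) `^ (- (mu + 3 / 4)) <= 4 * (1 + t) `^ (- (mu + 3 / 4)) by apply: half_powR; lra.
  have E : (t - s) `^ (- (3 / 4)) = (t - s) `^ (- 2^-1) * (t - s) `^ (- 4^-1).
    by rewrite -powRD ?(gt_eqF tau0) ?implybT//; congr (_ `^ _); field.
  rewrite E /c1 /c2; have q0 := powR_ge0 (t - s) (- 4^-1).
  move: ((1 + s) `^ (- (mu + 1))) ((1 + t) `^ (- (mu + 1))) ((1 + s) `^ (- (mu + 3 / 4))) ((1 + t) `^ (- (mu + 3 / 4))) H1 H2.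
  move: ((t - s) `^ (- 2^-1)) ((t - s) `^ (- 4^-1)) p1 q0 => T q T0 q0 X1 X2 X3 X4 H1 H2.
  rewrite (_ : 2 * T * _ = 2 * T * X1 + 2 * K2 * (T * q) * X3); last by ring.
  rewrite (_ : 8 * _ * _ + _ = 2 * T * (4 * X2) + 2 * K2 * (T * q) * (4 * X4)); last by ring.
  by apply: lerD; apply: ler_wpM2l => //; rewrite !mulr_ge0.
apply: (le_trans (integral_EFin_lin2 _ _ _ _ _ _ (integral_pwt mb0 mb1 t0) gB)).
- exact: measurable_pwt.
- exact: mg.
- exact: pwt_ge0.
- exact: g0.
- by rewrite !mulr_ge0// powR_ge0.
- by [].
rewrite lee_fin /c1 /c2.
have E1 : (1 + t) `^ (- 1) * (1 + t) `^ (1 - (mu + 2^-1)) = (1 + t) `^ (- (mu + 2^-1)).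
  by rewrite -powRD ?(gt_eqF t1) ?implybT//; congr (_ `^ _); lra.
have E2 : (1 + t) `^ (- (mu + 1)) * t `^ (1 - 2^-1) <= (1 + t) `^ (- (mu + 2^-1)) by apply: pow_absorb; lra.
have E3 : (1 + t) `^ (- (mu + 3 / 4)) * t `^ (1 - 3 / 4) <= (1 + t) `^ (- (mu + 2^-1)) by apply: pow_absorb; lra.
have E4 : 1 - (mu + 2^-1) = 2^-1 - mu by lra.
have E5 : (1 - 2^-1)^-1 = 2 :> R by rewrite (_ : 1 - 2^-1 = 2^-1) ?invrK//; lra.
have E6 : (1 - 3 / 4)^-1 = 4 :> R by rewrite (_ : 1 - 3 / 4 = 4^-1) ?invrK//; lra.
rewrite E5 E6 {1}E4 -E1; move: E2 (ler_wpM2l k2 E3); rewrite -E1.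
move: ((2^-1 - mu)^-1) (_ `^ _) (_ `^ _) (_ `^ _) (_ `^ _) (_ `^ _) (_ `^ _) => *; lra.
Qed.

End decay.

Definition cutwt (T b t s : R) : R := if T < s then (1 + s) `^ (- b) else 0.

Lemma cutwt_ge0 T b t s : 0 <= cutwt T b t s.
Proof. by rewrite /cutwt; case: ifP => // _; exact: powR_ge0. Qed.

Lemma measurable_cutwt T b t : measurable_fun setT (cutwt T b t).
Proof. by apply: measurable_fun_ifT; [exact: measurable_fun_ltr|exact: measurable_pow1|]. Qed.

(** As [d <= 1], [1 + s] is at least half of [1 + t] on the step, and [(t-s)^(-1/2)] has integral at
    most [2 * sqrt d]: this is the smallness gained from a short step. *)
Lemma integral_cutwt T b t d : 0 <= b -> b <= 2 -> 0 <= T -> T < t -> t <= T + d -> 0 < d -> d <= 1 ->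
  (\int[line R]_s (2 * rwt 2^-1 t s * cutwt T b t s)%:E <= (16 * Num.sqrt d * (1 + t) `^ (- b))%:E)%E.
Proof.
move=> b0 b2 T0 Tt td d0 d1; have t0 : 0 < t by exact: le_lt_trans Tt.
pose k := 8 * (1 + t) `^ (- b); have k0 : 0 <= k by rewrite mulr_ge0// powR_ge0.
apply: (@le_trans _ _ (\int[line R]_s (k * rwt 2^-1 (t - T) (s - T))%:E)%E).
  apply: ge0_integral_mono => s; rewrite lee_fin.
    by rewrite !mulr_ge0 ?cutwt_ge0// rwt_ge0.
  rewrite /cutwt; case: ifPn => Ts; last by rewrite mulr0 mulr_ge0// rwt_ge0.
  have [h|/[dup] h /rwt_out ->] := boolP (0 < s < t); last first.
    by rewrite mulr0 mul0r mulr_ge0// rwt_ge0.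
  have h' : 0 < s - T < t - T by rewrite subr_gt0 Ts/= ltrD2r; case/andP: h.
  rewrite !rwtE// (_ : t - T - (s - T) = t - s); last by ring.
  have H : (1 + s) `^ (- b) <= 4 * (1 + t) `^ (- b) by apply: half_powR => //; lra.
  rewrite /k (_ : 8 * _ * _ = 2 * (t - s) `^ (- 2^-1) * (4 * (1 + t) `^ (- b))); last by ring.
  by rewrite ler_wpM2l// mulr_ge0// powR_ge0.
rewrite integral_EFinZ//; last 2 first.
- by apply: (measurableT_comp (measurable_rwt _ _)); exact: measurable_funB.
- by move=> s; exact: rwt_ge0.
have -> : (\int[line R]_s (rwt 2^-1 (t - T) (s - T))%:E = \int[line R]_s (rwt 2^-1 (t - T) s)%:E)%E.
  apply: (@line_shift R (fun s => (rwt 2^-1 (t - T) s)%:E) (- T)).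
  - by apply/measurable_EFinP; exact: measurable_rwt.
  - by move=> s; rewrite lee_fin rwt_ge0.
have tT : 0 < t - T by rewrite subr_gt0.
have I : (\int[line R]_s (rwt 2^-1 (t - T) s)%:E <= ((1 - 2^-1)^-1 * (t - T) `^ (1 - 2^-1))%:E)%E by apply: integral_rwt => //; lra.
apply: (@le_trans _ _ (k%:E * ((1 - 2^-1)^-1 * (t - T) `^ (1 - 2^-1))%:E)%E); first by rewrite lee_wpmul2l// lee_fin.
have E5 : (1 - 2^-1)^-1 = 2 :> R by rewrite (_ : 1 - 2^-1 = 2^-1) ?invrK//; lra.
have E6 : (t - T) `^ (1 - 2^-1) <= Num.sqrt d.
  rewrite (_ : 1 - 2^-1 = 2^-1 :> R); last by lra.
  by rewrite powR12_sqrt ?(ltW tT)// ler_sqrt ?(ltW d0)//; lra.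
rewrite -EFinM lee_fin E5 /k (_ : 16 * _ * _ = 8 * (1 + t) `^ (- b) * (2 * Num.sqrt d)); last by ring.
by rewrite ler_wpM2l// ler_wpM2l.
Qed.

End TimeIntegrals.

(** * Decay of products of velocity and vorticity *)

Section Slices.
Context (R : realType) (al : R) (al0 : 0 < al).
Implicit Types (f h : R * R -> \bar R).

Lemma conv_add (p q1 q2 : R * R -> \bar R) x : measurable_fun setT p ->
  measurable_fun setT q1 -> measurable_fun setT q2 ->
  (forall x, 0 <= p x)%E -> (forall x, 0 <= q1 x)%E -> (forall x, 0 <= q2 x)%E ->
  (conv p (fun y => q1 y + q2 y) x = conv p q1 x + conv p q2 x)%E.
Proof.
move=> mp m1 m2 p0 q10 q20; have mpx : measurable_fun setT (fun y : R * R => p (x - y)).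
  exact: (measurableT_comp mp (measurable_csub x)).
rewrite /conv -ge0_integralD//.
- by apply: eq_integral => y _; rewrite ge0_muleDr.
- by move=> y _; exact: mule_ge0.
- exact: emeasurable_funM.
- by move=> y _; exact: mule_ge0.
- exact: emeasurable_funM.
Qed.

Section slice.
Variables (f h : R * R -> \bar R) (mf : measurable_fun setT f) (mh : measurable_fun setT h).
Hypotheses (f0 : forall x, (0 <= f x)%E) (h0 : forall x, (0 <= h x)%E).
Variables (A1 A2 B1 B2 : R) (A20 : 0 <= A2) (B20 : 0 <= B2).
Hypotheses (f1 : (\int[plane R]_x f x <= A1%:E)%E) (f2 : L2le f A2).
Hypotheses (h1 : (\int[plane R]_x h x <= B1%:E)%E) (h2 : L2le h B2).

Let A10 : 0 <= A1. Proof. by rewrite -lee_fin (le_trans _ f1)// integral_ge0. Qed.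

Let B10 : 0 <= B1. Proof. by rewrite -lee_fin (le_trans _ h1)// integral_ge0. Qed.

Let mV : measurable_fun setT (V al f). Proof. exact: measurable_V. Qed.

Let V0 x : (0 <= V al f x)%E. Proof. exact: V_ge0. Qed.

Let mVh : measurable_fun setT (fun x => V al f x * h x)%E. Proof. exact: emeasurable_funM. Qed.

Let vA0 : 0 <= velocity_cst al * A1.
Proof. by rewrite mulr_ge0// ltW// velocity_cst_gt0. Qed.

Let Vh_le x : (V al f x * h x <= (velocity_cst al * A1)%:E * h x)%E.
Proof. by rewrite lee_wpmul2r//; exact: V_le. Qed.

(** The velocity is bounded through the [L^1] norm of [f] alone, so the bound stays linear in the
    bound of [h]; meant for the current time step. *)
Lemma integral_V_short : (\int[plane R]_x (V al f x * h x) <= (velocity_cst al * A1 * B1)%:E)%E.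
Proof.
apply: (@le_trans _ _ (\int[plane R]_x ((velocity_cst al * A1)%:E * h x))%E).
  by apply: ge0_integral_mono => x; [exact: mule_ge0|exact: Vh_le].
rewrite ge0_integralZl// (EFinM (velocity_cst al * A1)).
by apply: lee_wpmul2l => //; rewrite lee_fin.
Qed.

Lemma L2le_conv_V_short c : L2le (conv (hkp c) (fun x => V al f x * h x)%E) (velocity_cst al * A1 * B2).
Proof.
apply: L2le_conv_hkp; [by rewrite mulr_ge0|exact: mVh|by move=> x; exact: mule_ge0|].
apply: (@L2le_mono R _ (fun x => (velocity_cst al * A1)%:E * h x)%E).
- exact: mVh.
- by apply: emeasurable_funM.
- by move=> x; exact: mule_ge0.
- exact: Vh_le.
- exact: L2leZ.
Qed.

Variables (k rho mu tau : R) (rho1 : 1 <= rho) (t0 : 0 < tau).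
Hypotheses (AB11 : A1 * B1 <= k * rho `^ (- mu)) (AB12 : A1 * B2 <= k * rho `^ (- (mu + 2^-1)))
  (AB22 : A2 * B2 <= k * rho `^ (- (mu + 1))).

Let rho0 : 0 < rho. Proof. exact: lt_le_trans rho1. Qed.

Let r0 : 0 < rho `^ 2^-1. Proof. exact: powR_gt0. Qed.

Let powD (b c : R) : rho `^ b * rho `^ c = rho `^ (b + c).
Proof. by rewrite powRD// (gt_eqF rho0) implybT. Qed.

(** The radius is the diffusive length [rho^(1/2)]: it balances the far field, of order
    [rho^(-mu) / r], and the near field, of order [r * rho^(-mu-1)]. The [301] is [1 + 300]. *)
Let near_far : A1 * B1 / rho `^ 2^-1 + 300 * rho `^ 2^-1 * (A2 * B2) <= k * (301 * rho `^ (- (mu + 2^-1))).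
Proof.
have e1 : rho `^ (- (mu + 2^-1)) = rho `^ (- mu) * rho `^ (- 2^-1) by rewrite powD; congr (_ `^ _); ring.
have e2 : rho `^ (- (mu + 2^-1)) = rho `^ 2^-1 * rho `^ (- (mu + 1)).
  by rewrite powD; congr (_ `^ _); move: (half2 R); lra.
have p1 := powR_ge0 rho (- 2^-1); have p2 := powR_ge0 rho 2^-1.
rewrite -powRN; have H1 := ler_wpM2r p1 AB11; have H2 := ler_wpM2l p2 AB22.
rewrite -(mulrA k) -e1 in H1; rewrite [leRHS]mulrCA -e2 in H2.
move: (rho `^ (- (mu + 2^-1))) (A1 * B1 * _) (A2 * B2) (rho `^ 2^-1) H1 H2 => X Y Z W H1 H2.
have n300 : 0 <= 300 :> R by exact: ler0n.
have n301 : 301 = 1 + 300 :> R by rewrite -natr1 addrC.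
have H3 := ler_wpM2l n300 H2; move: n301 H3; move: (300 : R) (301 : R) => K K' -> H3.
by lra.
Qed.

Lemma integral_V_decay : (\int[plane R]_x (V al f x * h x) <= (k * (301 * rho `^ (- (mu + 2^-1))))%:E)%E.
Proof.
apply: le_trans (integral_V_mul al0 mf f0 f1 A20 f2 mh h0 B20 h1 h2 r0) _.
by rewrite lee_fin; exact: near_far.
Qed.

(** For [rho <= tau] the smoothing from [L^1] to [L^2] is the better bound; for smaller [tau] the
    milder singularity [tau^(-1/4)] is kept to preserve integrability after the factor [tau^(-1/2)]
    of the gradient. *)
Definition slice_decay : R := if rho <= tau then tau `^ (- 2^-1) * (301 * rho `^ (- (mu + 2^-1)))
  else rho `^ (- (mu + 1)) + 500 * rho `^ (- (mu + 3 / 4)) * tau `^ (- (4^-1)).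

Lemma L2le_conv_V_decay : L2le (conv (hkp (2 * tau)) (fun x => V al f x * h x)%E) (k * slice_decay).
Proof.
have t2 : 0 < 2 * tau by rewrite mulr_gt0.
have k0 : 0 <= k.
  by rewrite -(pmulr_lge0 k (powR_gt0 (- mu) rho0)) (le_trans _ AB11)// mulr_ge0.
have dec b : 0 <= b -> (2 * tau) `^ (- b) <= tau `^ (- b).
  move=> b0; rewrite !powRN lef_pV2 ?posrE ?powR_gt0//; apply: ge0_ler_powR; rewrite ?nnegrE ?(ltW t0) ?(ltW t2)//.
  by rewrite ler_peMl ?(ltW t0)// ler1n.
have p1 := powR_ge0 (2 * tau) (- 2^-1); have p2 := powR_ge0 (2 * tau) (- (4^-1)).
have nf0 : 0 <= A1 * B1 / rho `^ 2^-1 + 300 * rho `^ 2^-1 * (A2 * B2).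
  apply: addr_ge0; first by apply: mulr_ge0; [exact: mulr_ge0|rewrite invr_ge0; exact: powR_ge0].
  by apply: mulr_ge0; [apply: mulr_ge0; [exact: ler0n|exact: powR_ge0]|exact: mulr_ge0].
rewrite /slice_decay; case: ifP => _.
  apply: (L2leW _ _ (L2le_conv_V_mul_singular al0 mf f0 f1 A20 f2 mh h0 B20 h1 h2 r0 t2)).
    by apply: mulr_ge0; [exact: p1|exact: nf0].
  rewrite [leRHS]mulrCA; apply: ler_pM; [exact: p1| |by apply: dec|exact: near_far].
  exact: nf0.
apply: (L2leW _ _ (L2le_conv_V_mul al0 mf f0 f1 A20 f2 mh h0 B20 h2 r0 t2)).
  apply: addr_ge0; first by rewrite !mulr_ge0 ?invr_ge0 ?powR_ge0.
  by apply: mulr_ge0; [apply: mulr_ge0; [apply: mulr_ge0; [exact: ler0n|exact: powR_ge0]|exact: powR_ge0]|exact: mulr_ge0].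
have e1 : rho `^ (- (mu + 1)) = rho `^ (- (mu + 2^-1)) * rho `^ (- 2^-1).
  by rewrite powD; congr (_ `^ _); move: (half2 R); lra.
have e2 : rho `^ (- (mu + 3 / 4)) = (rho `^ 2^-1) `^ 2^-1 * rho `^ (- (mu + 1)).
  by rewrite -powRrM powD; congr (_ `^ _); lra.
have q1 := powR_ge0 rho (- 2^-1); have q2 := powR_ge0 (rho `^ 2^-1) 2^-1.
have H1 := ler_wpM2r q1 AB12; rewrite -(mulrA k) -e1 [rho `^ (- 2^-1)]powRN in H1.
have H2 := ler_wpM2l q2 AB22; rewrite [leRHS]mulrCA -e2 in H2.
rewrite mulrDr; apply: lerD; first exact: H1.
have n500 : 0 <= 500 :> R by exact: ler0n.
move: (500 : R) n500 => K K00.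
have d4 : (2 * tau) `^ (- 4^-1) <= tau `^ (- 4^-1) by apply: dec; rewrite invr_ge0.
rewrite (_ : K * _ * _ * _ = (K * (2 * tau) `^ (- 4^-1)) * ((rho `^ 2^-1) `^ 2^-1 * (A2 * B2))); last by ring.
rewrite (_ : k * _ = (K * tau `^ (- 4^-1)) * (k * rho `^ (- (mu + 3 / 4)))); last by ring.
by apply: ler_pM => //; [rewrite mulr_ge0|rewrite !mulr_ge0|rewrite ler_wpM2l].
Qed.

End slice.

End Slices.

(** * Pointwise domination of the Duhamel term *)

Section Duhamel.
Context (R : realType) (al : R) (al0 : 0 < al).

Definition absE (f : R * R -> R) (y : R * R) : \bar R := (`|f y|)%:E.

Lemma absE_ge0 f y : (0 <= absE f y)%E. Proof. by rewrite lee_fin. Qed.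

Lemma measurable_absE f : measurable_fun setT f -> measurable_fun setT (absE f).
Proof. by move=> mf; apply/measurable_EFinP; exact: measurable_abs. Qed.

Variables (w om : R * (R * R) -> R) (a : R).
Hypotheses (mw : measurable_fun setT w) (mom : measurable_fun setT om).

Definition flux_majorant (z : R * (R * R)) : \bar R :=
  (V al (absE (fun y => w (z.1, y))) z.2 * (`|w z|)%:E +
   (V al (absE (fun y => om (z.1, y))) z.2 * (`|a * w z|)%:E +
    V al (absE (fun y => w (z.1, y))) z.2 * (`|a * om z|)%:E))%E.

Lemma measurable_abs3 (f : R * (R * R) -> R) : measurable_fun setT f -> measurable_fun setT (fun z => (`|f z|)%:E).
Proof. by move=> mf; apply/measurable_EFinP; exact: (measurableT_comp (@normr_measurable R setT) mf). Qed.

Lemma measurable_V_abs (f : R * (R * R) -> R) : measurable_fun setT f ->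
  measurable_fun setT (fun z => V al (absE (fun y => f (z.1, y))) z.2).
Proof.
move=> mf; apply: (measurable_V2 al (F := fun z => (`|f z|)%:E)); first exact: measurable_abs3.
by move=> z; rewrite lee_fin.
Qed.

Lemma V_abs_ge0 (f : R * R -> R) y : (0 <= V al (absE f) y)%E.
Proof. by apply: V_ge0 => z; exact: absE_ge0. Qed.

Lemma flux_majorant_ge0 z : (0 <= flux_majorant z)%E.
Proof.
have p (f : R * R -> R) (r : R) y : (0 <= V al (absE f) y * (`|r|)%:E)%E.
  by apply: mule_ge0; [exact: V_abs_ge0|rewrite lee_fin].
by apply: adde_ge0; [exact: p|apply: adde_ge0; exact: p].
Qed.

Lemma measurable_flux_majorant : measurable_fun setT flux_majorant.
Proof.
have mVw := measurable_V_abs mw; have mVo := measurable_V_abs mom.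
have maw : measurable_fun setT (fun z => a * w z) by apply: measurable_funM; [exact: measurable_cst|exact: mw].
have mao : measurable_fun setT (fun z => a * om z) by apply: measurable_funM; [exact: measurable_cst|exact: mom].
exact: (emeasurable_funD (emeasurable_funM mVw (measurable_abs3 mw))
  (emeasurable_funD (emeasurable_funM mVo (measurable_abs3 maw)) (emeasurable_funM mVw (measurable_abs3 mao)))).
Qed.

(** This weight and the time [dtime] are those that [dot_grad_heat_kernel] produces at time
    [t - s]. *)
Definition dweight (t s : R) : R := 2 * rwt 2^-1 t s.
Definition dtime (t s : R) : R := 2 * (t - s).

Lemma dweight_ge0 t s : 0 <= dweight t s.
Proof. by rewrite mulr_ge0// rwt_ge0. Qed.

Lemma measurable_dweight t : measurable_fun setT (dweight t).
Proof. by apply: measurable_funM; [exact: measurable_cst|exact: measurable_rwt]. Qed.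

Lemma measurable_dtime t : measurable_fun setT (dtime t).
Proof. by apply: measurable_funM; [exact: measurable_cst|exact: measurable_funB]. Qed.

Lemma dweight_gt0 t s : 0 < dweight t s -> 0 < s < t.
Proof. by rewrite /dweight pmulr_rgt0// => /rwt_gt0. Qed.

Definition duhamel_majorant t := hsup (dweight t) (dtime t) flux_majorant.

Lemma measurable_duhamel_majorant t : measurable_fun setT (duhamel_majorant t).
Proof.
apply: measurable_hsup; [exact: measurable_dweight|exact: measurable_dtime|exact: measurable_flux_majorant|
  exact: dweight_ge0|exact: flux_majorant_ge0].
Qed.

Lemma duhamel_majorant_ge0 t x : (0 <= duhamel_majorant t x)%E.
Proof. by apply: hsup_ge0; [exact: dweight_ge0|exact: flux_majorant_ge0]. Qed.

Lemma duhamel_le (v : R -> R * R -> R) t x : 0 < t ->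
  {ae line R, forall s, 0 < s < t -> [/\ in_L1 (fun y => w (s, y)), in_L1 (fun y => om (s, y)),
     (forall c e : R, c ^+ 2 + e ^+ 2 = 1 -> forall y, om (s, refl c e y) = om (s, y)) &
     forall y, v s y = w (s, y) + a * om (s, y)]} ->
  ((`|duhamel al v t x|)%:E <= duhamel_majorant t x)%E.
Proof.
move=> t0 H; pose g s := ((dweight t s)%:E * conv (hkp (dtime t s)) (fun y => flux_majorant (s, y)) x)%E.
have g0 s : (0 <= g s)%E.
  apply: mule_ge0; first by rewrite lee_fin dweight_ge0.
  by apply: conv_ge0 => y; [exact: hkp_ge0|exact: flux_majorant_ge0].
have mg : measurable_fun setT g.
  apply: emeasurable_funM; first by apply/measurable_EFinP; exact: measurable_dweight.
  have := measurable_conv_hkp2 (measurable_dtime t) measurable_flux_majorant flux_majorant_ge0.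
  by move=> m2; exact: (measurableT_comp m2 (pair2_measurable x)).
rewrite /duhamel_majorant /hsup -/g -(ge0_integral_lebesgue mg g0) /duhamel Rintegral_mkcond.
apply: abs_Rintegral_le_ae => //.
(* The hypothesis covers interior times only, whereas the Duhamel integral runs over the closed
   interval; its two ends form a null set. *)
have n0 : {ae line R, forall s, s != 0}.
  by exists [set 0]; split; [exact: measurable_set1|exact: line_set1|move=> s /= /negP; rewrite negbK => /eqP].
have nt : {ae line R, forall s, s != t}.
  by exists [set t]; split; [exact: measurable_set1|exact: line_set1|move=> s /= /negP; rewrite negbK => /eqP].
apply/ae_lebesgue; apply: filterS3 H n0 nt => s Hs s0 st.
rewrite patchE; case: ifPn => [|_]; last by rewrite normr0.
rewrite mem_setE in_itv/= => /andP[s0' st'].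
have h : 0 < s < t by rewrite !lt_def s0 s0' eq_sym st st'.
have [L1 L2 rad vE] := Hs h.
have ts : 0 < t - s by rewrite subr_gt0; case/andP: h.
have := conv_dot_split al0 x L1 L2 rad vE ts.
by rewrite /g /dweight (rwtE _ h).
Qed.

End Duhamel.

(** * The total flux of one time slice *)

Section SliceTotal.
Context (R : realType) (al : R) (al0 : 0 < al).
Variables (F G : R * R -> \bar R) (mF : measurable_fun setT F) (mG : measurable_fun setT G).
Hypotheses (F0 : forall x, (0 <= F x)%E) (G0 : forall x, (0 <= G x)%E).
Variables (ab rho tau mu N N' M : R) (b : bool).
Hypotheses (ab0 : 0 <= ab) (rho1 : 1 <= rho) (tau0 : 0 < tau) (mu0 : 0 < mu) (N0 : 0 <= N) (N0' : 0 <= N').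
Hypotheses (F1 : (\int[plane R]_x F x <= (N' * rho `^ (- mu))%:E)%E) (F2 : L2le F (N' * rho `^ (- (mu + 2^-1)))).
Hypotheses (FM : (\int[plane R]_x F x <= M%:E)%E).
Hypotheses (Fb1 : b -> (\int[plane R]_x F x <= (N * rho `^ (- mu))%:E)%E)
  (Fb2 : b -> L2le F (N * rho `^ (- (mu + 2^-1)))).
Hypotheses (G1 : (\int[plane R]_x G x <= 1%:E)%E) (G2 : L2le G (rho `^ (- 2^-1))).

Definition flux3 (x : R * R) : \bar R := (V al F x * F x + (V al G x * (ab%:E * F x) + V al F x * (ab%:E * G x)))%E.

Let powD (e c : R) : rho `^ e * rho `^ c = rho `^ (e + c).
Proof. by rewrite powRD// (gt_eqF (lt_le_trans ltr01 rho1)) implybT. Qed.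

Let pow_le (e c : R) : e <= c -> rho `^ e <= rho `^ c.
Proof. by move=> ec; apply: ler_powR. Qed.

Let p0 (e : R) : 0 <= rho `^ e. Proof. exact: powR_ge0. Qed.

Let mV f : measurable_fun setT f -> (forall x, (0 <= f x)%E) -> measurable_fun setT (V al f).
Proof. by move=> mf f0; exact: measurable_V. Qed.

Let maF : measurable_fun setT (fun x => ab%:E * F x)%E.
Proof. by apply: emeasurable_funM; [exact: measurable_cst|exact: mF]. Qed.

Let maG : measurable_fun setT (fun x => ab%:E * G x)%E.
Proof. by apply: emeasurable_funM; [exact: measurable_cst|exact: mG]. Qed.

Let aF0 x : (0 <= ab%:E * F x)%E. Proof. by apply: mule_ge0; [rewrite lee_fin|exact: F0]. Qed.

Let aG0 x : (0 <= ab%:E * G x)%E. Proof. by apply: mule_ge0; [rewrite lee_fin|exact: G0]. Qed.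

Let aF1 : (\int[plane R]_x (ab%:E * F x) <= (ab * (N' * rho `^ (- mu)))%:E)%E.
Proof. by rewrite ge0_integralZl// [leRHS]EFinM; apply: lee_wpmul2l; rewrite ?lee_fin. Qed.

Let aG1 : (\int[plane R]_x (ab%:E * G x) <= (ab * 1)%:E)%E.
Proof. by rewrite ge0_integralZl// [leRHS]EFinM; apply: lee_wpmul2l; rewrite ?lee_fin. Qed.

Let aF2 : L2le (fun x => ab%:E * F x)%E (ab * (N' * rho `^ (- (mu + 2^-1)))).
Proof. exact: L2leZ. Qed.

Let aG2 : L2le (fun x => ab%:E * G x)%E (ab * rho `^ (- 2^-1)).
Proof. exact: L2leZ. Qed.

Let T1 (x : R * R) : \bar R := (V al F x * F x)%E.
Let T2 (x : R * R) : \bar R := (V al G x * (ab%:E * F x))%E.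
Let T3 (x : R * R) : \bar R := (V al F x * (ab%:E * G x))%E.

Let mT1 : measurable_fun setT T1. Proof. exact: (emeasurable_funM (mV mF F0) mF). Qed.
Let mT2 : measurable_fun setT T2. Proof. exact: (emeasurable_funM (mV mG G0) maF). Qed.
Let mT3 : measurable_fun setT T3. Proof. exact: (emeasurable_funM (mV mF F0) maG). Qed.
Let T10 x : (0 <= T1 x)%E. Proof. by apply: mule_ge0; [apply: V_ge0|exact: F0]. Qed.
Let T20 x : (0 <= T2 x)%E. Proof. by apply: mule_ge0; [apply: V_ge0|exact: aF0]. Qed.
Let T30 x : (0 <= T3 x)%E. Proof. by apply: mule_ge0; [apply: V_ge0|exact: aG0]. Qed.
Let mT23 : measurable_fun setT (fun x => T2 x + T3 x)%E. Proof. exact: emeasurable_funD. Qed.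
Let T230 x : (0 <= T2 x + T3 x)%E. Proof. by apply: adde_ge0. Qed.

Let e1 : rho `^ (- mu) * rho `^ (- mu) <= rho `^ (- mu).
Proof. by rewrite powD; apply: pow_le; move: mu0; lra. Qed.
Let e2 : rho `^ (- mu) * rho `^ (- (mu + 2^-1)) <= rho `^ (- (mu + 2^-1)).
Proof. by rewrite powD; apply: pow_le; move: mu0; lra. Qed.
Let e3 : rho `^ (- (mu + 2^-1)) * rho `^ (- (mu + 2^-1)) <= rho `^ (- (mu + 1)).
Proof. by rewrite powD; apply: pow_le; move: mu0; lra. Qed.
Let e4 : rho `^ (- (mu + 2^-1)) * rho `^ (- 2^-1) = rho `^ (- (mu + 1)).
Proof. by rewrite powD; congr (_ `^ _); move: (half2 R); lra. Qed.
Let e5 : rho `^ (- mu) * rho `^ (- 2^-1) = rho `^ (- (mu + 2^-1)).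
Proof. by rewrite powD; congr (_ `^ _); ring. Qed.

Let mulsq (x y z : R) : x * y <= z -> (N * x) * (N * y) <= (N ^+ 2) * z.
Proof. by move=> h; rewrite (_ : _ * _ = N ^+ 2 * (x * y)); [rewrite ler_wpM2l// sqr_ge0|ring]. Qed.

Let pN e : 0 <= N * rho `^ e. Proof. by apply: mulr_ge0; [exact: N0|exact: p0]. Qed.
Let pN' e : 0 <= N' * rho `^ e. Proof. by apply: mulr_ge0; [exact: N0'|exact: p0]. Qed.
Let abN' e : 0 <= ab * (N' * rho `^ e). Proof. by apply: mulr_ge0; [exact: ab0|exact: pN']. Qed.
Let abp e : 0 <= ab * rho `^ e. Proof. by apply: mulr_ge0; [exact: ab0|exact: p0]. Qed.

Let h2a : 1 * (ab * (N' * rho `^ (- mu))) <= (ab * N') * rho `^ (- mu).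
Proof. by rewrite mul1r mulrA. Qed.
Let h2b : 1 * (ab * (N' * rho `^ (- (mu + 2^-1)))) <= (ab * N') * rho `^ (- (mu + 2^-1)).
Proof. by rewrite mul1r mulrA. Qed.
Let h2c : rho `^ (- 2^-1) * (ab * (N' * rho `^ (- (mu + 2^-1)))) <= (ab * N') * rho `^ (- (mu + 1)).
Proof. by rewrite -e4 [leLHS](_ : _ = ab * N' * (rho `^ (- (mu + 2^-1)) * rho `^ (- 2^-1)))//; ring. Qed.
Let h3a : N' * rho `^ (- mu) * (ab * 1) <= (ab * N') * rho `^ (- mu).
Proof. by rewrite mulr1 mulrC mulrA. Qed.
Let h3b : N' * rho `^ (- mu) * (ab * rho `^ (- 2^-1)) <= (ab * N') * rho `^ (- (mu + 2^-1)).
Proof. by rewrite -e5 [leLHS](_ : _ = ab * N' * (rho `^ (- mu) * rho `^ (- 2^-1)))//; ring. Qed.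
Let h3c : N' * rho `^ (- (mu + 2^-1)) * (ab * rho `^ (- 2^-1)) <= (ab * N') * rho `^ (- (mu + 1)).
Proof. by rewrite -e4 [leLHS](_ : _ = ab * N' * (rho `^ (- (mu + 2^-1)) * rho `^ (- 2^-1)))//; ring. Qed.

(** On a slice with [b] true, the constant [N] is available and the quadratic term is of order
    [N^2]. Otherwise one factor is replaced by the uniform bound [M], so that the large constant
    [N'] enters only linearly. *)
Definition cut_part (e : R) : R := if b then 0 else velocity_cst al * M * (N' * rho `^ e).

Let M0 : 0 <= M. Proof. by rewrite -lee_fin; apply: le_trans FM; exact: integral_ge0. Qed.

Let cut0 e : 0 <= cut_part e.
Proof.
rewrite /cut_part; case: (b) => //; apply: mulr_ge0; last exact: pN'.
by apply: mulr_ge0; [exact/ltW/velocity_cst_gt0|exact: M0].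
Qed.

Let n301 : 0 <= 301 * rho `^ (- (mu + 2^-1)).
Proof. by apply: mulr_ge0; [exact: ler0n|exact: p0]. Qed.

Let sd0 : 0 <= slice_decay rho mu tau.
Proof.
rewrite /slice_decay; case: ifP => _; first by apply: mulr_ge0; [exact: powR_ge0|exact: n301].
apply: addr_ge0; first exact: p0.
by apply: mulr_ge0; [apply: mulr_ge0; [exact: ler0n|exact: p0]|exact: powR_ge0].
Qed.

Let I1 : (\int[plane R]_x T1 x <= (N ^+ 2 * (301 * rho `^ (- (mu + 2^-1))) + cut_part (- mu))%:E)%E.
Proof.
rewrite /cut_part; case: ifPn => bT.
  rewrite addr0; have f1 := Fb1 bT; have f2 := Fb2 bT.
  exact: (integral_V_decay al0 mF mF F0 F0 (pN _) (pN _) f1 f2 f1 f2 rho1 (mulsq e1) (mulsq e3)).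
apply: le_trans (integral_V_short al0 mF mF F0 F0 FM F1) _.
by rewrite lee_fin lerDr; apply: mulr_ge0; [exact: sqr_ge0|exact: n301].
Qed.

Let I2 : (\int[plane R]_x T2 x <= (ab * N' * (301 * rho `^ (- (mu + 2^-1))))%:E)%E.
Proof. exact: (integral_V_decay al0 mG maF G0 aF0 (p0 _) (abN' _) G1 G2 aF1 aF2 rho1 h2a h2c). Qed.

Let I3 : (\int[plane R]_x T3 x <= (ab * N' * (301 * rho `^ (- (mu + 2^-1))))%:E)%E.
Proof. exact: (integral_V_decay al0 mF maG F0 aG0 (pN' _) (abp _) F1 F2 aG1 aG2 rho1 h3a h3c). Qed.

(** Each of the two mixed terms contributes [ab * N']; since [rho >= 1], the surplus decay
    [rho^(-2 mu)] of the quadratic term may be weakened to [rho^(-mu)]. *)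
Lemma integral_flux3 : (\int[plane R]_x flux3 x <=
  ((N ^+ 2 + 2 * ab * N') * (301 * rho `^ (- (mu + 2^-1))) + cut_part (- mu))%:E)%E.
Proof.
rewrite (_ : flux3 = fun x => T1 x + (T2 x + T3 x))%E// ge0_integralD// ge0_integralD//.
apply: le_trans (leeD I1 (leeD I2 I3)) _.
by rewrite -!EFinD lee_fin le_eqVlt; apply/orP; left; apply/eqP; move: (301 * _) (cut_part _) => X Y; ring.
Qed.

Let J1 : L2le (conv (hkp (2 * tau)) T1) (N ^+ 2 * slice_decay rho mu tau + cut_part (- (mu + 2^-1))).
Proof.
rewrite /cut_part; case: ifPn => bT.
  rewrite addr0; have f1 := Fb1 bT; have f2 := Fb2 bT.
  exact: (L2le_conv_V_decay al0 mF mF F0 F0 (pN _) (pN _) f1 f2 f1 f2 rho1 tau0 (mulsq e1) (mulsq e2) (mulsq e3)).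
apply: (L2leW _ _ (L2le_conv_V_short al0 mF mF F0 F0 (pN' _) FM F2 _)).
  by apply: mulr_ge0; [apply: mulr_ge0; [exact/ltW/velocity_cst_gt0|exact: M0]|exact: pN'].
by rewrite lerDr; apply: mulr_ge0; [exact: sqr_ge0|exact: sd0].
Qed.

Let J2 : L2le (conv (hkp (2 * tau)) T2) (ab * N' * slice_decay rho mu tau).
Proof. exact: (L2le_conv_V_decay al0 mG maF G0 aF0 (p0 _) (abN' _) G1 G2 aF1 aF2 rho1 tau0 h2a h2b h2c). Qed.

Let J3 : L2le (conv (hkp (2 * tau)) T3) (ab * N' * slice_decay rho mu tau).
Proof. exact: (L2le_conv_V_decay al0 mF maG F0 aG0 (pN' _) (abp _) F1 F2 aG1 aG2 rho1 tau0 h3a h3b h3c). Qed.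

Lemma L2le_flux3 : L2le (conv (hkp (2 * tau)) flux3)
  ((N ^+ 2 + 2 * ab * N') * slice_decay rho mu tau + cut_part (- (mu + 2^-1))).
Proof.
have mh := @measurable_hkp R (2 * tau); have h0 := @hkp_ge0 R (2 * tau).
have E : conv (hkp (2 * tau)) flux3 =
  (fun x => conv (hkp (2 * tau)) T1 x + (conv (hkp (2 * tau)) T2 x + conv (hkp (2 * tau)) T3 x))%E.
  apply/funext => x.
  rewrite (_ : flux3 = fun x => T1 x + (T2 x + T3 x))%E//.
  by rewrite (conv_add x mh mT1 mT23 h0 T10 T230) (conv_add x mh mT2 mT3 h0 T20 T30).
have mc q : measurable_fun setT q -> (forall x, (0 <= q x)%E) -> measurable_fun setT (conv (hkp (2 * tau)) q).
  by move=> mq q0; exact: measurable_conv.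
have c0 q : (forall x, (0 <= q x)%E) -> forall x, (0 <= conv (hkp (2 * tau)) q x)%E.
  by move=> q0 x; exact: conv_ge0.
have aN0 : 0 <= ab * N' * slice_decay rho mu tau.
  by apply: mulr_ge0; [apply: mulr_ge0; [exact: ab0|exact: N0']|exact: sd0].
have J23 := L2leD (mc _ mT2 T20) (mc _ mT3 T30) (c0 _ T20) (c0 _ T30) aN0 aN0 J2 J3.
have m23 := emeasurable_funD (mc _ mT2 T20) (mc _ mT3 T30).
have J : L2le (conv (hkp (2 * tau)) flux3) ((N ^+ 2 * slice_decay rho mu tau + cut_part (- (mu + 2^-1))) +
   (ab * N' * slice_decay rho mu tau + ab * N' * slice_decay rho mu tau)).
  rewrite E; apply: L2leD J1 J23.
  - exact: mc.
  - exact: m23.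
  - exact: c0.
  - by move=> x; apply: adde_ge0; exact: c0.
  - by apply: addr_ge0; [apply: mulr_ge0; [exact: sqr_ge0|exact: sd0]|exact: cut0].
  - exact: addr_ge0.
apply: (L2leW _ _ J).
  apply: addr_ge0; last exact: addr_ge0.
  by apply: addr_ge0; [apply: mulr_ge0; [exact: sqr_ge0|exact: sd0]|exact: cut0].
by rewrite le_eqVlt; apply/orP; left; apply/eqP; move: (slice_decay _ _ _) (cut_part _) => X Y; ring.
Qed.

End SliceTotal.

(** * Decay of the Duhamel majorant over one time step *)

Section DuhamelDecay.
Context (R : realType) (al : R) (al0 : 0 < al).
Variables (w : R * (R * R) -> R) (a mu N N' M T d t : R).
Hypotheses (mw : measurable_fun setT w) (mu0 : 0 < mu) (mu2 : mu < 2^-1) (N0 : 0 <= N) (N0' : 0 <= N').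
Hypotheses (M0 : 0 <= M) (T0 : 0 <= T) (Tt : T < t) (td : t <= T + d) (d0 : 0 < d) (d1 : d <= 1).
Let w_ s (y : R * R) := w (s, y).
Hypotheses (wN' : {ae line R, forall s, 0 < s < t ->
  (\int[plane R]_x absE (w_ s) x <= (N' * (1 + s) `^ (- mu))%:E)%E /\
  L2le (absE (w_ s)) (N' * (1 + s) `^ (- (mu + 2^-1)))}).
Hypotheses (wM : {ae line R, forall s, 0 < s < t -> (\int[plane R]_x absE (w_ s) x <= M%:E)%E}).
Hypotheses (wN : {ae line R, forall s, 0 < s <= T ->
  (\int[plane R]_x absE (w_ s) x <= (N * (1 + s) `^ (- mu))%:E)%E /\
  L2le (absE (w_ s)) (N * (1 + s) `^ (- (mu + 2^-1)))}).

Definition gauss (z : R * (R * R)) : R := heat_kernel (1 + z.1) z.2.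

Lemma measurable_gauss : measurable_fun setT gauss.
Proof.
have m1 : measurable_fun setT (fun z : R * (R * R) => (1 + z.1, z.2)).
  apply/measurable_fun_pairP; split; last exact: measurable_snd.
  by apply: measurable_funD; [exact: measurable_cst|exact: measurable_fst].
exact: (measurableT_comp (@measurable_heat_kernel2 R) m1).
Qed.

Lemma absE_gauss s : 0 < s -> absE (fun y => gauss (s, y)) = hk (1 + s).
Proof.
move=> s0; apply/funext => y; rewrite /absE /gauss /hk ger0_norm//.
by apply: heat_kernel_ge0; rewrite addr_ge0// ltW.
Qed.

Let slice s : 0 < s < t ->
  (\int[plane R]_x absE (w_ s) x <= (N' * (1 + s) `^ (- mu))%:E)%E /\
  L2le (absE (w_ s)) (N' * (1 + s) `^ (- (mu + 2^-1))) ->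
  (\int[plane R]_x absE (w_ s) x <= M%:E)%E ->
  (0 < s <= T -> (\int[plane R]_x absE (w_ s) x <= (N * (1 + s) `^ (- mu))%:E)%E /\
  L2le (absE (w_ s)) (N * (1 + s) `^ (- (mu + 2^-1)))) ->
  (\int[plane R]_x flux_majorant al w gauss a (s, x) <=
    ((N ^+ 2 + 2 * `|a| * N') * 301 * (1 + s) `^ (- (mu + 2^-1)) +
     velocity_cst al * M * N' * cutwt T mu t s)%:E)%E /\
  L2le (conv (hkp (dtime t s)) (fun x => flux_majorant al w gauss a (s, x)))
    ((N ^+ 2 + 2 * `|a| * N') * bdecay mu 301 500 t s +
     velocity_cst al * M * N' * cutwt T (mu + 2^-1) t s).
Proof.
move=> /andP[s0 st] [F1 F2] FM Fb.
have ms : measurable_fun setT (w_ s) by exact: (measurableT_comp mw (pair1_measurable s)).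
have mF := measurable_absE ms.
have mG : measurable_fun setT (@hk R (1 + s)) by exact: measurable_hk.
have F0 x : (0 <= absE (w_ s) x)%E by exact: absE_ge0.
have s1 : 0 < 1 + s by rewrite addr_gt0.
have G0 x : (0 <= hk (1 + s) x)%E by rewrite lee_fin heat_kernel_ge0// ltW.
have rho1 : 1 <= 1 + s by rewrite lerDl ltW.
have tau0 : 0 < t - s by rewrite subr_gt0.
have Fb1 : s <= T -> (\int[plane R]_x absE (w_ s) x <= (N * (1 + s) `^ (- mu))%:E)%E.
  by move=> sT; apply Fb; rewrite s0.
have Fb2 : s <= T -> L2le (absE (w_ s)) (N * (1 + s) `^ (- (mu + 2^-1))).
  by move=> sT; apply Fb; rewrite s0.
have G1 : (\int[plane R]_x hk (1 + s) x <= 1%:E)%E by rewrite integral_hk.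
have G2 := L2le_hk s1.
have E : (fun x => flux_majorant al w gauss a (s, x)) = flux3 al (absE (w_ s)) (hk (1 + s)) `|a|.
  have nM (r : R) : (`|a * r|%:E = `|a|%:E * `|r|%:E)%E by rewrite normrM EFinM.
  apply/funext => x; rewrite /flux_majorant /flux3 -(absE_gauss s0).
  by rewrite (nM (w (s, x))) (nM (gauss (s, x))).
have cutE e : cut_part al (1 + s) N' M (s <= T) (- e) = velocity_cst al * M * N' * cutwt T e t s.
  rewrite /cut_part /cutwt; case: leP => _; first by rewrite mulr0.
  by rewrite mulrA.
have a0 : 0 <= `|a| by exact: normr_ge0.
split.
  have -> : (\int[plane R]_x flux_majorant al w gauss a (s, x) =
    \int[plane R]_x flux3 al (absE (w_ s)) (hk (1 + s)) `|a| x)%E by rewrite -E.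
  have := integral_flux3 al0 mF mG F0 G0 a0 rho1 mu0 N0 N0' F1 F2 FM Fb1 Fb2 G1 G2.
  by rewrite cutE !mulrA.
rewrite E /dtime.
have := L2le_flux3 al0 mF mG F0 G0 a0 rho1 tau0 mu0 N0 N0' F1 F2 FM Fb1 Fb2 G1 G2.
by rewrite cutE.
Qed.

Let ae_slice : {ae line R, forall s, 0 < dweight t s ->
  (\int[plane R]_x flux_majorant al w gauss a (s, x) <=
    ((N ^+ 2 + 2 * `|a| * N') * 301 * (1 + s) `^ (- (mu + 2^-1)) +
     velocity_cst al * M * N' * cutwt T mu t s)%:E)%E /\
  L2le (conv (hkp (dtime t s)) (fun x => flux_majorant al w gauss a (s, x)))
    ((N ^+ 2 + 2 * `|a| * N') * bdecay mu 301 500 t s +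
     velocity_cst al * M * N' * cutwt T (mu + 2^-1) t s)}.
Proof.
apply: filterS3 wN' wM wN => s h1 h2 h3 /dweight_gt0 st.
exact: slice st (h1 st) (h2 st) h3.
Qed.

Let k0 : 0 <= N ^+ 2 + 2 * `|a| * N'.
Proof.
by apply: addr_ge0; [exact: sqr_ge0|apply: mulr_ge0; [apply: mulr_ge0; [exact: ler0n|exact: normr_ge0]|exact: N0']].
Qed.

Let c0 : 0 <= velocity_cst al * M * N'.
Proof. by apply: mulr_ge0; [apply: mulr_ge0; [exact/ltW/velocity_cst_gt0|exact: M0]|exact: N0']. Qed.

Let t0 : 0 < t. Proof. exact: le_lt_trans Tt. Qed.

Let p0 (e r : R) : 0 <= r `^ e. Proof. exact: powR_ge0. Qed.

Let n301 : 0 <= 301 :> R. Proof. exact: ler0n. Qed.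
Let n500 : 0 <= 500 :> R. Proof. exact: ler0n. Qed.

Let mm (f : R -> R) : measurable_fun setT f -> measurable_fun setT (fun s => 2 * rwt 2^-1 t s * f s).
Proof. by move=> mf; apply: measurable_funM; [exact: measurable_dweight|exact: mf]. Qed.

Let w2 s : 0 <= 2 * rwt 2^-1 t s. Proof. exact: (dweight_ge0 t s). Qed.

Lemma integral_duhamel_majorant :
  (\int[plane R]_x duhamel_majorant al w gauss a t x <=
   (((N ^+ 2 + 2 * `|a| * N') * (301 * (4 / (2^-1 - mu) + 16)) +
     velocity_cst al * M * N' * (16 * Num.sqrt d)) * (1 + t) `^ (- mu))%:E)%E.
Proof.
apply: (integral_hsup_le (measurable_dweight t) (measurable_dtime t) (measurable_flux_majorant al a mw measurable_gauss)
  (dweight_ge0 t) (@flux_majorant_ge0 _ al w gauss a)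
  (A := fun s => (N ^+ 2 + 2 * `|a| * N') * 301 * (1 + s) `^ (- (mu + 2^-1)) +
     velocity_cst al * M * N' * cutwt T mu t s)).
- apply: measurable_funD; (apply: measurable_funM; [exact: measurable_cst|]); [exact: measurable_pow1|exact: measurable_cutwt].
- move=> s; apply: addr_ge0; apply: mulr_ge0; [exact: mulr_ge0|exact: p0|exact: c0|exact: cutwt_ge0].
- by apply: filterS ae_slice => s h hs; case: (h hs).
have b0 : 0 <= mu by apply: ltW; exact: mu0.
have b2 : mu <= 2 by have := mu2; lra.
have J1 := integral_decay1 mu0 mu2 t0.
have J2 := integral_cutwt b0 b2 T0 Tt td d0 d1.
have k1 : 0 <= (N ^+ 2 + 2 * `|a| * N') * 301 by exact: mulr_ge0.
have J := integral_EFin_lin2 (mm (measurable_pow1 _)) (mm (measurable_cutwt T mu t))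
  (fun s => mulr_ge0 (w2 s) (p0 _ _)) (fun s => mulr_ge0 (w2 s) (cutwt_ge0 T mu t s)) k1 c0 J1 J2.
rewrite (_ : (_ * (1 + t) `^ _) = (N ^+ 2 + 2 * `|a| * N') * 301 * ((4 / (2^-1 - mu) + 16) * (1 + t) `^ (- mu)) +
  velocity_cst al * M * N' * (16 * Num.sqrt d * (1 + t) `^ (- mu))); last first.
  by move: (301 : R) (16 : R) (4 / _) => X Y Z; ring.
apply: le_trans J; rewrite le_eqVlt; apply/orP; left; apply/eqP.
apply: eq_integral => s _; congr (_%:E); rewrite /dweight.
by move: (301 : R) ((1 + s) `^ _) (cutwt _ _ _ _) (rwt _ _ _) => X Y Z W; ring.
Qed.

Lemma L2le_duhamel_majorant : L2le (duhamel_majorant al w gauss a t)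
   (((N ^+ 2 + 2 * `|a| * N') * (4 * 301 / (2^-1 - mu) + 16 + 32 * 500) +
     velocity_cst al * M * N' * (16 * Num.sqrt d)) * (1 + t) `^ (- (mu + 2^-1))).
Proof.
apply: (L2le_hsup (measurable_dweight t) (measurable_dtime t) (measurable_flux_majorant al a mw measurable_gauss)
  (dweight_ge0 t) (@flux_majorant_ge0 _ al w gauss a)
  (B := fun s => (N ^+ 2 + 2 * `|a| * N') * bdecay mu 301 500 t s +
     velocity_cst al * M * N' * cutwt T (mu + 2^-1) t s)).
- apply: measurable_funD; (apply: measurable_funM; [exact: measurable_cst|]); [exact: measurable_bdecay|exact: measurable_cutwt].
- move=> s; apply: addr_ge0; apply: mulr_ge0; [exact: k0|exact: bdecay_ge0|exact: c0|exact: cutwt_ge0].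
- by apply: filterS ae_slice => s h hs; case: (h hs).
have b0 : 0 <= mu + 2^-1 by apply: addr_ge0; [apply: ltW; exact: mu0|rewrite invr_ge0].
have b2 : mu + 2^-1 <= 2 by have := mu2; lra.
have J1 := integral_decay2 mu0 mu2 n301 n500 t0.
have J2 := integral_cutwt b0 b2 T0 Tt td d0 d1.
have J := integral_EFin_lin2 (mm (measurable_bdecay mu 301 500 t)) (mm (measurable_cutwt T (mu + 2^-1) t))
  (fun s => mulr_ge0 (w2 s) (bdecay_ge0 mu n301 n500 t s)) (fun s => mulr_ge0 (w2 s) (cutwt_ge0 T (mu + 2^-1) t s)) k0 c0 J1 J2.
rewrite (_ : (_ * (1 + t) `^ _) = (N ^+ 2 + 2 * `|a| * N') * ((4 * 301 / (2^-1 - mu) + 16 + 32 * 500) * (1 + t) `^ (- (mu + 2^-1))) +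
  velocity_cst al * M * N' * (16 * Num.sqrt d * (1 + t) `^ (- (mu + 2^-1)))); last first.
  by move: (4 * 301 / _) (16 : R) (32 * 500) => X Y Z; ring.
apply: le_trans J; rewrite le_eqVlt; apply/orP; left; apply/eqP.
apply: eq_integral => s _; congr (_%:E); rewrite /dweight.
by move: (bdecay _ _ _ _ _) (cutwt _ _ _ _) (rwt _ _ _) => Y Z W; ring.
Qed.

End DuhamelDecay.

Section AeMono.
Context (R : realType).

Lemma integral_le_ae (f g : R * R -> \bar R) : measurable_fun setT f -> measurable_fun setT g ->
  (forall x, (0 <= f x)%E) -> (forall x, (0 <= g x)%E) -> {ae plane R, forall x, (f x <= g x)%E} ->
  (\int[plane R]_x f x <= \int[plane R]_x g x)%E.
Proof.
move=> mf mg f0 g0 fg; apply: ae_ge0_le_integral; [exact: measurableT|by []|exact: mf|by []|exact: mg|].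
by apply: filterS fg => x h _.
Qed.

Lemma L2le_ae (f g : R * R -> \bar R) (A : R) : measurable_fun setT f -> measurable_fun setT g ->
  (forall x, (0 <= f x)%E) -> (forall x, (0 <= g x)%E) -> {ae plane R, forall x, (f x <= g x)%E} ->
  L2le g A -> L2le f A.
Proof.
move=> mf mg f0 g0 fg; apply: le_trans; apply: integral_le_ae.
- exact: (emeasurable_funM mf mf).
- exact: (emeasurable_funM mg mg).
- by move=> x; apply: mule_ge0.
- by move=> x; apply: mule_ge0.
- by apply: filterS fg => x h; apply: lee_pmul.
Qed.

Lemma in_L1_absE (f : R * R -> R) (A : R) : measurable_fun setT f ->
  (\int[plane R]_x absE f x <= A%:E)%E -> in_L1 f.
Proof.
move=> mf fA; apply/in_L1P/integrableP; split; first exact/measurable_EFinP.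
exact: le_lt_trans fA (ltry _).
Qed.

End AeMono.

(** * A priori bounds in [L^1] and [L^2] *)

Section Apriori.
Context (R : realType) (al : R) (al0 : 0 < al).
Variables (u : R * (R * R) -> R) (v : R -> R * R -> R) (f : R * R -> R) (M A1 A2 : R).
Hypotheses (mu_ : measurable_fun setT u) (mf : measurable_fun setT f) (M0 : 0 <= M) (A20 : 0 <= A2).
Hypotheses (uM : {ae line R, forall s, 0 < s -> (\int[plane R]_x absE (fun y => u (s, y)) x <= M%:E)%E}).
Hypotheses (vu : forall s y, 0 < s -> v s y = u (s, y)).
Hypotheses (f1 : (\int[plane R]_x absE f x <= A1%:E)%E) (f2 : L2le (absE f) A2).
Hypotheses (eqn : forall t, 0 < t ->
  {ae plane R, forall x, u (t, x) = heat_semigroup t f x - duhamel al v t x}).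

Let u_ s (y : R * R) := u (s, y).
Let c := velocity_cst al.
Let c0 : 0 <= c. Proof. exact/ltW/velocity_cst_gt0. Qed.

Let mus s : measurable_fun setT (u_ s).
Proof. exact: (measurableT_comp mu_ (pair1_measurable s)). Qed.

Let maus s : measurable_fun setT (absE (u_ s)).
Proof. exact: measurable_absE. Qed.

Let maf : measurable_fun setT (absE f). Proof. exact: measurable_absE. Qed.

(** The a priori bounds use the decomposition with [a = 0], in which the remainder is the solution
    itself and the mixed terms vanish. *)
Lemma flux_majorant0 s y : flux_majorant al u (@gauss R) 0 (s, y) = (V al (absE (u_ s)) y * absE (u_ s) y)%E.
Proof.
have E (A B C D : \bar R) (r r' : R) : (A * B + (C * `|0 * r|%:E + D * `|0 * r'|%:E) = A * B)%E.
  by rewrite !mul0r normr0 !mule0 !adde0.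
exact: E.
Qed.

Lemma solution_ae t : 0 < t ->
  {ae plane R, forall x, (absE (u_ t) x <= conv (hkp t) (absE f) x + duhamel_majorant al u (@gauss R) 0 t x)%E}.
Proof.
move=> t0; apply: filterS (eqn t0) => x E.
rewrite /absE /u_ E; apply: (@le_trans _ _ (`|heat_semigroup t f x|%:E + `|duhamel al v t x|%:E)%E).
  by rewrite -EFinD lee_fin ler_normB.
apply: leeD.
  rewrite /heat_semigroup t0 /conv -ge0_integral_leb2.
  - apply: abs_Rintegral_le => y; rewrite hkpE// /hk /absE -EFinM lee_fin normrM ger0_norm//.
    by rewrite heat_kernel_ge0// ltW.
  - by apply: emeasurable_funM; [exact: (measurableT_comp (measurable_hkp t) (measurable_csub x))|exact: maf].
  - by move=> y; apply: mule_ge0; [exact: hkp_ge0|exact: absE_ge0].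
apply: (duhamel_le al0 mu_ (@measurable_gauss R) x t0).
apply: filterS uM => s Hs /andP[s0 st]; split.
- exact: in_L1_absE (mus s) (Hs s0).
- apply/in_L1P; rewrite (_ : _ \o _ = EFin \o heat_kernel (1 + s))//.
  by apply: integrable_heat_kernel; rewrite addr_gt0.
- by move=> c' e' ce y; rewrite /gauss /heat_kernel refl_sqeucl.
- by move=> y; rewrite vu// mul0r addr0.
Qed.

Let mmaj t : measurable_fun setT (duhamel_majorant al u (@gauss R) 0 t).
Proof. exact: measurable_duhamel_majorant mu_ (@measurable_gauss R) t. Qed.

Let maj0 t x : (0 <= duhamel_majorant al u (@gauss R) 0 t x)%E.
Proof. exact: duhamel_majorant_ge0. Qed.

Let mfl := measurable_flux_majorant al 0 mu_ (@measurable_gauss R).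
Let fl0 := @flux_majorant_ge0 R al u (@gauss R) 0.

Let integral_dweight t : 0 < t -> (\int[line R]_s (dweight t s)%:E <= (4 * t `^ 2^-1)%:E)%E.
Proof.
move=> t0; rewrite /dweight (integral_EFinZ _ (ler0n R 2) (measurable_rwt 2^-1 t) (rwt_ge0 2^-1 t)).
have h0 : 0 <= 2^-1 :> R by rewrite invr_ge0.
have h1 : 2^-1 < 1 :> R by lra.
have := integral_rwt h0 h1 t0; rewrite (_ : (1 - 2^-1)^-1 = 2 :> R); last by field.
rewrite (_ : 1 - 2^-1 = 2^-1 :> R); last by field.
move=> h; apply: (@le_trans _ _ (2%:E * (2 * t `^ 2^-1)%:E)%E); first by apply: lee_wpmul2l => //; rewrite lee_fin.
by rewrite -EFinM lee_fin mulrA -natrM.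
Qed.

Let slice1 s : (\int[plane R]_x absE (u_ s) x <= M%:E)%E ->
  (\int[plane R]_x flux_majorant al u (@gauss R) 0 (s, x) <= (c * M * M)%:E)%E.
Proof.
move=> h; rewrite (_ : (fun x => _) = (fun x => V al (absE (u_ s)) x * absE (u_ s) x))%E; last first.
  by apply/funext => y; exact: flux_majorant0.
by apply: (integral_V_short al0 (maus s) (maus s)) => // x; exact: absE_ge0.
Qed.

Lemma integral_majorant t : 0 < t ->
  (\int[plane R]_x duhamel_majorant al u (@gauss R) 0 t x <= (4 * (c * M * M) * t `^ 2^-1)%:E)%E.
Proof.
move=> t0; have k0 : 0 <= c * M * M by rewrite !mulr_ge0.
apply: (integral_hsup_le (measurable_dweight t) (measurable_dtime t) mfl (dweight_ge0 t) fl0 (A := fun=> c * M * M)).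
- exact: measurable_cst.
- by move=> s; exact: k0.
- by apply: filterS uM => s h /dweight_gt0/andP[s0 _]; exact: slice1 (h s0).
under eq_integral do rewrite mulrC.
rewrite (integral_EFinZ _ k0 (measurable_dweight t)); last exact: dweight_ge0.
apply: (@le_trans _ _ ((c * M * M)%:E * (4 * t `^ 2^-1)%:E)%E).
  by apply: lee_wpmul2l; [rewrite lee_fin|exact: integral_dweight].
by rewrite -EFinM lee_fin mulrCA mulrA.
Qed.

Let cge (p q : R * R -> \bar R) : (forall x, (0 <= p x)%E) -> (forall x, (0 <= q x)%E) ->
  forall x, (0 <= conv p q x)%E.
Proof. by move=> p0 q0 x; exact: conv_ge0. Qed.

(** The assumed bound holds for almost every time; the integral equation turns it into a bound at
    every positive time. *)
Lemma apriori_L1 t : 0 < t ->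
  (\int[plane R]_x absE (u_ t) x <= (A1 + 4 * (c * M * M) * t `^ 2^-1)%:E)%E.
Proof.
move=> t0; have mc : measurable_fun setT (conv (hkp t) (absE f)).
  exact: (measurable_conv (measurable_hkp t) maf (@hkp_ge0 R t) (@absE_ge0 R f)).
have c00 x : (0 <= conv (hkp t) (absE f) x)%E by apply: conv_ge0 => y; [exact: hkp_ge0|exact: absE_ge0].
apply: (le_trans (integral_le_ae (maus t) (emeasurable_funD mc (mmaj t)) (@absE_ge0 _ _) _ (solution_ae t0))).
  by move=> x; apply: adde_ge0.
rewrite (ge0_integralD _ measurableT (fun x _ => c00 x) mc (fun x _ => maj0 t x) (mmaj t)).
rewrite EFinD; apply: leeD; last exact: integral_majorant.
by apply: le_trans f1; apply: integral_conv_hkp_le => // x; exact: absE_ge0.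
Qed.

Let L2le_conv_flux e s : 0 < e -> (\int[plane R]_x absE (u_ s) x <= M%:E)%E ->
  L2le (conv (hkp e) (fun y => flux_majorant al u (@gauss R) 0 (s, y))) (e `^ (- 2^-1) * (c * M * M)).
Proof.
move=> e0 h; apply: L2le_conv.
- exact: measurable_hkp.
- exact: (measurableT_comp mfl (pair1_measurable s)).
- by move=> x; exact: hkp_ge0.
- by move=> x; exact: fl0.
- exact: powR_ge0.
- by rewrite hkpE//; exact: L2le_hk.
- exact: slice1.
Qed.

Let powR_split (e r : R) : 0 < e -> 0 < r -> (e + r) `^ (- 2^-1) <= e `^ (- 4^-1) * r `^ (- 4^-1).
Proof.
move=> e0 r0; have er : 0 < e + r by rewrite addr_gt0.
have -> : (e + r) `^ (- 2^-1) = (e + r) `^ (- 4^-1) * (e + r) `^ (- 4^-1).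
  by rewrite -powRD ?(gt_eqF er) ?implybT//; congr (_ `^ _); lra.
have dec (x : R) : 0 < x -> x <= e + r -> (e + r) `^ (- 4^-1) <= x `^ (- 4^-1).
  move=> x0 xer; rewrite !powRN lef_pV2 ?posrE ?powR_gt0//; apply: ge0_ler_powR.
  - by rewrite invr_ge0.
  - by rewrite nnegrE ltW.
  - by rewrite nnegrE ltW.
  - exact: xer.
by apply: ler_pM; rewrite ?powR_ge0//; apply: dec; rewrite ?lerDl ?lerDr ?ltW.
Qed.

Let measurable_pow (b t : R) : measurable_fun setT (fun s : R => (t - s) `^ b).
Proof. by apply: (measurableT_comp (measurable_powR b)); apply: measurable_funB; [exact: measurable_cst|exact: measurable_id]. Qed.

Let integral_dweight4 t : 0 < t -> (\int[line R]_s (dweight t s * (t - s) `^ (- 4^-1))%:E <= (8 * t `^ 4^-1)%:E)%E.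
Proof.
move=> t0; have h0 : 0 <= 3 / 4 :> R by lra.
have h1 : 3 / 4 < 1 :> R by lra.
have := integral_rwt h0 h1 t0; rewrite (_ : (1 - 3 / 4)^-1 = 4 :> R); last by field.
rewrite (_ : 1 - 3 / 4 = 4^-1 :> R); last by field.
have -> : (fun s => (dweight t s * (t - s) `^ (- 4^-1))%:E) = (fun s => (2 * rwt (3 / 4) t s)%:E).
  apply/funext => s; congr (_%:E); rewrite /dweight -mulrA; congr (_ * _).
  have [h|h] := boolP (0 < s < t); last by rewrite !rwt_out// mul0r.
  have ts : 0 < t - s by case/andP: h => _; rewrite subr_gt0.
  by rewrite !rwtE// -powRD ?(gt_eqF ts) ?implybT//; congr (_ `^ _); lra.
rewrite (integral_EFinZ _ (ler0n R 2) (measurable_rwt (3 / 4) t) (rwt_ge0 (3 / 4) t)) => h.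
apply: (@le_trans _ _ (2%:E * (4 * t `^ 4^-1)%:E)%E); first by apply: lee_wpmul2l => //; rewrite lee_fin.
by rewrite -EFinM lee_fin mulrA -natrM.
Qed.

Let k0 : 0 <= c * M * M. Proof. by rewrite !mulr_ge0. Qed.

(** First pass. Estimating the flux in [L^1] and smoothing it gives the non-integrable singularity
    [(t-s)^(-1)]. An additional evolution by [e] reduces it to [e^(-1/4) (t-s)^(-3/4)]. *)
Let L2le_conv_majorant e t : 0 < e -> 0 < t ->
  L2le (conv (hkp e) (duhamel_majorant al u (@gauss R) 0 t)) (8 * (c * M * M) * e `^ (- 4^-1) * t `^ 4^-1).
Proof.
move=> e0 t0.
have wc s : 0 < dweight t s -> 0 < dtime t s.
  by move=> /dweight_gt0/andP[_ st]; rewrite /dtime mulr_gt0// subr_gt0.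
rewrite /duhamel_majorant (conv_hsup (measurable_dweight t) (measurable_dtime t) mfl (dweight_ge0 t) fl0 e0 wc).
have mc : measurable_fun setT (fun s => e + dtime t s).
  by apply: measurable_funD; [exact: measurable_cst|exact: measurable_dtime].
pose k := (c * M * M) * e `^ (- 4^-1); have kk0 : 0 <= k by rewrite mulr_ge0// powR_ge0.
apply: (L2le_hsup (measurable_dweight t) mc mfl (dweight_ge0 t) fl0 (B := fun s => k * (t - s) `^ (- 4^-1))).
- by apply: measurable_funM; [exact: measurable_cst|exact: measurable_pow].
- by move=> s; apply: mulr_ge0; [exact: kk0|exact: powR_ge0].
- apply: filterS uM => s h /dweight_gt0/andP[s0 st].
  have ts : 0 < t - s by rewrite subr_gt0.
  have ts2 : 0 < dtime t s by rewrite mulr_gt0.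
  have ets : 0 < e + dtime t s by rewrite addr_gt0.
  apply: (L2leW _ _ (L2le_conv_flux ets (h s0))); first by rewrite mulr_ge0// powR_ge0.
  rewrite [leLHS]mulrC /k -[leRHS]mulrA; apply: ler_wpM2l; first exact: k0.
  have ets' : 0 < e + (t - s) by exact: addr_gt0.
  apply: le_trans (powR_split e0 ts); rewrite !powRN lef_pV2 ?posrE ?(powR_gt0 _ ets) ?(powR_gt0 _ ets')//.
  apply: ge0_ler_powR; [by rewrite invr_ge0|by rewrite nnegrE ltW|by rewrite nnegrE ltW|].
  by rewrite lerD2l /dtime ler_peMl ?(ltW ts)// ler1n.
under eq_integral do rewrite mulrCA.
have m4 : measurable_fun setT (fun s => dweight t s * (t - s) `^ (- 4^-1)).
  by apply: measurable_funM; [exact: measurable_dweight|exact: measurable_pow].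
rewrite (integral_EFinZ _ kk0 m4); last by move=> s; rewrite mulr_ge0 ?dweight_ge0 ?powR_ge0.
apply: (@le_trans _ _ (k%:E * (8 * t `^ 4^-1)%:E)%E).
  by apply: lee_wpmul2l; [rewrite lee_fin|exact: integral_dweight4].
by rewrite -EFinM lee_fin /k le_eqVlt; apply/orP; left; apply/eqP; move: (8 : R) => X; ring.
Qed.

Let L2le_conv_solution e t : 0 < e -> 0 < t ->
  L2le (conv (hkp e) (absE (u_ t))) (A2 + 8 * (c * M * M) * e `^ (- 4^-1) * t `^ 4^-1).
Proof.
move=> e0 t0; have he := @hkp_ge0 R e; have ht := @hkp_ge0 R t; have mhe := @measurable_hkp R e.
have mc := measurable_conv (measurable_hkp t) maf ht (@absE_ge0 R f).
have c00 := cge ht (@absE_ge0 R f).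
have mm := measurable_conv mhe (mmaj t) he (maj0 t).
have mcc := measurable_conv mhe mc he c00.
have z0 : 0 <= 8 * (c * M * M) * e `^ (- 4^-1) * t `^ 4^-1.
  by apply: mulr_ge0; [apply: mulr_ge0; [apply: mulr_ge0; [exact: ler0n|exact: k0]|exact: powR_ge0]|exact: powR_ge0].
have J : L2le (conv (hkp e) (conv (hkp t) (absE f))) A2.
  apply: L2le_conv_hkp; [exact: A20|exact: mc|exact: c00|].
  by apply: L2le_conv_hkp; [exact: A20|exact: maf|exact: absE_ge0|exact: f2].
apply: L2le_mono (L2leD mcc mm (cge he c00) (cge he (maj0 t)) A20 z0 J (L2le_conv_majorant e0 t0)).
- exact: (measurable_conv mhe (maus t) he (@absE_ge0 R _)).
- exact: (emeasurable_funD mcc mm).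
- exact: (cge he (@absE_ge0 R _)).
move=> x; rewrite -(conv_add x mhe mc (mmaj t) he c00 (maj0 t)) /conv.
have mhx : measurable_fun setT (fun y : R * R => hkp e (x - y)) by exact: (measurableT_comp mhe (measurable_csub x)).
apply: integral_le_ae.
- by apply: emeasurable_funM; [exact: mhx|exact: maus].
- by apply: emeasurable_funM; [exact: mhx|exact: (emeasurable_funD mc (mmaj t))].
- by move=> y; apply: mule_ge0; [exact: he|exact: absE_ge0].
- by move=> y; apply: mule_ge0; [exact: he|apply: adde_ge0; [exact: c00|exact: maj0]].
by apply: filterS (solution_ae t0) => y h; apply: lee_wpmul2l; [exact: he|exact: h].
Qed.

(** Second pass. As the velocity is bounded, the evolved flux is at most a multiple of the evolved
    solution, which the first pass controls with [e] of order [t - s]; the resulting singularity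
    [(t-s)^(-3/4)] is integrable. *)
Let L2le_majorant t : 0 < t ->
  L2le (duhamel_majorant al u (@gauss R) 0 t) (c * M * A2 * (4 * t `^ 2^-1) +
    c * M * (8 * (c * M * M) * t `^ 4^-1) * (8 * t `^ 4^-1)).
Proof.
move=> t0; pose k1 := c * M * A2; pose k2 := c * M * (8 * (c * M * M) * t `^ 4^-1).
have k10 : 0 <= k1 by rewrite !mulr_ge0.
have k20 : 0 <= k2.
  by apply: mulr_ge0; [exact: mulr_ge0|apply: mulr_ge0; [apply: mulr_ge0; [exact: ler0n|exact: k0]|exact: powR_ge0]].
have cM0 : 0 <= c * M by exact: mulr_ge0.
apply: (L2le_hsup (measurable_dweight t) (measurable_dtime t) mfl (dweight_ge0 t) fl0
  (B := fun s => k1 + k2 * (t - s) `^ (- 4^-1))).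
- by apply: measurable_funD; [exact: measurable_cst|apply: measurable_funM; [exact: measurable_cst|exact: measurable_pow]].
- by move=> s; apply: addr_ge0 => //; apply: mulr_ge0 => //; exact: powR_ge0.
- apply: filterS uM => s h /dweight_gt0/andP[s0 st].
  have ts : 0 < t - s by rewrite subr_gt0.
  have ts2 : 0 < dtime t s by rewrite mulr_gt0.
  have hd := @hkp_ge0 R (dtime t s); have mhd := @measurable_hkp R (dtime t s).
  have mfs : measurable_fun setT (fun y => flux_majorant al u (@gauss R) 0 (s, y)).
    exact: (measurableT_comp mfl (pair1_measurable s)).
  have J := L2le_conv_solution ts2 s0.
  have mcu := measurable_conv mhd (maus s) hd (@absE_ge0 R _).
  have J' := L2leZ mcu (cge hd (@absE_ge0 R _)) cM0 J.
  apply: (@L2leW _ _ (c * M * (A2 + 8 * (c * M * M) * (dtime t s) `^ (- 4^-1) * s `^ 4^-1))).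
  + apply: mulr_ge0; first exact: cM0.
    apply: addr_ge0; first exact: A20.
    by apply: mulr_ge0; [apply: mulr_ge0; [apply: mulr_ge0; [exact: ler0n|exact: k0]|exact: powR_ge0]|exact: powR_ge0].
  + rewrite mulrDr /k1 lerD2l /k2 -[leRHS]mulrA; apply: ler_wpM2l; first exact: cM0.
    rewrite -[leLHS]mulrA -[leRHS]mulrA; apply: ler_wpM2l.
      by apply: mulr_ge0; [exact: ler0n|exact: k0].
    rewrite mulrC; apply: ler_pM; rewrite ?powR_ge0//.
      by apply: ge0_ler_powR; rewrite ?nnegrE ?invr_ge0//; exact: ltW.
    rewrite !powRN lef_pV2 ?posrE ?powR_gt0//.
    apply: ge0_ler_powR; rewrite ?nnegrE ?invr_ge0//; [exact: ltW|exact: ltW|].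
    by rewrite /dtime ler_peMl ?(ltW ts)// ler1n.
  + apply: (L2le_mono _ _ _ _ J').
    * exact: (measurable_conv mhd mfs hd (fun y => fl0 (s, y))).
    * by apply: emeasurable_funM; [exact: measurable_cst|exact: mcu].
    * exact: (cge hd (fun y => fl0 (s, y))).
    move=> x; rewrite /conv -ge0_integralZl//; last first.
    * by move=> y _; apply: mule_ge0; [exact: hd|exact: absE_ge0].
    * by apply: emeasurable_funM; [exact: (measurableT_comp mhd (measurable_csub x))|exact: maus].
    apply: ge0_integral_mono => y; first by apply: mule_ge0; [exact: hd|exact: fl0].
    rewrite flux_majorant0 [leRHS]muleCA; apply: lee_wpmul2l; first exact: hd.
    apply: lee_wpmul2r; first exact: absE_ge0.
    by apply: (V_le al0 (maus s) (@absE_ge0 R _)); exact: h.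
have m4 : measurable_fun setT (fun s => dweight t s * (t - s) `^ (- 4^-1)).
  by apply: measurable_funM; [exact: measurable_dweight|exact: measurable_pow].
have p4 s : 0 <= dweight t s * (t - s) `^ (- 4^-1) by rewrite mulr_ge0 ?dweight_ge0 ?powR_ge0.
apply: le_trans (integral_EFin_lin2 (measurable_dweight t) m4 (dweight_ge0 t) p4 k10 k20 (integral_dweight t0) (integral_dweight4 t0)).
rewrite le_eqVlt; apply/orP; left; apply/eqP; apply: eq_integral => s _; congr (_%:E); ring.
Qed.

Lemma apriori_L2 t : 0 < t ->
  L2le (absE (u_ t)) (A2 + (c * M * A2 * (4 * t `^ 2^-1) + c * M * (8 * (c * M * M) * t `^ 4^-1) * (8 * t `^ 4^-1))).
Proof.
move=> t0; have ht := @hkp_ge0 R t.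
have mc := measurable_conv (measurable_hkp t) maf ht (@absE_ge0 R f).
have c00 := cge ht (@absE_ge0 R f).
have J : L2le (conv (hkp t) (absE f)) A2.
  by apply: L2le_conv_hkp; [exact: A20|exact: maf|exact: absE_ge0|exact: f2].
apply: (L2le_ae (maus t) (emeasurable_funD mc (mmaj t)) (@absE_ge0 _ _) _ (solution_ae t0)).
  by move=> x; apply: adde_ge0; [exact: c00|exact: maj0].
apply: L2leD; [exact: mc|exact: mmaj|exact: c00|exact: maj0|exact: A20| |exact: J|exact: L2le_majorant].
have n8 : 0 <= 8 :> R by exact: ler0n.
have p (r b : R) : 0 <= r `^ b by exact: powR_ge0.
by apply: addr_ge0; apply: mulr_ge0; rewrite ?mulr_ge0.
Qed.

End Apriori.

(** * Decay of the linear part *)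

Section Weight.
Context (R : realType).
Implicit Types (x : R * R) (f : R * R -> R).

Lemma measurable_sqeucl_pow (k b : R) : measurable_fun setT (fun x : R * R => (k + sqeucl x) `^ b).
Proof.
apply: (measurableT_comp (measurable_powR b)); apply: measurable_funD; first exact: measurable_cst.
by apply: measurable_funD; apply: measurable_funX; [exact: measurable_fst|exact: measurable_snd].
Qed.

(* [(1 + |x|^2)^(-(2-b))] is a superposition of Gaussians, by the Gamma integral *)
Lemma weight_le (b : R) x : 0 <= b -> b < 1 ->
  (((1 + sqeucl x) `^ (- (2 - b)))%:E <=
   (4 * expR 1 * pi)%:E * \int[line R]_s ((ewt b s)%:E * hkp ((4 * s)^-1) x))%E.
Proof.
move=> b0 b1; set q := 1 + sqeucl x.
have q1 : 1 <= q by rewrite lerDl sqeucl_ge0.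
have q0 : 0 < q by exact: lt_le_trans q1.
have pi0 := pi_gt0 R; have e0 := expR_gt0 (1 : R).
(* On [[1/(2q), 1/q]] the exponential [e^(-s q)] is at least [1/e], and [s^(1-b)] is at least its
   value at the left end. *)
pose lo := (2 * q)^-1; pose hi := q^-1.
have lo0 : 0 < lo by rewrite invr_gt0 mulr_gt0.
have lohi : lo <= hi by rewrite lef_pV2 ?posrE ?mulr_gt0// ler_peMl ?(ltW q0)// ler1n.
pose k := (expR 1 * pi)^-1 * lo `^ (1 - b).
have k0 : 0 <= k by rewrite mulr_ge0 ?powR_ge0// invr_ge0 mulr_ge0 ?ltW.
have dk (y : R) : is_derive y (1 : R) (fun s : R => k * s) (k : R).
  by apply: is_derive_eq; rewrite /GRing.scale/= mulr1.
have FTC : (\int[line R]_s (if (lo <= s <= hi)%R then k else 0%R)%:E = (k * hi - k * lo)%:E)%E.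
  apply: (@line_FTC _ (cst k) (fun s => k * s)) => //.
  by move=> y _; exact: cst_continuous.
apply: (@le_trans _ _ ((4 * expR 1 * pi)%:E * (k * hi - k * lo)%:E)%E).
  have -> : q `^ (- (2 - b)) = q `^ (b - 1) * q^-1.
    by rewrite -powR_inv1 ?(ltW q0)// -powRD ?(gt_eqF q0) ?implybT//; congr (_ `^ _); ring.
  have loE : 2^-1 * q `^ (b - 1) <= lo `^ (1 - b).
    rewrite /lo invfM powRM ?invr_ge0 ?(ltW q0)//.
    have -> : q^-1 `^ (1 - b) = q `^ (b - 1).
      by rewrite -powR_inv1 ?(ltW q0)// -powRrM; congr (_ `^ _); ring.
    apply: ler_wpM2r; first exact: powR_ge0.
    rewrite -powR_inv1// -powRrM; apply: ler_powR; first by rewrite ler1n.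
    by lra.
  have dE : hi - lo = 2^-1 * q^-1.
    by rewrite /hi /lo; field; rewrite gt_eqF.
  rewrite -EFinM lee_fin -mulrBr dE /k.
  move: (q `^ (b - 1)) (lo `^ (1 - b)) loE => X Y XY.
  rewrite [leRHS](_ : _ = 2 * Y * q^-1); last first.
    by move: pi0 e0; move: (pi : R) (expR 1 : R) => P E P0 E0; field; rewrite !gt_eqF.
  by apply: ler_wpM2r; [rewrite invr_ge0 ltW|lra].
apply: lee_wpmul2l; first by rewrite lee_fin !mulr_ge0 ?ltW.
rewrite -FTC; apply: ge0_integral_mono => s; first by rewrite lee_fin; case: ifP.
case: ifPn => [/andP[los shi]|_]; last by apply: mule_ge0; [rewrite lee_fin ewt_ge0|exact: hkp_ge0].
have s0 : 0 < s by exact: lt_le_trans los.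
have s4 : 0 < (4 * s)^-1 by rewrite invr_gt0 mulr_gt0.
rewrite /hkp s4 -EFinM lee_fin /ewt s0 /heat_kernel.
rewrite (_ : (4 * pi * (4 * s)^-1)^-1 = s / pi); last first.
  by move: pi0; move: (pi : R) => P P0; field; rewrite !gt_eqF.
rewrite (_ : sqeucl x / (4 * (4 * s)^-1) = s * sqeucl x); last by field; rewrite gt_eqF.
have -> : expR (- s) * s `^ (- b) * (s / pi * expR (- (s * sqeucl x))) =
   pi^-1 * (expR (- (s * q)) * s `^ (1 - b)).
  have -> : s `^ (1 - b) = s * s `^ (- b).
    by rewrite -{2}(powRr1 (ltW s0)) -powRD ?(gt_eqF s0) ?implybT.
  have -> : expR (- (s * q)) = expR (- s) * expR (- (s * sqeucl x)).
    by rewrite -expRD; congr expR; rewrite /q; ring.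
  by ring.
rewrite /k invfM -mulrA mulrCA; apply: ler_wpM2l; first by rewrite invr_ge0 ltW.
apply: ler_pM; [by rewrite invr_ge0 ltW|exact: powR_ge0| |].
  rewrite -expRN ler_expR lerN2; have := ler_wpM2r (ltW q0) shi.
  by rewrite /hi mulVf ?gt_eqF.
by apply: ge0_ler_powR; [lra|rewrite nnegrE ltW|rewrite nnegrE ltW|exact: los].
Qed.

Lemma integral_weight (b : R) : 0 <= b -> b < 1 ->
  (\int[plane R]_x ((1 + sqeucl x) `^ (- (2 - b)))%:E <= (4 * expR 1 * pi * ((1 - b)^-1 + 1))%:E)%E.
Proof.
move=> b0 b1; have pi0 := pi_gt0 R; have e0 := expR_gt0 (1 : R).
have k0 : 0 <= 4 * expR 1 * pi :> R by rewrite !mulr_ge0 ?ltW.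
pose F (z : R * (R * R)) : \bar R := ((ewt b z.1)%:E * hkp ((4 * z.1)^-1) z.2)%E.
have F0 z : (0 <= F z)%E by apply: mule_ge0; [rewrite lee_fin ewt_ge0|exact: hkp_ge0].
have mF : measurable_fun setT F.
  apply: emeasurable_funM.
    by apply/measurable_EFinP; exact: (measurableT_comp (measurable_ewt b) measurable_fst).
  have m1 : measurable_fun setT (fun z : R * (R * R) => ((4 * z.1)^-1, z.2)).
    apply/measurable_fun_pairP; split; last exact: measurable_snd.
    have m4 : measurable_fun setT (fun z : R * (R * R) => 4 * z.1).
      by apply: measurable_funM; [exact: measurable_cst|exact: measurable_fst].
    exact: (measurableT_comp (@measurable_inv R) m4).
  exact: (measurableT_comp (@measurable_hkp2 R) m1).
have mG : measurable_fun setT (fun x => \int[line R]_s F (s, x))%E.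
  exact: (measurable_fun_fubini_tonelli_G (m1 := line R) _ mF F0).
have G0 x : (0 <= \int[line R]_s F (s, x))%E by apply: integral_ge0 => s _; exact: F0.
apply: (@le_trans _ _ (\int[plane R]_x ((4 * expR 1 * pi)%:E * \int[line R]_s F (s, x)))%E).
  by apply: ge0_integral_mono => x; [rewrite lee_fin powR_ge0|exact: weight_le].
rewrite (ge0_integralZl_EFin _ measurableT) => [|x _|//|//]; last exact: G0.
rewrite [leRHS]EFinM; apply: lee_wpmul2l; first by rewrite lee_fin.
rewrite -(fubini_tonelli (m1 := line R) (m2 := plane R) _ mF F0)/=.
apply: le_trans (integral_ewt b0 b1); apply: ge0_integral_mono => s.
  by apply: integral_ge0 => x _; exact: F0.
rewrite /F/= ge0_integralZl//; [|exact: measurable_hkp|by move=> x _; exact: hkp_ge0|by rewrite lee_fin ewt_ge0].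
by rewrite -[leRHS]mule1; apply: lee_wpmul2l; [rewrite lee_fin ewt_ge0|exact: integral_hkp_le1].
Qed.

(** Bound of the [L^2] norm of [(1+|x|^2)^(mu-1)]. By Cauchy-Schwarz this is the price of a moment
    of order [2 mu] in terms of the norm of [L^2(2)]. *)
Definition moment_cst (mu : R) : R := Num.sqrt (4 * expR 1 * pi * ((1 - 2 * mu)^-1 + 1)).

Lemma moment_cst_ge0 mu : 0 <= moment_cst mu. Proof. exact: sqrtr_ge0. Qed.

Section moments.
Variables (mu Q : R) (f : R * R -> R).
Hypotheses (mu0 : 0 <= mu) (mu2 : mu < 2^-1) (mf : measurable_fun setT f) (Q0 : 0 <= Q).
Hypothesis (fQ : (\int[plane R]_x (weighted 2 f x)%:E <= (Q ^+ 2)%:E)%E).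

Let w1 x : 1 <= 1 + sqeucl x. Proof. by rewrite lerDl sqeucl_ge0. Qed.
Let w0 x : 0 < 1 + sqeucl x. Proof. exact: lt_le_trans (w1 x). Qed.

Let maf := measurable_absE mf.

Let w2E x : (1 + sqeucl x) `^ 2 = (1 + sqeucl x) ^+ 2.
Proof. by apply: (@powR_mulrn _ _ 2); exact: ltW. Qed.

Lemma integral_moment : (\int[plane R]_x (((1 + sqeucl x) `^ mu)%:E * absE f x) <= (moment_cst mu * Q)%:E)%E.
Proof.
have b0 : 0 <= 2 * mu by rewrite mulr_ge0.
have b1 : 2 * mu < 1 by have := mu2; lra.
have pi0 := pi_gt0 R; have e0 := expR_gt0 (1 : R).
have -> : (fun x => ((1 + sqeucl x) `^ mu)%:E * absE f x)%E =
  (fun x => ((1 + sqeucl x) `^ (mu - 1))%:E * ((1 + sqeucl x)%:E * absE f x))%E.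
  apply/funext => x; rewrite muleA -[X in (X * absE f x)%E = _]/(_%:E) -[in RHS](EFinM (_ `^ _)).
  have -> // : (1 + sqeucl x) `^ mu = (1 + sqeucl x) `^ (mu - 1) * (1 + sqeucl x).
  by rewrite -{3}(powRr1 (ltW (w0 x))) -powRD ?(gt_eqF (w0 x)) ?implybT//; congr (_ `^ _); ring.
have m1 : measurable_fun setT (fun x : R * R => ((1 + sqeucl x) `^ (mu - 1))%:E).
  by apply/measurable_EFinP; exact: measurable_sqeucl_pow.
have m2 : measurable_fun setT (fun x : R * R => (1 + sqeucl x)%:E * absE f x)%E.
  apply: emeasurable_funM; last exact: maf.
  apply/measurable_EFinP; have := measurable_sqeucl_pow 1 1; congr measurable_fun.
  by apply/funext => x; rewrite powRr1// ltW.
apply: (le_cauchy_schwarz m1 m2).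
- by move=> x; rewrite lee_fin powR_ge0.
- by move=> x; apply: mule_ge0; [rewrite lee_fin ltW|exact: absE_ge0].
- exact: moment_cst_ge0.
- exact: Q0.
- rewrite sqr_sqrtr; last first.
    by rewrite mulr_ge0 ?addr_ge0 ?invr_ge0// ?mulr_ge0 ?subr_ge0 ?(ltW b1)// ltW.
  apply: le_trans (integral_weight b0 b1); apply: ge0_integral_mono => x.
    by rewrite -EFinM lee_fin mulr_ge0 ?powR_ge0.
  by rewrite -EFinM -powRD ?(gt_eqF (w0 x)) ?implybT// lee_fin; apply: ler_powR => //; lra.
- apply: le_trans fQ; apply: ge0_integral_mono => x.
    by rewrite /absE -!EFinM lee_fin mulr_ge0 ?mulr_ge0 ?(ltW (w0 x)).
  rewrite /absE -!EFinM lee_fin /weighted w2E.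
  by rewrite le_eqVlt; apply/orP; left; apply/eqP; ring.
Qed.

Lemma integral_moment0 : (\int[plane R]_x absE f x <= (moment_cst mu * Q)%:E)%E.
Proof.
apply: le_trans integral_moment; apply: ge0_integral_mono => x; first exact: absE_ge0.
rewrite -[leLHS]mul1e; apply: lee_wpmul2r; first exact: absE_ge0.
rewrite lee_fin -[leLHS](powRr0 (1 + sqeucl x)).
by apply: ler_powR; [exact: w1|exact: mu0].
Qed.

Lemma integral_momentmu : (\int[plane R]_x ((sqeucl x `^ mu)%:E * absE f x) <= (moment_cst mu * Q)%:E)%E.
Proof.
apply: le_trans integral_moment; apply: ge0_integral_mono => x.
  by apply: mule_ge0; [rewrite lee_fin powR_ge0|exact: absE_ge0].
apply: lee_wpmul2r; first exact: absE_ge0.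
rewrite lee_fin; apply: ge0_ler_powR; rewrite ?nnegrE ?sqeucl_ge0 ?(ltW (w0 x))//.
by rewrite lerDr.
Qed.

Lemma L2le_weighted : L2le (absE f) Q.
Proof.
apply: le_trans fQ; apply: ge0_integral_mono => x; first by apply: mule_ge0; exact: absE_ge0.
rewrite /absE -EFinM lee_fin /weighted -expr2 ler_peMl ?sqr_ge0//.
by rewrite w2E exprn_ege1.
Qed.

End moments.
End Weight.

(** * Moduli of continuity of the heat kernel *)

Section HeatDifference.
Context (R : realType).
Implicit Types (x y : R * R).

Definition hdiff (t : R) y x : \bar R := (`|heat_kernel t (x - y) - heat_kernel t x|)%:E.

Lemma hdiff_ge0 t y x : (0 <= hdiff t y x)%E. Proof. by rewrite lee_fin. Qed.

Lemma measurable_hdiff2 t : measurable_fun setT (fun z : (R * R) * (R * R) => hdiff t z.1 z.2).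
Proof.
apply/measurable_EFinP; apply: (measurableT_comp (@normr_measurable R setT)); apply: measurable_funB.
  exact: (measurableT_comp (measurable_heat_kernel t) (@measurable_sub21 R)).
exact: (measurableT_comp (measurable_heat_kernel t) measurable_snd).
Qed.

Lemma measurable_hdiff t y : measurable_fun setT (hdiff t y).
Proof. exact: (measurableT_comp (measurable_hdiff2 t) (pair1_measurable y)). Qed.

Let mshift t y : measurable_fun setT (fun x : R * R => hk t (x - y)).
Proof. exact: (measurableT_comp (measurable_hk t) (measurable_subc y)). Qed.

Let hk_ge0 t x : 0 < t -> (0 <= hk t x)%E.
Proof. by move=> t0; rewrite lee_fin heat_kernel_ge0// ltW. Qed.

Lemma integral_hk_shift_sqr t y : 0 < t ->
  (\int[plane R]_x (hk t (x - y)%R * hk t (x - y)%R) = hk (2 * t)%R 0%R)%E.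
Proof.
move=> t0; rewrite -(integral_hk_sqr t0).
apply: (plane_shift (f := fun x => hk t x * hk t x)%E).
  by apply: emeasurable_funM; exact: measurable_hk.
by move=> x; apply: mule_ge0; exact: hk_ge0.
Qed.

Lemma integral_hk_shift_mul t y : 0 < t ->
  (\int[plane R]_x (hk t (x - y)%R * hk t x) = hk (2 * t)%R y)%E.
Proof.
move=> t0; rewrite -(integral_hk_mul y t0); apply: eq_integral => x _.
by congr (_ * _)%E; rewrite /hk -heat_kernelN opprB.
Qed.

(** The left-hand side is at most both [1] and [z], hence at most any power of [z] with exponent
    between [0] and [1]. *)
Lemma one_sub_exp_le (b z : R) : 0 <= b -> b <= 1 -> 0 <= z -> 1 - expR (- (z / 8)) <= z `^ b.
Proof.
move=> b0 b1 z0; have [z1|z1] := leP 1 z.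
  apply: (@le_trans _ _ 1); first by rewrite gerBl expR_ge0.
  by rewrite -[leLHS](powRr0 z); apply: ler_powR.
have h : 1 - expR (- (z / 8)) <= z.
  by have := expR_ge1Dx (- (z / 8)); move: z0; move: (expR _) => e; lra.
apply: (le_trans h); have [->|zn] := eqVneq z 0; first exact: powR_ge0.
have zp : 0 < z by rewrite lt_def zn.
apply: (@le_trans _ _ (z `^ 1)); first by rewrite powRr1.
by apply: ger_powR => //; rewrite zp ltW.
Qed.

Lemma heat_kernel_defect (t b : R) y : 0 < t -> 0 <= b -> b <= 1 ->
  2 * (heat_kernel (2 * t) 0 - heat_kernel (2 * t) y) <= (4 * pi * t)^-1 * (sqeucl y / t) `^ b.
Proof.
move=> t0 b0 b1; have pi0 := pi_gt0 R.
have z0 : 0 <= sqeucl y / t by rewrite divr_ge0 ?sqeucl_ge0 ?ltW.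
have := one_sub_exp_le b0 b1 z0.
rewrite /heat_kernel (_ : sqeucl (0 : R * R) = 0); last by rewrite /sqeucl/= expr0n/= addr0.
rewrite mul0r oppr0 expR0 (_ : sqeucl y / (4 * (2 * t)) = sqeucl y / t / 8); last first.
  by field; rewrite gt_eqF.
move: (expR _) (_ `^ b) pi0; move: (pi : R) => P E X P0 h.
rewrite (_ : 2 * _ = (4 * P * t)^-1 * (1 - E)); last by field; rewrite !gt_eqF.
by apply: ler_wpM2l => //; rewrite invr_ge0 !mulr_ge0 ?ltW.
Qed.

(** Expanding the square, the semigroup law gives twice the drop of the kernel at time [2 * t] from
    the origin to [y]; [heat_kernel_defect] is used with exponent [2 mu]. *)
Lemma L2le_hdiff (t mu : R) y : 0 < t -> 0 <= mu -> mu <= 2^-1 ->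
  L2le (hdiff t y) (Num.sqrt ((4 * pi * t)^-1) * (sqeucl y / t) `^ mu).
Proof.
move=> t0 mu0 mu2; have pi0 := pi_gt0 R.
have t2 : 0 < 2 * t by rewrite mulr_gt0.
have mhh : measurable_fun setT (fun x => hk t (x - y)%R * hk t x)%E.
  by apply: emeasurable_funM; [exact: mshift|exact: measurable_hk].
(* The cross term is moved to the left, so that only nonnegative integrals are added. *)
have E : (\int[plane R]_x (hdiff t y x * hdiff t y x) + (2 * heat_kernel (2 * t) y)%:E =
    (2 * heat_kernel (2 * t) 0)%:E)%E.
  have -> : ((2 * heat_kernel (2 * t) y)%:E = \int[plane R]_x (2%:E * (hk t (x - y)%R * hk t x)))%E.
    rewrite (ge0_integralZl_EFin _ measurableT) => [|x _|//|//]; last first.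
      by apply: mule_ge0; exact: hk_ge0.
    by rewrite integral_hk_shift_mul// EFinM.
  have mdd : measurable_fun setT (fun x => hdiff t y x * hdiff t y x)%E.
    by apply: emeasurable_funM; exact: measurable_hdiff.
  have m2 : measurable_fun setT (fun x => 2%:E * (hk t (x - y)%R * hk t x))%E.
    by apply: emeasurable_funM; [exact: measurable_cst|exact: mhh].
  rewrite -(ge0_integralD _ measurableT _ mdd _ m2); last 2 first.
  - by move=> x _; apply: mule_ge0; exact: hdiff_ge0.
  - by move=> x _; apply: mule_ge0 => //; apply: mule_ge0; exact: hk_ge0.
  transitivity (\int[plane R]_x (hk t (x - y)%R * hk t (x - y)%R + hk t x * hk t x))%E.
    apply: eq_integral => x _; rewrite /hdiff /hk -!EFinM -!EFinD; congr (_%:E).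
    rewrite -expr2 real_normK ?num_real//; ring.
  have ms : measurable_fun setT (fun x => hk t (x - y)%R * hk t (x - y)%R)%E.
    by apply: emeasurable_funM; exact: mshift.
  have mk : measurable_fun setT (fun x => hk t x * hk t x)%E.
    by apply: emeasurable_funM; exact: measurable_hk.
  rewrite (ge0_integralD _ measurableT _ ms _ mk); last 2 first.
  - by move=> x _; apply: mule_ge0; exact: hk_ge0.
  - by move=> x _; apply: mule_ge0; exact: hk_ge0.
  by rewrite integral_hk_shift_sqr// integral_hk_sqr// /hk -EFinD; congr (_%:E); ring.
have E' : (\int[plane R]_x (hdiff t y x * hdiff t y x) =
    (2 * (heat_kernel (2 * t) 0 - heat_kernel (2 * t) y))%:E)%E.
  move: E; case: (integral _ _ _) => [r| |] //= [E]; congr (_%:E).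
  by rewrite mulrBr -E addrK.
rewrite /L2le E' lee_fin exprMn sqr_sqrtr; last by rewrite invr_ge0 !mulr_ge0 ?ltW.
have -> : (sqeucl y / t) `^ mu ^+ 2 = (sqeucl y / t) `^ (mu * 2) by rewrite -powR_mulrn ?powR_ge0// -powRrM.
by apply: heat_kernel_defect => //; [rewrite mulr_ge0|move: mu2; lra].
Qed.

(* Hellinger: [Phi_t] is a multiple of the square of [Phi_2t] *)
Lemma integral_hdiff_le (t mu : R) y : 0 < t -> 0 <= mu -> mu <= 2^-1 ->
  (\int[plane R]_x hdiff t y x <= (4 * (sqeucl y / t) `^ mu)%:E)%E.
Proof.
move=> t0 mu0 mu2; have pi0 := pi_gt0 R.
have t2 : 0 < 2 * t by rewrite mulr_gt0.
pose k := 16 * pi * t; have k0 : 0 < k by rewrite !mulr_gt0.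
have sqE x : heat_kernel t x = k * heat_kernel (2 * t) x ^+ 2.
  rewrite /heat_kernel exprMn -expRM_natl.
  rewrite (_ : 2%:R * - (sqeucl x / (4 * (2 * t))) = - (sqeucl x / (4 * t))); last by field; rewrite gt_eqF.
  rewrite [RHS]mulrA; congr (_ * _); rewrite /k; move: pi0; move: (pi : R) => P P0.
  by field; rewrite !gt_eqF.
pose S := Num.sqrt ((4 * pi * (2 * t))^-1).
have p0 x : 0 <= heat_kernel (2 * t) x by rewrite heat_kernel_ge0// ltW.
pose sum (x : R * R) : \bar R := (hk (2 * t) (x - y)%R + hk (2 * t) x)%E.
have msum : measurable_fun setT sum by apply: emeasurable_funD; [exact: mshift|exact: measurable_hk].
have sum0 x : (0 <= sum x)%E by apply: adde_ge0; exact: hk_ge0.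
have S2 : S ^+ 2 = (4 * pi * (2 * t))^-1 by rewrite sqr_sqrtr// invr_ge0 !mulr_ge0 ?ltW.
have sumL2 : L2le sum (S + S).
  have L2S x : L2le (hk (2 * t)) S.
    rewrite /L2le integral_hk_sqr// S2 lee_fin /heat_kernel.
    rewrite (_ : (4 * pi * (2 * t))^-1 = (4 * pi * (2 * (2 * t)))^-1 * 2); last first.
      by move: pi0; move: (pi : R) => P P0; field; rewrite !gt_eqF.
    apply: ler_wpM2l; first by rewrite invr_ge0 !mulr_ge0 ?ltW.
    apply: (@le_trans _ _ 1); last by rewrite ler1n.
    by rewrite -expR0 ler_expR oppr_le0 divr_ge0 ?sqeucl_ge0// !mulr_ge0 ?ltW.
  apply: L2leD; [exact: mshift|exact: measurable_hk|by move=> x; exact: hk_ge0|by move=> x; exact: hk_ge0|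
    exact: sqrtr_ge0|exact: sqrtr_ge0| |exact: L2S].
  by rewrite /L2le integral_hk_shift_sqr// -integral_hk_sqr//; exact: L2S.
(* Difference of two squares: the kernel difference at time [t] is a difference at time [2 * t]
   times a sum, ready for Cauchy-Schwarz. *)
have E : hdiff t y = (fun x => k%:E * (hdiff (2 * t) y x * sum x))%E.
  apply/funext => x; rewrite /hdiff /sum /hk -EFinD -!EFinM; congr (_%:E).
  rewrite !sqE -mulrBr subr_sqr normrM (gtr0_norm k0); congr (_ * _).
  by rewrite normrM; congr (_ * _); rewrite ger0_norm// addr_ge0.
have z0 : 0 <= (sqeucl y / (2 * t)) `^ mu by exact: powR_ge0.
have CS := le_cauchy_schwarz (measurable_hdiff (2 * t) y) msum (hdiff_ge0 (2 * t) y) sum0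
  (mulr_ge0 (sqrtr_ge0 _) z0) (addr_ge0 (sqrtr_ge0 _) (sqrtr_ge0 _)) (L2le_hdiff y t2 mu0 mu2) sumL2.
rewrite E (ge0_integralZl_EFin _ measurableT) => [|x _||]; last first.
- exact: ltW.
- by apply: emeasurable_funM; [exact: measurable_hdiff|exact: msum].
- by apply: mule_ge0; [exact: hdiff_ge0|exact: sum0].
apply: (le_trans (lee_wpmul2l _ CS)); first by rewrite lee_fin ltW.
rewrite -EFinM lee_fin -/S (_ : k * _ = k * 2 * S ^+ 2 * (sqeucl y / (2 * t)) `^ mu); last by ring.
rewrite S2 (_ : k * 2 * _ = 4); last first.
  by rewrite /k; move: pi0; move: (pi : R) => P P0; field; rewrite !gt_eqF.
apply: ler_wpM2l => //; apply: ge0_ler_powR; rewrite ?nnegrE ?divr_ge0 ?sqeucl_ge0 ?(ltW t0) ?(ltW t2)//.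
apply: ler_wpM2l; first exact: sqeucl_ge0.
by rewrite lef_pV2 ?posrE// ler_peMl ?(ltW t0)// ler1n.
Qed.

End HeatDifference.

(** * Heat evolution of data of mean zero *)

Section LinearDecay.
Context (R : realType).
Implicit Types (x y : R * R) (f : R * R -> R).

Definition hdiff_conv (t : R) f x : \bar R := (\int[plane R]_y (hdiff t y x * absE f y))%E.

Section decay.
Variables (f : R * R -> R) (mu Z : R) (mf : measurable_fun setT f) (mu0 : 0 <= mu) (mu2 : mu <= 2^-1).
Hypotheses (f1 : (\int[plane R]_x absE f x <= Z%:E)%E) (f2 : L2le (absE f) Z).
Hypothesis (fm : (\int[plane R]_x ((sqeucl x `^ mu)%:E * absE f x) <= Z%:E)%E).

Let maf := measurable_absE mf.

Let F t (z : (R * R) * (R * R)) : \bar R := (hdiff t z.1 z.2 * absE f z.1)%E.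

Let F0 t z : (0 <= F t z)%E. Proof. by apply: mule_ge0; [exact: hdiff_ge0|exact: absE_ge0]. Qed.

Let mF t : measurable_fun setT (F t).
Proof.
by apply: emeasurable_funM; [exact: measurable_hdiff2|exact: (measurableT_comp maf measurable_fst)].
Qed.

Let Z0 : 0 <= Z.
Proof. by rewrite -lee_fin (le_trans _ f1)// integral_ge0// => x _; exact: absE_ge0. Qed.

Lemma measurable_hdiff_conv t : measurable_fun setT (hdiff_conv t f).
Proof. exact: (measurable_fun_fubini_tonelli_G (m1 := plane R) _ (mF t) (F0 t)). Qed.

Lemma hdiff_conv_ge0 t x : (0 <= hdiff_conv t f x)%E.
Proof. by apply: integral_ge0 => y _; exact: (F0 t (y, x)). Qed.

Let msq : measurable_fun setT (fun y : R * R => sqeucl y `^ mu).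
Proof.
by have := @measurable_sqeucl_pow R 0 mu; congr measurable_fun; apply/funext => y; rewrite add0r.
Qed.

Let powz t y : 0 < t -> (sqeucl y / t) `^ mu = t `^ (- mu) * sqeucl y `^ mu.
Proof.
move=> t0; rewrite powRM ?sqeucl_ge0 ?invr_ge0 ?(ltW t0)// mulrC; congr (_ * _).
by rewrite -powR_inv1 ?(ltW t0)// -powRrM mulN1r.
Qed.

Let m_mf : measurable_fun setT (fun y => (sqeucl y `^ mu)%:E * absE f y)%E.
Proof. by apply: emeasurable_funM; [exact/measurable_EFinP|exact: maf]. Qed.

Let m_mf0 y : (0 <= (sqeucl y `^ mu)%:E * absE f y)%E.
Proof. by apply: mule_ge0; [rewrite lee_fin powR_ge0|exact: absE_ge0]. Qed.

Lemma integral_hdiff_conv t : 0 < t -> (\int[plane R]_x hdiff_conv t f x <= (4 * t `^ (- mu) * Z)%:E)%E.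
Proof.
move=> t0; rewrite -(fubini_tonelli (m1 := plane R) (m2 := plane R) _ (mF t) (F0 t))/=.
have k0 : 0 <= 4 * t `^ (- mu) by rewrite mulr_ge0 ?powR_ge0.
apply: (@le_trans _ _ (\int[plane R]_y ((4 * t `^ (- mu))%:E * ((sqeucl y `^ mu)%:E * absE f y)))%E).
  apply: ge0_integral_mono => y; first by apply: integral_ge0 => x _; exact: F0.
  rewrite /F/= ge0_integralZr//; [|exact: measurable_hdiff|by move=> x _; exact: hdiff_ge0|exact: absE_ge0].
  rewrite muleA; apply: lee_wpmul2r; first exact: absE_ge0.
  by have := integral_hdiff_le y t0 mu0 mu2; rewrite (powz y t0) mulrA EFinM.
rewrite (ge0_integralZl_EFin _ measurableT) => [|y _|//|//]; last exact: m_mf0.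
by rewrite [leRHS]EFinM; apply: lee_wpmul2l; rewrite ?lee_fin.
Qed.

Let sqrt_le (t : R) : 0 < t -> Num.sqrt ((4 * pi * t)^-1) <= t `^ (- 2^-1).
Proof.
move=> t0; have p1 := pi_gt1 R.
have -> : t `^ (- 2^-1) = Num.sqrt t^-1.
  by rewrite -powR12_sqrt ?invr_ge0 ?(ltW t0)// -(@powR_inv1 _ t) ?(ltW t0)// -powRrM mulN1r.
apply: ler_wsqrtr; rewrite lef_pV2 ?posrE ?mulr_gt0 ?pi_gt0//.
rewrite ler_peMl ?(ltW t0)//; move: p1; move: (pi : R) => P; lra.
Qed.

Lemma L2le_hdiff_conv t : 0 < t -> L2le (hdiff_conv t f) (t `^ (- (mu + 2^-1)) * Z).
Proof.
move=> t0; pose k := t `^ (- (mu + 2^-1)); have k0 : 0 <= k by exact: powR_ge0.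
pose A y := k * (sqeucl y `^ mu * `|f y|).
have mA' : measurable_fun setT (fun y => sqeucl y `^ mu * `|f y|).
  by apply: measurable_funM; [exact: msq|exact: measurable_abs].
have mA : measurable_fun setT A by apply: measurable_funM; [exact: measurable_cst|exact: mA'].
have A0 y : 0 <= A y by rewrite !mulr_ge0 ?powR_ge0.
apply: (minkowski_integral (m := plane R) (mF t) (F0 t) mA A0).
  apply: aeW => y; rewrite /F/=.
  have h : L2le (hdiff t y) (k * sqeucl y `^ mu).
    apply: (L2leW _ _ (L2le_hdiff y t0 mu0 mu2)); first by rewrite mulr_ge0 ?sqrtr_ge0 ?powR_ge0.
    rewrite (powz y t0) mulrA; apply: ler_wpM2r; first exact: powR_ge0.
    rewrite /k (_ : - (mu + 2^-1) = - 2^-1 + - mu); last by ring.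
    rewrite powRD ?(gt_eqF t0) ?implybT//; apply: ler_wpM2r; first exact: powR_ge0.
    exact: sqrt_le.
  have := L2leZ (measurable_hdiff t y) (hdiff_ge0 t y) (normr_ge0 (f y)) h.
  rewrite /A (_ : k * (_ * _) = `|f y| * (k * sqeucl y `^ mu)); last by ring.
  apply: le_trans.
  rewrite le_eqVlt; apply/orP; left; apply/eqP; apply: eq_integral => x _.
  by rewrite /absE !(muleC _ `|f y|%:E).
rewrite /A (integral_EFinZ _ k0 mA'); last by move=> y; rewrite mulr_ge0 ?powR_ge0.
rewrite EFinM; apply: lee_wpmul2l; first by rewrite lee_fin.
by apply: le_trans fm; apply: ge0_integral_mono => y; rewrite ?lee_fin ?mulr_ge0 ?powR_ge0// /absE -EFinM.
Qed.

(* for [t <= 1] the plain contraction bound is the better one *)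
Lemma linear_majorant (g : R * R -> R) t : 0 < t ->
  (forall x, ((`|g x|)%:E <= hdiff_conv t f x)%E) -> (forall x, ((`|g x|)%:E <= conv (hkp t) (absE f) x)%E) ->
  exists J : R * R -> \bar R, [/\ measurable_fun setT J, forall x, (0 <= J x)%E, forall x, ((`|g x|)%:E <= J x)%E,
    (\int[plane R]_x J x <= (8 * Z * (1 + t) `^ (- mu))%:E)%E & L2le J (8 * Z * (1 + t) `^ (- (mu + 2^-1)))].
Proof.
move=> t0 g1 g2; have t1 : 0 < 1 + t by rewrite addr_gt0.
have m22 : mu + 2^-1 <= 1 by move: mu2; lra.
have m20 : 0 <= mu + 2^-1 by rewrite addr_ge0 ?invr_ge0.
have p0 (b r : R) : 0 <= r `^ b by exact: powR_ge0.
have hpow (b r : R) : 0 <= b -> b <= 1 -> 0 < r -> (1 + t) <= 2 * r -> r `^ (- b) <= 2 * (1 + t) `^ (- b).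
  move=> b0 b1 r0 h; apply: (@le_trans _ _ (2 `^ b * (1 + t) `^ (- b))); last first.
    apply: ler_wpM2r; first exact: p0.
    by rewrite -[leRHS](powRr1 (ler0n R 2)); apply: ler_powR; rewrite ?ler1n.
  rewrite !powRN -ler_pdivrMl ?powR_gt0// -invfM -powRM ?(ltW r0)//.
  rewrite lef_pV2 ?posrE ?powR_gt0// ?mulr_gt0//.
  by apply: ge0_ler_powR => //; rewrite nnegrE ?(ltW t1)// mulr_ge0 ?ltW.
have m21 : mu <= 1 by move: mu2; lra.
have z8 (b : R) : 0 <= 8 * Z * (1 + t) `^ (- b).
  by apply: mulr_ge0; [apply: mulr_ge0; [exact: ler0n|exact: Z0]|exact: p0].
have [h|h] := leP 1 t.
  have h2 : 1 + t <= 2 * t by move: h; lra.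
  exists (hdiff_conv t f); split => //; [exact: measurable_hdiff_conv|exact: hdiff_conv_ge0| |].
    apply: le_trans (integral_hdiff_conv t0) _; rewrite lee_fin.
    have := ler_wpM2r Z0 (hpow mu t mu0 m21 t0 h2); move: (t `^ _) ((1 + t) `^ _) => X Y; lra.
  apply: (L2leW _ _ (L2le_hdiff_conv t0)); first by rewrite mulr_ge0.
  have := ler_wpM2r Z0 (hpow (mu + 2^-1) t m20 m22 t0 h2).
  have := mulr_ge0 (p0 (- (mu + 2^-1)) (1 + t)) Z0.
  move: (t `^ _) ((1 + t) `^ _) => X Y; lra.
have h2 : 1 + t <= 2 * 1 by move: h; lra.
have small (b : R) : 0 <= b -> b <= 1 -> Z <= 8 * Z * (1 + t) `^ (- b).
  move=> b0 b1; have := ler_wpM2r Z0 (hpow b 1 b0 b1 ltr01 h2); rewrite powR1.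
  have := mulr_ge0 (p0 (- b) (1 + t)) Z0; move: ((1 + t) `^ _) => Y; lra.
exists (conv (hkp t) (absE f)); split => //.
- exact: (measurable_conv (measurable_hkp t) maf (@hkp_ge0 R t) (@absE_ge0 R f)).
- by move=> x; apply: conv_ge0 => y; [exact: hkp_ge0|exact: absE_ge0].
- apply: (le_trans (integral_conv_hkp_le t maf (@absE_ge0 R f))).
  by apply: (le_trans f1); rewrite lee_fin; exact: small.
- apply: L2le_conv_hkp; [exact: z8|exact: maf|exact: absE_ge0|].
  by apply: (L2leW _ _ f2); [exact: Z0|exact: small].
Qed.

End decay.

Section semigroup.
Variables (v0 : R * R -> R) (L1v0 : in_L1 v0).

Let a := total_mass v0.
Let f y := v0 y - a * heat_kernel 1 y.

Let mv0 : measurable_fun setT v0. Proof. exact: in_L1_measurable. Qed.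
Let iv0 : (plane R).-integrable setT (EFin \o v0). Proof. exact/in_L1P. Qed.

Let mshift t x : measurable_fun setT (fun y : R * R => heat_kernel t (x - y)).
Proof. exact: (measurableT_comp (measurable_heat_kernel t) (measurable_csub x)). Qed.

Let total_massE : a = \int[plane R]_x v0 x.
Proof. by rewrite /a /total_mass Rintegral_leb2. Qed.

Lemma measurable_defect : measurable_fun setT f.
Proof.
apply: measurable_funB; first exact: mv0.
by apply: measurable_funM; [exact: measurable_cst|exact: measurable_heat_kernel].
Qed.

Let hkb t x : 0 < t -> `|heat_kernel t x| <= t^-1.
Proof. by move=> t0; rewrite ger0_norm ?heat_kernel_ge0 ?(ltW t0)//; exact: heat_kernel_le. Qed.

Let int_hk (t : R) : 0 < t -> (\int[plane R]_y heat_kernel t y)%R = 1.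
Proof. by move=> t0; rewrite /Rintegral integral_hk. Qed.

Let int_conv_hk (t : R) x : 0 < t -> (\int[plane R]_y (heat_kernel t (x - y) * heat_kernel 1 y))%R = heat_kernel (1 + t) x.
Proof.
move=> t0; rewrite /Rintegral; have := congr1 (fun g => fine (g x)) (conv_hk t0 (@ltr01 R)).
rewrite /conv /hk/= (addrC t) => <-; congr fine; exact: eq_integral.
Qed.

Let integrable_mul (t : R) x (h : R * R -> R) : 0 < t -> (plane R).-integrable setT (EFin \o h) -> measurable_fun setT h ->
  (plane R).-integrable setT (EFin \o (fun y => heat_kernel t (x - y) * h y)).
Proof.
move=> t0 ih mh; apply: (integrable_dom (h := fun y => `|h y|) (M := t^-1)).
- by apply: measurable_funM; [exact: mshift|exact: mh].
- exact: (integrable_abse ih).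
- by move=> y; exact: normr_ge0.
- by move=> y; rewrite normrM; apply: ler_wpM2r; [exact: normr_ge0|exact: hkb].
Qed.

(** [Omega t] is the evolution of [heat_kernel 1], so the left-hand side is the evolution of [f]. As
    [f] has mean zero, [heat_kernel t x] may be subtracted from the kernel. *)
Lemma linear_le_hdiff t x : 0 < t ->
  ((`|heat_semigroup t v0 x - a * Omega t x|)%:E <= hdiff_conv t f x)%E.
Proof.
move=> t0; have ih := integrable_heat_kernel (@ltr01 R); have mh := measurable_heat_kernel (1 : R).
pose D y := heat_kernel t (x - y) - heat_kernel t x.
have i1 := integrable_mul x t0 iv0 mv0; have i2 := integrable_mul x t0 ih mh.
have i3 := integrable_scale (heat_kernel t x) iv0; have i4 := integrable_scale (heat_kernel t x) ih.
have E : heat_semigroup t v0 x - a * Omega t x = (\int[plane R]_y (D y * f y))%R.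
  have -> : (fun y => D y * f y) = (fun y => (heat_kernel t (x - y) * v0 y - heat_kernel t x * v0 y) -
      a * (heat_kernel t (x - y) * heat_kernel 1 y - heat_kernel t x * heat_kernel 1 y)).
    by apply/funext => y; rewrite /D /f; ring.
  rewrite (RintegralB measurableT (integrable_sub i1 i3) (integrable_scale a (integrable_sub i2 i4))).
  rewrite (RintegralZl a measurableT (integrable_sub i2 i4)).
  rewrite (RintegralB measurableT i1 i3) (RintegralB measurableT i2 i4).
  rewrite (RintegralZl _ measurableT iv0) (RintegralZl _ measurableT ih) -total_massE int_hk// int_conv_hk//.
  rewrite /heat_semigroup t0 Rintegral_leb2; last by apply: measurable_funM; [exact: mshift|exact: mv0].
  by rewrite OmegaE; move: (Rintegral _ _ _) => X; ring.
by rewrite E; apply: abs_Rintegral_le => y; rewrite /hdiff /absE -EFinM lee_fin normrM; apply: ler_wpM2r.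
Qed.

Lemma linear_le_conv t x : 0 < t ->
  ((`|heat_semigroup t v0 x - a * Omega t x|)%:E <= conv (hkp t) (absE f) x)%E.
Proof.
move=> t0; have ih := integrable_heat_kernel (@ltr01 R); have mh := measurable_heat_kernel (1 : R).
have i1 := integrable_mul x t0 iv0 mv0; have i2 := integrable_mul x t0 ih mh.
have E : heat_semigroup t v0 x - a * Omega t x = (\int[plane R]_y (heat_kernel t (x - y) * f y))%R.
  have -> : (fun y => heat_kernel t (x - y) * f y) = (fun y => heat_kernel t (x - y) * v0 y -
      a * (heat_kernel t (x - y) * heat_kernel 1 y)).
    by apply/funext => y; rewrite /f; ring.
  rewrite (RintegralB measurableT i1 (integrable_scale a i2)) (RintegralZl a measurableT i2) int_conv_hk//.
  rewrite /heat_semigroup t0 Rintegral_leb2; last by apply: measurable_funM; [exact: mshift|exact: mv0].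
  by rewrite OmegaE.
rewrite E; apply: abs_Rintegral_le => y; rewrite hkpE// /hk /absE -EFinM lee_fin normrM; apply: ler_wpM2r => //.
by rewrite ger0_norm ?heat_kernel_ge0 ?(ltW t0).
Qed.

Section bounds.
Variables (mu Q : R) (mu0 : 0 <= mu) (mu2 : mu < 2^-1) (Q0 : 0 <= Q).
Hypothesis (vQ : (\int[plane R]_x (weighted 2 v0 x)%:E <= (Q ^+ 2)%:E)%E).

Let c := moment_cst mu.
Let c0 : 0 <= c. Proof. exact: moment_cst_ge0. Qed.

Lemma total_mass_le : `|a| <= c * Q.
Proof.
rewrite -lee_fin total_massE; apply: (@le_trans _ _ (\int[plane R]_x absE v0 x)%E).
  by apply: abs_Rintegral_le.
exact: integral_moment0.
Qed.

(** One constant for three bounds: [c Q] controls the mass and the moment of [v0], [5 c Q] those of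
    the Gaussian part since [|a| <= c Q], and [Q] the [L^2] norm of [v0]. *)
Let Z := (c + 5 * c + 1) * Q.

Let a5 : 5 * `|a| <= 5 * c * Q.
Proof. by rewrite -mulrA; apply: ler_wpM2l => //; exact: total_mass_le. Qed.

Let mk : measurable_fun setT (@hk R 1). Proof. exact: measurable_hk. Qed.
Let mv := measurable_absE mv0.
Let k0 x : (0 <= hk 1 x :> \bar R)%E. Proof. by rewrite lee_fin heat_kernel_ge0. Qed.
Let mak : measurable_fun setT (fun y => `|a|%:E * hk 1 y)%E.
Proof. by apply: emeasurable_funM; [exact: measurable_cst|exact: mk]. Qed.
Let ak0 y : (0 <= `|a|%:E * hk 1 y)%E. Proof. by apply: mule_ge0; [rewrite lee_fin|exact: k0]. Qed.

Let f_le y : (absE f y <= absE v0 y + `|a|%:E * hk 1 y)%E.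
Proof.
rewrite /absE /hk -EFinM -EFinD lee_fin /f; apply: (le_trans (ler_normB _ _)).
by rewrite normrM (ger0_norm (heat_kernel_ge0 y (@ler01 R))).
Qed.

Let maf : measurable_fun setT (absE f). Proof. exact: measurable_absE measurable_defect. Qed.

Let cQ0 : 0 <= c * Q. Proof. exact: mulr_ge0. Qed.

Lemma integral_defect : (\int[plane R]_x absE f x <= Z%:E)%E.
Proof.
apply: (@le_trans _ _ (\int[plane R]_x (absE v0 x + `|a|%:E * hk 1 x))%E).
  by apply: ge0_integral_mono => x; [exact: absE_ge0|exact: f_le].
rewrite (ge0_integralD _ measurableT (fun x _ => absE_ge0 v0 x) mv (fun x _ => ak0 x) mak).
rewrite (ge0_integralZl_EFin _ measurableT) => [|y _|//|//]; last exact: k0.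
rewrite integral_hk// mule1; apply: (le_trans (leeD (integral_moment0 mu0 mu2 mv0 Q0 vQ) (lexx _))).
rewrite -EFinD lee_fin /Z; have := total_mass_le; rewrite -/c; move: Q0 cQ0; lra.
Qed.

Lemma L2le_defect : L2le (absE f) Z.
Proof.
have ma : measurable_fun setT (fun x => absE v0 x + `|a|%:E * hk 1 x)%E by exact: emeasurable_funD.
have L1 : L2le (@hk R 1) 1 by have := L2le_hk (@ltr01 R); rewrite powR1.
have L2 := L2leZ mk k0 (normr_ge0 a) L1.
have a1 : 0 <= `|a| * 1 by rewrite mulr1.
have L3 := L2leD mv mak (absE_ge0 v0) ak0 Q0 a1 (L2le_weighted vQ) L2.
apply: (L2le_mono maf ma (absE_ge0 f) f_le); apply: (L2leW _ _ L3); first by rewrite addr_ge0.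
rewrite mulr1 /Z; have := total_mass_le; rewrite -/c; move: Q0 cQ0; lra.
Qed.

Lemma momentmu_defect : (\int[plane R]_x ((sqeucl x `^ mu)%:E * absE f x) <= Z%:E)%E.
Proof.
have msq : measurable_fun setT (fun x : R * R => (sqeucl x `^ mu)%:E).
  apply/measurable_EFinP; have := @measurable_sqeucl_pow R 0 mu.
  by congr measurable_fun; apply/funext => y; rewrite add0r.
have s0 (x : R * R) : (0 <= (sqeucl x `^ mu)%:E)%E by rewrite lee_fin powR_ge0.
have mk2 : measurable_fun setT (@hk R 2) by exact: measurable_hk.
have k20 x : (0 <= hk 2 x :> \bar R)%E by rewrite lee_fin heat_kernel_ge0.
have m1 : measurable_fun setT (fun x => (sqeucl x `^ mu)%:E * absE v0 x)%E by exact: emeasurable_funM.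
have m2 : measurable_fun setT (fun x => `|a|%:E * (hk 1 x + 4%:E * hk 2 x))%E.
  apply: emeasurable_funM; [exact: measurable_cst|apply: emeasurable_funD; first exact: mk].
  by apply: emeasurable_funM; [exact: measurable_cst|exact: mk2].
have p1 x : (0 <= (sqeucl x `^ mu)%:E * absE v0 x)%E by apply: mule_ge0; [exact: s0|exact: absE_ge0].
have p2' x : (0 <= 4%:E * hk 2 x :> \bar R)%E by apply: mule_ge0; [rewrite lee_fin|exact: k20].
have p2'' x : (0 <= hk 1 x + 4%:E * hk 2 x :> \bar R)%E by apply: adde_ge0; [exact: k0|exact: p2'].
have p2 x : (0 <= `|a|%:E * (hk 1 x + 4%:E * hk 2 x))%E by apply: mule_ge0; [rewrite lee_fin|exact: p2''].
(* As [2 mu <= 1], the weight [|x|^(2 mu)] is at most [1 + |x|], and [heat_kernel_moment] at time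
   [1] absorbs the factor [|x|]. *)
have sk x : sqeucl x `^ mu * heat_kernel 1 x <= heat_kernel 1 x + 4 * heat_kernel 2 x.
  have h1 : sqeucl x `^ mu <= 1 + Num.sqrt (sqeucl x).
    have [h|h] := leP (sqeucl x) 1.
      apply: (@le_trans _ _ (1 `^ mu)); last by rewrite powR1 lerDl sqrtr_ge0.
      by apply: ge0_ler_powR; rewrite ?nnegrE ?sqeucl_ge0.
    apply: (@le_trans _ _ (sqeucl x `^ 2^-1)); first by apply: ler_powR; exact: ltW.
    by rewrite powR12_sqrt ?sqeucl_ge0// lerDr.
  have := @heat_kernel_moment R 1 x ltr01; rewrite powR1 !mulr1 => h2.
  have := ler_wpM2r (heat_kernel_ge0 x (@ler01 R)) h1; move: h2.
  move: (heat_kernel 1 x) (heat_kernel 2 x) (Num.sqrt _) (_ `^ _) => A B C D; lra.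
apply: (@le_trans _ _ (\int[plane R]_x ((sqeucl x `^ mu)%:E * absE v0 x + `|a|%:E * (hk 1 x + 4%:E * hk 2 x)))%E).
  apply: ge0_integral_mono => x; first by apply: mule_ge0; [exact: s0|exact: absE_ge0].
  apply: (le_trans (lee_wpmul2l (s0 x) (f_le x))).
  rewrite ge0_muleDr; [|exact: absE_ge0|exact: ak0]; apply: leeD; first exact: lexx.
  rewrite muleCA; apply: lee_wpmul2l; first by rewrite lee_fin.
  by rewrite /hk -!EFinM -EFinD lee_fin; exact: sk.
rewrite (ge0_integralD _ measurableT (fun x _ => p1 x) m1 (fun x _ => p2 x) m2).
rewrite (ge0_integralZl_EFin _ measurableT) => [|y _||//]; last first.
- by apply: emeasurable_funD; [exact: mk|apply: emeasurable_funM; [exact: measurable_cst|exact: mk2]].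
- exact: p2''.
rewrite (ge0_integralD _ measurableT (fun x _ => k0 x) mk (fun x _ => p2' x)); last first.
  by apply: emeasurable_funM; [exact: measurable_cst|exact: mk2].
rewrite (ge0_integralZl_EFin _ measurableT) => [|y _|//|//]; last exact: k20.
rewrite !integral_hk// mule1 -EFinD -EFinM.
apply: (le_trans (leeD (integral_momentmu mu0 mu2 mv0 Q0 vQ) (lexx _))).
rewrite -EFinD lee_fin /Z -/c; have := total_mass_le; rewrite -/c; move: a5 Q0 cQ0; lra.
Qed.

Lemma linear_decay t : 0 < t ->
  exists J : R * R -> \bar R, [/\ measurable_fun setT J, forall x, (0 <= J x)%E,
    forall x, ((`|heat_semigroup t v0 x - a * Omega t x|)%:E <= J x)%E,
    (\int[plane R]_x J x <= (8 * ((c + 5 * c + 1) * Q) * (1 + t) `^ (- mu))%:E)%E &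
    L2le J (8 * ((c + 5 * c + 1) * Q) * (1 + t) `^ (- (mu + 2^-1)))].
Proof.
move=> t0; apply: (linear_majorant measurable_defect mu0 (ltW mu2) integral_defect L2le_defect momentmu_defect t0).
- by move=> x; exact: linear_le_hdiff.
- by move=> x; exact: linear_le_conv.
Qed.

End bounds.
End semigroup.
End LinearDecay.

(** * Continuation in time *)

Section Continuation.
Context (R : realType) (al : R) (al0 : 0 < al).
Variables (u : R * (R * R) -> R) (v : R -> R * R -> R) (v0 : R * R -> R) (M mu Q : R).
Hypotheses (mu_ : measurable_fun setT u) (mv0 : measurable_fun setT v0) (M0 : 0 <= M) (Q0 : 0 < Q).
Hypotheses (mu0 : 0 < mu) (mu2 : mu < 2^-1).
Hypotheses (uM : {ae line R, forall s, 0 < s -> (\int[plane R]_x absE (fun y => u (s, y)) x <= M%:E)%E}).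
Hypotheses (vu : forall s y, 0 < s -> v s y = u (s, y)).
Hypothesis (vQ : (\int[plane R]_x (weighted 2 v0 x)%:E <= (Q ^+ 2)%:E)%E).
Hypotheses (eqn : forall t, 0 < t ->
  {ae plane R, forall x, u (t, x) = heat_semigroup t v0 x - duhamel al v t x}).

Let a := total_mass v0.
Let c := moment_cst mu.
Let c0 : 0 <= c. Proof. exact: moment_cst_ge0. Qed.
Let mu00 : 0 <= mu. Proof. exact: ltW. Qed.
Let Q00 : 0 <= Q. Proof. exact: ltW. Qed.

Let L1v0 : in_L1 v0.
Proof. exact: in_L1_absE mv0 (integral_moment0 mu00 mu2 mv0 Q00 vQ). Qed.

Definition remainder (z : R * (R * R)) : R := u z - a * gauss z.

Let w_ s (y : R * R) := remainder (s, y).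

Lemma measurable_remainder : measurable_fun setT remainder.
Proof.
apply: measurable_funB; first exact: mu_.
by apply: measurable_funM; [exact: measurable_cst|exact: measurable_gauss].
Qed.

Let mw s : measurable_fun setT (w_ s).
Proof. exact: (measurableT_comp measurable_remainder (pair1_measurable s)). Qed.

Let maw s : measurable_fun setT (absE (w_ s)). Proof. exact: measurable_absE. Qed.
Let mau s : measurable_fun setT (absE (fun y => u (s, y))).
Proof. by apply: measurable_absE; exact: (measurableT_comp mu_ (pair1_measurable s)). Qed.

Let mak s : measurable_fun setT (fun y => `|a|%:E * hk (1 + s) y)%E.
Proof. by apply: emeasurable_funM; [exact: measurable_cst|exact: measurable_hk]. Qed.

Let ak0 s y : 0 < s -> (0 <= `|a|%:E * hk (1 + s) y)%E.
Proof. by move=> s0; rewrite mule_ge0// lee_fin heat_kernel_ge0// addr_ge0// ltW. Qed.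

Let w_le s y : 0 < s -> (absE (w_ s) y <= absE (fun y => u (s, y)) y + `|a|%:E * hk (1 + s) y)%E.
Proof.
move=> s0; rewrite -(absE_gauss s0) /absE -EFinM -EFinD lee_fin -normrM; exact: ler_normB.
Qed.

Let integral_w s (B : R) : 0 < s -> (\int[plane R]_x absE (fun y => u (s, y)) x <= B%:E)%E ->
  (\int[plane R]_x absE (w_ s) x <= (B + `|a|)%:E)%E.
Proof.
move=> s0 h; apply: (@le_trans _ _ (\int[plane R]_x (absE (fun y => u (s, y)) x + `|a|%:E * hk (1 + s) x))%E).
  by apply: ge0_integral_mono => x; [exact: absE_ge0|exact: w_le].
rewrite (ge0_integralD _ measurableT (fun x _ => absE_ge0 _ x) (mau s) (fun x _ => ak0 x s0) (mak s)).
rewrite (ge0_integralZl_EFin _ measurableT) => [|y _||//]; last 2 first.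
- by rewrite lee_fin heat_kernel_ge0// addr_ge0// ltW.
- exact: measurable_hk.
by rewrite integral_hk ?addr_gt0// mule1 EFinD; apply: leeD.
Qed.

Let L2le_w s (B : R) : 0 < s -> 0 <= B -> L2le (absE (fun y => u (s, y))) B -> L2le (absE (w_ s)) (B + `|a|).
Proof.
move=> s0 B0 h; have s1 : 0 < 1 + s by rewrite addr_gt0.
have k0 y : (0 <= hk (1 + s) y :> \bar R)%E by rewrite lee_fin heat_kernel_ge0// ltW.
have mk := @measurable_hk R (1 + s).
have L1 : L2le (@hk R (1 + s)) 1.
  apply: (L2leW _ _ (L2le_hk s1)); first exact: powR_ge0.
  rewrite powRN -[leRHS]invr1 lef_pV2 ?posrE ?powR_gt0//.
  rewrite -[leLHS](powRr0 (1 + s)); apply: ler_powR; last by rewrite invr_ge0.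
  by rewrite lerDl ltW.
have L2 := L2leZ mk k0 (normr_ge0 a) L1; rewrite mulr1 in L2.
have mm := emeasurable_funD (mau s) (mak s).
apply: (L2le_mono (maw s) mm (absE_ge0 _) (fun y => w_le y s0)).
exact: (L2leD (mau s) (mak s) (absE_ge0 _) (fun y => ak0 y s0) B0 (normr_ge0 a) h L2).
Qed.

Let M' := M + `|a|.
Let M0' : 0 <= M'. Proof. exact: addr_ge0. Qed.

Let wM : {ae line R, forall s, 0 < s -> (\int[plane R]_x absE (w_ s) x <= M'%:E)%E}.
Proof. by apply: filterS uM => s h s0; apply: integral_w => //; exact: h. Qed.

Let A0 := 8 * ((c + 5 * c + 1) * Q).
Let A0_gt0 : 0 < A0.
Proof.
by rewrite /A0 !mulr_gt0//; apply: ltr_pwDr => //; apply: addr_ge0; [exact: c0|apply: mulr_ge0; [exact: ler0n|exact: c0]].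
Qed.

Lemma remainder_ae t : 0 < t -> exists J : R * R -> \bar R,
  [/\ measurable_fun setT J, forall x, (0 <= J x)%E,
    {ae plane R, forall x, (absE (w_ t) x <= J x + duhamel_majorant al remainder (@gauss R) a t x)%E},
    (\int[plane R]_x J x <= (A0 * (1 + t) `^ (- mu))%:E)%E & L2le J (A0 * (1 + t) `^ (- (mu + 2^-1)))].
Proof.
move=> t0; have [J [mJ J0 Jle J1 J2]] := linear_decay L1v0 mu00 mu2 Q00 vQ t0.
exists J; split => //.
apply: filterS (eqn t0) => x E.
have wE : w_ t x = (heat_semigroup t v0 x - a * Omega t x) - duhamel al v t x.
  by rewrite /w_ /remainder E OmegaE /gauss/=; move: (heat_semigroup _ _ _) (duhamel _ _ _ _) (heat_kernel _ _) => X Y Z; ring.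
rewrite /absE wE; apply: (@le_trans _ _ (`|heat_semigroup t v0 x - a * Omega t x|%:E + `|duhamel al v t x|%:E)%E).
  by rewrite -EFinD lee_fin ler_normB.
apply: leeD; first exact: Jle.
apply: (duhamel_le al0 measurable_remainder (@measurable_gauss R) x t0).
apply: filterS wM => s Hs /andP[s0 st]; split.
- exact: in_L1_absE (mw s) (Hs s0).
- apply/in_L1P; rewrite (_ : _ \o _ = EFin \o heat_kernel (1 + s))//.
  by apply: integrable_heat_kernel; rewrite addr_gt0.
- by move=> c' e' ce y; rewrite /gauss /heat_kernel refl_sqeucl.
- by move=> y; rewrite vu// /remainder subrK.
Qed.

Definition decays (T N : R) := forall s, 0 < s <= T ->
  (\int[plane R]_x absE (w_ s) x <= (N * (1 + s) `^ (- mu))%:E)%E /\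
  L2le (absE (w_ s)) (N * (1 + s) `^ (- (mu + 2^-1))).

(** The constant of [L2le_duhamel_majorant]; it also exceeds the one of
    [integral_duhamel_majorant]. *)
Definition decay_cst : R := 4 * 301 / (2^-1 - mu) + 16 + 32 * 500.

Let C1 : 1 <= decay_cst.
Proof.
rewrite /decay_cst; have m2 : 0 <= (2^-1 - mu)^-1 by rewrite invr_ge0 subr_ge0 ltW.
by move: m2; move: ((2^-1 - mu)^-1) => X; lra.
Qed.

Let p0 (b r : R) : 0 <= r `^ b. Proof. exact: powR_ge0. Qed.

Lemma decaysW T N N' : 0 <= N -> N <= N' -> decays T N -> decays T N'.
Proof.
move=> N0 NN h s sT; have [h1 h2] := h s sT; split.
  by apply: (le_trans h1); rewrite lee_fin; apply: ler_wpM2r.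
by apply: (L2leW _ _ h2); [exact: mulr_ge0|apply: ler_wpM2r].
Qed.

(** [N] is the constant already established up to [T], [N'] a possibly much larger one that includes
    the new step. The point is that [N'] enters linearly and with two small coefficients, one of
    order [|a|] and one of order [sqrt d]. *)
Lemma decays_step T N N' d : 0 <= N -> 0 <= N' -> 0 <= T -> 0 < d -> d <= 1 ->
  decays T N -> decays (T + d) N' -> forall t, T < t <= T + d ->
  (\int[plane R]_x absE (w_ t) x <=
    ((A0 + ((N ^+ 2 + 2 * `|a| * N') * decay_cst + velocity_cst al * M' * N' * (16 * Num.sqrt d))) * (1 + t) `^ (- mu))%:E)%E /\
  L2le (absE (w_ t))
    ((A0 + ((N ^+ 2 + 2 * `|a| * N') * decay_cst + velocity_cst al * M' * N' * (16 * Num.sqrt d))) * (1 + t) `^ (- (mu + 2^-1))).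
Proof.
move=> N0 N0' T0 d0 d1 PN PN' t /andP[Tt td]; have t0 : 0 < t by exact: le_lt_trans Tt.
have [J [mJ J0 Jle J1 J2]] := remainder_ae t0.
have mmaj := measurable_duhamel_majorant al a measurable_remainder (@measurable_gauss R) t.
have maj0 := @duhamel_majorant_ge0 R al remainder (@gauss R) a t.
have wN' : {ae line R, forall s, 0 < s < t ->
  (\int[plane R]_x absE (w_ s) x <= (N' * (1 + s) `^ (- mu))%:E)%E /\
  L2le (absE (w_ s)) (N' * (1 + s) `^ (- (mu + 2^-1)))}.
  by apply: aeW => s /andP[s0 st]; apply: PN'; rewrite s0 (le_trans (ltW st)).
have wMt : {ae line R, forall s, 0 < s < t -> (\int[plane R]_x absE (w_ s) x <= M'%:E)%E}.
  by apply: filterS wM => s h /andP[s0 _]; exact: h.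
have wN : {ae line R, forall s, 0 < s <= T ->
  (\int[plane R]_x absE (w_ s) x <= (N * (1 + s) `^ (- mu))%:E)%E /\
  L2le (absE (w_ s)) (N * (1 + s) `^ (- (mu + 2^-1)))}.
  by apply: aeW => s; exact: PN.
have D1 := integral_duhamel_majorant al0 a measurable_remainder mu0 mu2 N0 N0' M0' T0 Tt td d0 d1 wN' wMt wN.
have D2 := L2le_duhamel_majorant al0 a measurable_remainder mu0 mu2 N0 N0' M0' T0 Tt td d0 d1 wN' wMt wN.
have mJ2 := emeasurable_funD mJ mmaj.
have J20 x : (0 <= J x + duhamel_majorant al remainder (@gauss R) a t x)%E by apply: adde_ge0.
have k0 : 0 <= N ^+ 2 + 2 * `|a| * N'.
  by apply: addr_ge0; [exact: sqr_ge0|apply: mulr_ge0 => //; exact: mulr_ge0].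
have e0 : 0 <= velocity_cst al * M' * N' * (16 * Num.sqrt d).
  apply: mulr_ge0; last by rewrite mulr_ge0 ?sqrtr_ge0.
  by apply: mulr_ge0 => //; apply: mulr_ge0 => //; exact/ltW/velocity_cst_gt0.
split.
  apply: (le_trans (integral_le_ae (maw t) mJ2 (absE_ge0 _) J20 Jle)).
  rewrite (ge0_integralD _ measurableT (fun x _ => J0 x) mJ (fun x _ => maj0 x) mmaj).
  apply: (le_trans (leeD J1 D1)); rewrite -EFinD lee_fin -mulrDl; apply: ler_wpM2r; first exact: p0.
  rewrite lerD2l lerD2r; apply: ler_wpM2l; first exact: k0.
  by rewrite /decay_cst; move: ((2^-1 - mu)^-1) => X; lra.
apply: (L2le_ae (maw t) mJ2 (absE_ge0 _) J20 Jle); rewrite mulrDl.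
apply: L2leD; [exact: mJ|exact: mmaj|exact: J0|exact: maj0| | |exact: J2|exact: D2].
  by apply: mulr_ge0; [exact: ltW|exact: p0].
apply: mulr_ge0; last exact: p0.
apply: addr_ge0 => //; apply: mulr_ge0 => //; exact: le_trans C1.
Qed.

Hypothesis (small : 64 * (A0 * decay_cst) <= 1).

(** With this choice the smallness condition gives [N1^2 * decay_cst <= A0], so that the part of the
    bound free of [N'] is at most [2 * A0], a quarter of [N1]. *)
Let N1 := 8 * A0.
Let N1_gt0 : 0 < N1. Proof. by rewrite mulr_gt0. Qed.

(** [A0] contains [48 * c * Q], and [|a|] is at most [c * Q]. *)
Let small_a : 2 * `|a| * decay_cst <= 8^-1.
Proof.
have h : 6 * `|a| <= 6 * (c * Q) by rewrite ler_wpM2l//; exact: (total_mass_le L1v0 mu00 mu2 Q00 vQ).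
have h2 : `|a| * 48 <= A0.
  rewrite /A0 (_ : 8 * _ = 48 * (c * Q) + 8 * Q); last by ring.
  by move: h Q0; rewrite /a; move: (c * Q) => X; lra.
have C0 : 0 <= decay_cst by exact: le_trans C1.
have := ler_wpM2r C0 h2; move: small; move: (A0 * decay_cst) => Y.
by rewrite (_ : `|a| * 48 * decay_cst = 24 * (2 * `|a| * decay_cst)); [lra|ring].
Qed.

Let small_A : A0 + N1 ^+ 2 * decay_cst <= 4^-1 * N1.
Proof.
have := ler_wpM2l (ltW A0_gt0) small; rewrite mulr1 /N1 => h.
have -> : (8 * A0) ^+ 2 * decay_cst = A0 * (64 * (A0 * decay_cst)) by ring.
by move: h; lra.
Qed.

(** The step is chosen from [alpha] and the [L^1] bound alone, independently of the time reached, so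
    that finitely many steps reach any given time. *)
Lemma exists_time_step : exists d : R, [/\ 0 < d, d <= 1 & velocity_cst al * M' * (16 * Num.sqrt d) <= 8^-1].
Proof.
pose K := velocity_cst al * M' * 16.
have K0 : 0 <= K by rewrite mulr_ge0//; apply: mulr_ge0 => //; exact/ltW/velocity_cst_gt0.
pose e := (8 * (K + 1))^-1; have K1 : 0 < 8 * (K + 1) by rewrite mulr_gt0// ltr_wpDl.
have e0 : 0 < e by rewrite invr_gt0.
have e1 : e <= 1 by rewrite invf_le1//; move: K0; lra.
exists (e ^+ 2); split; [exact: exprn_gt0|by rewrite exprn_ile1// ltW|].
rewrite sqrtr_sqr (ger0_norm (ltW e0)) mulrA -/K /e invfM mulrCA ler_piMr ?invr_ge0//.
by rewrite ler_pdivrMr ?mul1r ?lerDl// ltr_wpDl.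
Qed.

(* The integral equation halves any constant above [N1], so the a priori constant, however
   large, is reduced to [N1] after finitely many passes over the same interval. *)
Lemma decays_extend T d k : 0 <= T -> 0 < d -> d <= 1 -> velocity_cst al * M' * (16 * Num.sqrt d) <= 8^-1 ->
  decays T N1 -> decays (T + d) (2 ^+ k * N1) -> decays (T + d) N1.
Proof.
move=> T0 d0 d1 dM PT; elim: k => [|k IH]; first by rewrite expr0 mul1r.
move=> Pk; apply: IH => s /andP[s0 sT].
have k1 : 1 <= 2 ^+ k :> R by rewrite exprn_ege1// ler1n.
have N10 : 0 <= N1 by exact: ltW.
have [sT'|Ts] := leP s T.
  have N1k : N1 <= 2 ^+ k * N1 by rewrite ler_peMl.
  by apply: (decaysW N10 N1k PT); rewrite s0.
have Nk0 : 0 <= 2 ^+ k.+1 * N1 by apply: mulr_ge0 => //; exact: exprn_ge0.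
have Ts' : T < s <= T + d by rewrite Ts.
have [h1 h2] := decays_step N10 Nk0 T0 d0 d1 PT Pk Ts'.
set B := (A0 + _) in h1 h2.
(* The first part of [B] is at most [N1 / 4], hence at most half of the target; the second has
   coefficient at most [1/8 + 1/8] in front of [2^(k+1) * N1], which is the other half. *)
have BN : B <= 2 ^+ k * N1.
  have -> : B = (A0 + N1 ^+ 2 * decay_cst) + (2 * `|a| * decay_cst + velocity_cst al * M' * (16 * Num.sqrt d)) * (2 ^+ k.+1 * N1).
    by rewrite /B; move: (16 * _) decay_cst (velocity_cst al) => X Y Z; ring.
  have h3 := ler_wpM2r Nk0 (lerD small_a dM).
  have -> : 2 ^+ k * N1 = 2^-1 * (2 ^+ k * N1) + 4^-1 * (2 ^+ k.+1 * N1) by rewrite exprS; field.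
  have h4 : 4^-1 * N1 <= 2^-1 * (2 ^+ k * N1).
    by apply: ler_pM => //; [lra|rewrite ler_peMl].
  by apply: lerD; [exact: le_trans small_A h4|apply: (le_trans h3); apply: ler_wpM2r => //; lra].
have B0 : 0 <= B.
  rewrite /B; apply: addr_ge0; first exact: ltW.
  have C0 : 0 <= decay_cst by exact: le_trans C1.
  apply: addr_ge0.
    apply: mulr_ge0 => //; apply: addr_ge0; first exact: sqr_ge0.
    by apply: mulr_ge0 => //; exact: mulr_ge0.
  apply: mulr_ge0; last by rewrite mulr_ge0 ?sqrtr_ge0.
  by apply: mulr_ge0 => //; apply: mulr_ge0 => //; exact/ltW/velocity_cst_gt0.
split.
  by apply: (le_trans h1); rewrite lee_fin; apply: ler_wpM2r.
by apply: (L2leW _ _ h2); [exact: mulr_ge0|apply: ler_wpM2r].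
Qed.

(** The a priori bounds on a bounded interval suffice, as the constant may depend on [T]: the factor
    [1 + T] outweighs the decay factors, whose exponents are at most one. *)
Lemma decays_bounded T : 0 <= T -> exists N, 0 <= N /\ decays T N.
Proof.
move=> T0; set K := velocity_cst al; have K0 : 0 <= K by exact/ltW/velocity_cst_gt0.
pose B1 := c * Q + 4 * (K * M * M) * T `^ 2^-1 + `|a|.
pose B2 := Q + (K * M * Q * (4 * T `^ 2^-1) + K * M * (8 * (K * M * M) * T `^ 4^-1) * (8 * T `^ 4^-1)) + `|a|.
have KM0 : 0 <= K * M by exact: mulr_ge0.
have KMM0 : 0 <= K * M * M by exact: mulr_ge0.
have cQ0 : 0 <= c * Q by exact: mulr_ge0.
have B10 : 0 <= B1 by apply: addr_ge0 => //; apply: addr_ge0 => //; apply: mulr_ge0 => //; exact: mulr_ge0.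
have n8 : 0 <= 8 :> R by exact: ler0n.
have L2_0 s : 0 <= Q + (K * M * Q * (4 * s `^ 2^-1) + K * M * (8 * (K * M * M) * s `^ 4^-1) * (8 * s `^ 4^-1)).
  by apply: addr_ge0 => //; apply: addr_ge0; repeat (apply: mulr_ge0 => //).
have B20 : 0 <= B2 by apply: addr_ge0.
have T1 : 0 < 1 + T by rewrite ltr_pwDl.
exists ((B1 + B2) * (1 + T)); split; first exact: mulr_ge0 (addr_ge0 B10 B20) (ltW T1).
move=> s /andP[s0 sT]; have s1 : 0 < 1 + s by rewrite addr_gt0.
have pow (b : R) : 0 <= b -> b <= 1 -> 1 <= (1 + T) * (1 + s) `^ (- b).
  move=> b0 b1; rewrite powRN -ler_pdivrMr ?invr_gt0 ?powR_gt0// mul1r invrK.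
  apply: (@le_trans _ _ ((1 + s) `^ 1)); first by apply: ler_powR => //; rewrite lerDl ltW.
  by rewrite powRr1 ?(ltW s1)// lerD2l.
have mono (b : R) : 0 <= b -> s `^ b <= T `^ b.
  by move=> b0; apply: ge0_ler_powR; rewrite ?nnegrE ?(ltW s0).
have h1 := integral_moment0 mu00 mu2 mv0 Q00 vQ; have h2 := L2le_weighted vQ.
have L1 := apriori_L1 al0 mu_ mv0 M0 uM vu h1 eqn s0.
have L2 := apriori_L2 al0 mu_ mv0 M0 Q00 uM vu h2 eqn s0.
split.
  apply: (le_trans (integral_w s0 L1)); rewrite lee_fin.
  apply: (@le_trans _ _ (B1 + B2)).
    apply: ler_wpDr => //; rewrite lerD2r lerD2l; apply: ler_wpM2l; first exact: mulr_ge0.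
    by apply: mono; rewrite invr_ge0.
  have B0 : 0 <= B1 + B2 by exact: addr_ge0.
  rewrite -mulrA; apply: ler_peMr => //; apply: pow => //; move: mu2; lra.
apply: (L2leW _ _ (L2le_w s0 (L2_0 s) L2)); first by apply: addr_ge0.
apply: (@le_trans _ _ (B1 + B2)).
  apply: ler_wpDl => //; rewrite lerD2r lerD2l; apply: lerD.
    by apply: ler_wpM2l; [exact: mulr_ge0|apply: ler_wpM2l => //; apply: mono; rewrite invr_ge0].
  have m4 : s `^ 4^-1 <= T `^ 4^-1 by apply: mono; rewrite invr_ge0.
  apply: ler_pM; [repeat (apply: mulr_ge0 => //)|exact: mulr_ge0| |exact: ler_wpM2l].
  by apply: ler_wpM2l => //; apply: ler_wpM2l => //; exact: mulr_ge0.
have B0 : 0 <= B1 + B2 by exact: addr_ge0.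
rewrite -mulrA; apply: ler_peMr => //; apply: pow; first by rewrite addr_ge0 ?invr_ge0.
by move: mu2; lra.
Qed.

Theorem remainder_decay s : 0 < s ->
  (\int[plane R]_x absE (fun y => remainder (s, y)) x <= (N1 * (1 + s) `^ (- mu))%:E)%E /\
  L2le (absE (fun y => remainder (s, y))) (N1 * (1 + s) `^ (- (mu + 2^-1))).
Proof.
move=> s0; have [d [d0 d1 dM]] := exists_time_step.
have P n : decays (n%:R * d) N1.
  elim: n => [|n IH].
    by move=> t; rewrite mul0r => /andP[t0 /(lt_le_trans t0)]; rewrite ltxx.
  have nd0 : 0 <= n%:R * d by rewrite mulr_ge0// ltW.
  have [N' [N0' PN']] := decays_bounded (addr_ge0 nd0 (ltW d0)).
  have [k Nk] : exists k, N' <= 2 ^+ k * N1.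
    exists (Num.bound (N' / N1)); rewrite -ler_pdivrMr//.
    apply: (le_trans (ltW (archi_boundP _))); first by rewrite divr_ge0// ltW.
    by rewrite -natrX ler_nat ltnW// ltn_expl.
  rewrite -[n.+1]addn1 natrD mulrDl mul1r.
  exact: (decays_extend nd0 d0 d1 dM IH (decaysW N0' Nk PN')).
apply: (P (Num.bound (s / d))); rewrite s0/= -ler_pdivrMr//.
by apply/ltW/archi_boundP; rewrite divr_ge0// ltW.
Qed.

End Continuation.

(** * Interpolation between [L^1] and [L^2] *)

Section Interpolation.
Context (R : realType).

(** The first term dominates where [y <= l], the second where [y > l]. *)
Lemma powR_interpolate (l y p : R) : 0 < l -> 0 <= y -> 1 <= p -> p <= 2 ->
  y `^ p <= l `^ (p - 1) * y + l `^ (p - 2) * (y * y).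
Proof.
move=> l0 y0 p1 p2; have [->|yn] := eqVneq y 0.
  by rewrite powR0 ?gt_eqF ?(lt_le_trans ltr01)// !mulr0 addr0.
have yp : 0 < y by rewrite lt_def yn.
have yne : y == 0 = false by rewrite gt_eqF.
have [yl|ly] := leP y l.
  apply: ler_wpDr; first by rewrite mulr_ge0 ?powR_ge0// mulr_ge0.
  have -> : y `^ p = y `^ (p - 1) * y.
    by rewrite -{3}(powRr1 y0) -powRD ?yne ?implybT//; congr (_ `^ _); ring.
  by apply: ler_wpM2r => //; apply: ge0_ler_powR; rewrite ?nnegrE ?subr_ge0 ?(ltW l0).
apply: ler_wpDl; first by rewrite mulr_ge0 ?powR_ge0.
have -> : y `^ p = y `^ (p - 2) * (y * y).
  rewrite -{3 4}(powRr1 y0) -!powRD ?yne ?implybT//; congr (_ `^ _); ring.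
apply: ler_wpM2r; first exact: mulr_ge0.
rewrite -(opprB 2 p) !powRN lef_pV2 ?posrE ?powR_gt0//.
by apply: ge0_ler_powR; rewrite ?nnegrE ?subr_ge0 ?(ltW l0) ?(ltW ly).
Qed.

Lemma Lnorm_interpolate (g : R * R -> R) (mu K r p : R) : measurable_fun setT g -> 0 < K -> 0 < r ->
  1 <= p -> p <= 2 ->
  (\int[plane R]_x absE g x <= (K * r `^ (- mu))%:E)%E -> L2le (absE g) (K * r `^ (- (mu + 2^-1))) ->
  ('N[leb2]_(p%:E)[EFin \o g] <= (2 * K * r `^ (- 1 - mu + p^-1))%:E)%E.
Proof.
move=> mg K0 r0 p1 p2 g1 g2; have p0 : 0 < p by exact: lt_le_trans p1.
(* The threshold is the ratio of the squared [L^2] bound to the [L^1] bound; it makes both terms of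
   the interpolation equal to [B]. *)
pose l := K * r `^ (- 1 - mu); have l0 : 0 < l by rewrite mulr_gt0// powR_gt0.
have rne : r == 0 = false by rewrite gt_eqF.
have Kne : K == 0 = false by rewrite gt_eqF.
pose B := K `^ p * r `^ (1 - (1 + mu) * p).
have B0 : 0 <= B by rewrite mulr_ge0 ?powR_ge0.
have mag := measurable_absE mg.
have mpow : measurable_fun setT (fun x => (`|g x| `^ p)%:E).
  apply/measurable_EFinP; exact: (measurableT_comp (measurable_powR p) (measurable_abs mg)).
have mgg : measurable_fun setT (fun x => absE g x * absE g x)%E by exact: emeasurable_funM.
have gg0 x : (0 <= absE g x * absE g x)%E by apply: mule_ge0; exact: absE_ge0.
have I : (\int[plane R]_x (`|g x| `^ p)%:E <= (2 * B)%:E)%E.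
  apply: (@le_trans _ _ (\int[plane R]_x ((l `^ (p - 1))%:E * absE g x + (l `^ (p - 2))%:E * (absE g x * absE g x)))%E).
    apply: ge0_integral_mono => x; first by rewrite lee_fin powR_ge0.
    by rewrite /absE -!EFinM -EFinD lee_fin; exact: powR_interpolate.
  have m1 : measurable_fun setT (fun x => (l `^ (p - 1))%:E * absE g x)%E.
    by apply: emeasurable_funM; [exact: measurable_cst|exact: mag].
  have m2 : measurable_fun setT (fun x => (l `^ (p - 2))%:E * (absE g x * absE g x))%E.
    by apply: emeasurable_funM; [exact: measurable_cst|exact: mgg].
  have q1 x : (0 <= (l `^ (p - 1))%:E * absE g x)%E by rewrite mule_ge0 ?absE_ge0// lee_fin powR_ge0.
  have q2 x : (0 <= (l `^ (p - 2))%:E * (absE g x * absE g x))%E by rewrite mule_ge0// lee_fin powR_ge0.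
  rewrite (ge0_integralD _ measurableT (fun x _ => q1 x) m1 (fun x _ => q2 x) m2).
  rewrite (ge0_integralZl_EFin _ measurableT) => [|x _||]; last 3 first.
  - exact: absE_ge0.
  - exact: mag.
  - exact: powR_ge0.
  rewrite (ge0_integralZl_EFin _ measurableT) => [|x _||]; last 3 first.
  - exact: gg0.
  - exact: mgg.
  - exact: powR_ge0.
  have lp (b : R) : l `^ b = K `^ b * r `^ ((- 1 - mu) * b).
    by rewrite /l powRM ?powR_ge0 ?(ltW K0)// -powRrM.
  have E1 : l `^ (p - 1) * (K * r `^ (- mu)) = B.
    rewrite lp (_ : _ * _ * _ = (K `^ (p - 1) * K) * (r `^ ((- 1 - mu) * (p - 1)) * r `^ (- mu))); last by ring.
    rewrite -{2}(powRr1 (ltW K0)) -!powRD ?rne ?Kne ?implybT// /B.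
    by congr (_ `^ _ * _ `^ _); ring.
  have E2 : l `^ (p - 2) * (K * r `^ (- (mu + 2^-1))) ^+ 2 = B.
    rewrite lp (_ : _ * _ = (K `^ (p - 2) * (K * K)) *
      (r `^ ((- 1 - mu) * (p - 2)) * (r `^ (- (mu + 2^-1)) * r `^ (- (mu + 2^-1))))); last by ring.
    rewrite -{2 3}(powRr1 (ltW K0)) -!powRD ?rne ?Kne ?implybT// /B.
    by congr (_ `^ _ * _ `^ _); [ring|field].
  apply: (@le_trans _ _ ((l `^ (p - 1))%:E * (K * r `^ (- mu))%:E + (l `^ (p - 2))%:E * ((K * r `^ (- (mu + 2^-1))) ^+ 2)%:E)%E).
    by apply: leeD; apply: lee_wpmul2l; rewrite ?lee_fin ?powR_ge0.
  by rewrite -!EFinM E1 E2 -EFinD lee_fin mulr2n mulrDl mul1r.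
rewrite unlock.
have -> : (\int[leb2]_x `|(EFin \o g) x| `^ p = \int[plane R]_x (`|g x| `^ p)%:E)%E.
  by rewrite -ge0_integral_leb2.
apply: (@le_trans _ _ ((2 * B)%:E `^ p^-1)%E).
  apply: gt0_ler_poweR; rewrite ?invr_ge0 ?(ltW p0)//.
  - by rewrite in_itv/= leey andbT; apply: integral_ge0 => x _; rewrite lee_fin powR_ge0.
  - by rewrite in_itv/= leey andbT lee_fin mulr_ge0.
rewrite poweR_EFin lee_fin powRM// /B powRM ?powR_ge0// -!powRrM mulfV ?gt_eqF// powRr1 ?(ltW K0)//.
rewrite (_ : (1 - (1 + mu) * p) / p = - 1 - mu + p^-1); last by field; rewrite gt_eqF.
rewrite mulrA; apply: ler_wpM2r; first exact: powR_ge0.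
apply: ler_wpM2r; first exact: ltW.
rewrite -[leRHS](powRr1 (ler0n R 2)); apply: ler_powR; first by rewrite ler1n.
by rewrite invf_le1.
Qed.

End Interpolation.

(** * The corrected profile and the conclusion *)

Section Final.
Context (R : realType).

Lemma measurable_laplacian_heat_kernel (t : R) : 0 < t -> measurable_fun setT (laplacian (heat_kernel t)).
Proof.
move=> t0; have -> : laplacian (heat_kernel t) = fun x => (sqeucl x / (4 * t ^+ 2) - t^-1) * heat_kernel t x.
  by apply/funext => x; exact: laplacian_heat_kernel.
have ms : measurable_fun setT (fun x : R * R => sqeucl x / (4 * t ^+ 2)).
  apply: measurable_funM; last exact: measurable_cst.
  by apply: measurable_funD; apply: measurable_funX; [exact: measurable_fst|exact: measurable_snd].
by apply: measurable_funM; [apply: measurable_funB; [exact: ms|exact: measurable_cst]|exact: measurable_heat_kernel].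
Qed.

(** The Laplacian gains a full power of [1 + t] over the profile, at least as much as the claimed
    [mu]; the correction term can therefore be added to the remainder at the end. *)
Lemma laplacian_gauss_decay (t mu : R) : 0 <= t -> mu <= 1 ->
  (\int[plane R]_x absE (laplacian (Omega t)) x <= (6 * (1 + t) `^ (- mu))%:E)%E /\
  L2le (absE (laplacian (Omega t))) (6 * (1 + t) `^ (- (mu + 2^-1))).
Proof.
move=> t0 mu1; have t1 : 0 < 1 + t by rewrite ltr_pwDl.
have t2 : 0 < 2 * (1 + t) by rewrite mulr_gt0.
have mL := measurable_absE (measurable_laplacian_heat_kernel t1).
have mk : measurable_fun setT (@hk R (2 * (1 + t))) by exact: measurable_hk.
have k0 x : (0 <= hk (2 * (1 + t)) x :> \bar R)%E by rewrite lee_fin heat_kernel_ge0// ltW.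
have c0 : 0 <= 6 / (1 + t) by rewrite divr_ge0// ltW.
have Lle x : (absE (laplacian (Omega t)) x <= (6 / (1 + t))%:E * hk (2 * (1 + t)) x)%E.
  by rewrite /absE /hk -EFinM lee_fin; exact: laplacian_heat_kernel_le.
have mck : measurable_fun setT (fun x => (6 / (1 + t))%:E * hk (2 * (1 + t)) x)%E.
  by apply: emeasurable_funM; [exact: measurable_cst|exact: mk].
have tinv : (1 + t)^-1 = (1 + t) `^ (- 1) by rewrite powR_inv1// ltW.
have tge : 1 <= 1 + t by rewrite lerDl.
split.
  apply: (@le_trans _ _ (\int[plane R]_x ((6 / (1 + t))%:E * hk (2 * (1 + t)) x))%E).
    by apply: ge0_integral_mono => x; [exact: absE_ge0|exact: Lle].
  rewrite (ge0_integralZl_EFin _ measurableT (fun x _ => k0 x) mk c0) integral_hk// mule1 lee_fin.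
  apply: ler_wpM2l; first exact: ler0n.
  by rewrite tinv; apply: ler_powR; rewrite ?lerN2.
apply: (L2le_mono mL mck (absE_ge0 _) Lle).
apply: (L2leW _ _ (L2leZ mk k0 c0 (L2le_hk t2))); first by rewrite mulr_ge0 ?powR_ge0.
rewrite -mulrA; apply: ler_wpM2l; first exact: ler0n.
apply: (@le_trans _ _ ((1 + t) `^ (- 1) * (1 + t) `^ (- 2^-1))).
  rewrite tinv; apply: ler_wpM2l; first exact: powR_ge0.
  rewrite !powRN lef_pV2 ?posrE ?powR_gt0//; apply: ge0_ler_powR; rewrite ?nnegrE ?invr_ge0 ?(ltW t1) ?(ltW t2)//.
  by rewrite ler_peMl ?(ltW t1)// ler1n.
rewrite -powRD ?(gt_eqF t1) ?implybT//; apply: ler_powR => //.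
by rewrite -opprD lerN2 lerD2r.
Qed.

Lemma duhamel0 (al : R) v (x : R * R) : duhamel al v 0 x = 0.
Proof. by rewrite /duhamel set_itv1 Rintegral_set1. Qed.

Lemma weighted_le (v0 : R * R -> R) (Q : R) : 0 <= Q -> in_L2w 2 v0 -> normL2w 2 v0 <= Q ->
  (\int[plane R]_x (weighted 2 v0 x)%:E <= (Q ^+ 2)%:E)%E.
Proof.
move=> Q0 [mv0 fin] nQ.
have mw : measurable_fun setT (weighted 2 v0).
  apply: measurable_funM; first exact: measurable_sqeucl_pow.
  by apply: measurable_funX; exact: measurable_abs.
have w0 x : 0 <= weighted 2 v0 x by rewrite mulr_ge0 ?powR_ge0 ?sqr_ge0.
have I0 : (0 <= \int[leb2]_x (weighted 2 v0 x)%:E)%E by apply: integral_ge0 => x _; rewrite lee_fin.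
rewrite -ge0_integral_leb2//; last exact/measurable_EFinP.
rewrite -(@fineK _ (\int[leb2]_x (weighted 2 v0 x)%:E)%E) ?ge0_fin_numE// lee_fin.
have -> : fine (\int[leb2]_x (weighted 2 v0 x)%:E) = normL2w 2 v0 ^+ 2.
  by rewrite /normL2w sqr_sqrtr// fine_ge0.
by rewrite ler_pXn2r// nnegrE ?sqrtr_ge0.
Qed.

End Final.

Theorem theorem1p2 (R : realType) (alpha : R) (halpha : 0 < alpha)
    (mu : R) (hmu : 0 < mu < 2^-1) :
  exists2 r0 : R, 0 < r0 &
  forall v0 : R * R -> R, in_L2w 2 v0 -> normL2w 2 v0 <= r0 ->
  forall v : R -> R * R -> R, global_solution alpha v0 v ->
  forall p : R, 1 <= p <= 2 ->
  exists2 C : R, 0 < C &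
  forall t : R, 0 <= t ->
    ('N[leb2]_(p%:E)[(fun x : R * R =>
        (v t x - total_mass v0 *
           (Omega t x - alpha ^+ 2 * laplacian (Omega t) x))%:E)]
     <= (C * (1 + t) `^ (- 1 - mu + p^-1))%:E)%E.
Proof.
case/andP: hmu => mu0 mu2; pose c := moment_cst mu; pose B := c + 5 * c + 1.
have c0 : 0 <= c by exact: moment_cst_ge0.
have B0 : 0 < B by rewrite ltr_wpDl// addr_ge0// mulr_ge0.
have D0 : 0 < decay_cst mu.
  rewrite /decay_cst; have m2 : 0 < (2^-1 - mu)^-1 by rewrite invr_gt0 subr_gt0.
  by move: m2; move: ((2^-1 - mu)^-1) => X; lra.
(* The smallness condition is linear in the size of the data, with coefficient [K]; the radius
   [K^-1] satisfies it with equality. This radius, rather than the norm of [v0], serves as [Q],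
   which is thus positive for every datum. *)
pose K := 64 * (8 * B * decay_cst mu).
have K0 : 0 < K by apply: mulr_gt0; [exact: ltr0n|apply: mulr_gt0 => //; apply: mulr_gt0].
exists K^-1; first by rewrite invr_gt0.
move=> v0 wv0 nv0 v [[mv [M vM]] eqv] p /andP[p1 p2].
have Q0 : 0 < K^-1 by rewrite invr_gt0.
have vQ := weighted_le (ltW Q0) wv0 nv0; have mv0 := wv0.1.
have small : 64 * (8 * (B * K^-1) * decay_cst mu) <= 1.
  rewrite [leLHS](_ : _ = K * K^-1); last by rewrite /K; move: (64 : R) => X; ring.
  by rewrite mulfV ?gt_eqF.
set a := total_mass v0.
have mD : measurable [set z : R * (R * R) | 0 <= z.1].
  have := @measurable_fst _ _ R (R * R)%type measurableT _ (measurable_itv `[0, +oo[).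
  by rewrite setTI; congr measurable; apply/seteqP; split => z /=; rewrite in_itv/= andbT.
(* Extension by zero to negative times, which gives a function measurable on the whole of
   space-time. *)
pose u := (fun z : R * (R * R) => v z.1 z.2) \_ [set z | 0 <= z.1].
have mu_ : measurable_fun setT u.
  exact: (measurable_restrictT (fun z : R * (R * R) => v z.1 z.2) mD).1.
have uE s y : 0 <= s -> u (s, y) = v s y by move=> s0; rewrite /u patchE mem_set.
pose M' := Num.max M 0.
have M0' : 0 <= M' by rewrite le_max lexx orbT.
have uM : {ae line R, forall s, 0 < s -> (\int[plane R]_x absE (fun y => u (s, y)) x <= M'%:E)%E}.
  move/ae_lebesgue : vM; apply: filterS => s h s0.
  have mus : measurable_fun setT (fun y => u (s, y)) by exact: (measurableT_comp mu_ (pair1_measurable s)).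
  rewrite -ge0_integral_leb2; [|exact: measurable_absE|exact: absE_ge0].
  apply: (@le_trans _ _ M%:E); last by rewrite lee_fin le_max lexx.
  apply: le_trans (h (ltW s0)); rewrite Lnorm1 le_eqVlt; apply/orP; left; apply/eqP.
  by apply: eq_integral => x _; rewrite /absE uE// ltW.
have vu s y : 0 < s -> v s y = u (s, y) by move=> s0; rewrite uE// ltW.
have eqn t : 0 < t -> {ae plane R, forall x, u (t, x) = heat_semigroup t v0 x - duhamel alpha v t x}.
  move=> t0; move/ae_leb2 : (eqv t (ltW t0)); apply: filterS => x <-; exact: uE (ltW t0).
have decay := remainder_decay halpha mu_ mv0 M0' Q0 mu0 mu2 uM vu vQ eqn small.
pose N1 := 8 * (8 * (B * K^-1)).
have N10 : 0 < N1 by rewrite !mulr_gt0.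
pose r t (y : R * R) := v t y - a * Omega t y.
have mvt t : 0 <= t -> measurable_fun setT (v t).
  move=> t0; have : measurable_fun setT (fun y => u (t, y)) by exact: (measurableT_comp mu_ (pair1_measurable t)).
  by congr measurable_fun; apply/funext => y; rewrite uE.
have mO t : measurable_fun setT (Omega (R := R) t) by exact: (measurable_heat_kernel (1 + t)).
have mr t : 0 <= t -> measurable_fun setT (r t).
  move=> t0; apply: measurable_funB; first exact: mvt.
  by apply: measurable_funM; [exact: measurable_cst|exact: mO].
have rdecay t : 0 <= t -> (\int[plane R]_x absE (r t) x <= (N1 * (1 + t) `^ (- mu))%:E)%E /\
    L2le (absE (r t)) (N1 * (1 + t) `^ (- (mu + 2^-1))).
  rewrite le_eqVlt => /predU1P[<-|t0]; last first.
    have := decay t t0; rewrite (_ : (fun y => remainder u v0 (t, y)) = r t)//.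
    by apply/funext => y; rewrite /remainder uE ?(ltW t0).
  (* At [t = 0] the integral equation gives [v0] almost everywhere, and the bounds on
     [v0 - a * heat_kernel 1] are the claim. *)
  rewrite addr0 !powR1 !mulr1; have L1 := integral_moment0 (ltW mu0) mu2 mv0 (ltW Q0) vQ.
  have iv0 := in_L1_absE mv0 L1.
  have Z0 : 0 <= B * K^-1 by rewrite mulr_ge0// ltW.
  have ZN : B * K^-1 <= N1 by rewrite /N1; move: Z0; clear; move: (B * _) => X; lra.
  have rE : {ae plane R, forall x : R * R, (absE (r 0%R) x <= absE (fun y : R * R => (v0 y - total_mass v0 * heat_kernel 1 y)%R) x)%E}.
    move/ae_leb2 : (eqv 0 (lexx _)); apply: filterS => x E.
    by rewrite /absE /r E duhamel0 /heat_semigroup ltxx subr0 OmegaE addr0.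
  have mf := measurable_absE (measurable_defect iv0).
  have m0 := measurable_absE (mr 0 (lexx _)).
  split.
    apply: (le_trans (integral_le_ae m0 mf (absE_ge0 _) (absE_ge0 _) rE)).
    by apply: (le_trans (integral_defect iv0 (ltW mu0) mu2 (ltW Q0) vQ)); rewrite lee_fin.
  apply: (L2le_ae m0 mf (absE_ge0 _) (absE_ge0 _) rE).
  exact: (L2leW Z0 ZN (L2le_defect iv0 (ltW mu0) mu2 (ltW Q0) vQ)).
pose N2 := N1 + `|a * alpha ^+ 2| * 6.
have N20 : 0 < N2 by rewrite ltr_pwDl// mulr_ge0.
exists (2 * N2) => [|t t0]; first by rewrite mulr_gt0.
have t1 : 0 < 1 + t by rewrite ltr_pwDl.
have [r1 r2] := rdecay t t0.
have mu1 : mu <= 1 by move: mu2; clear; lra.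
have [l1 l2] := laplacian_gauss_decay t0 mu1.
pose g x := v t x - a * (Omega t x - alpha ^+ 2 * laplacian (Omega t) x).
have mL : measurable_fun setT (laplacian (Omega (R := R) t)) by exact: (measurable_laplacian_heat_kernel t1).
have mg : measurable_fun setT g.
  apply: measurable_funB; first exact: mvt.
  apply: measurable_funM; first exact: measurable_cst.
  apply: measurable_funB; first exact: mO.
  by apply: measurable_funM; [exact: measurable_cst|exact: mL].
have maL := measurable_absE mL; have mar := measurable_absE (mr t t0).
have k0 : (0 <= `|a * alpha ^+ 2|%:E)%E by rewrite lee_fin.
have mkL : measurable_fun setT (fun x => `|a * alpha ^+ 2|%:E * absE (laplacian (Omega t)) x)%E.
  by apply: emeasurable_funM; [exact: measurable_cst|exact: maL].
have kL0 x : (0 <= `|a * alpha ^+ 2|%:E * absE (laplacian (Omega t)) x)%E.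
  by apply: mule_ge0; [exact: k0|exact: absE_ge0].
have gle x : (absE g x <= absE (r t) x + `|a * alpha ^+ 2|%:E * absE (laplacian (Omega t)) x)%E.
  rewrite /absE -EFinM -EFinD lee_fin -normrM (_ : g x = r t x + a * alpha ^+ 2 * laplacian (Omega t) x).
    exact: ler_normD.
  by rewrite /g /r; ring.
apply: (Lnorm_interpolate mg N20 t1 p1 p2).
  apply: (@le_trans _ _ (\int[plane R]_x (absE (r t) x + `|a * alpha ^+ 2|%:E * absE (laplacian (Omega t)) x))%E).
    by apply: ge0_integral_mono => x; [exact: absE_ge0|exact: gle].
  rewrite (ge0_integralD _ measurableT (fun x _ => absE_ge0 _ x) mar (fun x _ => kL0 x) mkL).
  rewrite (ge0_integralZl_EFin _ measurableT (fun x _ => absE_ge0 _ x) maL (normr_ge0 _)).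
  rewrite /N2 mulrDl EFinD; apply: leeD; first exact: r1.
  by rewrite -mulrA EFinM; apply: lee_wpmul2l.
have mrk := emeasurable_funD mar mkL.
have j1 : 0 <= N1 * (1 + t) `^ (- (mu + 2^-1)) by rewrite mulr_ge0 ?powR_ge0// ltW.
have j2 : 0 <= `|a * alpha ^+ 2| * (6 * (1 + t) `^ (- (mu + 2^-1))) by rewrite mulr_ge0// mulr_ge0 ?powR_ge0.
apply: (L2le_mono (measurable_absE mg) mrk (absE_ge0 _) gle).
rewrite /N2 mulrDl -(mulrA `|a * alpha ^+ 2|).
by apply: (L2leD mar mkL (absE_ge0 _) kL0 j1 j2 r2); exact: (L2leZ maL (absE_ge0 _) (normr_ge0 _) l2).
Qed.
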